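(* Let $k$ be a positive integer and let $f:\mathbb{N}\to(0,\infty)$ be a positive multiplicative function such that $\sum_{p}|f(p)-1|=\infty$ (sum over all primes $p$) and $f(p)\to 1$ as $p\to\infty$. Then there exists a real number $c>0$ such that the set of $k$-tuples $\{(f(p+1),\ldots,f(p+k)) : p \text{ prime}\}$ is dense either in $[0,c]^k$ or in $[c,+\infty)^k$.
   Context: A multiplicative function satisfies $f(1)=1$ and $f(mn)=f(m)f(n)$ whenever $\gcd(m,n)=1$. ''Dense in $A$'' means every point of $A$ is a limit of tuples from the set. *)

(* Defs.v *)
From mathcomp Require Import all_boot all_order all_algebra.
From mathcomp Require Import reals.
Unset Printing Implicit Defensive.
Import Order.TTheory GRing.Theory Num.Theory.
Local Open Scope ring_scope.

Section Defs.
Variable R : realType.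

(* f : N -> R, domain N = positive integers; values at 0 are irrelevant. *)
Definition multiplicative_fn (f : nat -> R) : Prop :=
  f 1%N = 1 /\
  forall m n : nat, (0 < m)%N -> (0 < n)%N -> coprime m n -> f (m * n)%N = f m * f n.

Definition positive_fun (f : nat -> R) : Prop := forall n : nat, (0 < n)%N -> 0 < f n.

Definition prime_sum_diverges (f : nat -> R) : Prop :=
  forall M : R, exists N : nat, M < \sum_(p < N | prime p) `|f p - 1|.

Definition tends_to_one_on_primes (f : nat -> R) : Prop :=
  forall e : R, 0 < e -> exists N : nat, forall p : nat, prime p -> (N <= p)%N -> `|f p - 1| < e.

Definition prime_shift_tuples (f : nat -> R) (k : nat) (y : 'I_k -> R) : Prop :=
  exists p : nat, prime p /\ forall i : 'I_k, y i = f (p + i.+1)%N.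

Definition dense_in (k : nat) (S A : ('I_k -> R) -> Prop) : Prop :=
  forall x, A x -> forall e : R, 0 < e -> exists y, S y /\ forall i : 'I_k, `|y i - x i| < e.

Definition box0c (k : nat) (c : R) (x : 'I_k -> R) : Prop := forall i, 0 <= x i <= c.
Definition boxcinf (k : nat) (c : R) (x : 'I_k -> R) : Prop := forall i, c <= x i.

End Defs.

(* Main.v *)
(** For k fixed, there are primes p in any class prime to W (W divisible by the small primes) such
    that the parts of p+1, ..., p+k prime to W are squarefree, free of small prime factors, and
    have at most K0 = K0(k) prime factors.  Imposing p = q - i mod q^2 for the primes q of disjoint
    finite sets Q_i with f(q) > 1, one gets f(p+i) = f(i+1) * prod_(q in Q_i) f(q) * r_i, where r_i
    is a product of at most K0 values f(q') with q' large, hence close to 1; the middle products can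
    be brought close to any number >= 1, since the sum of (f(q) - 1)^+ over primes diverges and its
    terms tend to 0.  If that sum converges, the argument applies to 1/f.

    The almost prime statement is a sieve estimate for the weights Lambda(n) g(n) / n, where
    g(n) = (4 v (1 - v))^m and v = n^(-1/N).  The Brun-Hooley sieve reduces it to the mean of these
    weights against products over q in B of [q | n + i_q] - [q does not divide n] / (q - 1).  When
    the product of B is large, Vaughan's identity and a dispersion argument (Cauchy-Schwarz,
    complete sums over periods) apply.  When it is small, one expands in Dirichlet characters:
    the m-th differences of L'/L at scale 1/N are estimated by a recurrence that only needs a lower
    bound of the L-series on the real axis to the right of 1.  Such a bound may fail for an
    exceptional real character, but by the repulsion of exceptional characters and L(1, chi) <> 0
    there are arbitrarily large scales without one. *)

Require Import Defs.
From mathcomp Require Import all_boot all_order all_algebra.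
From mathcomp Require Import reals sequences.
From mathcomp Require Import analysis.exp.
From mathcomp.real_closed Require Import complex.
From mathcomp Require Import spectral.
From mathcomp Require Import ring lra zify.
Set Implicit Arguments.
Unset Strict Implicit.
Import Order.TTheory GRing.Theory Num.Theory.
Local Open Scope ring_scope.
Import ComplexField.Normc.
Ltac ring_le := rewrite le_eqVlt; apply/orP; left; apply/eqP; ring.
Arguments normc : simpl never.

(** * Powers and logarithms of integers *)

Section RealPowers.
Variable R : realType.
Implicit Types (s t a : R) (n m : nat).

(** The sieve may lose a fixed power of log X, because both estimates of its remainder save as large
    a power as desired; this is why a crude combinatorial sieve is enough. With z = 2^(2^t), the
    level D and the length X are fixed powers of z, whence the bound K0 on the number of prime
    factors above z. Moduli are split at (2^t)^(4 gam), a power of log X: above it Rankin's trick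
    converts the size of the modulus into a saving, below it characters are used. No zero-free
    region and no complex variable enter. The exponent m is of order log log X, so that 2^(-m) is
    already a power of log X, and the m-th difference of L'/L with step 1/N is about m! (P / N)^m
    with P a power of log log X, as soon as |L(s, chi)| is at least a negative power of log log X on
    a short real interval. An exceptional modulus is never estimated: a single prime p is sought, so
    the scale t may be chosen. Series are replaced by their truncations throughout, and bounds hold
    from some truncation on. *)

Definition lnn (n : nat) : R := ln n%:R.
(** The real power n^(-s). Since [ln 0 = 0], the value at n = 0 is 1. *)
Definition pw s (n : nat) : R := expR (- (s * lnn n)).

Lemma lnn1 : lnn 1 = 0. Proof. exact: ln1. Qed.

Lemma lnn_ge0 n : 0 <= lnn n.
Proof.
case: n => [|n]; first by rewrite /lnn ln0.
by rewrite ln_ge0 // ler1n.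
Qed.

Lemma lnnM m n : (0 < m)%N -> (0 < n)%N -> lnn (m * n) = lnn m + lnn n.
Proof. by move=> m0 n0; rewrite /lnn natrM lnM // posrE ltr0n. Qed.

Lemma lnn_le m n : (0 < m)%N -> (m <= n)%N -> lnn m <= lnn n.
Proof.
move=> m0 mn; rewrite /lnn ler_ln ?ler_nat // posrE ltr0n //.
exact: leq_trans mn.
Qed.

Lemma expR_lnn n : (0 < n)%N -> expR (lnn n) = n%:R.
Proof. by move=> n0; rewrite /lnn lnK // posrE ltr0n. Qed.

Lemma lnnX m n : (0 < m)%N -> lnn (m ^ n) = n%:R * lnn m.
Proof. by move=> m0; rewrite /lnn natrX lnXn ?ltr0n // mulr_natl. Qed.

Lemma lnnS_le n : (0 < n)%N -> lnn n.+1 - lnn n <= n%:R^-1.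
Proof.
move=> n0; have n0' : 0 < n%:R :> R by rewrite ltr0n.
rewrite /lnn -ln_div ?posrE ?ltr0n //.
have -> : n.+1%:R / n%:R = 1 + n%:R^-1 :> R by rewrite -natr1 mulrDl divff ?lt0r_neq0 // mul1r.
by apply: le_ln1Dx; apply: lt_trans (_ : 0 < _); rewrite ?ltrN10 // invr_gt0.
Qed.

Lemma lnnS_ge n : (0 < n)%N -> n.+1%:R^-1 <= lnn n.+1 - lnn n.
Proof.
move=> n0; have n0' : 0 < n%:R :> R by rewrite ltr0n.
have n1' : 0 < n.+1%:R :> R by rewrite ltr0n.
have -> : lnn n.+1 - lnn n = - ln (1 + - n.+1%:R^-1).
  rewrite /lnn -opprB -ln_div ?posrE ?ltr0n //; congr (- ln _).
  have -> : n%:R = n.+1%:R - 1 :> R by rewrite -natr1; ring.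
  by rewrite mulrBl divff ?lt0r_neq0 // mul1r.
rewrite lerNr; apply: le_ln1Dx.
by rewrite ltrN2 invf_lt1 // ltr1n.
Qed.

Lemma pw_ge0 s n : 0 <= pw s n. Proof. exact: expR_ge0. Qed.
Lemma pwn1 s : pw s 1 = 1. Proof. by rewrite /pw lnn1 mulr0 oppr0 expR0. Qed.

Lemma pw1 n : (0 < n)%N -> pw 1 n = n%:R^-1.
Proof. by move=> n0; rewrite /pw mul1r expRN expR_lnn. Qed.

Lemma pwM s m n : (0 < m)%N -> (0 < n)%N -> pw s (m * n) = pw s m * pw s n.
Proof. by move=> m0 n0; rewrite /pw lnnM // mulrDr opprD expRD. Qed.

Lemma pwD s t n : pw (s + t) n = pw s n * pw t n.
Proof. by rewrite /pw mulrDl opprD expRD. Qed.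

Lemma pwXn s k n : pw s n ^+ k = pw (k%:R * s) n.
Proof. by rewrite /pw -expRM_natl mulrN mulrA. Qed.

Lemma pw_le1 s n : 0 <= s -> pw s n <= 1.
Proof. by move=> s0; rewrite expR_le1 oppr_le0 mulr_ge0 // lnn_ge0. Qed.

Lemma pw_le s m n : 0 <= s -> (0 < m)%N -> (m <= n)%N -> pw s n <= pw s m.
Proof. by move=> s0 m0 mn; rewrite ler_expR lerN2 ler_wpM2l // lnn_le. Qed.

Lemma pw_les s t n : s <= t -> pw t n <= pw s n.
Proof. by move=> st; rewrite ler_expR lerN2 ler_wpM2r // lnn_ge0. Qed.

Lemma pwS_diff s n : 0 <= s -> (0 < n)%N -> pw s n - pw s n.+1 <= s / n%:R * pw s n.
Proof.
move=> s0 n0.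
have -> : pw s n.+1 = pw s n * expR (- (s * (lnn n.+1 - lnn n))).
  by rewrite /pw -expRD; congr expR; ring.
have := expR_ge1Dx (- (s * (lnn n.+1 - lnn n))).
have := lnnS_le n0; have := pw_ge0 s n.
set E := expR _; set d := _ - _; set p := pw s n => p0 dn E1.
have sd : s * d <= s / n%:R by rewrite ler_wpM2l.
nra.
Qed.

Lemma onesub_pw_le s n : 0 <= s -> 0 <= 1 - pw s n <= s * lnn n.
Proof.
move=> s0; rewrite subr_ge0 pw_le1 //= /pw.
have := expR_ge1Dx (- (s * lnn n)); lra.
Qed.

(** Discrete form of the comparison of (n+1)^(-1-a) with the integral of x^(-1-a); the right-hand
    side telescopes. *)
Lemma pw_step a n : 0 < a -> (0 < n)%N ->
  pw (1 + a) n.+1 <= a^-1 * (pw a n - pw a n.+1).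
Proof.
move=> a0 n0.
have -> : pw a n = pw a n.+1 * expR (a * (lnn n.+1 - lnn n)).
  by rewrite /pw -expRD; congr expR; ring.
rewrite pwD pw1 // mulrC -[X in _ <= X]mulrC ler_pdivlMr //.
have := expR_ge1Dx (a * (lnn n.+1 - lnn n)).
have := lnnS_ge n0; have := pw_ge0 a n.+1.
set E := expR _; set d := _ - _; set p := pw _ _; set i := _^-1 => p0 di E1.
have : a * i <= a * d by rewrite ler_pM2l.
nra.
Qed.

Lemma sum_pw_le a (A B : nat) : 0 < a -> (0 < A)%N ->
  \sum_(A <= n < B) pw (1 + a) n.+1 <= pw a A / a.
Proof.
move=> a0 A0; case: (leqP A B) => [AB|/ltnW BA]; last first.
  by rewrite big_geq // divr_ge0 ?pw_ge0 // ltW.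
apply: (@le_trans _ _ (\sum_(A <= n < B) (- a^-1 * pw a n.+1 - (- a^-1 * pw a n)))).
  apply: ler_sum_nat => n /andP[An nB].
  have := pw_step a0 (leq_trans A0 An); lra.
rewrite telescope_sumr // mulrC.
have := pw_ge0 a B; have : 0 < a^-1 by rewrite invr_gt0.
set x := a^-1; nra.
Qed.

Lemma sum_inv_le (A B : nat) : (0 < A)%N -> (A <= B)%N ->
  \sum_(A <= n < B) (n.+1%:R^-1 : R) <= lnn B - lnn A.
Proof.
move=> A0 AB; rewrite -telescope_sumr //.
by apply: ler_sum_nat => n /andP[An nB]; apply: lnnS_ge; apply: leq_trans An.
Qed.

Lemma harmonic_le (X : nat) : \sum_(1 <= n < X.+1) (n%:R^-1 : R) <= 1 + lnn X.
Proof.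
case: X => [|X]; first by rewrite big_geq // addr_ge0 // lnn_ge0.
rewrite big_nat_recl // invr1 lerD2l.
by apply: le_trans (@sum_inv_le 1 X.+1 isT isT) _; rewrite lnn1 subr0.
Qed.

Lemma sum_inv_sqr_le (A B : nat) : (0 < A)%N ->
  \sum_(A <= n < B) (n.+1%:R ^- 2 : R) <= A%:R^-1.
Proof.
move=> A0; have /= := @sum_pw_le 1 A B ltr01 A0.
rewrite divr1 pw1 //; apply: le_trans.
by apply: ler_sum_nat => n _; rewrite pwD pw1 // expr2 invfM.
Qed.

Lemma sum_pw_full a (X : nat) : 0 < a ->
  \sum_(1 <= n < X.+1) pw (1 + a) n <= 1 + a^-1.
Proof.
move=> a0; case: X => [|X].
  by rewrite big_geq // addr_ge0 // invr_ge0 ltW.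
rewrite big_nat_recl // pwn1 lerD2l.
apply: le_trans (@sum_pw_le a 1 X.+1 a0 isT) _.
by rewrite pwn1 mul1r.
Qed.

Lemma lnn_pw_le a n : 0 < a -> lnn n * pw a n <= a^-1.
Proof.
move=> a0; rewrite /pw expRN ler_pdivrMr ?expR_gt0 //.
rewrite -(@ler_pM2l _ a) // mulrA divff ?lt0r_neq0 // mul1r.
have := expR_ge1Dx (a * lnn n); lra.
Qed.

Lemma expR_ge_pow (x : R) j : 0 <= x -> x ^+ j / j`!%:R <= expR x.
Proof.
move=> x0; case: j => [|j].
  by rewrite expr0 fact0 divr1 -expR0 ler_expR.
by apply: le_trans (expR_ge1Dxn j x0); rewrite lerDr.
Qed.

(* x^j <= 2^j j! e^(x/2), applied to x = ln n *)
Lemma lnnX_le n j : (0 < n)%N -> lnn n ^+ j <= 2 ^+ j * j`!%:R * expR (lnn n / 2).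
Proof.
move=> n0; have := @expR_ge_pow (lnn n / 2) j (divr_ge0 (lnn_ge0 n) (ler0n R 2)).
rewrite ler_pdivrMr ?ltr0n ?fact_gt0 // expr_div_n ler_pdivrMr ?exprn_gt0 ?ltr0n //.
by move=> h; apply: le_trans h _; rewrite le_eqVlt; apply/orP; left; apply/eqP; ring.
Qed.

Lemma expR_lnn2 (b : nat) : (2 ^ b)%:R = expR (b%:R * lnn 2) :> R.
Proof. by rewrite -(lnnX b (isT : (0 < 2)%N)) expR_lnn // expn_gt0. Qed.

End RealPowers.

(** * The functions of Moebius and von Mangoldt *)

Section DivisorSums.
Variable R : comNzRingType.
Implicit Types (f F : nat -> R) (n d m X : nat).

Definition dsum n f : R := \sum_(1 <= d < n.+1 | (d %| n)%N) f d.

Lemma dsum_widen X n f : (0 < n <= X)%N ->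
  dsum n f = \sum_(1 <= d < X.+1 | (d %| n)%N) f d.
Proof.
case/andP=> n0 nX; rewrite /dsum [in RHS](big_cat_nat (n := n.+1)) //=.
rewrite [Y in _ = _ + Y](_ : _ = 0) ?addr0 // big_nat_cond big_pred0 // => d.
apply/negbTE/negP => /andP[/andP[h _] /(dvdn_leq n0)]; lia.
Qed.

Lemma sum_eq_index X (c : nat) (v : R) : (0 < c <= X)%N ->
  \sum_(1 <= n < X.+1) (if (n == c)%N then v else 0) = v.
Proof.
move=> cX; rewrite -big_mkcond /= -big_filter.
suff -> : [seq i <- index_iota 1 X.+1 | i == c] = [:: c] by rewrite big_seq1.
rewrite filter_pred1_uniq ?iota_uniq // mem_index_iota; lia.
Qed.

Lemma sum_eq_index0 X (c : nat) (v : R) : ~~ (0 < c <= X)%N ->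
  \sum_(1 <= n < X.+1) (if (n == c)%N then v else 0) = 0.
Proof.
move=> cX; rewrite big_nat_cond big1 // => n /andP[nX _]; case: eqP => // e; lia.
Qed.

(** As [F] vanishes beyond [X], both b and n may run over 1..X; no range then depends on [a], and
    sums can be exchanged freely. *)
Lemma sum_mult X a (f : nat -> R) F : (0 < a)%N ->
  (forall n, (X < n)%N -> F n = 0) ->
  \sum_(1 <= b < X.+1) f b * F (a * b)%N =
  \sum_(1 <= n < X.+1 | (a %| n)%N) f (n %/ a)%N * F n.
Proof.
move=> a0 F0.
transitivity (\sum_(1 <= b < X.+1) \sum_(1 <= n < X.+1)
   (if n == (a * b)%N then f b * F n else 0)).
  apply: eq_big_nat => b /andP[b1 bX].
  transitivity (\sum_(1 <= n < X.+1)
     (if n == (a * b)%N then f b * F (a * b)%N else 0)); last first.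
    by apply: eq_bigr => n _; case: eqP => [->|].
  case: (leqP (a * b) X) => h; first by rewrite sum_eq_index // muln_gt0 a0 b1.
  by rewrite sum_eq_index0 ?F0 ?mulr0 //; lia.
rewrite exchange_big [RHS]big_mkcond /=; apply: eq_big_nat => n /andP[n1 nX].
case: ifPn => an; last first.
  rewrite big1 // => b _; case: eqP => // e; case/negP: an.
  by rewrite e dvdn_mulr.
rewrite -(@sum_eq_index X (n %/ a)%N (f (n %/ a)%N * F n)); last first.
  rewrite divn_gt0 // dvdn_leq //=; apply: leq_trans (leq_div _ _) _; lia.
apply: eq_bigr => b _; case: eqP => [->|h].
  by rewrite mulKn // eqxx.
by case: eqP => // e; case: h; rewrite e mulnC divnK.
Qed.

(** Every summation over a Dirichlet convolution below, in particular in Vaughan's identity, goes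
    through this rectangular form: the condition a b <= X is carried by the support of [F]. *)
Lemma sum_dsum X (f : nat -> nat -> R) F :
  (forall n, (X < n)%N -> F n = 0) ->
  \sum_(1 <= n < X.+1) F n * dsum n (fun d => f d (n %/ d)%N) =
  \sum_(1 <= a < X.+1) \sum_(1 <= b < X.+1) f a b * F (a * b)%N.
Proof.
move=> F0.
transitivity (\sum_(1 <= n < X.+1) \sum_(1 <= a < X.+1)
    (if (a %| n)%N then f a (n %/ a)%N * F n else 0)).
  apply: eq_big_nat => n nX; rewrite (dsum_widen (X := X)) //.
  rewrite -big_mkcond /= mulr_sumr; apply: eq_bigr => d _; exact: mulrC.
rewrite exchange_big; apply: eq_big_nat => a /andP[a1 aX].
by rewrite -big_mkcond (sum_mult _ a1 F0).
Qed.

End DivisorSums.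

Section Moebius.
Variable R : comNzRingType.

Definition mobius (n : nat) : R :=
  if all (fun p => logn p n == 1%N) (primes n) then (-1) ^+ size (primes n) else 0.

Lemma mobius1 : mobius 1 = 1. Proof. by rewrite /mobius /= expr0. Qed.

Lemma mobius_prime_mul p d : prime p -> (0 < d)%N ->
  mobius (p * d) = if (p %| d)%N then 0 else - mobius d.
Proof.
move=> pp d0; have p0 := prime_gt0 pp.
have pd0 : (0 < p * d)%N by rewrite muln_gt0 p0.
case: ifPn => pd.
  rewrite /mobius; case: allP => // /(_ p).
  rewrite mem_primes pp pd0 dvdn_mulr // => /(_ isT).
  by rewrite lognM // logn_prime // eqxx add1n eqSS -leqn0 leqNgt logn_gt0 mem_primes pp d0 pd.
have perm : perm_eq (primes (p * d)) (p :: primes d).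
  apply: uniq_perm; rewrite ?primes_uniq //= ?mem_primes ?(negbTE pd) ?andbF ?primes_uniq //.
  by move=> q; rewrite inE primesM // primes_prime // inE.
rewrite /mobius (perm_size perm) (perm_all _ perm) /= exprS mulN1r.
rewrite lognM // logn_prime // eqxx (lognE p d) (negbTE pd) !andbF /=.
suff -> : all (fun q => logn q (p * d) == 1%N) (primes d) =
          all (fun q => logn q d == 1%N) (primes d).
  by case: ifP; rewrite ?oppr0.
apply: eq_in_all => q; rewrite mem_primes => /and3P[_ _ qd].
rewrite lognM // logn_prime //; case: (q =P p) => // e.
by rewrite e (negbTE pd) in qd.
Qed.

(** For the least prime p of n, a divisor d prime to p cancels against p d, and [mobius] vanishes at
    p d when p divides d. *)
Lemma dsum_mobius n : (0 < n)%N -> dsum n mobius = if n == 1%N then 1 else 0.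
Proof.
move=> n0; case: eqP => [->|/eqP n1].
  by rewrite /dsum big_mkcond big_nat1 dvd1n mobius1.
have n1' : (1 < n)%N by lia.
have pp := pdiv_prime n1'; set p := pdiv n in pp.
have p0 := prime_gt0 pp.
rewrite /dsum (bigID (fun d => p %| d)%N) /=.
have -> : \sum_(1 <= d < n.+1 | (d %| n)%N && (p %| d)%N) mobius d =
  \sum_(1 <= d < n.+1 | (p %| d)%N) 1 * (if (d %| n)%N then mobius d else 0).
  rewrite (eq_bigl (fun d => (p %| d) && (d %| n))%N); last by move=> d; rewrite andbC.
  by rewrite big_mkcondr; apply: eq_bigr => d _; rewrite mul1r.
pose F d := if (d %| n)%N then mobius d else 0.
rewrite -[X in X + _](@sum_mult _ n p (fun=> 1) F) //; last first.
  by move=> d h; rewrite /F gtnNdvd.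
rewrite [X in _ + X]big_mkcond -big_split /= big_nat_cond big1 // => d /andP[/andP[d1 dn] _].
rewrite /F mobius_prime_mul //; case: (boolP (p %| d)%N) => pd /=.
  by rewrite andbF if_same mulr0 addr0.
rewrite andbT Gauss_dvd ?prime_coprime // pdiv_dvd /=.
by case: ifP => _; rewrite ?mul1r ?mulr0 ?addr0 ?addNr.
Qed.

End Moebius.

Section Mangoldt.
Variable R : realType.
Notation lnn := (lnn R).

(** At most one pair (p, j) contributes. The double sum is preferred to a case analysis because it
    can be exchanged with a sum over divisors. *)
Definition mangoldt (d : nat) : R :=
  \sum_(1 <= p < d.+1 | prime p) \sum_(1 <= j < d.+1) (if d == (p ^ j)%N then lnn p else 0).

Lemma mangoldt_ge0 d : 0 <= mangoldt d.
Proof. by apply: sumr_ge0 => p _; apply: sumr_ge0 => j _; case: ifP => // _; exact: lnn_ge0. Qed.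

Lemma mangoldt_widen X d : (0 < d <= X)%N ->
  mangoldt d = \sum_(1 <= p < X.+1 | prime p) \sum_(1 <= j < X.+1)
    (if d == (p ^ j)%N then lnn p else 0).
Proof.
case/andP=> d0 dX; rewrite /mangoldt [in RHS](big_cat_nat (n := d.+1)) //=.
rewrite [Y in _ = _ + Y](_ : _ = 0) ?addr0.
  apply: eq_bigr => p pp; rewrite [in RHS](big_cat_nat (n := d.+1)) //=.
  rewrite [Y in _ = _ + Y](_ : _ = 0) ?addr0 //.
  rewrite big_nat_cond big1 // => j /andP[/andP[jd _] _].
  case: eqP => // e; have := ltn_expl j (prime_gt1 pp); lia.
rewrite big_nat_cond big1 // => p /andP[/andP[pd _] pp].
rewrite big_nat_cond big1 // => j /andP[/andP[jd _] _].
case: eqP => // e; have : (p ^ 1 <= p ^ j)%N by rewrite leq_exp2l // prime_gt1.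
lia.
Qed.

Lemma mangoldt_prime p : prime p -> mangoldt p = lnn p.
Proof.
move=> pp; have p0 := prime_gt0 pp; have p1 := prime_gt1 pp.
rewrite /mangoldt big_mkcond (bigD1_seq p) ?iota_uniq //= ?mem_index_iota ?p0 ?ltnSn // pp.
rewrite [X in _ + X]big1 ?addr0 => [|q /negP qnp].
  rewrite (bigD1_seq 1%N) ?iota_uniq //= ?mem_index_iota ?expn1 ?eqxx //.
  rewrite big1 ?addr0 // => j /eqP j1; case: eqP => // e; case: j1.
  apply/eqP; rewrite -(eqn_exp2l _ _ p1) expn1 -e eqxx //.
case: ifP => // pq; rewrite big1 // => j _; case: eqP => // e; case: qnp.
have : (p %| q ^ j)%N by rewrite -e.
case: j e => [|j e]; first by rewrite expn0; lia.
by rewrite Euclid_dvdX // andbT dvdn_prime2 // eq_sym.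
Qed.

Lemma mangoldt_ppow d : mangoldt d != 0 ->
  exists p j, [/\ prime p, (0 < j)%N & d = (p ^ j)%N].
Proof.
move=> h; have : has (fun p => has (fun j => prime p && (d == p ^ j)%N) (index_iota 1 d.+1)) (index_iota 1 d.+1).
  apply/contraT => nh; case/negP: h; apply/eqP; rewrite /mangoldt big_seq_cond big1 //.
  move=> p /andP[pi pp]; rewrite big_seq_cond big1 // => j /andP[ji _].
  case: eqP => // e; case/negP: nh; apply/hasP; exists p => //; apply/hasP; exists j => //.
  by rewrite pp -e eqxx.
case/hasP => p _ /hasP [j]; rewrite mem_index_iota => /andP[j0 _] /andP[pp /eqP e].
by exists p, j.
Qed.

Lemma lnn_prod (I : Type) (r : seq I) (P : pred I) (F : I -> nat) :
  (forall i, P i -> (0 < F i)%N) ->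
  lnn (\prod_(i <- r | P i) F i) = \sum_(i <- r | P i) lnn (F i).
Proof.
move=> F0.
suff : (0 < \prod_(i <- r | P i) F i)%N /\ lnn (\prod_(i <- r | P i) F i) = \sum_(i <- r | P i) lnn (F i) by case.
elim/big_rec2: _ => [|i x y Pi [y0 e]]; first by rewrite lnn1.
by split; rewrite ?muln_gt0 ?F0 ?lnnM ?F0 ?e.
Qed.

Lemma dsum_mangoldt n : (0 < n)%N -> dsum n mangoldt = lnn n.
Proof.
move=> n0; rewrite -[in RHS](partnT n0) /partn lnn_prod; last first.
  by move=> p; rewrite inE; case: p => [|p] _; rewrite ?expn_gt0 // lognE.
rewrite [in RHS]big_ltn // {1}lognE /= expn0 lnn1 add0r.
transitivity (\sum_(1 <= d < n.+1 | (d %| n)%N) \sum_(1 <= p < n.+1 | prime p) \sum_(1 <= j < n.+1)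
    (if d == (p ^ j)%N then lnn p else 0)).
  rewrite /dsum big_nat_cond [RHS]big_nat_cond; apply: eq_bigr => d /andP[dn _].
  by rewrite (@mangoldt_widen n).
rewrite exchange_big /= [RHS](bigID prime) /= [X in _ = _ + X]big1 ?addr0; last first.
  by move=> p np; rewrite lognE (negbTE np) expn0 lnn1.
apply: eq_bigr => p pp; have p0 := prime_gt0 pp.
rewrite lnnX // exchange_big /=.
transitivity (\sum_(1 <= j < n.+1) (if (j < (logn p n).+1)%N then lnn p else 0)).
  apply: eq_big_nat => j jn; rewrite ltnS -pfactor_dvdn // big_mkcond /=.
  case: ifPn => pn.
    rewrite -[RHS](@sum_eq_index _ n (p ^ j)%N); last by rewrite expn_gt0 p0 dvdn_leq.
    by apply: eq_bigr => d _; case: eqP => [->|]; rewrite ?pn ?if_same.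
  by rewrite big1 // => d _; case: eqP => [->|]; rewrite ?(negbTE pn) ?if_same.
have h : (logn p n < n.+1)%N by rewrite ltnS ltnW // ltn_logl.
rewrite (big_cat_nat (n := (logn p n).+1)) //= (eq_big_nat _ _ (F2 := fun=> lnn p)); last first.
  by move=> i /andP[_ ->].
rewrite [Y in _ + Y](_ : _ = 0) ?addr0 ?sumr_const_nat ?subn1 ?mulr_natl //.
by rewrite big_nat_cond big1 // => i /andP[/andP[h1 _] _]; rewrite ltnNge h1.
Qed.

Lemma mangoldt_le d : mangoldt d <= lnn d.
Proof.
case: d => [|d]; first by rewrite /mangoldt big_geq // lnn_ge0.
rewrite -dsum_mangoldt // /dsum big_mkcond big_nat_recr //= dvdnn lerDr.
by apply: sumr_ge0 => i _; case: ifP => // _; exact: mangoldt_ge0.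
Qed.

End Mangoldt.
Global Opaque mangoldt mobius.

(** * Estimates of Chebyshev and Mertens *)

Section Mertens.
Variable R : realType.
Notation lnn := (lnn R).
Notation mangoldt := (mangoldt R).

Definition chebyshev (x : nat) : R := \sum_(1 <= n < x.+1) mangoldt n.

Lemma count_mult X y d : (0 < d)%N -> (y <= X)%N ->
  \sum_(1 <= b < X.+1) (if (d * b <= y)%N then 1 else 0 : R) = (y %/ d)%:R.
Proof.
move=> d0 yX; have h : (y %/ d < X.+1)%N by rewrite ltnS (leq_trans (leq_div _ _)).
rewrite (big_cat_nat (n := (y %/ d).+1)) //= [Y in Y + _](eq_big_nat _ _ (F2 := fun=> 1)); last first.
  by move=> i /andP[_ hi]; rewrite mulnC -leq_divRL // -ltnS hi.
rewrite [Y in _ + Y](_ : _ = 0) ?addr0 ?sumr_const_nat ?subn1 ?mulr_natl //.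
rewrite big_nat_cond big1 // => i /andP[/andP[h1 _] _].
by rewrite mulnC -leq_divRL // leqNgt h1.
Qed.

Lemma lnn_fact y : lnn y`! = \sum_(1 <= n < y.+1) lnn n.
Proof.
elim: y => [|y IH]; first by rewrite fact0 big_geq // lnn1.
by rewrite factS lnnM ?fact_gt0 // IH [RHS]big_nat_recr //= addrC.
Qed.

(** Sum [dsum_mangoldt] over n <= y: a given d divides y %/ d of these n. The separate bound [X]
    allows the identities for y and 2y to be compared term by term. *)
Lemma sum_mangoldt_div X y : (y <= X)%N ->
  \sum_(1 <= d < X.+1) mangoldt d * (y %/ d)%:R = lnn y`!.
Proof.
move=> yX; transitivity (\sum_(1 <= n < X.+1) (if (n <= y)%N then 1 else 0) * dsum n mangoldt).
  rewrite (@sum_dsum _ X (fun d _ => mangoldt d)) => [|n nX]; last by rewrite leqNgt (leq_ltn_trans yX nX).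
  by apply: eq_big_nat => d /andP[d0 dX]; rewrite -mulr_sumr (count_mult d0 yX).
have yX' : (y.+1 <= X.+1)%N by [].
rewrite lnn_fact (big_cat_nat (n := y.+1)) //= [Y in _ + Y](_ : _ = 0) ?addr0.
  by apply: eq_big_nat => n /andP[n1 ny]; rewrite -ltnS ny mul1r dsum_mangoldt.
rewrite big_nat_cond big1 // => i /andP[/andP[h1 _] _]; by rewrite leqNgt h1 mul0r.
Qed.

Lemma bin_le_exp2 n k : ('C(n, k) <= 2 ^ n)%N.
Proof.
have [kn|kn] := leqP k n; last by rewrite bin_small.
rewrite -[2%N]/(1 + 1)%N expnDn (bigD1 (Ordinal (kn : (k < n.+1)%N))) //=.
by rewrite !exp1n !muln1 leq_addr.
Qed.

(** The logarithm of the central binomial coefficient is the sum of mangoldt d * (2y %/ d - 2 (y %/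
    d)). All terms are nonnegative, and the integer factor is at least 1 for y < d <= 2y. *)
Lemma chebyshev_double y : chebyshev y.*2 <= chebyshev y + y.*2%:R * lnn 2.
Proof.
have yy : (y <= y.*2)%N by rewrite -addnn leq_addr.
have e1 := sum_mangoldt_div (leqnn y.*2); have e2 := sum_mangoldt_div yy.
have bf : lnn y.*2`! = lnn 'C(y.*2, y) + (lnn y`! + lnn y`!).
  rewrite -lnnM ?fact_gt0 // -lnnM ?bin_gt0 ?muln_gt0 ?fact_gt0 //.
  by rewrite -(bin_fact yy) -addnn addnK.
have b2 : lnn 'C(y.*2, y) <= y.*2%:R * lnn 2.
  by rewrite -lnnX // lnn_le ?bin_gt0 // bin_le_exp2.
suff : chebyshev y.*2 - chebyshev y <=
   \sum_(1 <= d < y.*2.+1) (mangoldt d * (y.*2 %/ d)%:R - 2 * (mangoldt d * (y %/ d)%:R)).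
  rewrite sumrB -mulr_sumr e1 e2 bf; lra.
rewrite [X in X <= _](_ : _ = \sum_(y.+1 <= d < y.*2.+1) mangoldt d); last first.
  by rewrite /chebyshev [X in X - _](big_cat_nat (n := y.+1)) //=; ring.
rewrite [X in _ <= X](big_cat_nat (n := y.+1)) //=.
have dd n d : (2 * (n %/ d) <= n.*2 %/ d)%N.
  case: d => [|d]; first by rewrite !divn0.
  by rewrite leq_divRL // -mulnA -muln2 mulnC leq_mul2r leq_trunc_div orbT.
rewrite -[X in X <= _]add0r lerD //.
  apply: sumr_ge0 => d _; rewrite mulrCA -mulrBr mulr_ge0 ?mangoldt_ge0 //.
  by rewrite subr_ge0 -natrM ler_nat dd.
apply: ler_sum_nat => d /andP[yd dy].
rewrite mulrCA -mulrBr ler_peMr ?mangoldt_ge0 //.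
rewrite (divn_small (m := y)) // mulr0 subr0 ler1n divn_gt0; lia.
Qed.

Lemma lnn2_le1 : lnn 2 <= 1.
Proof. by have := @lnnS_le R 1 isT; rewrite lnn1 subr0 invr1. Qed.

Lemma lnn2_ge : 2^-1 <= lnn 2.
Proof. by have := @lnnS_ge R 1 isT; rewrite lnn1 subr0. Qed.

Lemma chebyshev_mono x y : (x <= y)%N -> chebyshev x <= chebyshev y.
Proof.
move=> xy; have xy' : (x.+1 <= y.+1)%N by [].
rewrite /chebyshev [X in _ <= X](big_cat_nat (n := x.+1)) //= lerDl.
by apply: sumr_ge0 => i _; exact: mangoldt_ge0.
Qed.

(** Induction by halving: with u the upper half of x, the bound 4u + 2u must not exceed 4x. This
    holds for x >= 2, with equality at x = 3. *)
Lemma chebyshev_le x : chebyshev x <= 4 * x%:R.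
Proof.
elim/ltn_ind: x => x IH.
case: (leqP x 1) => x1.
  case: x x1 {IH} => [|[|//]] _; first by rewrite /chebyshev big_geq // mulr0.
  by rewrite /chebyshev big_nat1; apply: le_trans (mangoldt_le R _) _; rewrite lnn1 mulr1.
have h1 : (x <= (uphalf x).*2)%N by rewrite uphalf_half; lia.
have h2 : (uphalf x < x)%N by rewrite uphalf_half; lia.
have h3 : ((uphalf x).*2 + 4 * uphalf x <= 4 * x)%N by rewrite uphalf_half; lia.
have := chebyshev_double (uphalf x); have := chebyshev_mono h1; have := IH _ h2.
have := lnn2_le1; have : (((uphalf x).*2 + 4 * uphalf x)%:R : R) <= (4 * x)%:R by rewrite ler_nat.
rewrite natrD !natrM; have : 0 <= (uphalf x).*2%:R :> R by [].
nra.
Qed.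

Lemma lnn_fact_ge x : x%:R * lnn x - x%:R <= lnn x`!.
Proof.
elim: x => [|x IH]; first by rewrite fact0 lnn1 mul0r subr0.
rewrite factS lnnM ?fact_gt0 //.
case: x IH => [|x] IH; first by rewrite fact0 lnn1; lra.
have h := @lnnS_le R x.+1 isT.
have x0 : 0 < x.+1%:R :> R by rewrite ltr0n.
rewrite -(ler_pM2l x0) divff ?lt0r_neq0 // in h.
rewrite -[x.+2%:R]natr1; lra.
Qed.

Lemma lnn_fact_le x : lnn x`! <= x%:R * lnn x.
Proof.
rewrite lnn_fact; apply: (@le_trans _ _ (\sum_(1 <= n < x.+1) lnn x)).
  by apply: ler_sum_nat => n /andP[n1 nx]; rewrite lnn_le.
by rewrite sumr_const_nat subn1 mulr_natl.
Qed.

Definition mertens (x : nat) : R := \sum_(1 <= n < x.+1) mangoldt n / n%:R.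

(** Replacing x %/ d by x / d in [sum_mangoldt_div] costs less than 1 for each d, in total at most
    [chebyshev x], which gives the 4. *)
Lemma mertens_le x : (0 < x)%N -> mertens x <= lnn x + 4.
Proof.
move=> x0; have x0' : 0 < x%:R :> R by rewrite ltr0n.
rewrite -(ler_pM2l x0').
have := sum_mangoldt_div (leqnn x); have := lnn_fact_le x; have := chebyshev_le x.
suff : x%:R * mertens x <= \sum_(1 <= d < x.+1) mangoldt d * (x %/ d)%:R + chebyshev x by lra.
rewrite /mertens /chebyshev mulr_sumr -big_split; apply: ler_sum_nat => d /andP[d1 dx] /=.
have d0 : 0 < d%:R :> R by rewrite ltr0n.
rewrite mulrCA -[X in _ + X]mulr1 -mulrDr ler_wpM2l ?mangoldt_ge0 //.
rewrite ler_pdivrMr // natr1 -natrM ler_nat; apply: ltnW; exact: ltn_ceil.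
Qed.

Lemma mertens_ge x : (0 < x)%N -> lnn x - 1 <= mertens x.
Proof.
move=> x0; have x0' : 0 < x%:R :> R by rewrite ltr0n.
rewrite -(ler_pM2l x0').
have := sum_mangoldt_div (leqnn x); have := lnn_fact_ge x.
suff : \sum_(1 <= d < x.+1) mangoldt d * (x %/ d)%:R <= x%:R * mertens x by lra.
rewrite /mertens mulr_sumr; apply: ler_sum_nat => d /andP[d1 dx] /=.
have d0 : 0 < d%:R :> R by rewrite ltr0n.
rewrite mulrCA ler_wpM2l ?mangoldt_ge0 //.
rewrite ler_pdivlMr // -natrM ler_nat; exact: leq_trunc_div.
Qed.

Lemma mertens_window A B : (0 < A)%N -> (A <= B)%N ->
  lnn B - lnn A - 5 <= \sum_(A.+1 <= n < B.+1) mangoldt n / n%:R <= lnn B - lnn A + 5.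
Proof.
move=> A0 AB; have B0 := leq_trans A0 AB; have AB' : (A.+1 <= B.+1)%N by [].
have e : mertens B = mertens A + \sum_(A.+1 <= n < B.+1) mangoldt n / n%:R.
  by rewrite /mertens (big_cat_nat (n := A.+1)).
have := mertens_le A0; have := mertens_le B0; have := mertens_ge A0; have := mertens_ge B0.
by move=> *; apply/andP; split; lra.
Qed.

(** Since log p >= log A, the sum is at most (log A + 5) / log A by [mertens_window], and log A >=
    log 2 >= 1/2 makes this at most 1 + 10. *)
Lemma sum_inv_primes_window A : (1 < A)%N ->
  \sum_(A.+1 <= p < (A * A).+1 | prime p) (p%:R^-1 : R) <= 11.
Proof.
move=> A1; have A0 := ltnW A1.
have AB : (A <= A * A)%N by rewrite leq_pmulr.
have lA : 2^-1 <= lnn A.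
  by apply: le_trans lnn2_ge _; apply: lnn_le.
have lA0 : 0 < lnn A by apply: lt_le_trans lA; rewrite invr_gt0.
have /andP[_] := mertens_window A0 AB; rewrite lnnM // addrK => h.
apply: (@le_trans _ _ ((lnn A + 5) / lnn A)); last first.
  by rewrite ler_pdivrMr //; lra.
rewrite ler_pdivlMr //; apply: le_trans h; rewrite mulr_suml big_mkcond.
apply: ler_sum_nat => p /andP[pA _]; case: ifPn => pp; last by rewrite divr_ge0 ?mangoldt_ge0.
rewrite mangoldt_prime // mulrC ler_wpM2r ?invr_ge0 // lnn_le //; exact: ltnW.
Qed.

End Mertens.

(** * Vaughan's identity *)

Section Vaughan.
Variable R : realType.
Notation lnn := (lnn R).
Notation mangoldt := (mangoldt R).
Notation mobius := (mobius R).

Definition cut U (f : nat -> R) (n : nat) : R := if (n <= U)%N then f n else 0.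

(** For m >= 1 this is the sum of mobius d over the divisors d > U of m, by [dsum_mobius]. *)
Definition vaughan_coef U (m : nat) : R :=
  (if m == 1%N then 1 else 0) - dsum m (cut U mobius).

Lemma vaughan_coef0 U m : (0 < m <= U)%N -> vaughan_coef U m = 0.
Proof.
case/andP=> m0 mU; rewrite /vaughan_coef -(dsum_mobius R m0).
rewrite (_ : dsum m (cut U mobius) = dsum m mobius) ?subrr //.
rewrite /dsum big_nat_cond [RHS]big_nat_cond; apply: eq_bigr => d /andP[/andP[_ dm] _].
by rewrite /cut (leq_trans _ mU).
Qed.

(** Opening [vaughan_coef] in the bilinear sum, its delta at m = 1 gives the left-hand side back.
    The remaining sum has coefficients mobius d with d <= U; splitting off n <= V there and applying
    mangoldt * 1 = log gives the two linear sums. *)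
Lemma vaughan_identity X U V F : (0 < X)%N -> (forall n, (X < n)%N -> F n = 0) ->
  \sum_(1 <= n < X.+1) (mangoldt n - cut V mangoldt n) * F n =
  \sum_(1 <= n < X.+1) \sum_(1 <= m < X.+1)
     (mangoldt n - cut V mangoldt n) * vaughan_coef U m * F (n * m)%N +
  \sum_(1 <= d < X.+1) cut U mobius d * \sum_(1 <= j < X.+1) lnn j * F (d * j)%N -
  \sum_(1 <= d < X.+1) cut U mobius d * \sum_(1 <= n < X.+1) cut V mangoldt n *
     \sum_(1 <= l < X.+1) F (d * n * l)%N.
Proof.
move=> X0 F0; set a := fun n => mangoldt n - cut V mangoldt n.
have FM c : (0 < c)%N -> forall n, (X < n)%N -> F (c * n)%N = 0.
  by move=> c0 n nX; apply: F0; apply: leq_trans nX _; rewrite leq_pmull.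
have inner n : (0 < n)%N -> \sum_(1 <= m < X.+1) vaughan_coef U m * F (n * m)%N =
   F n - \sum_(1 <= d < X.+1) cut U mobius d * \sum_(1 <= l < X.+1) F (d * n * l)%N.
  move=> n0; under eq_bigr do rewrite /vaughan_coef mulrBl.
  rewrite sumrB; congr (_ - _).
    rewrite -[RHS](@sum_eq_index _ X 1%N); last by rewrite X0.
    by apply: eq_bigr => m _; case: eqP => [->|]; rewrite ?muln1 ?mul1r ?mul0r.
  under eq_bigr do rewrite mulrC.
  rewrite (@sum_dsum _ X (fun d _ => cut U mobius d) (fun m => F (n * m)%N) (FM n n0)).
  apply: eq_bigr => d _; rewrite mulr_sumr; apply: eq_bigr => l _.
  by rewrite mulnCA mulnA.
have e1 : \sum_(1 <= n < X.+1) \sum_(1 <= m < X.+1) a n * vaughan_coef U m * F (n * m)%N =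
   \sum_(1 <= n < X.+1) a n * F n - \sum_(1 <= d < X.+1) cut U mobius d *
      \sum_(1 <= n < X.+1) a n * \sum_(1 <= l < X.+1) F (d * n * l)%N.
  transitivity (\sum_(1 <= n < X.+1) (a n * F n - \sum_(1 <= d < X.+1)
      a n * (cut U mobius d * \sum_(1 <= l < X.+1) F (d * n * l)%N))).
    apply: eq_big_nat => n /andP[n0 _].
    by rewrite -[X in _ - X]mulr_sumr -mulrBr -inner // mulr_sumr; apply: eq_bigr => m _; rewrite mulrA.
  rewrite sumrB; congr (_ - _); rewrite exchange_big; apply: eq_bigr => d _ /=.
  by rewrite mulr_sumr; apply: eq_bigr => n _; rewrite mulrCA.
have e2 d : (0 < d)%N -> \sum_(1 <= n < X.+1) mangoldt n * \sum_(1 <= l < X.+1) F (d * n * l)%N =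
    \sum_(1 <= j < X.+1) lnn j * F (d * j)%N.
  move=> d0; transitivity (\sum_(1 <= j < X.+1) F (d * j)%N * dsum j mangoldt).
    rewrite (@sum_dsum _ X (fun n _ => mangoldt n) (fun m => F (d * m)%N) (FM d d0)).
    by apply: eq_bigr => n _; rewrite mulr_sumr; apply: eq_bigr => l _; rewrite mulnA.
  by apply: eq_big_nat => j /andP[j0 _]; rewrite dsum_mangoldt // mulrC.
rewrite e1 -[in RHS]addrA -[LHS](subrK (\sum_(1 <= d < X.+1) cut U mobius d *
      \sum_(1 <= n < X.+1) a n * \sum_(1 <= l < X.+1) F (d * n * l)%N)); congr (_ + _).
rewrite -sumrB; apply: eq_big_nat => d /andP[d0 _].
rewrite -mulrBr -e2 // -sumrB; congr (_ * _); apply: eq_bigr => n _.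
by rewrite /a mulrBl.
Qed.

End Vaughan.

(** * Sums over periods *)

Definition periodic {T : Type} (Q : nat) (f : nat -> T) := forall n, f (n + Q)%N = f n.

Section Periodic.
Variable A : comNzRingType.
Implicit Types (f g : nat -> A) (Q q n : nat).

Lemma periodicM (T : Type) Q j (f : nat -> T) n : periodic Q f -> f (n + j * Q)%N = f n.
Proof.
move=> pf; elim: j => [|j IH]; first by rewrite mul0n addn0.
by rewrite mulSn addnCA addnC pf.
Qed.

Lemma periodic_mod (T : Type) Q (f : nat -> T) n : periodic Q f -> f (n %% Q)%N = f n.
Proof. by move=> pf; rewrite [in RHS](divn_eq n Q) addnC periodicM. Qed.

Lemma periodic_congr (T : Type) Q (f : nat -> T) n n' : periodic Q f ->
  n = n' %[mod Q] -> f n = f n'.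
Proof. by move=> pf e; rewrite -(periodic_mod n pf) e periodic_mod. Qed.

Lemma periodic_scale (T : Type) Q c (f : nat -> T) : periodic Q f -> periodic Q (fun n => f (c * n)%N).
Proof. by move=> pf n; rewrite mulnDr periodicM. Qed.

Lemma crt_sum Q q f g : (0 < Q)%N -> (0 < q)%N -> coprime Q q ->
  periodic Q f -> periodic q g ->
  \sum_(0 <= n < Q * q) f n * g n = (\sum_(0 <= n < Q) f n) * (\sum_(0 <= n < q) g n).
Proof.
move=> Q0 q0 cop pf pg; rewrite !big_mkord big_distrlr pair_bigA /=.
pose h (n : 'I_(Q * q)) := (Ordinal (ltn_pmod n Q0), Ordinal (ltn_pmod n q0)).
have hI : injective h.
  move=> x y [] /eqP e1 /eqP e2; apply: val_inj => /=.
  have : (x == y %[mod Q * q])%N by rewrite chinese_remainder // e1 e2.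
  by rewrite !modn_small // => /eqP.
have hB : bijective h by apply: inj_card_bij => //; rewrite card_prod !card_ord.
rewrite [RHS](reindex h) /=; last exact: onW_bij.
by apply: eq_bigr => n _; rewrite !periodic_mod.
Qed.

Lemma scale_sum Q f n : (0 < Q)%N -> coprime n Q -> periodic Q f ->
  \sum_(0 <= m < Q) f (n * m)%N = \sum_(0 <= m < Q) f m.
Proof.
move=> Q0 cop pf; rewrite !big_mkord.
pose h (m : 'I_Q) := Ordinal (ltn_pmod (n * m) Q0).
have hI : injective h.
  move=> x y [] e; apply: val_inj => /=.
  wlog xy : x y e / (y <= x)%N => [W|].
    by case: (leqP y x) => [/W ->|/ltnW /W ->].
  have : (n * x == n * y %[mod Q])%N by rewrite e.
  rewrite eqn_mod_dvd ?leq_mul2l ?xy ?orbT // -mulnBr Gauss_dvdr; last by rewrite coprime_sym.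
  have [//|d0] := posnP (x - y)%N; first by move=> /eqP; rewrite subn_eq0 => xy' _; apply/eqP; rewrite eqn_leq xy'.
  by move=> /(dvdn_leq d0); have := ltn_ord x; lia.
rewrite [RHS](reindex h) /=; last exact/onW_bij/injF_bij.
by apply: eq_bigr => m _; rewrite periodic_mod.
Qed.

Lemma period_shift_sum Q f a : periodic Q f ->
  \sum_(a <= n < a + Q) f n = \sum_(0 <= n < Q) f n.
Proof.
move=> pf; elim: a => [|a IH]; first by rewrite add0n.
case: Q pf IH => [|Q] pf IH; first by rewrite addn0 !big_geq.
rewrite -IH [RHS]big_ltn; last by lia.
rewrite addSn [LHS]big_nat_recr /=; last by lia.
by rewrite pf addrC.
Qed.

End Periodic.

Section Variation.
Variable R : realType.
Local Notation C := R[i].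
Implicit Types (H : nat -> C) (phi : nat -> R).
Local Open Scope complex_scope.

Lemma normcR (x : R) : normc x%:C = `|x|.
Proof. by rewrite /normc /= expr0n /= addr0 sqrtr_sqr. Qed.

Lemma normc_ge0 (z : C) : 0 <= normc z.
Proof. by case: z => a b; exact: sqrtr_ge0. Qed.

Lemma normcD (x y : C) : normc (x + y) <= normc x + normc y.
Proof. exact: le_normcD. Qed.

Lemma normcN (x : C) : normc (- x) = normc x.
Proof. exact: complex.normcN. Qed.

Lemma normc_sum (I : Type) (r : seq I) (P : pred I) (F : I -> C) :
  normc (\sum_(i <- r | P i) F i) <= \sum_(i <- r | P i) normc (F i).
Proof.
elim/big_rec2: _ => [|i y1 y2 _ h]; first by rewrite normc0.
by apply: le_trans (normcD _ _) _; rewrite lerD2l.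
Qed.

Lemma normcB (x y : C) : normc (x - y) <= normc x + normc y.
Proof. by apply: le_trans (normcD _ _) _; rewrite normcN. Qed.

Lemma normcBC (x y : C) : normc (x - y) = normc (y - x).
Proof. by rewrite -normcN opprB. Qed.

Lemma normc_ge_sub (x y : C) : normc x - normc y <= normc (x - y).
Proof. by rewrite lerBlDr; apply: le_trans (normcD _ _); rewrite subrK. Qed.

(** Complete periods contribute 0, and at most Q terms of size at most 1 remain. *)
Lemma periodic_partial_sum Q H a b : (0 < Q)%N -> periodic Q H ->
  \sum_(0 <= n < Q) H n = 0 -> (forall n, normc (H n) <= 1) ->
  normc (\sum_(a <= n < b) H n) <= Q%:R.
Proof.
move=> Q0 pH H0 H1; have [k] := ubnP (b - a)%N; elim: k a => // k IH a kab.
case: (leqP b (a + Q)) => h.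
  apply: le_trans (normc_sum _ _ _) _; apply: (@le_trans _ _ (\sum_(a <= n < b) 1)).
    exact: ler_sum.
  by rewrite sumr_const_nat ler_nat leq_subLR.
rewrite (big_cat_nat (n := (a + Q)%N)) ?leq_addr //=; last exact: ltnW.
by rewrite period_shift_sum // H0 add0r; apply: IH; lia.
Qed.

Lemma abel_summation H phi a b : (a <= b)%N ->
  \sum_(a <= n < b) H n * (phi n)%:C = (\sum_(a <= n < b) H n) * (phi b)%:C -
   \sum_(a <= n < b) (\sum_(a <= j < n.+1) H j) * (phi n.+1 - phi n)%:C.
Proof.
move=> ab; rewrite -(subnKC ab); elim: (b - a)%N => [|k IH].
  by rewrite addn0 !big_geq // mul0r subr0.
have h : (a <= a + k)%N by rewrite leq_addr.
rewrite addnS !(big_nat_recr (a + k)%N) //= IH.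
rewrite !rmorphB /=; ring.
Qed.

Lemma periodic_weighted_sum Q H phi a b : (0 < Q)%N -> periodic Q H ->
  \sum_(0 <= n < Q) H n = 0 -> (forall n, normc (H n) <= 1) -> (a <= b)%N ->
  normc (\sum_(a <= n < b) H n * (phi n)%:C) <=
    Q%:R * (`|phi b| + \sum_(a <= n < b) `|phi n.+1 - phi n|).
Proof.
move=> Q0 pH H0 H1 ab; rewrite abel_summation //.
apply: le_trans (normcB _ _) _; rewrite mulrDr lerD //.
  by rewrite normcM normcR ler_wpM2r // periodic_partial_sum.
apply: le_trans (normc_sum _ _ _) _; rewrite mulr_sumr; apply: ler_sum => n _.
by rewrite normcM normcR ler_wpM2r // periodic_partial_sum.
Qed.

(** In the constant 3, one unit is the boundary term of Abel summation and two come from the sum of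
    1/n^2 over n >= a, which is at most 2/a. *)
Lemma periodic_inv_sum Q H phi (Phi : R) a b : (0 < Q)%N -> periodic Q H ->
  \sum_(0 <= n < Q) H n = 0 -> (forall n, normc (H n) <= 1) -> (0 < a <= b)%N ->
  (forall n, (a <= n)%N -> `|phi n| <= Phi / n%:R) ->
  (forall n, (a <= n)%N -> `|phi n.+1 - phi n| <= Phi / n%:R ^+ 2) ->
  normc (\sum_(a <= n < b) H n * (phi n)%:C) <= 3 * Q%:R * Phi / a%:R.
Proof.
move=> Q0 pH H0 H1 /andP[a0 ab] f1 f2.
apply: le_trans (periodic_weighted_sum phi Q0 pH H0 H1 ab) _.
have a0' : 0 < a%:R :> R by rewrite ltr0n.
have a1' : 1 <= a%:R :> R by rewrite ler1n.
have Phi0 : 0 <= Phi.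
  have := f1 a (leqnn a); rewrite ler_pdivlMr // => h; apply: le_trans h; exact: mulr_ge0.
rewrite (_ : 3 * Q%:R * Phi / a%:R = Q%:R * (3 * (Phi / a%:R))); last by ring.
rewrite ler_wpM2l //.
have e1 : `|phi b| <= Phi / a%:R.
  apply: le_trans (f1 b ab) _; rewrite ler_wpM2l // lef_pV2 ?posrE ?ltr0n ?ler_nat //.
  exact: leq_trans ab.
suff e2 : \sum_(a <= n < b) `|phi n.+1 - phi n| <= Phi * (2 / a%:R) by lra.
apply: (@le_trans _ _ (\sum_(a <= n < b) Phi / n%:R ^+ 2)).
  by apply: ler_sum_nat => n /andP[an _]; exact: f2.
rewrite -mulr_sumr ler_wpM2l //.
move: ab; rewrite leq_eqVlt => /orP[/eqP <-|ab]; first by rewrite big_geq // divr_ge0.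
rewrite big_ltn //; apply: (@le_trans _ _ (a%:R ^- 2 + a%:R^-1)).
  rewrite lerD2l; case: b ab {e1} => // b ab.
  by rewrite -(big_addn 0 _ 1) || rewrite big_add1; apply: sum_inv_sqr_le.
have : a%:R ^- 2 <= a%:R^-1 :> R by rewrite lef_pV2 ?posrE ?exprn_gt0 // expr2 ler_peMr // ltW.
lra.
Qed.

End Variation.

Section VariationReal.
Variable R : realType.
Implicit Types (H : nat -> R) (phi : nat -> R).

Lemma periodic_inv_sumR Q H phi (Phi : R) a b : (0 < Q)%N -> periodic Q H ->
  \sum_(0 <= n < Q) H n = 0 -> (forall n, `|H n| <= 1) -> (0 < a <= b)%N ->
  (forall n, (a <= n)%N -> `|phi n| <= Phi / n%:R) ->
  (forall n, (a <= n)%N -> `|phi n.+1 - phi n| <= Phi / n%:R ^+ 2) ->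
  `|\sum_(a <= n < b) H n * phi n| <= 3 * Q%:R * Phi / a%:R.
Proof.
move=> Q0 pH H0 H1 ab f1 f2.
have := @periodic_inv_sum R Q (fun n => real_complex R (H n)) phi Phi a b Q0.
rewrite -normcR rmorph_sum /=; under [in X in _ -> X]eq_bigr do rewrite rmorphM.
apply => //; first by move=> n; rewrite pH.
  by rewrite -rmorph_sum /= H0.
by move=> n; have := H1 n; rewrite -normcR.
Qed.

(* H minus its mean has mean zero, at the price of the bound 2 *)
Lemma periodic_inv_sum_mean Q H phi (Phi : R) a b : (0 < Q)%N -> periodic Q H ->
  (forall n, `|H n| <= 1) -> (0 < a <= b)%N ->
  (forall n, (a <= n)%N -> `|phi n| <= Phi / n%:R) ->
  (forall n, (a <= n)%N -> `|phi n.+1 - phi n| <= Phi / n%:R ^+ 2) ->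
  `|\sum_(a <= n < b) H n * phi n| <=
    `|\sum_(0 <= n < Q) H n| / Q%:R * \sum_(a <= n < b) `|phi n| + 6 * Q%:R * Phi / a%:R.
Proof.
move=> Q0 pH H1 ab f1 f2; set mu := (\sum_(0 <= n < Q) H n) / Q%:R.
have Q0' : 0 < Q%:R :> R by rewrite ltr0n.
have mu1 : `|mu| <= 1.
  rewrite normrM normfV (ger0_norm (ltW Q0')) ler_pdivrMr // mul1r.
  apply: le_trans (ler_norm_sum _ _ _) _.
  apply: (@le_trans _ _ (\sum_(0 <= n < Q) 1)); first exact: ler_sum.
  by rewrite sumr_const_nat subn0.
pose K n := (H n - mu) / 2.
have := @periodic_inv_sumR Q K phi Phi a b Q0.
have -> : \sum_(a <= n < b) K n * phi n = (\sum_(a <= n < b) H n * phi n - mu * \sum_(a <= n < b) phi n) / 2.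
  rewrite mulr_sumr -sumrB mulr_suml; apply: eq_bigr => n _; rewrite /K; ring.
move=> h; have {}h : `|(\sum_(a <= n < b) H n * phi n - mu * \sum_(a <= n < b) phi n) / 2| <= 3 * Q%:R * Phi / a%:R.
  apply: h => //.
  - by move=> n; rewrite /K pH.
  - rewrite /K -mulr_suml sumrB sumr_const_nat subn0 -[mu *+ Q]mulr_natr divfK ?subrr ?mul0r //.
    exact: lt0r_neq0.
  - move=> n; rewrite /K normrM [`|2^-1|]ger0_norm ?invr_ge0 // ler_pdivrMr // mul1r.
    by apply: le_trans (ler_normB _ _) _; rewrite -[2]/(1 + 1) lerD.
rewrite normrM [`|2^-1|]ger0_norm ?invr_ge0 // ler_pdivrMr // in h.
have e : `|mu * \sum_(a <= n < b) phi n| <= `|\sum_(0 <= n < Q) H n| / Q%:R * \sum_(a <= n < b) `|phi n|.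
  rewrite normrM /mu normrM normfV (ger0_norm (ltW Q0')) ler_wpM2l ?ler_norm_sum //.
  by rewrite divr_ge0 // ltW.
rewrite -[X in `|X|](subrK (mu * \sum_(a <= n < b) phi n)).
apply: le_trans (ler_normD _ _) _; rewrite addrC lerD //; apply: le_trans h _; lra.
Qed.

End VariationReal.

(** * Twisted sums over primes *)

Section TwistedWeights.
Variable R : realType.
Local Notation C := R[i].
Notation lnn := (lnn R).
Local Open Scope complex_scope.
Implicit Types (s h : R) (k i j n : nat).

(** Up to sign, the k-th difference with step h, in the variable s, of the i-th derivative of
    n^(-s). *)
Definition logweight s h k i n : R := pw s n * (1 - pw h n) ^+ k * lnn n ^+ i.

Lemma subrX_le (x y : R) k : 0 <= y <= x -> x ^+ k - y ^+ k <= k%:R * x ^+ k.-1 * (x - y).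
Proof.
case/andP=> y0 yx; have x0 := le_trans y0 yx.
elim: k => [|k IH]; first by rewrite !expr0 subrr mul0r mul0r.
rewrite /= !exprS -natr1.
have e : k%:R * x ^+ k = x * (k%:R * x ^+ k.-1).
  by case: (k) => [|k']; rewrite ?mul0r ?mulr0 //= exprS mulrCA.
have yk : y ^+ k <= x ^+ k by rewrite lerXn2r.
have : x * (x ^+ k - y ^+ k) <= k%:R * x ^+ k * (x - y).
  by rewrite e -mulrA ler_wpM2l.
have xy0 : 0 <= x - y by rewrite subr_ge0.
have := ler_wpM2r xy0 yk; set a := x ^+ k; set b := y ^+ k; lra.
Qed.

Lemma logweight_ge0 s h k i n : 0 <= h -> 0 <= logweight s h k i n.
Proof.
move=> h0; have /andP[u0 _] := onesub_pw_le n h0.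
by rewrite !mulr_ge0 ?pw_ge0 ?exprn_ge0 ?lnn_ge0.
Qed.

Lemma logweight_le s h k i n : 1 <= s -> 0 <= h -> (0 < n)%N ->
  logweight s h k i n <= h ^+ k * (lnn n ^+ (k + i) / n%:R).
Proof.
move=> s1 h0 n0; have /andP[u0 u1] := onesub_pw_le n h0.
have L0 : 0 <= lnn n by exact: lnn_ge0.
rewrite /logweight exprD -(pw1 R n0).
have e1 : pw s n <= pw 1 n by apply: pw_les.
have e2 : (1 - pw h n) ^+ k <= h ^+ k * lnn n ^+ k by rewrite -exprMn lerXn2r ?nnegrE ?mulr_ge0.
rewrite -mulrA [X in _ <= X](_ : _ = pw 1 n * (h ^+ k * lnn n ^+ k * lnn n ^+ i)); last by ring.
apply: ler_pM => //; rewrite ?pw_ge0 ?mulr_ge0 ?exprn_ge0 //.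
by rewrite ler_wpM2r ?exprn_ge0.
Qed.

Lemma logweight_step s h k i n : 1 <= s <= 2 -> 0 <= h -> (0 < n)%N ->
  `|logweight s h k i n.+1 - logweight s h k i n| <=
   h ^+ k * ((2 * lnn n.+1 ^+ (k + i) + (k + i)%:R * lnn n.+1 ^+ (k + i).-1) / n%:R ^+ 2).
Proof.
case/andP=> s1 s2 h0 n0; rewrite /logweight.
have /andP[u0 u1] := onesub_pw_le n h0; have /andP[u0' u1'] := onesub_pw_le n.+1 h0.
have a01 : 0 <= pw s n - pw s n.+1 by rewrite subr_ge0 pw_le // (le_trans ler01).
have a1 := pwS_diff (le_trans ler01 s1) n0.
have b1 := pwS_diff h0 n0; have hn1 := pw_le1 n h0.
have L0 := lnn_ge0 R n; have LL : lnn n <= lnn n.+1 by apply: lnn_le.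
have Ld := lnnS_le R n0; have pn := pw_ge0 s n; have pn1 : pw s n <= n%:R^-1.
  by rewrite -pw1 // pw_les.
have uu : 1 - pw h n <= 1 - pw h n.+1 by rewrite lerB // pw_le.
set a := pw s n in a01 a1 pn pn1 *; set a' := pw s n.+1 in a01 a1 *.
set w := n%:R^-1 : R in Ld pn1 *; have w0 : 0 <= w by rewrite invr_ge0.
have ud : (1 - pw h n.+1) - (1 - pw h n) <= h * w.
  rewrite (_ : _ - _ = pw h n - pw h n.+1); last by ring.
  by apply: le_trans b1 _; rewrite ler_piMr // mulr_ge0.
set u := 1 - pw h n in u0 u1 uu ud *; set u' := 1 - pw h n.+1 in u0' u1' uu ud *.
set L := lnn n in L0 LL Ld u1 *; set L' := lnn n.+1 in LL Ld u1' *.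
have L'0 : 0 <= L' by exact: le_trans LL.
have bc : 0 <= u ^+ k * L ^+ i <= u' ^+ k * L' ^+ i.
  rewrite mulr_ge0 ?exprn_ge0 //=.
  by apply: ler_pM; rewrite ?exprn_ge0 // lerXn2r.
have bc' : u' ^+ k * L' ^+ i <= h ^+ k * L' ^+ (k + i).
  rewrite exprD mulrA ler_wpM2r ?exprn_ge0 // -exprMn lerXn2r ?nnegrE ?mulr_ge0 //.
have d1 : (u' ^+ k - u ^+ k) * L' ^+ i <= h ^+ k * (k%:R * L' ^+ (k + i).-1 * w).
  have := @subrX_le u' u k; rewrite u0 uu => /(_ isT) q1.
  case: k q1 {bc bc'} => [|k] q1; first by rewrite !expr0 subrr !mul0r mulr0.
  apply: (@le_trans _ _ (k.+1%:R * (h * L') ^+ k * (h * w) * L' ^+ i)).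
    rewrite ler_wpM2r ?exprn_ge0 //; apply: le_trans q1 _ => /=.
    have q2 : u' ^+ k <= (h * L') ^+ k by rewrite lerXn2r ?nnegrE ?mulr_ge0.
    apply: ler_pM => //; rewrite ?subr_ge0 //; first by rewrite mulr_ge0 ?exprn_ge0.
    by rewrite ler_wpM2l.
  rewrite addSn /= exprMn exprD exprS; ring_le.
have d2 : u ^+ k * (L' ^+ i - L ^+ i) <= h ^+ k * (i%:R * L' ^+ (k + i).-1 * w).
  have := @subrX_le L' L i; rewrite L0 LL => /(_ isT) q1.
  case: i q1 {bc bc' d1} => [|i] q1; first by rewrite !expr0 subrr mulr0 !mul0r mulr0.
  apply: (@le_trans _ _ ((h * L') ^+ k * (i.+1%:R * L' ^+ i * w))).
    have q2 : L' ^+ i.+1 - L ^+ i.+1 <= i.+1%:R * L' ^+ i * w.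
    by apply: le_trans q1 _; rewrite ler_wpM2l ?mulr_ge0 ?exprn_ge0.
  have q3 : u ^+ k <= (h * L') ^+ k.
    by rewrite lerXn2r ?nnegrE ?mulr_ge0 // (le_trans uu).
  by apply: ler_pM => //; rewrite ?exprn_ge0 // subr_ge0 lerXn2r.
  rewrite addnS /= exprMn exprD; ring_le.
have d : u' ^+ k * L' ^+ i - u ^+ k * L ^+ i <= h ^+ k * ((k + i)%:R * L' ^+ (k + i).-1 * w).
  rewrite natrD; have -> : u' ^+ k * L' ^+ i - u ^+ k * L ^+ i =
    (u' ^+ k - u ^+ k) * L' ^+ i + u ^+ k * (L' ^+ i - L ^+ i) by ring.
  lra.
move: bc => /andP[bc0 bc1].
have -> : a' * u' ^+ k * L' ^+ i - a * u ^+ k * L ^+ i =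
   a * (u' ^+ k * L' ^+ i - u ^+ k * L ^+ i) - (a - a') * (u' ^+ k * L' ^+ i) by ring.
apply: le_trans (ler_normB _ _) _.
rewrite !normrM !ger0_norm ?subr_ge0 ?mulr_ge0 ?exprn_ge0 //; last by rewrite -subr_ge0.
have p1 : a * (u' ^+ k * L' ^+ i - u ^+ k * L ^+ i) <= w * (h ^+ k * ((k + i)%:R * L' ^+ (k + i).-1 * w)).
  by apply: ler_pM => //; rewrite subr_ge0.
have p2 : (a - a') * (u' ^+ k * L' ^+ i) <= (2 * w * w) * (h ^+ k * L' ^+ (k + i)).
  apply: ler_pM => //; first exact: le_trans bc1.
  apply: le_trans a1 _; rewrite -/w; apply: ler_pM; rewrite ?mulr_ge0 ?(le_trans ler01 s1) //.
  by rewrite ler_wpM2r.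
have -> : (n%:R ^+ 2)^-1 = w ^+ 2 :> R by rewrite /w exprVn.
move: p1 p2; set t := h ^+ k; set A := L' ^+ _; set B := L' ^+ _; rewrite expr2; lra.
Qed.

(** The trivial bound up to q^2 contributes 1 + 2 log q, and the tail beyond q^2 contributes 25; see
    [twisted_sum_bound]. *)
Definition logK (q : nat) : R := 2 * lnn q + 26.

Lemma logK_ge q : 26 <= logK q.
Proof. by rewrite /logK lerDr mulr_ge0 // lnn_ge0. Qed.

(** The sum is cut at q^2. Below, each term is bounded trivially. Above, Abel summation over the
    period costs a factor q, which the square root of q^2 pays for: (log n)^j <= 2^j j! n^(1/2)
    leaves a factor n^(-1/2) at n = q^2. This is where the factorial comes from. *)
Lemma twisted_sum_bound q (chi : nat -> C) s h k i X : (0 < q)%N -> periodic q chi ->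
  \sum_(0 <= n < q) chi n = 0 -> (forall n, normc (chi n) <= 1) ->
  1 <= s <= 2 -> 0 <= h ->
  normc (\sum_(1 <= n < X.+1) chi n * (logweight s h k i n)%:C) <=
    h ^+ k * ((k + i)`!%:R * logK q ^+ (k + i).+1).
Proof.
move=> q0 pc c0 c1 /andP[s1 s2] h0; set j := (k + i)%N.
have q0' : 0 < q%:R :> R by rewrite ltr0n.
have hk : 0 <= h ^+ k by rewrite exprn_ge0.
have Q2 : (0 < q ^ 2)%N by rewrite expn_gt0 q0.
have lQ : lnn (q ^ 2) = 2 * lnn q by rewrite lnnX.
have j1 : 1 <= j`!%:R :> R by rewrite ler1n fact_gt0.
have K0 := logK_ge q; have l0 : 0 <= 2 * lnn q by rewrite mulr_ge0 // lnn_ge0.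
have small Y : (Y <= q ^ 2)%N ->
   normc (\sum_(1 <= n < Y.+1) chi n * (logweight s h k i n)%:C) <=
   h ^+ k * ((2 * lnn q) ^+ j * (1 + 2 * lnn q)).
  move=> YQ; apply: le_trans (normc_sum _ _ _) _.
  apply: (@le_trans _ _ (\sum_(1 <= n < Y.+1) h ^+ k * (2 * lnn q) ^+ j * n%:R^-1)).
    apply: ler_sum_nat => n /andP[n1 nY]; rewrite normcM normcR ger0_norm ?logweight_ge0 //.
    apply: (@le_trans _ _ (1 * logweight s h k i n)); first by rewrite ler_wpM2r ?logweight_ge0.
    rewrite mul1r -mulrA; apply: le_trans (logweight_le k i s1 h0 n1) _.
    rewrite ler_wpM2l // ler_wpM2r ?invr_ge0 // lerXn2r ?nnegrE ?lnn_ge0 // -lQ lnn_le //.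
    by rewrite -ltnS; apply: leq_trans nY _.
  rewrite -mulr_sumr -mulrA ler_wpM2l // ler_wpM2l ?exprn_ge0 //.
  apply: le_trans (harmonic_le R Y) _; rewrite lerD2l -lQ.
  by case: Y YQ => [|Y] YQ; [rewrite /lnn ln0 // lnn_ge0 | exact: lnn_le].
have fin1 : (2 * lnn q) ^+ j * (1 + 2 * lnn q) + 25 * (2 ^+ j * j`!%:R) <= j`!%:R * logK q ^+ j.+1.
  have e1 : (2 * lnn q) ^+ j <= logK q ^+ j by rewrite lerXn2r ?nnegrE //; rewrite /logK; lra.
  have e2 : 2 ^+ j <= logK q ^+ j by rewrite lerXn2r ?nnegrE //; lra.
  have e3 : 0 <= logK q ^+ j by rewrite exprn_ge0 //; lra.
  have t1 : (2 * lnn q) ^+ j * (1 + 2 * lnn q) <= logK q ^+ j * (1 + 2 * lnn q).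
    by rewrite ler_wpM2r //; lra.
  have t2 : logK q ^+ j * (1 + 2 * lnn q) <= j`!%:R * (logK q ^+ j * (1 + 2 * lnn q)).
    by rewrite ler_peMl // mulr_ge0 //; lra.
  have t3 : 2 ^+ j * j`!%:R <= j`!%:R * logK q ^+ j.
    by rewrite mulrC ler_wpM2l.
  rewrite exprS; move: t1 t2 t3; rewrite /logK; set E := (_ + 26) ^+ j; set Fc := j`!%:R; lra.
have tail : 0 <= 25 * (2 ^+ j * j`!%:R) :> R by rewrite !mulr_ge0 ?exprn_ge0.
case: (leqP X (q ^ 2)) => XQ.
  apply: le_trans (small X XQ) _; rewrite ler_wpM2l //; lra.
rewrite (big_cat_nat (n := (q ^ 2).+1)) //=; last by rewrite ltnS ltnW.
apply: le_trans (normcD _ _) _.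
suff big : normc (\sum_((q ^ 2).+1 <= n < X.+1) chi n * (logweight s h k i n)%:C) <=
   h ^+ k * (25 * (2 ^+ j * j`!%:R)).
  apply: le_trans (lerD (small _ (leqnn _)) big) _; rewrite -mulrDr ler_wpM2l //.
apply: le_trans (periodic_weighted_sum _ q0 pc c0 c1 _) _; first by rewrite ltnS ltnW.
have pwhalf n : (0 < n)%N -> lnn n ^+ j / n%:R <= 2 ^+ j * j`!%:R * pw 2^-1 n.
  move=> n0; rewrite -(pw1 R n0).
  have -> : pw (2^-1) n = expR (lnn n / 2) * pw 1 n.
    rewrite /pw -expRD; congr expR; lra.
  by rewrite mulrA ler_wpM2r ?pw_ge0 // lnnX_le.
have pq : pw 2^-1 (q ^ 2) = q%:R^-1 :> R.
  by rewrite /pw lQ -(pw1 R q0) /pw; congr expR; lra.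
have T1 : `|logweight s h k i X.+1| <= h ^+ k * (2 ^+ j * j`!%:R * q%:R^-1).
  rewrite ger0_norm ?logweight_ge0 //; apply: le_trans (logweight_le k i s1 h0 _) _ => //.
  rewrite ler_wpM2l //; apply: le_trans (pwhalf X.+1 isT) _.
  by rewrite -pq ler_wpM2l ?mulr_ge0 ?exprn_ge0 // pw_le ?invr_ge0 //; exact: leqW (ltnW XQ).
have T2 : \sum_((q ^ 2).+1 <= n < X.+1) `|logweight s h k i n.+1 - logweight s h k i n| <=
   h ^+ k * (24 * (2 ^+ j * j`!%:R) * q%:R^-1).
  apply: (@le_trans _ _ (\sum_((q ^ 2).+1 <= n < X.+1) h ^+ k * (12 * (2 ^+ j * j`!%:R)) * pw (1 + 2^-1) n.+1)).
    apply: ler_sum_nat => n /andP[nq nX]; have n0 : (0 < n)%N by apply: leq_ltn_trans nq.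
    apply: le_trans (logweight_step k i _ h0 n0) _; first by rewrite s1.
    rewrite -/j -mulrA ler_wpM2l //.
    have E0 := expR_ge0 (lnn n.+1 / 2); set E := expR _ in E0.
    have f1 := @lnnX_le R n.+1 j isT; rewrite -/E in f1.
    have f2 : j%:R * lnn n.+1 ^+ j.-1 <= 2 ^+ j * j`!%:R * E.
      case: (j) => [|j']; first by rewrite mul0r !mulr_ge0 ?exprn_ge0.
      have := @lnnX_le R n.+1 j' isT; rewrite -/E /= => f.
      have := ler_wpM2l (ler0n R j'.+1) f.
      rewrite factS natrM exprS => f'; apply: le_trans f' _.
      have : 0 <= j'.+1%:R * (2 ^+ j' * j'`!%:R * E) by rewrite !mulr_ge0 ?exprn_ge0.
      lra.
    have f3 : (2 * lnn n.+1 ^+ j + j%:R * lnn n.+1 ^+ j.-1) <= 3 * (2 ^+ j * j`!%:R) * E by lra.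
    apply: (@le_trans _ _ (3 * (2 ^+ j * j`!%:R) * E / n%:R ^+ 2)).
      by rewrite ler_wpM2r // invr_ge0 exprn_ge0.
    have -> : pw (1 + 2^-1) n.+1 = E / n.+1%:R ^+ 2.
      rewrite -exprVn -(pw1 R (isT : (0 < n.+1)%N)) pwXn /E /pw -expRD; congr expR; lra.
    rewrite (_ : 12 * _ * _ = 3 * (2 ^+ j * j`!%:R) * E * (4 / n.+1%:R ^+ 2)); last by ring.
    rewrite ler_wpM2l ?mulr_ge0 ?exprn_ge0 //.
    have n0' : 0 < n%:R :> R by rewrite ltr0n.
    rewrite ler_pdivlMr ?exprn_gt0 // mulrC ler_pdivrMr ?exprn_gt0 //.
    have : 1 <= n%:R :> R by rewrite ler1n.
    rewrite -natr1; nra.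
  rewrite -mulr_sumr.
  apply: (@le_trans _ _ (h ^+ k * (12 * (2 ^+ j * j`!%:R)) * (q%:R^-1 / 2^-1))).
    rewrite ler_wpM2l ?mulr_ge0 ?exprn_ge0 // -pq.
    apply: le_trans (@sum_pw_le R 2^-1 (q ^ 2).+1 X.+1 _ isT) _; first by rewrite invr_gt0.
    by rewrite ler_wpM2r ?invr_ge0 // pw_le ?invr_ge0.
  rewrite invrK; ring_le.
apply: le_trans (ler_wpM2l (ltW q0') (lerD T1 T2)) _.
have qq : q%:R / q%:R = 1 :> R by rewrite divff // lt0r_neq0.
rewrite [X in X <= _](_ : _ = h ^+ k * (25 * (2 ^+ j * j`!%:R)) * (q%:R / q%:R)); last by ring.
by rewrite qq mulr1.
Qed.

End TwistedWeights.

(** * Finite differences of L'/L *)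

Section TwistedPrimeSums.
Variable R : realType.
Local Notation C := R[i].
Notation lnn := (lnn R).
Notation mangoldt := (mangoldt R).
Local Open Scope complex_scope.
Implicit Types (s h : R) (k i j n X : nat) (chi : nat -> C).

(** Truncated at X and up to a common sign, [Lsum], [Dsum] and [Psum] are the k-th differences with
    step h of L, of -L' and of -L'/L. *)
Definition Lsum X chi s h k : C :=
  \sum_(1 <= n < X.+1) chi n * (logweight s h k 0 n)%:C.
Definition Dsum X chi s h k : C :=
  \sum_(1 <= n < X.+1) chi n * (logweight s h k 1 n)%:C.
Definition Psum X chi s h k : C :=
  \sum_(1 <= n < X.+1) chi n * (mangoldt n * logweight s h k 0 n)%:C.

Lemma pw_vanishes (a e : R) : 0 < a -> 0 < e ->
  exists X0, forall X, (X0 <= X)%N -> pw a X <= e.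
Proof.
move=> a0 e0; pose b := (Num.truncn ((a * lnn 2)^-1 * - ln e)).+1.
have l2 : 0 < lnn 2 by apply: lt_le_trans (lnn2_ge R); rewrite invr_gt0.
exists (2 ^ b)%N => X hX; apply: (@le_trans _ _ (pw a (2 ^ b))).
  by apply: pw_le; rewrite ?expn_gt0 // ltW.
rewrite /pw lnnX // -[X in _ <= X](lnK (x := e)) ?posrE // ler_expR lerNl mulrCA.
have al : 0 < a * lnn 2 by rewrite mulr_gt0.
rewrite -ler_pdivrMr // mulrC /b; apply: ltW; exact: truncnS_gt.
Qed.

(* the part of the double sum over a, b <= X lying above the hyperbola ab <= X *)
Definition hyp_tail X (al : R) : R :=
  pw al X * ((2 / al) * (1 + al^-1) * (1 + 2 / al)).

(** Leibniz rule for differences of L * (-L'/L) = -L'. It is the binomial expansion of the m-th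
    power of 1 - (ab)^(-h) = a^(-h) (1 - b^(-h)) + (1 - a^(-h)); the powers of a^(-h) are the shifts
    of s in [Lsum]. Truncation leaves the pairs with ab > X, which a surplus 2 al in the exponent
    makes small. *)
Lemma Psum_convolution X chi s h m al : (0 < X)%N ->
  (forall a b, chi (a * b)%N = chi a * chi b) -> (forall n, normc (chi n) <= 1) ->
  0 <= h -> 0 < al -> 1 + 2 * al <= s ->
  normc (\sum_(k < m.+1) ('C(m, k))%:R * (Lsum X chi (s + (m - k)%:R * h) h k * Psum X chi s h (m - k))
    - Dsum X chi s h m) <= hyp_tail X al.
Proof.
move=> X0 cM c1 h0 al0 sal.
pose W n : C := chi n * (logweight s h m 0 n)%:C.
pose G a b : C := if (a * b <= X)%N then 0 else W (a * b)%N * (mangoldt b)%:C.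
have e1 : \sum_(k < m.+1) ('C(m, k))%:R * (Lsum X chi (s + (m - k)%:R * h) h k * Psum X chi s h (m - k))
   = \sum_(1 <= a < X.+1) \sum_(1 <= b < X.+1) W (a * b)%N * (mangoldt b)%:C.
  transitivity (\sum_(1 <= a < X.+1) \sum_(1 <= b < X.+1) \sum_(k < m.+1)
     ('C(m, k))%:R * ((chi a * (logweight (s + (m - k)%:R * h) h k 0 a)%:C) *
        (chi b * (mangoldt b * logweight s h (m - k) 0 b)%:C))).
    transitivity (\sum_(k < m.+1) \sum_(1 <= a < X.+1) \sum_(1 <= b < X.+1)
       ('C(m, k))%:R * ((chi a * (logweight (s + (m - k)%:R * h) h k 0 a)%:C) *
        (chi b * (mangoldt b * logweight s h (m - k) 0 b)%:C))).
      apply: eq_bigr => k _; rewrite /Lsum /Psum big_distrl mulr_sumr /=.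
      by apply: eq_bigr => a _; rewrite !mulr_sumr.
    rewrite exchange_big /=; by apply: eq_bigr => a _; rewrite exchange_big.
  apply: eq_big_nat => a /andP[a0 _]; apply: eq_big_nat => b /andP[b0 _].
  rewrite /W cM.
  transitivity (chi a * chi b * (mangoldt b * \sum_(k < m.+1) ('C(m, k))%:R *
     (logweight (s + (m - k)%:R * h) h k 0 a * logweight s h (m - k) 0 b))%:C).
    move: (mangoldt b) => mb; rewrite [in RHS]rmorphM [in RHS]rmorph_sum /= !mulr_sumr; apply: eq_bigr => k _.
    rewrite !rmorphM /= rmorph_nat; ring.
  suff -> : \sum_(k < m.+1) ('C(m, k))%:R *
     (logweight (s + (m - k)%:R * h) h k 0 a * logweight s h (m - k) 0 b) = logweight s h m 0 (a * b).
    by rewrite -!mulrA -rmorphM /= (mulrC (mangoldt b)).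
  have -> : logweight s h m 0 (a * b) = pw s a * pw s b *
      (pw h a * (1 - pw h b) + (1 - pw h a)) ^+ m.
    rewrite /logweight expr0 mulr1 !pwM //; congr (_ * _ ^+ _); ring.
  rewrite exprDn mulr_sumr; apply: eq_bigr => k _.
  by rewrite /logweight !expr0 !mulr1 pwD -pwXn exprMn -mulr_natr; ring.
have e2 : Dsum X chi s h m = \sum_(1 <= a < X.+1) \sum_(1 <= b < X.+1)
    (if (a * b <= X)%N then W (a * b)%N * (mangoldt b)%:C else 0).
  pose F n : C := if (n <= X)%N then W n else 0.
  have F0 n : (X < n)%N -> F n = 0 by move=> nX; rewrite /F leqNgt nX.
  transitivity (\sum_(1 <= n < X.+1) F n * dsum n (fun d => (mangoldt d)%:C)).
    apply: eq_big_nat => n /andP[n0 nX]; rewrite /F -ltnS nX /W.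
    rewrite /dsum -rmorph_sum /= -/(dsum n mangoldt) dsum_mangoldt //.
    by rewrite -mulrA -rmorphM /logweight expr0 mulr1 expr1.
  rewrite (@sum_dsum _ X (fun d _ => (mangoldt d)%:C) F F0) exchange_big /=.
  apply: eq_bigr => a _; apply: eq_bigr => b _; rewrite mulnC /F.
  by case: ifP; rewrite ?mulr0 // mulrC.
rewrite e1 e2 -sumrB; under eq_bigr do rewrite -sumrB.
have pB (b : nat) : (0 < b)%N -> mangoldt b * pw (1 + al) b <= 2 / al * pw (1 + al / 2) b.
  move=> b0; have := mangoldt_le R b; have L := @lnn_pw_le R (al / 2) b (divr_gt0 al0 (ltr0n R 2)).
  have -> : pw (1 + al) b = pw (al / 2) b * pw (1 + al / 2) b.
    by rewrite -pwD; congr (pw _ b); clear; lra.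
  rewrite mulrA => ml; rewrite ler_wpM2r ?pw_ge0 //.
  apply: le_trans (ler_wpM2r (pw_ge0 _ _) ml) _; apply: le_trans L _.
  by rewrite invf_div.
apply: le_trans (normc_sum _ _ _) _.
apply: (@le_trans _ _ (\sum_(1 <= a < X.+1) \sum_(1 <= b < X.+1)
    pw al X * (pw (1 + al) a * (2 / al * pw (1 + al / 2) b)))).
  apply: ler_sum_nat => a /andP[a0 _]; apply: le_trans (normc_sum _ _ _) _.
  apply: ler_sum_nat => b /andP[b0 _]; case: ifPn => [_|abX].
    by rewrite subrr normc0 !mulr_ge0 ?pw_ge0 // ?invr_ge0 // ltW.
  rewrite subr0 /W !normcM !normcR !ger0_norm ?mangoldt_ge0 ?logweight_ge0 //.
  apply: (@le_trans _ _ (pw (1 + 2 * al) (a * b) * mangoldt b)).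
    rewrite ler_wpM2r ?mangoldt_ge0 //.
    apply: (@le_trans _ _ (1 * logweight s h m 0 (a * b))); first by rewrite ler_wpM2r ?logweight_ge0.
    rewrite mul1r /logweight expr0 mulr1.
    apply: (@le_trans _ _ (pw s (a * b) * 1)); last by rewrite mulr1 pw_les.
    have /andP[u0 _] := onesub_pw_le (a * b) h0.
    rewrite ler_wpM2l ?pw_ge0 // exprn_ile1 //; have := pw_ge0 h (a * b); lra.
  have -> : 1 + 2 * al = al + (1 + al) by ring.
  rewrite pwD -mulrA; apply: ler_pM; rewrite ?pw_ge0 ?mulr_ge0 ?pw_ge0 ?mangoldt_ge0 //.
    by apply: pw_le => //; [exact: ltW | apply: ltnW; rewrite ltnNge].
  rewrite pwM // -mulrA ler_wpM2l ?pw_ge0 // mulrC; exact: pB.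
rewrite /hyp_tail.
under eq_bigr do rewrite -!mulr_sumr.
rewrite -mulr_sumr -mulr_suml ler_wpM2l ?pw_ge0 //.
rewrite [X in _ <= X](_ : _ = (1 + al^-1) * (2 / al * (1 + 2 / al))); last by ring.
have al2 : 0 <= 2 / al by rewrite divr_ge0 // ltW.
have S1 := @sum_pw_full R al X al0.
have S2 := @sum_pw_full R (al / 2) X (divr_gt0 al0 (ltr0n R 2)); rewrite invf_div in S2.
apply: ler_pM => //.
- by apply: sumr_ge0 => n _; exact: pw_ge0.
- by rewrite mulr_ge0 // sumr_ge0 // => n _; exact: pw_ge0.
by rewrite ler_wpM2l.
Qed.

Lemma geometric_quarter (j : nat) : \sum_(k < j) (4^-1 : R) ^+ k.+1 <= 3^-1.
Proof.
have : \sum_(k < j) (4^-1 : R) ^+ k.+1 <= (1 - 4^-1 ^+ j) / 3.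
  elim: j => [|j IH]; first by rewrite big_ord0 expr0 subrr mul0r.
  rewrite big_ord_recr /= exprS; move: IH; set a := 4^-1 ^+ j; lra.
have : 0 <= (4^-1 : R) ^+ j by rewrite exprn_ge0 // invr_ge0.
move: (4^-1 ^+ j) => a; lra.
Qed.

Lemma add2_le_exp4 (j : nat) : (j + 2 <= 2 * 4 ^ j)%N.
Proof. by elim: j => // i IH; rewrite expnS; lia. Qed.

(* P = 4 K^2 / kap is chosen so that the recurrence closes with total weight 5/6 < 1. *)
Lemma Psum_recurrence m h (K kap : R) (l : nat -> nat -> C) (D : nat -> C) (f : nat -> C) :
  0 <= h <= 1 -> 0 < kap <= K -> 1 <= K ->
  (forall j, (j <= m)%N -> kap <= normc (l j 0%N)) ->
  (forall j k, normc (l j k) <= h ^+ k * (k`!%:R * K ^+ k.+1)) ->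
  (forall j, normc (D j) <= h ^+ j * (j.+1`!%:R * K ^+ j.+2)) ->
  (forall j, (j <= m)%N ->
    normc (\sum_(k < j.+1) ('C(j, k))%:R * (l (j - k)%N k * f (j - k)%N) - D j) <= h ^+ j) ->
  forall j, (j <= m)%N -> normc (f j) <= h ^+ j * (j`!%:R * (4 * K ^+ 2 / kap) ^+ j.+1).
Proof.
move=> /andP[h0 h1] /andP[kap0 kapK] K1 l0 lk Dj E.
set P := 4 * K ^+ 2 / kap.
have K0 : 0 < K by apply: lt_le_trans K1.
have P0 : 0 < P by rewrite /P divr_gt0 // mulr_gt0 // exprn_gt0.
have Pk : P * kap = 4 * K ^+ 2 by rewrite /P divfK // lt0r_neq0.
have K0' := ltW K0; have P0' := ltW P0; have kap0' := ltW kap0.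
elim/ltn_ind => j IH jm.
have Ej := E j jm; rewrite big_ord_recl /= bin0 mul1r subn0 in Ej.
set S := \sum_(k < j) _ in Ej.
have hj : 0 <= h ^+ j by rewrite exprn_ge0.
have SB : normc S <= h ^+ j * (j`!%:R * (P ^+ j.+1 * kap * 3^-1)).
  apply: le_trans (normc_sum _ _ _) _.
  apply: (@le_trans _ _ (\sum_(k < j) h ^+ j * (j`!%:R * (P ^+ j.+1 * kap * 4^-1 ^+ k.+1)))); last first.
    by rewrite -!mulr_sumr !ler_wpM2l ?mulr_ge0 ?exprn_ge0 ?(ltW P0) ?(ltW kap0) // geometric_quarter.
  apply: ler_sum => k _; rewrite /bump /= add1n.
  have kj : (k.+1 <= j)%N by exact: ltn_ord.
  have fb := IH (j - k.+1)%N ltac:(clear -kj; lia) ltac:(clear -jm; lia).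
  have lb := lk (j - k.+1)%N k.+1.
  rewrite !normcM (_ : normc _ = 'C(j, k.+1)%:R); last first.
    by rewrite -(rmorph_nat (real_complex R)) normcR ger0_norm.
  have nc := ler_pM (normc_ge0 _) (normc_ge0 _) lb fb.
  apply: le_trans (ler_wpM2l (ler0n _ _) nc) _.
  have fe : 'C(j, k.+1)%:R * (k.+1`!%:R * (j - k.+1)`!%:R) = j`!%:R :> R.
    by rewrite -!natrM bin_fact.
  have he : h ^+ k.+1 * h ^+ (j - k.+1) = h ^+ j by rewrite -exprD subnKC.
  rewrite [X in X <= _](_ : _ = (h ^+ k.+1 * h ^+ (j - k.+1)) *
    (('C(j, k.+1)%:R * (k.+1`!%:R * (j - k.+1)`!%:R)) * (K ^+ k.+2 * P ^+ (j - k.+1).+1))); last by ring.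
  rewrite fe he !ler_wpM2l //.
  have Pe : P ^+ j.+1 = P ^+ k.+1 * P ^+ (j - k.+1).+1.
    by rewrite -exprD; congr (_ ^+ _); clear -kj; lia.
  rewrite Pe [X in _ <= X](_ : _ = (P ^+ k.+1 * 4^-1 ^+ k.+1 * kap) * P ^+ (j - k.+1).+1); last by ring.
  rewrite ler_wpM2r ?exprn_ge0 ?(ltW P0) //.
  rewrite -exprMn [(P * 4^-1) ^+ _]exprS.
  have -> : P * 4^-1 * (P * 4^-1) ^+ k * kap = (P * kap) * 4^-1 * (P * 4^-1) ^+ k by ring.
  rewrite Pk (_ : 4 * K ^+ 2 * 4^-1 = K ^+ 2); last by field.
  rewrite -addn2 exprD mulrC ler_wpM2l ?exprn_ge0 ?(ltW K0) // lerXn2r ?nnegrE ?(ltW K0) //.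
    by rewrite divr_ge0 // ltW.
  rewrite -(ler_pM2r kap0) [X in _ <= X](_ : _ = (P * kap) / 4); last by ring.
  rewrite Pk expr2 (_ : 4 * _ / 4 = K * K); last by field.
  by rewrite ler_wpM2l // ltW.
have DB : normc (D j) + h ^+ j <= h ^+ j * (j`!%:R * (P ^+ j.+1 * kap * 2^-1)).
  have f1 : 1 <= j`!%:R :> R by rewrite ler1n fact_gt0.
  have Kj : 1 <= K ^+ j.+2 by rewrite exprn_ege1.
  apply: (@le_trans _ _ (h ^+ j * (j`!%:R * (j.+2%:R * K ^+ j.+2)))).
    have := Dj j; rewrite factS natrM => dj.
    have : h ^+ j * 1 <= h ^+ j * (j`!%:R * K ^+ j.+2).
      rewrite ler_wpM2l //; apply: (@le_trans _ _ (1 * K ^+ j.+2)); first by rewrite mul1r.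
      by rewrite ler_wpM2r // (le_trans ler01).
    rewrite -[j.+2%:R]natr1; move: dj; clear; move: (normc _) (h ^+ j) (j`!%:R) (K ^+ _) (j.+1%:R) => *; lra.
  rewrite !ler_wpM2l //.
  have Pe : P ^+ j.+1 * kap = 4 * K ^+ 2 * P ^+ j by rewrite exprS -Pk; ring.
  rewrite Pe.
  have P4 : 4 * K <= P.
    by rewrite -(ler_pM2r kap0) Pk expr2 -mulrA ler_wpM2l // ler_wpM2l // ltW.
  have Pj : (4 * K) ^+ j <= P ^+ j by apply: lerXn2r => //; rewrite ?nnegrE ?mulr_ge0.
  apply: (@le_trans _ _ (4 * K ^+ 2 * (4 * K) ^+ j * 2^-1)).
    rewrite exprMn -[j.+2]addn2 exprD.
    have j4 : (j + 2)%:R <= 2 * 4 ^+ j :> R.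
      by rewrite -natrX -natrM ler_nat add2_le_exp4.
    have KK : 0 <= K ^+ j * K ^+ 2 by rewrite mulr_ge0 ?exprn_ge0 // ltW.
    have := ler_wpM2r KK j4; move: (K ^+ j) (K ^+ 2) (4 ^+ j) (_%:R) => *; lra.
  by rewrite ler_wpM2r ?invr_ge0 // ler_wpM2l // mulr_ge0 // exprn_ge0.
have main : normc (l j 0%N * f j) <= normc S + (normc (D j) + h ^+ j).
  have -> : l j 0%N * f j = (l j 0%N * f j + S - D j) + (D j - S) by ring.
  apply: le_trans (normcD _ _) _; apply: le_trans (lerD Ej (normcB _ _)) _.
  by rewrite addrC [normc (D j) + _]addrC -addrA.
rewrite normcM in main.
have low := ler_wpM2r (normc_ge0 (f j)) (l0 j jm).
rewrite -(ler_pM2l kap0); apply: le_trans low _; apply: le_trans main _.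
apply: le_trans (lerD SB DB) _.
have : 0 <= h ^+ j * (j`!%:R * (P ^+ j.+1 * kap)) by rewrite !mulr_ge0 ?exprn_ge0.
clear; move: (h ^+ j) (j`!%:R) (P ^+ _) => *; lra.
Qed.

End TwistedPrimeSums.

(** * Lower bounds for L-series near 1 *)

Section LowerBounds.
Variable R : realType.
Local Notation C := R[i].
Notation lnn := (lnn R).
Notation mangoldt := (mangoldt R).
Local Open Scope complex_scope.
Implicit Types (s h : R) (q k i j n X Y : nat) (chi : nat -> C).

Definition Lser X chi s : C := \sum_(1 <= n < X.+1) chi n * (pw s n)%:C.

Definition cmult chi := [/\ chi 1%N = 1, (forall a b, chi (a * b)%N = chi a * chi b) &
  forall n, normc (chi n) <= 1].

Definition oscillating q chi := [/\ (0 < q)%N, periodic q chi & \sum_(0 <= n < q) chi n = 0].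

Lemma Lsum0 X chi s h : Lsum X chi s h 0 = Lser X chi s.
Proof. by apply: eq_bigr => n _; rewrite /logweight !expr0 !mulr1. Qed.

Lemma Lser_le X chi s q : cmult chi -> oscillating q chi -> 1 <= s <= 2 ->
  normc (Lser X chi s) <= logK R q.
Proof.
case=> _ _ c1 [q0 pc c0] s12; rewrite -(Lsum0 X chi s 0).
by have := twisted_sum_bound 0 0 X q0 pc c0 c1 s12 (lexx 0); rewrite expr0 fact0 !mul1r expr1.
Qed.

Lemma Lser_variation X chi s h q : cmult chi -> oscillating q chi -> 1 <= s <= 2 -> 0 <= h ->
  normc (Lser X chi s - Lser X chi (s + h)) <= h * logK R q ^+ 2.
Proof.
case=> _ _ c1 [q0 pc c0] s12 h0.
have := twisted_sum_bound 1 0 X q0 pc c0 c1 s12 h0; rewrite expr1 addn0 mul1r.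
congr (normc _ <= _); rewrite /Lser -sumrB; apply: eq_bigr => n _.
by rewrite -mulrBr -rmorphB /logweight expr0 mulr1 expr1 pwD mulrBr mulr1.
Qed.

Lemma Lser_cauchy X X' chi s q : cmult chi -> oscillating q chi -> 1 <= s <= 2 ->
  (X <= X')%N -> normc (Lser X' chi s - Lser X chi s) <= 6 * q%:R / X.+1%:R.
Proof.
case=> _ _ c1 [q0 pc c0] /andP[s1 s2] XX; have XX' : (X.+1 <= X'.+1)%N by [].
have -> : Lser X' chi s - Lser X chi s = \sum_(X.+1 <= n < X'.+1) chi n * (pw s n)%:C.
  by rewrite /Lser [Y in Y - _](big_cat_nat (n := X.+1)) //=; ring.
have := @periodic_inv_sum R q chi (pw s) 2 X.+1 X'.+1 q0 pc c0 c1.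
rewrite (_ : 3 * q%:R * 2 / X.+1%:R = 6 * q%:R / X.+1%:R); last by ring.
have bnd n : (0 < n)%N -> 0 <= pw s n <= n%:R^-1.
  by move=> n0; rewrite pw_ge0 -pw1 //= pw_les.
apply=> // n nX; have n0 : (0 < n)%N by exact: leq_trans nX.
  have /andP[b0 b1] := bnd n n0; rewrite ger0_norm //; apply: le_trans b1 _.
  by rewrite -[X in X <= _]mul1r ler_wpM2r // ?invr_ge0 //; clear; lra.
have := pwS_diff (le_trans ler01 s1) n0; have /andP[b0 b1] := bnd n n0.
rewrite distrC ger0_norm ?subr_ge0 ?pw_le ?(le_trans ler01 s1) // => h; apply: le_trans h _.
rewrite expr2 invfM mulrA; apply: ler_pM => //; first by rewrite divr_ge0 // (le_trans ler01 s1).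
by rewrite ler_wpM2r // invr_ge0.
Qed.

(** Plays the role of |L(1, chi)| <= e without constructing the limit. *)
Definition Lsmall chi (e : R) := exists X0, forall X, (X0 <= X)%N -> normc (Lser X chi 1) <= e.

Lemma inv_nat_small (c e : R) : 0 < e -> exists X0, forall X, (X0 <= X)%N -> c / X.+1%:R <= e.
Proof.
move=> e0; exists (Num.truncn (c / e)) => X hX.
rewrite ler_pdivrMr ?ltr0n // mulrC -ler_pdivrMr //; apply: ltW.
by apply: lt_le_trans (truncnS_gt _) _; rewrite ler_nat ltnS.
Qed.

(** The negation provides only arbitrarily late truncations above e; [Lser_cauchy] carries one of
    them to all later ones at the price of a factor 2. *)
Lemma not_Lsmall chi q (e : R) : cmult chi -> oscillating q chi -> 0 < e -> ~ Lsmall chi e ->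
  exists X0, forall X, (X0 <= X)%N -> e / 2 <= normc (Lser X chi 1).
Proof.
move=> cm os e0 ns; have [X1 hX1] := inv_nat_small (6 * q%:R) (divr_gt0 e0 (ltr0n R 2)).
case: (boolp.EM (exists X, (X1 <= X)%N /\ e < normc (Lser X chi 1))) => [[X [XX1 eX]]|ne]; last first.
  case: ns; exists X1 => X hX; rewrite leNgt; apply/negP => h; apply: ne; by exists X.
exists X => X' hX'.
have := Lser_cauchy cm os (s := 1) _ hX'; rewrite lexx ler1n => /(_ isT) h1.
have h2 := hX1 X XX1; have h3 := normc_ge_sub (Lser X chi 1) (Lser X chi 1 - Lser X' chi 1).
rewrite subKr in h3; rewrite normcBC in h1.
have h12 := le_trans h1 h2; clear -h12 h3 eX; lra.
Qed.

(** At s = 1 half of the threshold is available, that is 2 eta K^2; moving s by at most eta changes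
    L by at most eta K^2. *)
Lemma Lser_lower chi q (K eta : R) : cmult chi -> oscillating q chi -> logK R q <= K ->
  0 < eta <= 1 -> ~ Lsmall chi (4 * eta * K ^+ 2) ->
  exists X0, forall X, (X0 <= X)%N -> forall s, 1 <= s <= 1 + eta ->
     eta * K ^+ 2 <= normc (Lser X chi s).
Proof.
move=> cm os qK /andP[eta0 eta1] ns; have K26 := logK_ge R q.
have K0 : 0 < K by apply: lt_le_trans qK; apply: lt_le_trans K26; rewrite ltr0n.
have e0 : 0 < 4 * eta * K ^+ 2 by rewrite !mulr_gt0 // exprn_gt0.
have [X0 hX0] := not_Lsmall cm os e0 ns; exists X0 => X hX s /andP[s1 s2].
have := @Lser_variation X chi 1 (s - 1) q cm os; rewrite lexx ler1n subr_ge0 => /(_ isT s1).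
rewrite (_ : 1 + (s - 1) = s); last by ring.
move=> v; have h := hX0 X hX.
have h3 := normc_ge_sub (Lser X chi 1) (Lser X chi 1 - Lser X chi s); rewrite subKr in h3.
have : (s - 1) * logK R q ^+ 2 <= eta * K ^+ 2.
  apply: ler_pM; rewrite ?subr_ge0 ?sqr_ge0 //; first by clear -s2; lra.
  by apply: lerXn2r => //; rewrite ?nnegrE ?(ltW K0) // (le_trans _ K26).
have : 0 <= eta * K ^+ 2 by rewrite mulr_ge0 ?sqr_ge0 // ltW.
clear -h h3 v; move: v h3; move: (normc (_ - _)) (_ * logK R q ^+ 2) => *; lra.
Qed.

Definition eulerinv Y chi s : C := \prod_(1 <= p < Y.+1 | prime p) (1 - chi p * (pw s p)%:C).
Definition rough Y n := all (fun p => Y < p)%N (primes n).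
Definition rough_sum X Y chi s : C := \sum_(1 <= n < X.+1 | rough Y n) chi n * (pw s n)%:C.

Lemma rough_gt Y n : (0 < n)%N -> rough Y n -> n != 1%N -> (Y < n)%N.
Proof.
move=> n0 /allP h n1; have n2 : (1 < n)%N by move: n0 n1; case: n {h} => [|[|]].
have pp := pdiv_prime n2.
apply: leq_trans (dvdn_leq n0 (pdiv_dvd n)); apply: h.
by rewrite mem_primes pp n0 pdiv_dvd.
Qed.

Lemma sum_pw_tail (al : R) A B : 0 < al -> (0 < A)%N ->
  \sum_(A.+1 <= n < B.+1) pw (1 + al) n <= pw al A / al.
Proof.
by move=> al0 A0; have := @sum_pw_le R al A B al0 A0; rewrite big_add1.
Qed.

Lemma rough_sum_near1 X Y chi (al : R) : cmult chi -> 0 < al -> (0 < Y <= X)%N ->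
  normc (rough_sum X Y chi (1 + al) - 1) <= pw al Y / al.
Proof.
move=> [chi1 cM c1] al0 /andP[Y0 YX].
rewrite /rough_sum big_mkcond big_ltn; last by rewrite ltnS (leq_trans Y0).
rewrite {1}/rough /= chi1 pwn1 mulr1.
set S := \sum_(_ <= _ < _) _; have -> : 1 + S - 1 = S by ring.
rewrite {}/S.
apply: le_trans (normc_sum _ _ _) _; apply: le_trans (sum_pw_tail X al0 Y0).
have YX' : (Y.+1 <= X.+1)%N by [].
have b n : normc (chi n * (pw (1 + al) n)%:C) <= pw (1 + al) n.
  by rewrite normcM normcR ger0_norm ?pw_ge0 // ler_piMl ?pw_ge0.
rewrite (big_cat_nat (n := Y.+1)) //= [Y in Y + _](_ : _ = 0) ?add0r.
  by apply: ler_sum_nat => n _; case: ifP => _; rewrite ?normc0 ?pw_ge0 //; exact: b.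
rewrite big_nat_cond big1 // => n /andP[/andP[n1 nY] _].
case: ifP => [/(rough_gt (ltnW n1))|]; last by rewrite normc0.
rewrite neq_ltn n1 orbT => /(_ isT) h; move: nY; rewrite ltnS leqNgt h //.
Qed.

(** Sifting out one prime: the multiples of p among the terms are p b with b <= X / p, so
    multiplication by the Euler factor at p removes them, except that the subtracted sum runs up to
    X instead of X / p. The bound is that excess. *)
Lemma rough_sum_step X p chi (al : R) : cmult chi -> 0 < al -> prime p -> (p <= X)%N ->
  normc (rough_sum X p.-1 chi (1 + al) * (1 - chi p * (pw (1 + al) p)%:C) -
    rough_sum X p chi (1 + al)) <= pw al (X %/ p) / al.
Proof.
move=> [chi1 cM c1] al0 pp pX; have p0 := prime_gt0 pp.
set s := 1 + al; pose c := chi p * (pw s p)%:C; rewrite -/c.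
pose T n := chi n * (pw s n)%:C.
have Ts b : (0 < b)%N -> T (p * b)%N = c * T b.
  by move=> b0; rewrite /T /c cM pwM // rmorphM /=; ring.
have e1 : rough_sum X p.-1 chi s = rough_sum X p chi s +
   \sum_(1 <= b < (X %/ p).+1 | rough p.-1 b) c * T b.
  rewrite {1}/rough_sum (bigID (fun n => p %| n)%N) /= addrC; congr (_ + _).
    rewrite /rough_sum big_nat_cond [RHS]big_nat_cond; apply: eq_bigl => n.
    case: (boolP (1 <= n < X.+1)%N) => //= /andP[n0 _].
    apply/andP/allP => [[/allP h pn] r rn|h].
      have := h r rn; rewrite prednK // leq_eqVlt => /orP[/eqP e|//].
      by move: rn pn; rewrite mem_primes -e => /and3P[_ _ ->].
    split; first by apply/allP => r /h; apply: leq_trans; rewrite prednK.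
    apply/negP => pn; have := h p; rewrite mem_primes pp n0 pn ltnn => /(_ isT) //.
  pose F n : C := if (n <= X)%N && rough p.-1 n then T n else 0.
  have F0 n : (X < n)%N -> F n = 0 by move=> nX; rewrite /F leqNgt nX.
  transitivity (\sum_(1 <= n < X.+1 | (p %| n)%N) 1 * F n).
    rewrite big_nat_cond [RHS]big_nat_cond big_mkcond [RHS]big_mkcond.
    apply: eq_bigr => n _; rewrite /F ltnS.
    by case: (1 <= n)%N; case: (n <= X)%N; case: (rough _ n); case: (p %| n)%N; rewrite ?mul1r.
  rewrite -[LHS](@sum_mult _ X p (fun=> 1) F p0 F0).
  have XpX : ((X %/ p).+1 <= X.+1)%N by rewrite ltnS leq_div.
  rewrite (big_cat_nat (n := (X %/ p).+1)) //= [Y in _ + Y](_ : _ = 0) ?addr0; last first.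
    rewrite big_nat_cond big1 // => b /andP[/andP[b1 _] _].
    by rewrite F0 ?mulr0 // mulnC -ltn_divLR.
  rewrite [RHS]big_mkcond; apply: eq_big_nat => b /andP[b0 bX]; rewrite mul1r /F.
  have -> : (p * b <= X)%N by rewrite mulnC -leq_divRL // -ltnS.
  rewrite andTb Ts //; congr (if _ then _ else _).
  apply/allP/allP => h r rn; first by apply: h; rewrite primesM // rn orbT.
  move: rn; rewrite primesM // => /orP[|/h //].
  by rewrite primes_prime // inE => /eqP ->; rewrite prednK.
have -> : rough_sum X p.-1 chi s * (1 - c) - rough_sum X p chi s =
   - (c * \sum_((X %/ p).+1 <= b < X.+1 | rough p.-1 b) T b).
  have e2 : rough_sum X p.-1 chi s = \sum_(1 <= b < (X %/ p).+1 | rough p.-1 b) T b +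
      \sum_((X %/ p).+1 <= b < X.+1 | rough p.-1 b) T b.
    by rewrite /rough_sum (big_cat_nat (n := (X %/ p).+1)) //= ltnS leq_div.
  rewrite mulrBr mulr1 {1}e1 e2 -mulr_sumr; ring.
rewrite normcN normcM.
have nc : normc c <= 1.
  rewrite normcM normcR ger0_norm ?pw_ge0 // mulr_ile1 ?normc_ge0 ?pw_ge0 //.
  by rewrite pw_le1 // addr_ge0 // ltW.
apply: le_trans (ler_wpM2r (normc_ge0 _) nc) _; rewrite mul1r.
apply: le_trans (normc_sum _ _ _) _.
apply: le_trans (sum_pw_tail X al0 _); last by rewrite divn_gt0.
rewrite big_mkcond; apply: ler_sum_nat => n _; case: ifP => _; last exact: pw_ge0.
by rewrite normcM normcR ger0_norm ?pw_ge0 // ler_piMl ?pw_ge0.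
Qed.

Lemma euler_factor_le2 chi s p : cmult chi -> 0 <= s -> normc (1 - chi p * (pw s p)%:C) <= 2.
Proof.
case=> _ _ c1 s0; apply: le_trans (normcB _ _) _; rewrite normc1.
have : normc (chi p * (pw s p)%:C) <= 1; last by lra.
by rewrite normcM normcR ger0_norm ?pw_ge0 // mulr_ile1 ?normc_ge0 ?pw_ge0 // pw_le1.
Qed.

Lemma euler_sift Y chi (al e : R) : cmult chi -> 0 < al -> 0 < e ->
  exists X0, forall X, (X0 <= X)%N ->
    normc (Lser X chi (1 + al) * eulerinv Y chi (1 + al) - rough_sum X Y chi (1 + al)) <= e.
Proof.
move=> cm al0; elim: Y e => [|Y IH] e e0.
  exists 0%N => X _; rewrite /eulerinv big_geq // mulr1 /Lser /rough_sum.
  rewrite (_ : \sum_(1 <= n < X.+1 | rough 0 n) _ = \sum_(1 <= n < X.+1) chi n * (pw (1 + al) n)%:C).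
    by rewrite subrr normc0 ltW.
  rewrite big_nat_cond [RHS]big_nat_cond; apply: eq_bigl => n.
  case: (boolP (1 <= n < X.+1)%N) => //= _; apply/allP => r.
  by rewrite mem_primes => /and3P[/prime_gt0].
have [X1 h1] := IH (e / 4) (divr_gt0 e0 (ltr0n R 4)).
rewrite /eulerinv; case: (boolP (prime Y.+1)) => pY; last first.
  exists X1 => X hX; rewrite big_mkcond big_nat_recr //= (negbTE pY) mulr1 -big_mkcond.
  have := h1 X hX; rewrite /eulerinv.
  suff -> : rough_sum X Y.+1 chi (1 + al) = rough_sum X Y chi (1 + al).
    by move=> h; apply: le_trans h _; clear -e0; lra.
  rewrite /rough_sum big_nat_cond [RHS]big_nat_cond; apply: eq_bigl => n.
  case: (boolP (1 <= n < X.+1)%N) => //= _.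
  apply: eq_in_all => r; rewrite mem_primes => /and3P[pr _ _].
  by rewrite ltn_neqAle; case: eqP => // er; rewrite er pr in pY.
have al2 : 0 < al * e / 2 by rewrite divr_gt0 ?mulr_gt0.
have [X2 h2] := pw_vanishes al0 al2.
exists (maxn X1 (maxn Y.+1 (X2 * Y.+1))) => X; rewrite !geq_max => /and3P[hX1 hXY hX2].
rewrite big_mkcond big_nat_recr //= pY -big_mkcond -/(eulerinv Y chi (1 + al)).
have st := rough_sum_step cm al0 pY hXY; rewrite /= in st.
set E := eulerinv _ _ _; set u := 1 - _ in st *; set A := rough_sum X Y _ _ in st *.
have -> : Lser X chi (1 + al) * (E * u) - rough_sum X Y.+1 chi (1 + al) =
   (Lser X chi (1 + al) * E - A) * u + (A * u - rough_sum X Y.+1 chi (1 + al)) by ring.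
apply: le_trans (normcD _ _) _; rewrite normcM.
have u2 : normc u <= 2 by apply: euler_factor_le2 => //; rewrite addr_ge0 // ltW.
have a1 : normc (Lser X chi (1 + al) * E - A) * normc u <= e / 4 * 2.
  by apply: ler_pM; rewrite ?normc_ge0 //; exact: h1.
have a2 : pw al (X %/ Y.+1) / al <= e / 2.
  rewrite ler_pdivrMr // mulrC mulrA; apply: h2.
  by rewrite leq_divRL.
clear -a1 a2 st; lra.
Qed.

(** L times the inverse Euler product over p <= Y is close to the sum over integers free of primes
    <= Y, hence to 1; the two errors are at most 1/4 each. [Y] depends on [al] only, so one [Y]
    serves all the characters of a product inequality. *)
Lemma euler_lower (al : R) : 0 < al -> exists Y, forall chi, cmult chi ->
  exists X0, forall X, (X0 <= X)%N ->
    2^-1 <= normc (Lser X chi (1 + al)) * normc (eulerinv Y chi (1 + al)).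
Proof.
move=> al0; have al4 : 0 < al / 4 by rewrite divr_gt0.
have [Y0 hY0] := pw_vanishes al0 al4; pose Y := Y0.+1; exists Y => chi cm.
have q4 : 0 < 4^-1 :> R by rewrite invr_gt0.
have [X1 h1] := euler_sift Y cm al0 q4.
exists (maxn X1 Y) => X; rewrite geq_max => /andP[hX1 hXY].
have YX : (0 < Y <= X)%N by [].
have a1 := h1 X hX1; have a2 := rough_sum_near1 cm al0 YX.
have a3 : pw al Y / al <= 4^-1.
  by rewrite ler_pdivrMr // mulrC; apply: hY0.
set A := rough_sum _ _ _ _ in a1 a2; rewrite -normcM; set L := Lser _ _ _ * _ in a1 *.
have b1 := normc_ge_sub 1 (1 - L); rewrite subKr normc1 in b1.
have b2 : normc (1 - L) <= normc (A - 1) + normc (L - A).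
  by rewrite normcBC (_ : L - 1 = (A - 1) + (L - A)) ?normcD //; ring.
clear -a1 a2 a3 b1 b2; lra.
Qed.

End LowerBounds.

(** * Repulsion of characters with small L(1, chi) *)

Section Repulsion.
Variable R : realType.
Local Notation C := R[i].
Local Open Scope complex_scope.
Implicit Types (s K : R) (q n p X Y : nat) (chi : nat -> C).

Lemma sqr_normc (z : C) : normc z ^+ 2 = complex.Re z ^+ 2 + complex.Im z ^+ 2.
Proof. by case: z => a b; rewrite /normc sqr_sqrtr // addr_ge0 ?sqr_ge0. Qed.

Lemma le_expR_sub1 (x : R) : x <= expR (x - 1).
Proof. have := expR_ge1Dx (x - 1); lra. Qed.

Lemma sqr_normc_oneB (r : R) (z : C) :
  normc (1 - z * r%:C) ^+ 2 = 1 - 2 * r * complex.Re z + r ^+ 2 * normc z ^+ 2.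
Proof. rewrite !sqr_normc; case: z => a b /=; ring. Qed.

Definition unimodular chi := forall n, chi n = 0 \/ normc (chi n) = 1.

(* Each factor is at most the exponential of itself minus 1; the exponents add up to
   8 r^2 - 4 r (1 + Re z)^2. *)
Lemma factor_341 (r : R) (z : C) : 0 <= r <= 1 -> z = 0 \/ normc z = 1 ->
  normc (1 - 1 * r%:C) ^+ 6 * normc (1 - z * r%:C) ^+ 8 * normc (1 - z ^+ 2 * r%:C) ^+ 2
    <= expR (8 * r ^+ 2).
Proof.
move=> /andP[r0 r1] [->|z1].
  rewrite [0 ^+ 2]expr2 !mul0r subr0 normc1 !expr1n !mulr1 mul1r -rmorphB normcR ger0_norm ?subr_ge0 //.
  apply: (@le_trans _ _ 1); first by rewrite exprn_ile1 ?subr_ge0 // lerBlDr lerDl.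
  by rewrite -[X in X <= _]expR0 ler_expR mulr_ge0 ?sqr_ge0.
rewrite -[6%N]/(2 * 3)%N -[8%N]/(2 * 4)%N !exprM.
have zz : normc (z ^+ 2) = 1 by rewrite expr2 normcM z1 mulr1.
rewrite !sqr_normc_oneB z1 zz normc1 expr1n /=.
set a := complex.Re z.
have ab : a ^+ 2 + complex.Im z ^+ 2 = 1 by rewrite -sqr_normc z1 expr1n.
have re2 : complex.Re (z ^+ 2) = complex.Re z ^+ 2 - complex.Im z ^+ 2.
  by case: (z) => x y; rewrite [_ ^+ 2 in LHS]expr2 /=; ring.
have {}re2 : complex.Re (z ^+ 2) = 2 * a ^+ 2 - 1 by rewrite re2 -/a; clear -ab; lra.
rewrite re2.
have h1 := sqr_ge0 (normc (1 - 1 * r%:C)); rewrite sqr_normc_oneB normc1 expr1n /= in h1.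
have h2 := sqr_ge0 (normc (1 - z * r%:C)); rewrite sqr_normc_oneB z1 expr1n -/a in h2.
have h3 := sqr_ge0 (normc (1 - z ^+ 2 * r%:C)).
rewrite sqr_normc_oneB zz expr1n re2 in h3.
set A := 1 - _ + _ in h1 *; set B := 1 - _ + _ in h2 *; set D := 1 - _ + _ in h3 *.
apply: (@le_trans _ _ (expR (A - 1) ^+ 3 * expR (B - 1) ^+ 4 * expR (D - 1))).
  apply: ler_pM; rewrite ?mulr_ge0 ?exprn_ge0 //; last exact: le_expR_sub1.
  by apply: ler_pM; rewrite ?exprn_ge0 // lerXn2r ?nnegrE ?expR_ge0 ?le_expR_sub1.
rewrite -!expRM_natl -!expRD ler_expR /A /B /D.
have : 0 <= r * (1 + a) ^+ 2 by rewrite mulr_ge0 ?sqr_ge0.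
clear; nra.
Qed.

(** Bounding each factor 1 - t r by exp(-t r), the exponents add up to -r (1 + x)(1 + y) <= 0. *)
Lemma factor_repulsion (r x y : R) : 0 <= r <= 1 -> -1 <= x <= 1 -> -1 <= y <= 1 ->
  (1 - r) * (1 - x * r) * (1 - y * r) * (1 - x * y * r) <= 1.
Proof.
move=> r01 x1 y1; have e : forall t : R, -1 <= t <= 1 -> 0 <= 1 - t * r <= expR (- (t * r)).
  move=> t t1; apply/andP; split; first by clear -t1 r01; nra.
  by have := expR_ge1Dx (- (t * r)); rewrite addrC; lra.
have xy1 : -1 <= x * y <= 1 by clear -x1 y1; nra.
have e1 := e 1 (introT andP (conj (ltac:(clear; lra) : -1 <= 1 :> R) (lexx 1))).
rewrite !mul1r in e1; move: (e _ x1) (e _ y1) (e _ xy1) e1 => /andP[a0 a1] /andP[b0 b1] /andP[c0 c1] /andP[d0 d1].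
apply: (@le_trans _ _ (expR (- r) * expR (- (x * r)) * expR (- (y * r)) * expR (- (x * y * r)))).
  by do 3! (apply: ler_pM; rewrite ?mulr_ge0 //).
rewrite -!expRD -expR0 ler_expR.
have : 0 <= r * ((1 + x) * (1 + y)).
  move: r01 x1 y1 => /andP[r0 _] /andP[p1 _] /andP[p2 _].
  by rewrite !mulr_ge0 //; [clear -p1; lra | clear -p2; lra].
clear; lra.
Qed.

Lemma normc_eulerinv Y chi s :
  normc (eulerinv Y chi s) = \prod_(1 <= p < Y.+1 | prime p) normc (1 - chi p * (pw s p)%:C).
Proof. exact: (big_morph (@normc R) (@normcM R) (@normc1 R)). Qed.

Definition one_char : nat -> C := fun=> 1.

Lemma cmult_one : cmult one_char.
Proof. by split=> // *; rewrite ?mul1r ?normc1. Qed.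

Lemma Lser_one_le X (al : R) : 0 < al -> normc (Lser X one_char (1 + al)) <= 1 + al^-1.
Proof.
move=> al0; apply: le_trans (normc_sum _ _ _) _; apply: le_trans (sum_pw_full X al0).
by apply: ler_sum => n _; rewrite mul1r normcR ger0_norm ?pw_ge0.
Qed.

(** The exponent 16 is 8 times a bound 2 for the sum of p^(-2). *)
Lemma euler_341 Y chi s : unimodular chi -> 1 <= s ->
  normc (eulerinv Y one_char s) ^+ 6 * normc (eulerinv Y chi s) ^+ 8 *
    normc (eulerinv Y (fun n => chi n ^+ 2) s) ^+ 2 <= expR 16.
Proof.
move=> um s1; rewrite !normc_eulerinv -!prodrXl -!big_split /=.
apply: (@le_trans _ _ (\prod_(1 <= p < Y.+1 | prime p) expR (8 * pw s p ^+ 2))).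
  apply: ler_prod => p _; apply/andP; split; first by rewrite !mulr_ge0 ?exprn_ge0 ?normc_ge0.
  by apply: factor_341 => //; rewrite pw_ge0 pw_le1 // (le_trans ler01).
rewrite -expR_sum ler_expR -mulr_sumr (_ : 16 = 8 * 2); last by clear; lra.
rewrite ler_wpM2l //.
have := @sum_pw_full R 1 Y ltr01; rewrite invr1 => h.
apply: le_trans h; rewrite big_mkcond; apply: ler_sum_nat => p _.
case: ifP => _; last exact: pw_ge0.
rewrite pwXn; apply: pw_les; clear -s1; lra.
Qed.

Lemma euler_repulsion Y (x y : nat -> R) s : (forall n, -1 <= x n <= 1) ->
  (forall n, -1 <= y n <= 1) -> 0 <= s ->
  normc (eulerinv Y one_char s) * normc (eulerinv Y (fun n => (x n)%:C) s) *
   normc (eulerinv Y (fun n => (y n)%:C) s) * normc (eulerinv Y (fun n => (x n * y n)%:C) s) <= 1.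
Proof.
move=> x1 y1 s0; rewrite !normc_eulerinv -!big_split /=.
apply: (@le_trans _ _ (\prod_(1 <= p < Y.+1 | prime p) 1)); last by rewrite big1.
apply: ler_prod => p _; rewrite !mulr_ge0 ?normc_ge0 //=.
set r := pw s p; have r01 : 0 <= r <= 1 by rewrite pw_ge0 pw_le1.
have nn (t : R) : -1 <= t <= 1 -> normc (1 - t%:C * r%:C) = 1 - t * r.
  by move=> t1; rewrite -rmorphM -rmorphB normcR ger0_norm //; clear -t1 r01; nra.
rewrite !nn // -?(rmorph1 (real_complex R)) ?nn ?mul1r.
- exact: factor_repulsion.
- by clear -x1 y1; move: (x1 p) (y1 p); nra.
- by apply/andP; split; clear; lra.
Qed.

(** In [complex_not_Lsmall] the product of L-values is at most 2^6 5^8 eta^2 K^18, to be multiplied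
    by e^16. Hence the power K^9 in [sep_eta] and the factor e^(-8); the factor 10^(-7) brings the
    result below 2^(-16). *)
Definition sep_const : R := expR (- 8) / 10 ^+ 7.
Definition sep_eta (K : R) : R := sep_const / K ^+ 9.

Lemma sep_eta_bounds K : 26 <= K -> [/\ 0 < sep_eta K, sep_eta K <= 1 & sep_eta K * K ^+ 9 = sep_const].
Proof.
move=> K26; have K0 : 0 < K by apply: lt_le_trans K26; rewrite ltr0n.
have c0 : 0 < sep_const by rewrite /sep_const divr_gt0 ?expR_gt0 ?exprn_gt0 ?ltr0n.
have c1 : sep_const <= 1.
  rewrite /sep_const ler_pdivrMr ?exprn_gt0 ?ltr0n // mul1r.
  apply: (@le_trans _ _ 1); first by rewrite expR_le1; clear; lra.
  by rewrite exprn_ege1 // ler1n.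
have K9 : 0 < K ^+ 9 by rewrite exprn_gt0.
split; first by rewrite /sep_eta divr_gt0.
  rewrite /sep_eta ler_pdivrMr // mul1r (le_trans c1) // exprn_ege1 //; clear -K26; lra.
by rewrite /sep_eta divfK // lt0r_neq0.
Qed.

Lemma Lsmall_shift chi q K : cmult chi -> oscillating q chi -> logK R q <= K ->
  Lsmall chi (4 * sep_eta K * K ^+ 2) ->
  exists X0, forall X, (X0 <= X)%N -> normc (Lser X chi (1 + sep_eta K)) <= 5 * sep_eta K * K ^+ 2.
Proof.
move=> cm os qK [X0 hX0]; exists X0 => X hX; have K26 := le_trans (logK_ge R q) qK.
have [e0 e1 _] := sep_eta_bounds K26.
have := @Lser_variation _ X chi 1 (sep_eta K) q cm os; rewrite lexx ler1n => /(_ isT (ltW e0)) v.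
have h := hX0 X hX; have := normc_ge_sub (Lser X chi (1 + sep_eta K)) (Lser X chi 1).
rewrite normcBC => h3.
have : sep_eta K * logK R q ^+ 2 <= sep_eta K * K ^+ 2.
  have q0 := le_trans (ler0n R 26) (logK_ge R q); have K0 := le_trans (ler0n R 26) K26.
  by apply: ler_wpM2l; [exact: ltW | apply: lerXn2r; rewrite ?nnegrE].
move: h h3 v; clear; move: (normc (_ - _)) (_ * logK R q ^+ 2) => *; lra.
Qed.

(** The inequality 3-4-1 at s = 1 + eta, with exponents doubled: the series of the trivial character
    is at most 2/eta and enters with exponent 6, while a small L(s, chi) is O(eta K^2) and enters
    with exponent 8. Smallness at 1 would thus contradict [euler_lower]. *)
Lemma complex_not_Lsmall chi q K : cmult chi -> unimodular chi -> oscillating q chi ->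
  oscillating q (fun n => chi n ^+ 2) -> logK R q <= K ->
  ~ Lsmall chi (4 * sep_eta K * K ^+ 2).
Proof.
move=> cm um os os2 qK ls; have K26 := le_trans (logK_ge R q) qK.
have K0 : 0 < K by apply: lt_le_trans K26; rewrite ltr0n.
have [e0 e1 eK] := sep_eta_bounds K26.
have cm2 : cmult (fun n => chi n ^+ 2).
  case: cm => a b c; split=> [|x y|n]; rewrite ?a ?expr1n ?b ?exprMn //.
  by rewrite expr2 normcM mulr_ile1 ?normc_ge0.
have [X1 h1] := Lsmall_shift cm os qK ls.
have [Y hY] := euler_lower e0.
have [Xa ha] := hY _ cmult_one; have [Xb hb] := hY _ cm; have [Xc hc] := hY _ cm2.
pose X := (X1 + Xa + Xb + Xc)%N.
have {}h1 := h1 X ltac:(rewrite /X; clear; lia); have {}ha := ha X ltac:(rewrite /X; clear; lia).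
have {}hb := hb X ltac:(rewrite /X; clear; lia); have {}hc := hc X ltac:(rewrite /X; clear; lia).
have s1 : 1 <= 1 + sep_eta K by rewrite lerDl ltW.
have E := euler_341 Y um s1.
have l1 := Lser_one_le X e0.
have l2 : normc (Lser X (fun n => chi n ^+ 2) (1 + sep_eta K)) <= K.
  by apply: le_trans qK; apply: Lser_le => //; rewrite s1 /=; clear -e1; lra.
move: h1 ha hb hc E l1 l2.
set E1 := normc (eulerinv _ one_char _); set E2 := normc (eulerinv _ chi _); set E3 := normc (eulerinv _ _ _).
set L1 := normc (Lser X one_char _); set L2 := normc (Lser X chi _); set L3 := normc (Lser X _ _).
have : [/\ 0 <= E1, 0 <= E2, 0 <= E3, 0 <= L1 & 0 <= L2] by split; exact: normc_ge0.
have : 0 <= L3 by exact: normc_ge0.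
move: E1 E2 E3 L1 L2 L3 => E1 E2 E3 L1 L2 L3 L30 [E10 E20 E30 L10 L20] h1 ha hb hc E l1 l2.
set eta := sep_eta K in e0 e1 eK h1 l1.
have e0' := ltW e0; have K0' := ltW K0.
have low : 2^-1 ^+ 16 <= (L1 * E1) ^+ 6 * (L2 * E2) ^+ 8 * (L3 * E3) ^+ 2.
  rewrite (_ : 16 = 6 + 8 + 2)%N // !exprD; apply: ler_pM; rewrite ?mulr_ge0 ?exprn_ge0 ?invr_ge0 //.
    by apply: ler_pM; rewrite ?exprn_ge0 ?invr_ge0 // lerXn2r ?nnegrE ?invr_ge0 ?mulr_ge0.
  by rewrite lerXn2r ?nnegrE ?invr_ge0 ?mulr_ge0.
have l1' : L1 * eta <= 2.
  apply: (@le_trans _ _ ((1 + eta^-1) * eta)); first by rewrite ler_wpM2r // ltW.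
  by rewrite mulrDl mul1r mulVf ?lt0r_neq0 //; clear -e1; lra.
have up : L1 ^+ 6 * L2 ^+ 8 * L3 ^+ 2 * eta ^+ 6 <= 2 ^+ 6 * (5 * eta * K ^+ 2) ^+ 8 * K ^+ 2.
  rewrite (_ : _ * eta ^+ 6 = (L1 * eta) ^+ 6 * L2 ^+ 8 * L3 ^+ 2); last by ring.
  have K20 : 0 <= 5 * eta * K ^+ 2 by apply: mulr_ge0; [exact: mulr_ge0 | exact: sqr_ge0].
  have x1 : (L1 * eta) ^+ 6 <= 2 ^+ 6 by apply: lerXn2r; rewrite ?nnegrE // mulr_ge0.
  have x2 : L2 ^+ 8 <= (5 * eta * K ^+ 2) ^+ 8 by apply: lerXn2r; rewrite ?nnegrE.
  have x3 : L3 ^+ 2 <= K ^+ 2 by apply: lerXn2r; rewrite ?nnegrE.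
  have x0 : 0 <= (L1 * eta) ^+ 6 by rewrite exprn_ge0 // mulr_ge0.
  by apply: ler_pM => //; [rewrite mulr_ge0 // exprn_ge0 | exact: exprn_ge0 | apply: ler_pM => //; exact: exprn_ge0].
have up2 : L1 ^+ 6 * L2 ^+ 8 * L3 ^+ 2 <= 25 * 10 ^+ 6 * sep_const ^+ 2.
  have e6 : 0 < eta ^+ 6 by rewrite exprn_gt0.
  rewrite -(ler_pM2r e6); apply: le_trans up _; rewrite -eK; ring_le.
have fin : 2^-1 ^+ 16 <= 25 * 10 ^+ 6 * sep_const ^+ 2 * expR 16.
  apply: le_trans low _.
  rewrite [X in X <= _](_ : _ = (L1 ^+ 6 * L2 ^+ 8 * L3 ^+ 2) * (E1 ^+ 6 * E2 ^+ 8 * E3 ^+ 2)); last by ring.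
  by apply: ler_pM => //; rewrite ?mulr_ge0 ?exprn_ge0.
have ee : expR (- 8) ^+ 2 * expR 16 = 1 :> R.
  rewrite -expRM_natl -expRD (_ : _ + _ = 0) ?expR0 //; clear; lra.
have c2 : sep_const ^+ 2 * expR 16 = (10 ^+ 14)^-1.
  by rewrite /sep_const expr_div_n mulrAC ee mul1r -exprM.
move: fin; rewrite -mulrA c2; clear; apply/negP; rewrite -ltNge; lra.
Qed.

(** Two small values at s = 1 + eta, each O(eta K^2), face a single factor 2/eta from the trivial
    character and the bound K for the product character, so the product of the four L-values
    contradicts [euler_repulsion]. *)
Lemma real_repulsion (x y : nat -> R) qx qy K :
  let cx := fun n => (x n)%:C in let cy := fun n => (y n)%:C in
  cmult cx -> cmult cy -> oscillating qx cx -> oscillating qy cy ->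
  oscillating (qx * qy) (fun n => (x n * y n)%:C) -> logK R (qx * qy) <= K ->
  Lsmall cx (4 * sep_eta K * K ^+ 2) -> ~ Lsmall cy (4 * sep_eta K * K ^+ 2).
Proof.
move=> cx cy cmx cmy osx osy osxy qK lx ly; have K26 := le_trans (logK_ge R _) qK.
have qx0 : (0 < qx)%N by case: osx. have qy0 : (0 < qy)%N by case: osy.
have qxK : logK R qx <= K.
  apply: le_trans qK; rewrite /logK lerD2r ler_wpM2l // lnn_le // leq_pmulr //.
have qyK : logK R qy <= K.
  apply: le_trans qK; rewrite /logK lerD2r ler_wpM2l // lnn_le // leq_pmull //.
have K0 : 0 < K by apply: lt_le_trans K26; rewrite ltr0n.
have [e0 e1 eK] := sep_eta_bounds K26.
have rng (u : nat -> R) : cmult (fun n => (u n)%:C) -> forall n, -1 <= u n <= 1.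
  by case=> _ _ c n; have := c n; rewrite normcR ler_norml.
have cmxy : cmult (fun n => (x n * y n)%:C).
  case: cmx cmy => a b c [a' b' c']; split=> [|u v|n].
  - by rewrite rmorphM /= -/(cx 1%N) -/(cy 1%N) a a' mulr1.
  - by rewrite !rmorphM /= -/(cx (u * v)%N) -/(cy (u * v)%N) b b' /cx /cy; ring.
  - by rewrite rmorphM /= normcM mulr_ile1 ?normc_ge0 //; [exact: c | exact: c'].
have [X1 h1] := Lsmall_shift cmx osx qxK lx; have [X2 h2] := Lsmall_shift cmy osy qyK ly.
have [Y hY] := euler_lower e0.
have [Xa ha] := hY _ cmult_one; have [Xb hb] := hY _ cmx; have [Xc hc] := hY _ cmy; have [Xd hd] := hY _ cmxy.
pose X := (X1 + X2 + Xa + Xb + Xc + Xd)%N.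
have {}h1 := h1 X ltac:(rewrite /X; clear; lia); have {}h2 := h2 X ltac:(rewrite /X; clear; lia).
have {}ha := ha X ltac:(rewrite /X; clear; lia); have {}hb := hb X ltac:(rewrite /X; clear; lia).
have {}hc := hc X ltac:(rewrite /X; clear; lia); have {}hd := hd X ltac:(rewrite /X; clear; lia).
have s1 : 1 <= 1 + sep_eta K by rewrite lerDl ltW.
have E := @euler_repulsion Y x y (1 + sep_eta K) (rng _ cmx) (rng _ cmy) (le_trans ler01 s1).
have l1 := Lser_one_le X e0.
have l2 : normc (Lser X (fun n => (x n * y n)%:C) (1 + sep_eta K)) <= K.
  by apply: le_trans qK; apply: Lser_le => //; rewrite s1 /=; clear -e1; lra.
move: h1 h2 ha hb hc hd E l1 l2.
set E1 := normc (eulerinv _ one_char _); set E2 := normc (eulerinv _ cx _).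
set E3 := normc (eulerinv _ cy _); set E4 := normc (eulerinv _ _ _).
set L1 := normc (Lser X one_char _); set L2 := normc (Lser X cx _).
set L3 := normc (Lser X cy _); set L4 := normc (Lser X _ _).
have : [/\ 0 <= E1, 0 <= E2, 0 <= E3 & 0 <= E4] by split; exact: normc_ge0.
have : [/\ 0 <= L1, 0 <= L2, 0 <= L3 & 0 <= L4] by split; exact: normc_ge0.
move: E1 E2 E3 E4 L1 L2 L3 L4 => E1 E2 E3 E4 L1 L2 L3 L4 [? ? ? ?] [? ? ? ?] h1 h2 ha hb hc hd E l1 l2.
set eta := sep_eta K in e0 e1 eK h1 h2 l1.
have e0' := ltW e0; have K0' := ltW K0.
have low : 2^-1 ^+ 4 <= (L1 * E1) * (L2 * E2) * (L3 * E3) * (L4 * E4).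
  have i0 : 0 <= 2^-1 :> R by rewrite invr_ge0.
  rewrite (_ : 2^-1 ^+ 4 = 2^-1 * 2^-1 * 2^-1 * 2^-1); last by ring.
  have y1 := ler_pM i0 i0 ha hb; have y2 := ler_pM (mulr_ge0 i0 i0) i0 y1 hc.
  exact: ler_pM (mulr_ge0 (mulr_ge0 i0 i0) i0) i0 y2 hd.
have l1' : L1 * eta <= 2.
  apply: (@le_trans _ _ ((1 + eta^-1) * eta)); first by rewrite ler_wpM2r // ltW.
  by rewrite mulrDl mul1r mulVf ?lt0r_neq0 //; clear -e1; lra.
have K20 : 0 <= 5 * eta * K ^+ 2 by apply: mulr_ge0; [exact: mulr_ge0 | exact: sqr_ge0].
have up : L1 * L2 * L3 * L4 * eta <= 2 * (5 * eta * K ^+ 2) * (5 * eta * K ^+ 2) * K.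
  rewrite [X in X <= _](_ : _ = (L1 * eta) * L2 * L3 * L4); last by ring.
  have z0 : 0 <= L1 * eta by exact: mulr_ge0.
  have y1 : L1 * eta * L2 <= 2 * (5 * eta * K ^+ 2) by exact: ler_pM.
  have y2 : L1 * eta * L2 * L3 <= 2 * (5 * eta * K ^+ 2) * (5 * eta * K ^+ 2).
    by apply: ler_pM => //; exact: mulr_ge0.
  by apply: ler_pM => //; apply: mulr_ge0 => //; exact: mulr_ge0.
have up2 : L1 * L2 * L3 * L4 <= 50 * sep_const.
  rewrite -(ler_pM2r e0); apply: le_trans up _; rewrite -eK.
  rewrite [X in X <= _](_ : _ = 50 * eta ^+ 2 * K ^+ 5); last by ring.
  rewrite [X in _ <= X](_ : _ = 50 * eta ^+ 2 * K ^+ 9); last by ring.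
  apply: ler_wpM2l; first by apply: mulr_ge0; [exact: ler0n | exact: sqr_ge0].
  by apply: ler_weXn2l => //; apply: le_trans K26; rewrite ler1n.
have fin : 2^-1 ^+ 4 <= 50 * sep_const.
  apply: le_trans low _; apply: le_trans up2.
  rewrite [X in X <= _](_ : _ = (L1 * L2 * L3 * L4) * (E1 * E2 * E3 * E4)); last by ring.
  by apply: ler_piMr => //; do 2! (apply: mulr_ge0 => //); exact: mulr_ge0.
have : sep_const <= (10 ^+ 7)^-1.
  rewrite /sep_const -[X in _ <= X]mul1r ler_wpM2r ?invr_ge0 ?exprn_ge0 // expR_le1; clear; lra.
move: fin; clear => fin c; have : 2^-1 ^+ 4 <= 50 * (10 ^+ 7)^-1 :> R.
  by apply: le_trans fin _; rewrite ler_wpM2l.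
apply/negP; rewrite -ltNge; lra.
Qed.

End Repulsion.

(** * L(1, chi) <> 0 for real characters *)

Section RealNonvanishing.
Variable R : realType.
Local Open Scope complex_scope.
Implicit Types (x : nat -> R) (z u : R) (q n p m j a b X : nat).

Lemma dsum_prime_mul x p j m : (forall a b, x (a * b)%N = x a * x b) -> prime p ->
  (0 < m)%N -> ~~ (p %| m)%N ->
  dsum (p ^ j.+1 * m) x = x p * dsum (p ^ j * m) x + dsum m x.
Proof.
move=> xM pp m0 pm; have p0 := prime_gt0 pp; set n := (p ^ j * m)%N.
have n0 : (0 < n)%N by rewrite muln_gt0 expn_gt0 p0.
have e : (p ^ j.+1 * m = p * n)%N by rewrite expnS mulnA.
rewrite e; have pn0 : (0 < p * n)%N by rewrite muln_gt0 p0.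
have npn : (0 < n <= p * n)%N by rewrite n0 leq_pmull.
have mpn : (0 < m <= p * n)%N by rewrite m0 -e leq_pmull // expn_gt0 p0.
rewrite (dsum_widen x npn) (dsum_widen x mpn) /dsum (bigID (fun d => p %| d)%N) /=; congr (_ + _).
  pose F d := if (d %| p * n)%N then x d else 0.
  have F0 d : (p * n < d)%N -> F d = 0 by move=> h; rewrite /F gtnNdvd.
  transitivity (\sum_(1 <= d < (p * n).+1 | (p %| d)%N) 1 * F d).
    rewrite big_mkcond [RHS]big_mkcond; apply: eq_bigr => d _; rewrite mul1r /F.
    by case: (p %| d)%N; case: (d %| _)%N.
  rewrite -[LHS](@sum_mult _ (p * n) p (fun=> 1) F p0 F0) mulr_sumr [RHS]big_mkcond.
  by apply: eq_bigr => b _; rewrite mul1r /F dvdn_pmul2l // xM.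
rewrite big_nat_cond [RHS]big_nat_cond; apply: eq_bigl => d; congr (_ && _).
rewrite -e; apply/andP/idP => [[dn pd]|dm].
  by move: dn; rewrite Gauss_dvdr // coprimeXr // coprime_sym prime_coprime.
split; first exact: dvdn_mull.
by apply/negP => pd; move/negP: pm; apply; exact: dvdn_trans dm.
Qed.

(** By multiplicativity of the convolution 1 * x it is enough to look at prime powers: the value at
    p^j is 1, j + 1, or alternately 1 and 0 according to x p, and for even j it is at least 1. *)
Lemma dsum_real_char x : x 1%N = 1 -> (forall a b, x (a * b)%N = x a * x b) ->
  (forall n, [|| x n == 0, x n == 1 | x n == -1]) ->
  (forall n, (0 < n)%N -> 0 <= dsum n x) /\ (forall r, (0 < r)%N -> 1 <= dsum (r ^ 2) x).
Proof.
move=> x1 xM x3.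
have step p m : prime p -> (0 < m)%N -> ~~ (p %| m)%N -> 0 <= dsum m x ->
    forall j, 0 <= dsum (p ^ j * m) x /\ dsum m x <= dsum (p ^ (2 * j) * m) x.
  move=> pp m0 pm g0.
  (* For x p = -1 the next value is the value at m minus the present one; the upper bound is what
     keeps it nonnegative in the induction. *)
  have pos j : 0 <= dsum (p ^ j * m) x /\ (x p = -1 -> dsum (p ^ j * m) x <= dsum m x).
    elim: j => [|j [IH1 IH2]]; first by rewrite expn0 mul1n.
    rewrite dsum_prime_mul //; case/or3P: (x3 p) => /eqP xp; rewrite xp.
    - by rewrite mul0r add0r; split=> // /esym/eqP; rewrite oppr_eq0 oner_eq0.
    - by rewrite mul1r addr_ge0 //; split=> // /eqP; rewrite -addr_eq0 (_ : 1 + 1 = 2%:R) ?pnatr_eq0.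
    - by have := IH2 xp; split=> [|_]; lra.
  move=> j; split; first by case: (pos j).
  elim: j => [|j IH]; first by rewrite muln0 expn0 mul1n.
  rewrite (_ : 2 * j.+1 = (2 * j).+2)%N; last by lia.
  rewrite !dsum_prime_mul //; have [p1 p2] := pos (2 * j)%N.
  case/or3P: (x3 p) => /eqP xp; rewrite xp; [lra|lra|].
  by have := p2 xp; lra.
split.
  elim/ltn_ind=> n IH n0; case: (leqP n 1) => n1.
    by rewrite (_ : n = 1%N) ?/dsum ?big_mkcond ?big_nat1 /= ?x1 //; lia.
  have pp := pdiv_prime n1; have [m cpm e] := pfactor_coprime pp n0.
  have m0 : (0 < m)%N by move: n0; rewrite {1}e muln_gt0 => /andP[].
  rewrite e mulnC; have pm : ~~ (pdiv n %| m)%N by rewrite -prime_coprime.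
  have mn : (m < n)%N.
    have : (1 < pdiv n ^ logn (pdiv n) n)%N.
      by rewrite -(expn0 (pdiv n)) ltn_exp2l ?prime_gt1 // logn_gt0 mem_primes pp n0 pdiv_dvd.
    by rewrite [in X in _ -> X]e => h; rewrite ltn_Pmulr.
  by case: (step _ m pp m0 pm (IH m mn m0) (logn (pdiv n) n)).
elim/ltn_ind=> n IH n0; case: (leqP n 1) => n1.
  by rewrite (_ : n = 1%N) ?/dsum ?big_mkcond ?big_nat1 /= ?x1 //; lia.
have pp := pdiv_prime n1; have [m cpm e] := pfactor_coprime pp n0.
have m0 : (0 < m)%N by move: n0; rewrite {1}e muln_gt0 => /andP[].
have pm : ~~ (pdiv n %| m)%N by rewrite -prime_coprime.
have mn : (m < n)%N.
  have : (1 < pdiv n ^ logn (pdiv n) n)%N.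
    by rewrite -(expn0 (pdiv n)) ltn_exp2l ?prime_gt1 // logn_gt0 mem_primes pp n0 pdiv_dvd.
  by rewrite [in X in _ -> X]e => h; rewrite ltn_Pmulr.
have IHm := IH m mn m0.
rewrite e expnMn mulnC -expnM (mulnC _ 2%N).
have m20 : (0 < m ^ 2)%N by rewrite expn_gt0 m0.
have pm2 : ~~ (pdiv n %| m ^ 2)%N by rewrite Euclid_dvdX // (negbTE pm).
have [_ h] := step _ _ pp m20 pm2 (le_trans ler01 IHm) (logn (pdiv n) n).
exact: le_trans IHm h.
Qed.

Definition geo z a : R := \sum_(0 <= i < a) z ^+ i.

Lemma geo_1B z a : 1 - z ^+ a = (1 - z) * geo z a.
Proof.
elim: a => [|a IH]; first by rewrite expr0 subrr /geo big_geq // mulr0.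
by rewrite /geo big_nat_recr //= -/(geo z a) mulrDr -IH exprS; ring.
Qed.

Lemma geo_ge z a : 0 <= z <= 1 -> a%:R * z ^+ a <= geo z a.
Proof.
move=> z01; apply: (@le_trans _ _ (\sum_(0 <= i < a) z ^+ a)).
  by rewrite sumr_const_nat subn0 mulr_natl.
by apply: ler_sum_nat => i /andP[_ ia]; apply: ler_wiXn2l => //; [case/andP: z01 | case/andP: z01 | exact: ltnW].
Qed.

(* Pairing the exponents e and 2a-1-e in the product of the two geometric sums. *)
Lemma geo_mul_ge z a : 0 <= z <= 1 -> a%:R * a.+1%:R * z ^+ a <= geo z a * geo z a.+1.
Proof.
move=> z01; have /andP[z0 z1] := z01; rewrite /geo !big_mkord.
have e : (\sum_(i < a) z ^+ i) * (\sum_(j < a.+1) z ^+ j) = \sum_(i < a) \sum_(j < a.+1) z ^+ (i + j).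
  by rewrite big_distrlr; apply: eq_bigr => i _; apply: eq_bigr => j _; rewrite exprD.
have e' : \sum_(i < a) \sum_(j < a.+1) z ^+ (i + j) =
    \sum_(i < a) \sum_(j < a.+1) z ^+ ((a - i.+1) + (a - j)).
  rewrite (reindex_inj rev_ord_inj) /=; apply: eq_bigr => i _.
  by rewrite (reindex_inj rev_ord_inj) /=; apply: eq_bigr => j _; rewrite subSS.
suff : 2 * (a%:R * a.+1%:R * z ^+ a) <= \sum_(i < a) \sum_(j < a.+1) z ^+ (i + j) +
   \sum_(i < a) \sum_(j < a.+1) z ^+ ((a - i.+1) + (a - j)).
  by rewrite -e' e; clear; lra.
rewrite -big_split /= [Y in Y <= _](_ : _ = \sum_(i < a) \sum_(j < a.+1) (2 * z ^+ a)); last first.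
  by rewrite !sumr_const !card_ord -mulrnA -[RHS]mulr_natr natrM; ring.
apply: ler_sum => i _; rewrite -big_split /=; apply: ler_sum => j _.
have key (e1 e2 : nat) : (e1 + e2 = (2 * a).-1)%N -> (e1 < a)%N -> 2 * z ^+ a <= z ^+ e1 + z ^+ e2.
  move=> s l; have -> : e2 = (e1 + ((a - e1) + (a - e1)).-1)%N by clear -s l; lia.
  have -> : z ^+ a = z ^+ e1 * z ^+ (a - e1) by rewrite -exprD subnKC // ltnW.
  rewrite exprD; set d := (a - e1)%N.
  have d1 : z ^+ (d + d) <= z ^+ (d + d).-1 by apply: ler_wiXn2l => //; exact: leq_pred.
  have ze : 0 <= z ^+ e1 by exact: exprn_ge0.
  have : 0 <= (1 - z ^+ d) ^+ 2 by exact: sqr_ge0.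
  rewrite exprD in d1; move: d1 ze; clear; move: (z ^+ e1) (z ^+ d) (z ^+ _.-1) => E D F; nra.
have iA := ltn_ord i; have jA := ltn_ord j.
case: (ltnP (i + j) a) => ij; first by apply: key => //; clear -iA jA; lia.
by rewrite addrC; apply: key; clear -iA jA ij; lia.
Qed.

(** If L(1, chi) = 0, every truncation is only the remaining tail. *)
Lemma Lsmall_all_bound q (chi : nat -> R[i]) : cmult chi -> oscillating q chi ->
  (forall e : R, 0 < e -> Lsmall chi e) ->
  forall X, normc (Lser X chi 1) <= 6 * q%:R / X.+1%:R.
Proof.
move=> cm os ls X; apply/ler_addgt0Pr => e e0; have [X0 h0] := ls e e0.
have h := h0 (X + X0)%N (leq_addl _ _).
have c := @Lser_cauchy _ X (X + X0) chi 1 q cm os; rewrite lexx ler1n leq_addr in c.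
have {c} := c isT isT; rewrite normcBC.
have := normc_ge_sub (Lser X chi 1) (Lser X chi 1 - Lser (X + X0) chi 1).
rewrite subKr; move: h; clear.
move: (normc (_ - _)) (normc (Lser _ _ _)) (normc (Lser _ _ _)) (6 * _ / _) => *; lra.
Qed.

Lemma exists_large (c1 c2 u : R) : 0 < u -> exists X0, forall X, (X0 <= X)%N ->
  c1 / X.+1%:R <= 1 /\ c2 * (X%:R * expR (- (u * X%:R))) <= 1.
Proof.
move=> u0; have [X1 h1] := inv_nat_small c1 ltr01.
have [X2 h2] := inv_nat_small (`|c2| * (2 / u ^+ 2)) ltr01.
exists (X1 + X2).+1 => X hX; split; first by apply: h1; lia.
case: X hX => // X hX; have {h2} := h2 X ltac:(lia); apply: le_trans.
have X0 : 0 < X.+1%:R :> R by rewrite ltr0n.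
set Y : R := X.+1%:R in X0 *; have X0' := ltW X0; clearbody Y.
apply: (@le_trans _ _ (`|c2| * (Y * expR (- (u * Y))))).
  by rewrite ler_wpM2r ?ler_norm // mulr_ge0 ?expR_ge0.
rewrite -mulrA ler_wpM2l //.
have ux : 0 <= u * Y by rewrite mulr_ge0 // ltW.
have := @expR_ge_pow R _ 2 ux; rewrite (_ : 2`! = 2)%N // => e.
rewrite expRN ler_pdivrMr ?expR_gt0 //.
have uY : 0 <= 2 / u ^+ 2 / Y by rewrite !divr_ge0 ?exprn_ge0 // ltW.
apply: le_trans (ler_wpM2l uY e).
rewrite [X in _ <= X](_ : _ = Y); first exact: lexx.
by field; rewrite (lt0r_neq0 X0) (lt0r_neq0 u0).
Qed.

(** The kernel of Monsky's proof that L(1, chi) <> 0: the Lambert kernel z^a / (1 - z^a) subtracted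
    from its approximation 1 / (a (1 - z)). It decreases in a, so its twist by a character is
    bounded by Abel summation independently of z. *)
Definition lambert z a : R := a%:R^-1 / (1 - z) - z ^+ a / (1 - z ^+ a).

Lemma lambert_props z a : 0 < z < 1 -> (0 < a)%N ->
  0 <= lambert z a /\ lambert z a.+1 <= lambert z a.
Proof.
move=> /andP[z0 z1] a0; have z01 : 0 <= z <= 1 by rewrite !ltW.
have u0 : 0 < 1 - z by rewrite subr_gt0.
have S0 b : (0 < b)%N -> 0 < geo z b.
  by move=> b0; apply: lt_le_trans (geo_ge b z01); rewrite mulr_gt0 ?ltr0n ?exprn_gt0.
have a0' : 0 < a%:R :> R by rewrite ltr0n.
have a1' : 0 < a.+1%:R :> R by rewrite ltr0n.
have eq b : (0 < b)%N -> lambert z b = (b%:R^-1 - z ^+ b / geo z b) / (1 - z).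
  by move=> b0; rewrite /lambert geo_1B invfM; ring.
rewrite !eq //; split.
  rewrite divr_ge0 ?(ltW u0) // subr_ge0 ler_pdivrMr ?S0 // mulrC ler_pdivlMr //.
  by rewrite mulrC geo_ge.
rewrite ler_pM2r ?invr_gt0 //.
have h := geo_mul_ge a z01; have g0 := S0 a a0; have g1 := S0 a.+1 isT.
have gS : geo z a.+1 = geo z a + z ^+ a by rewrite /geo big_nat_recr.
have ge1 : geo z a.+1 = 1 + z * geo z a.
  by rewrite /geo big_nat_recl // expr0 mulr_sumr; congr (_ + _); apply: eq_bigr => i _; rewrite exprS.
rewrite lerBlDr -subr_ge0.
have -> : a%:R^-1 - z ^+ a / geo z a + z ^+ a.+1 / geo z a.+1 - a.+1%:R^-1 =
   (geo z a * geo z a.+1 - a%:R * a.+1%:R * z ^+ a) / (a%:R * a.+1%:R * (geo z a * geo z a.+1)).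
  have e1 : geo z a.+1 - z * geo z a = 1 by rewrite ge1; ring.
  have -> : geo z a * geo z a.+1 - a%:R * a.+1%:R * z ^+ a =
     geo z a * geo z a.+1 - a%:R * a.+1%:R * z ^+ a * (geo z a.+1 - z * geo z a) by rewrite e1 mulr1.
  rewrite exprS -[a.+1%:R]natr1 in a1' *.
  by field; rewrite (lt0r_neq0 g0) (lt0r_neq0 g1) (lt0r_neq0 a0') (lt0r_neq0 a1').
by rewrite divr_ge0 ?subr_ge0 // !mulr_ge0 // ltW.
Qed.

(** The Lambert series of x is the sum of z^n times the convolution 1 * x. Were L(1) = 0, its
    approximation by 1 / (a (1 - z)) would contribute almost nothing, and [lambert] bounds the rest
    by q; but the squares alone make the series unbounded as z tends to 1. *)
Lemma real_char_not_Lsmall q x : let cx := fun n => (x n)%:C in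
  cmult cx -> oscillating q cx -> (forall n, [|| x n == 0, x n == 1 | x n == -1]) ->
  exists e : R, 0 < e /\ ~ Lsmall cx e.
Proof.
move=> cx cm os x3; apply: boolp.contrapT => H.
have ls (e : R) : 0 < e -> Lsmall cx e.
  by move=> e0; apply: boolp.contrapT => h; apply: H; exists e.
have Lall := Lsmall_all_bound cm os ls.
have [x1 xM xle] := cm; have [q0 pc c0] := os.
have x1' : x 1%N = 1 by case: x1.
have xM' a b : x (a * b)%N = x a * x b.
  by have := xM a b; rewrite /cx -rmorphM; case.
have [gpos gsq] := dsum_real_char x1' xM' x3.
(* The squares up to J^2 contribute at least J/2 = q + 4, since z^(J^2) = exp(-1/2) >= 1/2, against
   the upper bound q + 2. *)
pose J := (2 * q + 8)%N; pose u : R := (2 * (J ^ 2)%:R)^-1; pose z := expR (- u).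
have J0 : (0 < J)%N by rewrite /J addn_gt0 orbT.
have J20 : 0 < (J ^ 2)%:R :> R by rewrite ltr0n expn_gt0 J0.
have u0 : 0 < u by rewrite invr_gt0 mulr_gt0.
have zX n : z ^+ n = expR (- (u * n%:R)) by rewrite /z -expRM_natr mulNr.
have z0 : 0 < z by exact: expR_gt0.
have z1 : z < 1 by rewrite expR_lt1 oppr_lt0.
have z01 : 0 < z < 1 by rewrite z0.
have w0 : 0 < 1 - z by rewrite subr_gt0.
have [X0 hX0] := exists_large (6 * q%:R / (1 - z)) ((1 - z)^-1) u0.
pose X := (X0 + J ^ 2)%N; have [b1 b2] := hX0 X (leq_addr _ _).
have za a : (0 < a)%N -> 0 < 1 - z ^+ a.
  by move=> a0; rewrite subr_gt0 exprn_ilt1 -?lt0n // ltW.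
have low : J%:R / 2 <= \sum_(1 <= n < X.+1) z ^+ n * dsum n x.
  apply: (@le_trans _ _ (\sum_(1 <= j < J.+1) z ^+ (j ^ 2))).
    apply: (@le_trans _ _ (\sum_(1 <= j < J.+1) 2^-1)).
      by rewrite sumr_const_nat subn1 -[2^-1 *+ _]mulr_natl.
    apply: ler_sum_nat => j /andP[j1 jJ]; rewrite zX.
    have := expR_ge1Dx (- (u * (j ^ 2)%:R)).
    have : u * (j ^ 2)%:R <= u * (J ^ 2)%:R by rewrite ler_wpM2l ?(ltW u0) // ler_nat leq_exp2r.
    have -> : u * (J ^ 2)%:R = 2^-1 by rewrite /u invfM -mulrA mulVf ?mulr1 // lt0r_neq0.
    by clear; lra.
  apply: (@le_trans _ _ (\sum_(1 <= n < X.+1) \sum_(1 <= j < J.+1) (if n == (j ^ 2)%N then z ^+ n else 0))).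
    rewrite exchange_big /=; apply: ler_sum_nat => j /andP[j1 jJ].
    rewrite -[X in X <= _](@sum_eq_index _ X (j ^ 2)%N).
      by apply: ler_sum => n _; case: eqP => [->|].
    rewrite expn_gt0 j1 /X; apply: leq_trans (leq_addl _ _).
    by rewrite leq_exp2r.
  apply: ler_sum_nat => n /andP[n1 nX].
  have zn : 0 <= z ^+ n by rewrite exprn_ge0 // ltW.
  case: (boolP [exists j : 'I_J.+1, n == (j ^ 2)%N]) => [/existsP[r /eqP nr]|/existsPn ne].
    have r0 : (0 < r)%N by move: n1; rewrite nr; case: (nat_of_ord r).
    apply: (@le_trans _ _ (\sum_(1 <= j < J.+1) (if j == r :> nat then z ^+ n else 0))).
      apply: ler_sum => j _; case: eqP => // h; case: eqP => // e; case: e.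
      by apply/eqP; rewrite -(@eqn_exp2r _ _ 2) // -nr h.
    rewrite sum_eq_index; last by rewrite r0 -ltnS ltn_ord.
    by rewrite -[X in X <= _]mulr1 ler_wpM2l // nr gsq.
  rewrite big_nat_cond big1 ?mulr_ge0 ?gpos // => j /andP[/andP[_ jJ] _].
  by have := ne (Ordinal jJ) => /= /negbTE ->.
have e1 : \sum_(1 <= n < X.+1) z ^+ n * dsum n x =
   \sum_(1 <= a < X.+1) x a * (z ^+ a / (1 - z ^+ a) - z ^+ (a * (X %/ a).+1) / (1 - z ^+ a)).
  pose F n : R := if (n <= X)%N then z ^+ n else 0.
  transitivity (\sum_(1 <= n < X.+1) F n * dsum n x).
    by apply: eq_big_nat => n /andP[_ nX]; rewrite /F -ltnS nX.
  rewrite (@sum_dsum _ X (fun d _ => x d) F) => [|n nX]; last by rewrite /F leqNgt nX.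
  apply: eq_big_nat => a /andP[a0 aX]; rewrite -mulr_sumr; congr (_ * _).
  have hX : ((X %/ a).+1 <= X.+1)%N by rewrite ltnS leq_div.
  rewrite (big_cat_nat (n := (X %/ a).+1)) //= [Y in _ + Y](_ : _ = 0) ?addr0; last first.
    rewrite big_nat_cond big1 // => b /andP[/andP[b1' _] _]; rewrite /F.
    by rewrite mulnC -leq_divRL // leqNgt b1'.
  transitivity (\sum_(1 <= b < (X %/ a).+1) (z ^+ a) ^+ b).
    by apply: eq_big_nat => b /andP[_ bX]; rewrite /F mulnC -leq_divRL // -ltnS bX exprM mulrC -exprM mulnC exprM || rewrite /F mulnC -leq_divRL // -ltnS bX mulnC exprM.
  have zn0 := lt0r_neq0 (za a a0).
  rewrite big_add1 /=.
  have -> : \sum_(0 <= i < X %/ a) (z ^+ a) ^+ i.+1 = z ^+ a * geo (z ^+ a) (X %/ a).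
    by rewrite /geo mulr_sumr; apply: eq_bigr => i _; rewrite exprS.
  have := geo_1B (z ^+ a) (X %/ a) => g.
  have -> : geo (z ^+ a) (X %/ a) = (1 - (z ^+ a) ^+ (X %/ a)) / (1 - z ^+ a) by rewrite g mulrAC divff // mul1r.
  rewrite mulnS exprD exprM; ring.
have e2 : \sum_(1 <= a < X.+1) x a * (z ^+ a / (1 - z ^+ a)) =
   (\sum_(1 <= a < X.+1) x a * pw 1 a) / (1 - z) - \sum_(1 <= a < X.+1) x a * lambert z a.
  rewrite mulr_suml -sumrB; apply: eq_big_nat => a /andP[a0 _]; rewrite /lambert pw1 //; ring.
have t1 : (\sum_(1 <= a < X.+1) x a * pw 1 a) / (1 - z) <= 1.
  apply: le_trans b1; rewrite mulrAC ler_wpM2r ?invr_ge0 ?(ltW w0) //.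
  apply: le_trans (Lall X); apply: le_trans (ler_norm _) _.
  by rewrite -normcR rmorph_sum /=; under eq_bigr do rewrite rmorphM.
have t2 : - \sum_(1 <= a < X.+1) x a * lambert z a <= q%:R.
  apply: le_trans (ler_norm _) _; rewrite normrN -normcR rmorph_sum /=.
  under eq_bigr do rewrite rmorphM.
  apply: le_trans (periodic_weighted_sum _ q0 pc c0 xle _) _ => //.
  rewrite -[X in _ <= X]mulr1 ler_wpM2l //.
  have [p0 _] := lambert_props z01 (isT : (0 < X.+1)%N).
  rewrite ger0_norm // (eq_big_nat _ _ (F2 := fun n => - lambert z n.+1 - - lambert z n)); last first.
    move=> n /andP[n0 _]; have [_ h] := lambert_props z01 n0.
    by rewrite ler0_norm ?subr_le0 // opprB opprK addrC.
  rewrite telescope_sumr // opprK addrA subrr add0r.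
  rewrite /lambert invr1 expr1 -mulrBl divff //; exact: lt0r_neq0.
have t3 : \sum_(1 <= a < X.+1) x a * - (z ^+ (a * (X %/ a).+1) / (1 - z ^+ a)) <= 1.
  apply: le_trans b2.
  apply: (@le_trans _ _ (\sum_(1 <= a < X.+1) z ^+ X / (1 - z))); last first.
    by rewrite sumr_const_nat subn1 /= -[(_ / _) *+ X]mulr_natl zX; ring_le.
  apply: ler_sum_nat => a /andP[a0 aX].
  have q1 : 0 <= z ^+ (a * (X %/ a).+1) / (1 - z ^+ a).
    by rewrite divr_ge0 ?exprn_ge0 ?(ltW z0) // ltW // za.
  have q2 : z ^+ (a * (X %/ a).+1) / (1 - z ^+ a) <= z ^+ X / (1 - z).
    apply: ler_pM; rewrite ?exprn_ge0 ?invr_ge0 ?(ltW z0) ?(ltW (za _ _)) //.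
      by apply: ler_wiXn2l; rewrite ?(ltW z0) ?(ltW z1) // mulnC ltnW // ltn_ceil.
    rewrite lef_pV2 ?posrE ?za // lerB // -[X in _ <= X]expr1.
    by apply: ler_wiXn2l; rewrite ?(ltW z0) ?(ltW z1).
  apply: le_trans q2; case/or3P: (x3 a) => /eqP ->; move: q1; clear; lra.
have : J%:R / 2 <= q%:R + 2 :> R.
  apply: le_trans low _; rewrite e1; under eq_bigr do rewrite mulrBr -mulrN.
  rewrite big_split /= e2; apply: le_trans (lerD (lerD t1 t2) t3) _; clear; lra.
rewrite /J natrD natrM; clear; lra.
Qed.

End RealNonvanishing.

(** * Dirichlet characters *)

Section DirichletCharacters.
Variable R : realType.
Local Notation C := R[i].
Notation lnn := (lnn R).
Local Open Scope complex_scope.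
Implicit Types (h kap K eta : R) (q e n m p t X W : nat) (chi : nat -> C).

Record dchar q chi : Prop := DChar {
  dchar_mod_gt0 : (0 < q)%N;
  dchar_periodic : periodic q chi;
  dchar1 : chi 1%N = 1;
  dcharM : forall a b, chi (a * b)%N = chi a * chi b;
  dchar_unit : forall n, coprime n q -> normc (chi n) = 1;
  dchar_nunit : forall n, ~~ coprime n q -> chi n = 0 }.

Definition nonprincipal q chi := exists2 a, coprime a q & chi a != 1.

Lemma dchar_unimodular q chi : dchar q chi -> unimodular chi.
Proof.
case=> _ _ _ _ u nu n; case: (boolP (coprime n q)) => [/u|/nu]; by [right | left].
Qed.

Lemma dchar_cmult q chi : dchar q chi -> cmult chi.
Proof.
move=> d; case: (d) => _ _ c1 cM _ _; split=> // n.
by case: (dchar_unimodular d n) => ->; rewrite ?normc0.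
Qed.

Lemma oscillating_of q chi a : (0 < q)%N -> periodic q chi ->
  (forall b c, chi (b * c)%N = chi b * chi c) -> coprime a q -> chi a != 1 -> oscillating q chi.
Proof.
move=> q0 pc cM ca ca1; split=> //.
have := @scale_sum _ q chi a q0 ca pc; under eq_bigr do rewrite cM.
rewrite -mulr_sumr; set S := \sum_(_ <= _ < _) _ => /eqP.
rewrite -subr_eq0 -[X in _ - X]mul1r -mulrBl mulf_eq0 subr_eq0 (negbTE ca1) /=.
by move=> /eqP.
Qed.

Lemma dchar_oscillating q chi : dchar q chi -> nonprincipal q chi -> oscillating q chi.
Proof. by case=> q0 pc _ cM _ _ [a ca c1]; exact: oscillating_of ca c1. Qed.

(** At s = 1 + m h > 1 the truncation error of [Psum_convolution] tends to 0 with X; once it is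
    below h^m the recurrence applies. The shifts by at most m h keep all arguments within
    [1, 1 + 2 m h], where the lower bound is assumed. *)
Lemma twisted_prime_small chi q K kap h m : cmult chi -> oscillating q chi ->
  logK R q <= K -> 0 < kap -> (0 < m)%N -> 0 < h -> 2 * m%:R * h <= 1 ->
  (exists X1, forall X, (X1 <= X)%N -> forall s, 1 <= s <= 1 + 2 * m%:R * h ->
     kap <= normc (Lser X chi s)) ->
  exists X0, forall X, (X0 <= X)%N ->
   normc (Psum X chi (1 + m%:R * h) h m) <= h ^+ m * (m`!%:R * (4 * K ^+ 2 / kap) ^+ m.+1).
Proof.
move=> cm os qK kap0 m0 h0 mh [X1 hX1]; have [c1 cM cle] := cm; have [q0 pc c0] := os.
have m1 : 1 <= m%:R :> R by rewrite ler1n.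
have h1 : h <= 1 by move: h0 mh m1; clear; nra.
have K26 := le_trans (logK_ge R q) qK.
pose al := m%:R * h / 2; have al0 : 0 < al by rewrite divr_gt0 ?mulr_gt0 ?ltr0n.
have h01 : 0 <= h <= 1 by rewrite ltW.
set s := 1 + m%:R * h; have sal : 1 + 2 * al <= s by rewrite /s /al; clear; lra.
have cst0 : 0 < (2 / al) * (1 + al^-1) * (1 + 2 / al).
  have a1 : 0 < al^-1 by rewrite invr_gt0.
  have a2 : 0 < 2 / al by exact: divr_gt0.
  by apply: mulr_gt0; [apply: mulr_gt0 => // | ]; exact: addr_gt0.
have hm0 : 0 < h ^+ m by rewrite exprn_gt0.
have [X2 hX2] := pw_vanishes al0 (divr_gt0 hm0 cst0).
exists (X1 + X2).+1 => X hX.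
have {}hX1 := hX1 X ltac:(clear -hX; lia); have {}hX2 := hX2 X ltac:(clear -hX; lia).
have X0 : (0 < X)%N by clear -hX; lia.
have s12 : 1 <= s <= 2.
  rewrite /s; have : 0 < m%:R * h by rewrite mulr_gt0 ?ltr0n.
  by move: mh; clear => *; apply/andP; split; lra.
have Kpow a : logK R q ^+ a <= K ^+ a.
  by apply: lerXn2r => //; rewrite nnegrE ?(le_trans (ler0n R 26)) ?logK_ge.
have jh j : (j <= m)%N -> 0 <= j%:R * h <= m%:R * h.
  by move=> jm; rewrite mulr_ge0 ?(ltW h0) //= ler_wpM2r ?(ltW h0) // ler_nat.
have kapK : kap <= K.
  have := hX1 1; rewrite lexx lerDl => /(_ _) k1.
  apply: le_trans (k1 _) _; first by rewrite !mulr_ge0 // ltW.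
  by apply: le_trans qK; apply: Lser_le; rewrite // lexx ler1n.
have [kapK0 K1] : (0 < kap <= K) /\ 1 <= K.
  by rewrite kap0; split=> //; apply: le_trans K26; rewrite ler1n.
(* The minimum with m keeps the shifted argument at most 2 for every j, as the upper bounds on [l]
   are required without restriction on j. *)
apply: (@Psum_recurrence R m h K kap (fun j k => Lsum X chi (s + (minn j m)%:R * h) h k)
  (fun j => Dsum X chi s h j) (fun k => Psum X chi s h k)) => //.
- move=> j jm; rewrite Lsum0; apply: hX1; have /andP[j0 j1] := jh _ (geq_minr j m).
  have p0 : 0 <= m%:R * h by rewrite mulr_ge0 // ltW.
  by rewrite /s; move: j0 j1 p0; clear => *; apply/andP; split; lra.
- move=> j k; have /andP[j0 j1] := jh _ (geq_minr j m).
  have sj : 1 <= s + (minn j m)%:R * h <= 2.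
    have p0 : 0 <= m%:R * h by rewrite mulr_ge0 // ltW.
    by rewrite /s; move: j0 j1 p0 mh; clear => *; apply/andP; split; lra.
  have := twisted_sum_bound k 0 X q0 pc c0 cle sj (ltW h0); rewrite addn0 => b.
  apply: le_trans b _; rewrite ler_wpM2l ?exprn_ge0 ?(ltW h0) // ler_wpM2l //.
- move=> j; have := twisted_sum_bound j 1 X q0 pc c0 cle s12 (ltW h0); rewrite addn1 => b.
  by apply: le_trans b _; rewrite ler_wpM2l ?exprn_ge0 ?(ltW h0) // ler_wpM2l.
move=> j jm; have := @Psum_convolution R X chi s h j al X0 cM cle (ltW h0) al0 sal.
under eq_bigr => k _ do rewrite -[(j - k)%N in X in _ + X](minn_idPl (leq_trans (leq_subr k j) jm)).
move=> b; apply: le_trans b _; apply: (@le_trans _ _ (h ^+ m)).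
  by rewrite /hyp_tail -ler_pdivlMr.
by apply: ler_wiXn2l => //; exact: ltW.
Qed.

(* chi has no period W * (e / p) on the units, for any prime p dividing e *)
Definition full_char W e chi := forall p, prime p -> (p %| e)%N ->
  exists u, [/\ coprime u (W * e), u = 1 %[mod W * (e %/ p)] & chi u != 1].

Definition squarefree e := forall p, prime p -> ~~ (p ^ 2 %| e)%N.

Lemma squarefree_logn e p : (0 < e)%N -> squarefree e -> prime p -> logn p e = (p %| e)%N.
Proof.
move=> e0 sf pp; have := sf p pp; rewrite pfactor_dvdn // -ltnNge ltnS => l1.
case: (boolP (p %| e)%N) => pe; last by rewrite lognE (negbTE pe) !andbF.
by apply/eqP; rewrite eqn_leq l1 logn_gt0 mem_primes pp e0.
Qed.

Lemma squarefree_eq e1 e2 : (0 < e1)%N -> (0 < e2)%N -> squarefree e1 -> squarefree e2 ->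
  (forall p, prime p -> (p %| e1)%N = (p %| e2)%N) -> e1 = e2.
Proof.
move=> h1 h2 s1 s2 E; apply: eqn_from_log => // p.
case: (boolP (prime p)) => pp; last by rewrite /logn (negbTE pp).
by rewrite !squarefree_logn // E.
Qed.

(** If p did not divide e2, the Chinese remainder theorem would give v equal to u modulo W e1 and to
    1 modulo W e2, where u is the witness of [full_char] at p. Then chi2 v = 1 and chi1 v = chi1 u
    <> 1. *)
Lemma full_char_dvd W e1 e2 (chi1 chi2 : nat -> C) : (0 < e1)%N -> (0 < e2)%N ->
  squarefree e1 -> coprime e1 W -> dchar (W * e1) chi1 -> dchar (W * e2) chi2 ->
  full_char W e1 chi1 ->
  (forall n, coprime n (W * e1) -> coprime n (W * e2) -> chi1 n * chi2 n = 1) ->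
  forall p, prime p -> (p %| e1)%N -> (p %| e2)%N.
Proof.
move=> e10 e20 sf cW d1 d2 full pr p pp pe; apply/negPn/negP => npe.
have W0 : (0 < W)%N by have := dchar_mod_gt0 d1; rewrite muln_gt0 => /andP[].
have [u [cu u1 cu1]] := full p pp pe.
set f := (e1 %/ p)%N; have ef : (e1 = f * p)%N by rewrite /f divnK.
have pf : ~~ (p %| f)%N.
  apply/negP => pf; move/negP: (sf p pp); apply.
  by rewrite ef expnS expn1 dvdn_mul.
have pW : ~~ (p %| W)%N.
  apply/negP => pW; have := coprime_dvdl pe cW; rewrite prime_coprime // pW //.
have cM : coprime (W * f * e2) p.
  by rewrite coprime_sym !coprimeMr !prime_coprime // pW pf npe.
pose v := chinese (W * f * e2) p 1 u.
have v1 : v = 1 %[mod W * f * e2] by rewrite chinese_modl.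
have vu : v = u %[mod p] by rewrite chinese_modr.
have modd a b c d : (c %| d)%N -> a = b %[mod d] -> a = b %[mod c].
  by move=> cd ab; rewrite -(modn_dvdm a cd) ab modn_dvdm.
have v2 : v = 1 %[mod W * e2] by apply: modd v1; rewrite mulnAC dvdn_mulr.
have vf : v = u %[mod W * f].
  by rewrite u1; apply: modd v1; rewrite dvdn_mulr.
have ve1 : v = u %[mod W * e1].
  rewrite ef mulnA; apply/eqP; rewrite chinese_remainder ?vf ?vu ?eqxx //.
  by move: cM; rewrite !coprimeMl => /andP[].
have c1 : coprime v (W * e1) by rewrite -coprime_modl ve1 coprime_modl.
have c2 : coprime v (W * e2) by rewrite -coprime_modl v2 coprime_modl coprime1n.
have := pr v c1 c2; rewrite (periodic_congr (dchar_periodic d1) ve1).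
rewrite (periodic_congr (dchar_periodic d2) v2) (dchar1 d2) mulr1 => E.
by rewrite E eqxx in cu1.
Qed.

Variables (W beta : nat).
Hypothesis W0 : (0 < W)%N.

(** Linear in t, that is in log log X, and large enough to bound [logK] for a product of two moduli
    taken at the scales t and t + 1. *)
Definition Kscale t : R := (26 + 4 * lnn W + 4 * beta%:R) * t.+1%:R.

Lemma Kscale_logK t e1 e2 : (0 < e1 <= 2 ^ (beta * t))%N -> (0 < e2 <= 2 ^ (beta * t.+1))%N ->
  logK R (W * e1 * (W * e2)) <= Kscale t.
Proof.
move=> /andP[a0 a1] /andP[b0 b1]; rewrite /logK !lnnM ?muln_gt0 ?W0 ?a0 ?b0 //.
have la : lnn e1 <= (beta * t)%:R * lnn 2 by rewrite -lnnX // lnn_le.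
have lb : lnn e2 <= (beta * t.+1)%:R * lnn 2 by rewrite -lnnX // lnn_le.
have l2 := lnn2_le1 R; have lW := lnn_ge0 R W.
have l20 := lnn_ge0 R 2.
have ma : (beta * t)%:R * lnn 2 <= (beta * t)%:R by rewrite -[X in _ <= X]mulr1 ler_wpM2l.
have mb : (beta * t.+1)%:R * lnn 2 <= (beta * t.+1)%:R by rewrite -[X in _ <= X]mulr1 ler_wpM2l.
rewrite /Kscale; move: la lb ma mb; rewrite !natrM -natr1 => la lb ma mb.
have t0 : 0 <= t%:R :> R by []; have be0 : 0 <= beta%:R :> R by [].
have bt := mulr_ge0 be0 t0; have wt := mulr_ge0 lW t0.
move: la lb ma mb t0 be0 bt wt lW; clear.
move: (lnn e1) (lnn e2) (lnn W) (lnn 2) (t%:R) (beta%:R) => *; nra.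
Qed.

Lemma Kscale_ge t : 26 * t.+1%:R <= Kscale t.
Proof. by rewrite /Kscale ler_wpM2r // -addrA lerDl addr_ge0 // mulr_ge0 // lnn_ge0. Qed.

Lemma Kscale_mono t : Kscale t <= Kscale t.+1.
Proof.
by rewrite /Kscale ler_wpM2l ?ler_nat // !addr_ge0 // mulr_ge0 // lnn_ge0.
Qed.

Definition small_level t : R := 4 * sep_eta (Kscale t) * Kscale t ^+ 2.

Definition exceptional t e chi :=
  [/\ (0 < e <= 2 ^ (beta * t))%N, squarefree e, coprime e W, dchar (W * e) chi &
   [/\ nonprincipal (W * e) chi, full_char W e chi & Lsmall chi (small_level t)]].

Lemma Kscale_ge26 t : 26 <= Kscale t.
Proof. by apply: le_trans (Kscale_ge t); rewrite ler_peMr // ler1n. Qed.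

Lemma Kscale_gt0 t : 0 < Kscale t.
Proof. by apply: lt_le_trans (Kscale_ge26 t); rewrite ltr0n. Qed.

Lemma small_levelE t : small_level t = 4 * sep_const R / Kscale t ^+ 7.
Proof.
have K0 := lt0r_neq0 (Kscale_gt0 t); rewrite /small_level /sep_eta.
by field; rewrite K0.
Qed.

Lemma sep_const_gt0 : 0 < sep_const R.
Proof. by rewrite /sep_const divr_gt0 ?expR_gt0 ?exprn_gt0 ?ltr0n. Qed.

Lemma small_level_mono t : small_level t.+1 <= small_level t.
Proof.
rewrite !small_levelE ler_wpM2l ?(mulr_ge0 (ler0n R 4) (ltW sep_const_gt0)) //.
rewrite lef_pV2 ?posrE ?exprn_gt0 ?Kscale_gt0 // lerXn2r ?nnegrE ?(ltW (Kscale_gt0 _)) //.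
exact: Kscale_mono.
Qed.

Lemma Lsmall_le chi (a b : R) : a <= b -> Lsmall chi a -> Lsmall chi b.
Proof. by move=> ab [X0 h]; exists X0 => X hX; apply: le_trans (h X hX) ab. Qed.

Lemma exceptional_logK t e chi : exceptional t e chi -> logK R (W * e) <= Kscale t.
Proof.
case=> /andP[e0 et] _ _ _ _; have e1 : (0 < 1 <= 2 ^ (beta * t.+1))%N by rewrite expn_gt0.
have ee : (0 < e <= 2 ^ (beta * t))%N by rewrite e0.
apply: le_trans (Kscale_logK ee e1).
by rewrite /logK lerD2r ler_wpM2l // lnn_le ?muln_gt0 ?W0 ?e0 // leq_pmulr // muln_gt0 W0.
Qed.

(** If some value had a square other than 1, the character chi^2 would have mean zero and
    [complex_not_Lsmall] would apply. *)
Lemma exceptional_real t e chi : exceptional t e chi ->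
  forall n, [|| chi n == 0, chi n == 1 | chi n == -1].
Proof.
move=> ex n; have qK := exceptional_logK ex; case: ex => _ _ _ d [np fu ls].
case: (boolP (coprime n (W * e))) => cn; last by rewrite (dchar_nunit d cn) eqxx.
suff : chi n ^+ 2 == 1 by rewrite sqrf_eq1 => ->; rewrite orbT.
apply/negPn/negP => h.
apply: (complex_not_Lsmall (dchar_cmult d) (dchar_unimodular d) (dchar_oscillating d np) _ qK ls).
apply: (@oscillating_of _ _ n) => //; first exact: dchar_mod_gt0 d.
  by move=> a; rewrite (dchar_periodic d).
by move=> a b; rewrite (dcharM d) exprMn.
Qed.

Lemma real_char_re chi : (forall n, [|| chi n == 0, chi n == 1 | chi n == -1]) ->
  exists x : nat -> R, chi = (fun n => (x n)%:C) /\ forall n, [|| x n == 0, x n == 1 | x n == -1].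
Proof.
move=> h; exists (fun n => complex.Re (chi n)); split.
  by apply: boolp.funext => n; case/or3P: (h n) => /eqP -> //=; rewrite -rmorphN1 || rewrite -(rmorphN1 (real_complex R)).
by move=> n; case/or3P: (h n) => /eqP -> /=; rewrite eqxx ?orbT.
Qed.

(** By repulsion the product of the two characters is trivial on common units. Since both are full,
    this forces the same primes into e1 and e2, hence e1 = e2 by squarefreeness, and the characters
    agree as they are real. *)
Lemma exceptional_next t e1 e2 chi1 chi2 : exceptional t e1 chi1 -> exceptional t.+1 e2 chi2 ->
  e1 = e2 /\ chi1 = chi2.
Proof.
move=> ex1 ex2; have r1 := exceptional_real ex1; have r2 := exceptional_real ex2.
case: ex1 ex2 => b1 s1 w1 d1 [n1 f1 l1] [b2 s2 w2 d2 [n2 f2 l2]].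
have pr : forall n, coprime n (W * e1) -> coprime n (W * e2) -> chi1 n * chi2 n = 1.
  move=> n c1 c2; apply/eqP/negPn/negP => h.
  have [x [ex x3]] := real_char_re r1; have [y [ey y3]] := real_char_re r2.
  have d1' := d1; have d2' := d2; rewrite ex in d1' l1 n1; rewrite ey in d2' l2 n2.
  apply: (@real_repulsion R x y (W * e1) (W * e2) (Kscale t)) l1 _ => //.
  - exact: dchar_cmult d1'.
  - exact: dchar_cmult d2'.
  - exact: dchar_oscillating d1' n1.
  - exact: dchar_oscillating d2' n2.
  - have -> : (fun n => (x n * y n)%:C) = (fun n => chi1 n * chi2 n).
      by apply: boolp.funext => j; rewrite ex ey rmorphM.
    apply: (@oscillating_of _ _ n) => //.
    + by rewrite muln_gt0 (dchar_mod_gt0 d1) (dchar_mod_gt0 d2).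
    + move=> j; congr (_ * _); first by rewrite mulnC periodicM //; exact: dchar_periodic d1.
      by rewrite periodicM //; exact: dchar_periodic d2.
    + by move=> a b; rewrite (dcharM d1) (dcharM d2) mulrACA.
    + by rewrite coprimeMr c1.
  - exact: Kscale_logK.
  - exact: Lsmall_le (small_level_mono t) l2.
have [e10 e20] : (0 < e1)%N /\ (0 < e2)%N by case/andP: b1; case/andP: b2.
have E : e1 = e2.
  apply: squarefree_eq => // p pp; apply/idP/idP.
    exact: (full_char_dvd e10 e20 s1 w1 d1 d2 f1 pr).
  apply: (full_char_dvd e20 e10 s2 w2 d2 d1 f2 _ pp) => n c2 c1.
  by rewrite mulrC pr.
split=> //; apply: boolp.funext => n; subst e2.
case: (boolP (coprime n (W * e1))) => cn; last by rewrite (dchar_nunit d1 cn) (dchar_nunit d2 cn).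
have := pr n cn cn; have sq : chi2 n * chi2 n = 1.
  case/or3P: (r2 n) => /eqP z; rewrite z ?mulr1 ?mulrNN ?mulr1 //.
  by have := dchar_unit d2 cn; rewrite z normc0 => /eqP; rewrite eq_sym oner_eq0.
by move/(congr1 (fun z => z * chi2 n)); rewrite -mulrA sq mulr1 mul1r.
Qed.

(** If every scale from t0 on were exceptional, [exceptional_next] would propagate one character
    through all of them. As [small_level] tends to 0, its value at 1 would be below every positive
    bound, against [real_char_not_Lsmall]. *)
Theorem good_scales t0 : exists2 t, (t0 <= t)%N & forall e chi, ~ exceptional t e chi.
Proof.
apply: boolp.contrapT => H.
have ex t : (t0 <= t)%N -> exists e chi, exceptional t e chi.
  move=> t0t; apply: boolp.contrapT => h; apply: H; exists t => // e chi x.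
  by apply: h; exists e, chi.
have [e [chi x0]] := ex t0 (leqnn t0).
have xt t : (t0 <= t)%N -> exceptional t e chi.
  elim: t => [|t IH]; first by rewrite leqn0 => /eqP <-.
  rewrite leq_eqVlt => /orP[/eqP <- //|]; rewrite ltnS => t0t.
  have [e' [chi' x']] := ex t.+1 (leq_trans t0t (leqnSn t)).
  by have [-> ->] := exceptional_next (IH t0t) x'.
have r := exceptional_real x0; have [x [ex' x3]] := real_char_re r.
case: (x0) => _ _ _ d [np _ _]; have cm := dchar_cmult d; have os := dchar_oscillating d np.
rewrite ex' in cm os; have [eps [eps0 ns]] := real_char_not_Lsmall cm os x3.
have c0 := sep_const_gt0.
have [T hT] := inv_nat_small (4 * sep_const R) eps0.
have := xt (t0 + T)%N (leq_addr _ _); case=> _ _ _ _ [_ _ ls]; apply: ns; rewrite -ex'.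
apply: Lsmall_le ls; apply: le_trans (hT (t0 + T)%N (leq_addl _ _)).
rewrite small_levelE ler_wpM2l ?(mulr_ge0 (ler0n R 4) (ltW sep_const_gt0)) //.
rewrite lef_pV2 ?posrE ?exprn_gt0 ?Kscale_gt0 ?ltr0n //.
apply: (@le_trans _ _ (Kscale (t0 + T))).
  apply: le_trans (Kscale_ge _); rewrite ler_peMl // ler1n //.
by rewrite -[X in X <= _]expr1 ler_weXn2l // (le_trans _ (Kscale_ge26 _)) // ler1n.
Qed.

End DirichletCharacters.

(** * Existence and orthogonality of Dirichlet characters *)

Section Characters.
Variable R : realType.
Local Notation C := R[i].
Local Open Scope complex_scope.

Lemma normc_normE (z : C) : `|z| = (normc z)%:C.
Proof. by rewrite normc_def; case: z. Qed.

Lemma conj_mul_norm (z : C) : Num.conj z * z = (normc z ^+ 2)%:C.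
Proof. by rewrite mulrC -normCK normc_normE rmorphXn. Qed.

Variable q : nat.
Hypothesis q0 : (0 < q)%N.

Let idx (n : nat) : 'I_q := Ordinal (ltn_pmod n q0).

(** For a prime to q, the permutation matrix of multiplication by a on the residues modulo q.
    Characters are obtained as joint eigenvalues of these matrices. *)
Definition mulmat (a : nat) : 'M[C]_q := \matrix_(i, j) (i == idx (a * j))%:R.

Lemma idx_eq m n : (idx m == idx n) = (m == n %[mod q])%N.
Proof. by []. Qed.

Lemma idxK (i : 'I_q) : idx i = i.
Proof. by apply: val_inj; rewrite /= modn_small. Qed.

Lemma mulmatM a b : mulmat a *m mulmat b = mulmat (a * b).
Proof.
apply/matrixP => i j; rewrite !mxE (bigD1 (idx (b * j))) //= !mxE eqxx mulr1.
rewrite big1 ?addr0 => [|k /negbTE kb]; last by rewrite !mxE kb mulr0.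
by congr (_ %:R); congr nat_of_bool; congr (_ == _); apply: val_inj; rewrite /= modnMmr mulnA.
Qed.

Lemma mulmat1 : mulmat 1 = 1%:M.
Proof. by apply/matrixP => i j; rewrite !mxE mul1n idxK. Qed.

Lemma mulmat_mod a : mulmat (a %% q) = mulmat a.
Proof.
by apply/matrixP => i j; rewrite !mxE; congr (_ == _)%:R; apply: val_inj; rewrite /= modnMml.
Qed.

Lemma inverse_mod a : coprime a q -> exists2 a', coprime a' q & a * a' = 1 %[mod q].
Proof.
move=> ca; have [a00|a0] := posnP a.
  by move: ca; rewrite a00 /coprime gcd0n => /eqP q1; exists 1%N; [exact: coprime1n | by rewrite q1 !modn1].
case: (egcdnP q a0) => km kn e _; rewrite (eqP ca) in e.
have e' : a * km = 1 %[mod q] by rewrite mulnC e modnMDl.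
exists km => //; have := coprime1n q; rewrite -coprime_modl -e' coprime_modl coprimeMl.
by case/andP.
Qed.

Lemma mulmat_adj a a' : coprime a q -> coprime a' q -> a * a' = 1 %[mod q] ->
  map_mx Num.conj (mulmat a)^T = mulmat a'.
Proof.
move=> ca ca' aa'; apply/matrixP => i j; rewrite !mxE rmorph_nat; congr (_ %:R); congr nat_of_bool.
rewrite -{1}(idxK j) -[in RHS](idxK i) !idx_eq.
have inv b b' (x y : nat) : b * b' = 1 %[mod q] -> (x == b * y %[mod q])%N -> (y == b' * x %[mod q])%N.
  move=> bb /eqP xy; apply/eqP; rewrite -modnMmr xy modnMmr mulnA (mulnC b') -modnMml bb.
  by rewrite modnMml mul1n.
by apply/idP/idP; apply: inv => //; rewrite mulnC.
Qed.

(** Commuting matrices have a common unitary triangular form. The adjoint of [mulmat a] is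
    [mulmat a'] for an inverse a' of a, so the form of each of them is triangular on both sides,
    that is diagonal. *)
Lemma unit_diagonalization : exists U : 'M[C]_q, U *m map_mx Num.conj U^T = 1%:M /\
  forall a, coprime a q -> forall i j, i != j -> (U *m mulmat a *m map_mx Num.conj U^T) i j = 0.
Proof.
pose As := [seq mulmat a | a <- iota 0 q & coprime a q].
have [|U Uu /allP trig] := @cotrigonalization C q As.
  move=> A B /mapP[a _ ->] /mapP[b _ ->]; by rewrite /comm_mx !mulmatM mulnC.
exists U; split; first exact/unitarymxP.
have inAs a : coprime a q -> mulmat a \in As.
  move=> ca; apply/mapP; exists (a %% q)%N; last by rewrite mulmat_mod.
  by rewrite mem_filter coprime_modl ca mem_iota add0n ltn_mod q0.
have low a : coprime a q -> forall i j : 'I_q, (i < j)%N -> (U *m mulmat a *m map_mx Num.conj U^T) i j = 0.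
  move=> ca i j ij; have /is_trig_mxP H := trig _ (inAs a ca).
  by have := H i j ij; rewrite conjymx.
move=> a ca i j; case: (ltngtP i j) => [ij|ji|/val_inj ->]; last by rewrite eqxx.
  by move=> _; exact: low.
move=> _; have [a' ca' aa'] := inverse_mod ca.
have := low a' ca' j i ji; rewrite -(mulmat_adj ca ca' aa') => h.
have e : U *m map_mx Num.conj (mulmat a)^T *m map_mx Num.conj U^T =
   map_mx Num.conj (U *m mulmat a *m map_mx Num.conj U^T)^T.
  rewrite !trmx_mul !map_mxM mulmxA; congr (_ *m _ *m _).
  by apply/matrixP => x y; rewrite !mxE /= conjCK.
by move: h; rewrite e !mxE => /eqP; rewrite conjC_eq0 => /eqP.
Qed.

(** The index r is a diagonal position, so a character may occur several times; the weights account
    for the multiplicities. Orthogonality is the relation between the columns of a unitary matrix,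
    the column at a being d a r times the column at 1. *)
Lemma dirichlet_characters : exists (chi : 'I_q -> nat -> C) (w : 'I_q -> R),
  [/\ forall r, dchar q (chi r), forall r, 0 <= w r, \sum_r w r = 1 &
   forall a b, coprime a q -> coprime b q ->
     \sum_r (w r)%:C * (Num.conj (chi r a) * chi r b) = if (a == b %[mod q])%N then 1 else 0].
Proof.
have [U [UU off]] := unit_diagonalization.
set Ua := map_mx Num.conj U^T in UU off.
have UU' : Ua *m U = 1%:M by exact: mulmx1C.
pose d a r := (U *m mulmat a *m Ua) r r.
have diagE a r (j : 'I_q) : coprime a q -> (U *m mulmat a) r j = d a r * U r j.
  move=> ca; have -> : U *m mulmat a = (U *m mulmat a *m Ua) *m U by rewrite -mulmxA UU' mulmx1.
  rewrite mxE (bigD1 r) //= big1 ?addr0 // => k kr.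
  by rewrite off ?mul0r // eq_sym.
have colE a r (j : nat) : (U *m mulmat a) r (idx j) = U r (idx (a * j)).
  rewrite mxE (bigD1 (idx (a * j))) //= mxE /= big1 ?addr0.
    rewrite (_ : idx (a * j) == _) ?mulr1 //; apply/eqP/val_inj; by rewrite /= modnMmr.
  move=> k kb; rewrite mxE (_ : idx (a * idx j) = idx (a * j)) ?(negbTE kb) ?mulr0 //.
  by apply: val_inj; rewrite /= modnMmr.
have dM a b r : coprime a q -> coprime b q -> d (a * b)%N r = d a r * d b r.
  move=> ca cb; rewrite /d -mulmatM.
  have -> : U *m (mulmat a *m mulmat b) *m Ua = (U *m mulmat a *m Ua) *m (U *m mulmat b *m Ua).
    by rewrite !mulmxA -[U *m mulmat a *m Ua *m U]mulmxA UU' mulmx1.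
  rewrite mxE (bigD1 r) //= big1 ?addr0 // => k kr.
  by rewrite (off a ca r k) ?mul0r // eq_sym.
have d1 r : d 1%N r = 1 by rewrite /d mulmat1 mulmx1 UU mxE eqxx.
have dmod a r : d (a %% q)%N r = d a r by rewrite /d mulmat_mod.
have dn a r : coprime a q -> normc (d a r) = 1.
  move=> ca; have [a' ca' aa'] := inverse_mod ca.
  have e : d a' r = Num.conj (d a r).
    rewrite /d -(mulmat_adj ca ca' aa').
    have -> : U *m map_mx Num.conj (mulmat a)^T *m Ua = map_mx Num.conj (U *m mulmat a *m Ua)^T.
      rewrite /Ua !trmx_mul !map_mxM mulmxA; congr (_ *m _ *m _).
      by apply/matrixP => x y; rewrite !mxE /= conjCK.
    by rewrite !mxE.
  have := dM a a' r ca ca'; rewrite -dmod aa' dmod d1 e mulrC conj_mul_norm => /esym/(congr1 (@complex.Re R)) /= h.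
  by apply/eqP; rewrite -sqrp_eq1 ?normc_ge0 // h.
clearbody d.
pose chi r n : C := if coprime n q then d n r else 0.
pose w r : R := normc (U r (idx 1)) ^+ 2.
exists chi, w.
have orth a b : coprime a q -> coprime b q ->
     \sum_r (w r)%:C * (Num.conj (chi r a) * chi r b) = if (a == b %[mod q])%N then 1 else 0.
  move=> ca cb; transitivity ((Ua *m U) (idx a) (idx b)); last first.
    by rewrite UU' mxE idx_eq; case: eqP.
  rewrite mxE; apply: eq_bigr => r _; rewrite /chi ca cb !mxE.
  have e c : coprime c q -> U r (idx c) = d c r * U r (idx 1).
    by move=> cc; rewrite -diagE // colE muln1.
  have wE : (w r)%:C = Num.conj (U r (idx 1)) * U r (idx 1) by rewrite conj_mul_norm.
  rewrite (e a ca) (e b cb) wE [Num.conj (d a r * _)]rmorphM /=; ring.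
split=> //.
- move=> r; split=> //.
  + move=> n; rewrite /chi -coprime_modl modnDr coprime_modl.
    by case: ifP => // _; rewrite -dmod modnDr dmod.
  + by rewrite /chi coprime1n d1.
  + move=> a b; rewrite /chi coprimeMl; case: (boolP (coprime a q)) => ca; last by rewrite mul0r.
    by case: (boolP (coprime b q)) => cb; rewrite ?mulr0 // dM.
  + by move=> n cn; rewrite /chi cn dn.
  + by move=> n /negbTE cn; rewrite /chi cn.
- by move=> r; exact: sqr_ge0.
- have := orth 1%N 1%N (coprime1n q) (coprime1n q); rewrite eqxx.
  rewrite (eq_bigr (fun r => (w r)%:C)) => [|r _]; last first.
    by rewrite /chi coprime1n d1 rmorph1 mulr1 mulr1.
  by rewrite -rmorph_sum => /(congr1 (@complex.Re R)).
Qed.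

(** A bound is demanded only for the characters that occur in the expansion of [h]; this is how the
    trivial character and those of smaller modulus are excluded later. *)
Lemma fourier_bound (h : nat -> R) (c : nat -> R) (T : R) :
  periodic q h -> (forall n, ~~ coprime n q -> h n = 0) -> (forall n, `|h n| <= 1) -> 0 <= T ->
  (forall chi, dchar q chi -> \sum_(0 <= a < q) (h a)%:C * Num.conj (chi a) != 0 ->
     exists Y0, forall Y, (Y0 <= Y)%N -> normc (\sum_(1 <= n < Y.+1) (c n)%:C * chi n) <= T) ->
  exists Y0, forall Y, (Y0 <= Y)%N -> `|\sum_(1 <= n < Y.+1) c n * h n| <= q%:R * T.
Proof.
move=> ph hu h1 T0 H; have [chi [w [ch w0 w1 orth]]] := dirichlet_characters.
pose hh r : C := \sum_(0 <= a < q) (h a)%:C * Num.conj (chi r a).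
have hn n : (h n)%:C = \sum_r (w r)%:C * (hh r * chi r n).
  transitivity (\sum_(0 <= a < q) (h a)%:C * \sum_r (w r)%:C * (Num.conj (chi r a) * chi r n)); last first.
    rewrite /hh; under eq_bigr do rewrite mulr_sumr.
    rewrite exchange_big /=; apply: eq_bigr => r _; rewrite mulr_suml mulr_sumr.
    by apply: eq_bigr => a _; ring.
  case: (boolP (coprime n q)) => cn; last first.
    rewrite hu // big1 // => a _; rewrite big1 ?mulr0 // => r _.
    by rewrite (dchar_nunit (ch r) cn) !mulr0.
  rewrite big_mkord (bigD1 (idx n)) //= orth ?coprime_modl // modn_mod eqxx mulr1.
  rewrite big1 ?addr0 ?(periodic_mod n ph) // => a an.
  case: (boolP (coprime a q)) => ca; last by rewrite hu // mul0r.
  rewrite orth // (_ : (a == n %[mod q])%N = false) ?mulr0 //; apply: contraNF an => /eqP e.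
  by apply/eqP/val_inj; rewrite /= -e modn_small.
have hc r : exists y, hh r != 0 -> forall Y, (y <= Y)%N ->
    normc (\sum_(1 <= n < Y.+1) (c n)%:C * chi r n) <= T.
  have [z|z] := eqVneq (hh r) 0; first by exists 0%N.
  by have [y hy] := H _ (ch r) z; exists y.
have [Y0 hY0] := boolp.choice hc.
exists (\max_r Y0 r) => Y YY.
rewrite -normcR rmorph_sum /=.
have -> : \sum_(1 <= n < Y.+1) (c n * h n)%:C =
   \sum_r (w r)%:C * (hh r * \sum_(1 <= n < Y.+1) (c n)%:C * chi r n).
  under [RHS]eq_bigr do rewrite !mulr_sumr.
  rewrite exchange_big /=; apply: eq_bigr => i _; rewrite rmorphM /= hn mulr_sumr.
  by apply: eq_bigr => r _; ring.
apply: le_trans (normc_sum _ _ _) _.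
apply: (@le_trans _ _ (\sum_r w r * (q%:R * T))); last by rewrite -mulr_suml w1 mul1r.
apply: ler_sum => r _; rewrite !normcM normcR ger0_norm ?w0 // ler_wpM2l ?w0 //.
have hq : normc (hh r) <= q%:R.
  apply: le_trans (normc_sum _ _ _) _; apply: (@le_trans _ _ (\sum_(0 <= a < q) 1)).
    apply: ler_sum => a _; rewrite normcM normcR mulr_ile1 ?normc_ge0 //.
    have -> : normc (Num.conj (chi r a)) = normc (chi r a).
      by apply: complexI; rewrite -!normc_normE norm_conjC.
    by have [_ _] := dchar_cmult (ch r); apply.
  by rewrite sumr_const_nat subn0.
have [z|z] := eqVneq (hh r) 0; first by rewrite z normc0 mul0r mulr_ge0.
by apply: ler_pM; rewrite ?normc_ge0 //; apply: hY0 => //; exact: leq_trans (leq_bigmax r) YY.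
Qed.

End Characters.

(** * Local factors and dispersion *)

Section LocalFunctions.
Variable R : realType.
Variables (Z W : nat).
Local Notation T := 'I_Z.
Implicit Types (q : T) (B : {set T}) (i : T -> nat) (n m : nat).

Definition sievable q := prime q && ~~ (q %| W)%N.
Definition modulus B : nat := \prod_(q in B) (q : nat).

(** The condition q | n + i q minus its mean over the units modulo q. For q not dividing i q it
    vanishes on the multiples of q and has mean zero along every progression n * m. *)
Definition locfun i q n : R :=
  (if (q %| n + i q)%N then 1 else 0) - (if (q %| n)%N then 0 else 1) / (q%:R - 1).

Definition locprod i B n : R := \prod_(q in B) locfun i q n.

Definition admissible i := forall q, sievable q -> ~~ (q %| i q)%N.

Lemma prime_sub1_ge1 q : prime q -> 1 <= q%:R - 1 :> R.
Proof. by move=> /prime_gt1 h; rewrite lerBrDr -[1 + 1]/(2%:R) ler_nat. Qed.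

Lemma locfun_periodic i q : periodic q (locfun i q).
Proof. by move=> n; rewrite /locfun addnAC !(dvdn_addl _ (dvdnn q)). Qed.

Lemma locfun0 i q n : ~~ (q %| i q)%N -> (q %| n)%N -> locfun i q n = 0.
Proof. by move=> iq qn; rewrite /locfun qn dvdn_addr // (negbTE iq) mul0r subr0. Qed.

Lemma locfun_le1 i q n : prime q -> ~~ (q %| i q)%N -> `|locfun i q n| <= 1.
Proof.
move=> pq iq; have h := prime_sub1_ge1 pq.
case: (boolP (q %| n)%N) => qn; first by rewrite locfun0 // normr0.
rewrite /locfun (negbTE qn) mul1r; set u := q%:R - 1 in h *.
have u0 : 0 < u by exact: lt_le_trans h.
have ui : 0 <= u^-1 <= 1 by rewrite invr_ge0 (ltW u0) invf_le1.
by case: ifP => _; rewrite ler_norml; move: ui => /andP[? ?]; apply/andP; split; lra.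
Qed.

Lemma sum_dvd_shift (q c : nat) : (0 < q)%N ->
  \sum_(0 <= m < q) (if (q %| m + c)%N then 1 else 0 : R) = 1.
Proof.
move=> q0; transitivity (\sum_(c <= m < c + q) (if (q %| m)%N then 1 else 0 : R)).
  by rewrite [RHS](big_addn 0 (c + q) c xpredT) addKn.
rewrite (@period_shift_sum _ q (fun m => if (q %| m)%N then 1 else 0)).
  rewrite big_ltn // dvdn0 big_nat_cond big1 ?addr0 // => m /andP[/andP[m0 mq] _].
  by rewrite gtnNdvd.
by move=> m; rewrite (dvdn_addl _ (dvdnn q)).
Qed.

Lemma sum_ndvd (q : nat) : (0 < q)%N ->
  \sum_(0 <= m < q) (if (q %| m)%N then 0 else 1 : R) = q%:R - 1.
Proof.
move=> q0; rewrite big_ltn // dvdn0 add0r (eq_big_nat _ _ (F2 := fun=> 1)) => [|m /andP[m0 mq]].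
  by rewrite sumr_const_nat natrB.
by rewrite gtnNdvd.
Qed.

Lemma sum_dvd_mul (q n c : nat) : (0 < q)%N -> coprime n q ->
  \sum_(0 <= m < q) (if (q %| n * m + c)%N then 1 else 0 : R) = 1.
Proof.
move=> q0 cn; apply: etrans (sum_dvd_shift c q0).
apply: (@scale_sum R q (fun m => if (q %| m + c)%N then 1 else 0) n q0 cn).
by move=> m; rewrite addnAC (dvdn_addl _ (dvdnn q)).
Qed.

Lemma sum_locfun i q n : prime q -> ~~ (q %| i q)%N -> \sum_(0 <= m < q) locfun i q (n * m) = 0.
Proof.
move=> pq iq; have q0 := prime_gt0 pq; have h := prime_sub1_ge1 pq.
case: (boolP (q %| n)%N) => qn.
  by rewrite big1 // => m _; rewrite locfun0 // dvdn_mulr.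
have cn : coprime n q by rewrite coprime_sym prime_coprime.
rewrite /locfun sumrB sum_dvd_mul // -mulr_suml.
under [in X in _ - X]eq_bigr do rewrite Euclid_dvdM // (negbTE qn) /=.
rewrite sum_ndvd // divff ?subrr //; apply: lt0r_neq0; exact: lt_le_trans h.
Qed.

(** Near orthogonality: the two divisibility conditions hold for a common m only if n = n' modulo q,
    and the centering terms contribute at most 1/(q - 1). *)
Lemma locfun_correlation i q n n' : prime q -> ~~ (q %| i q)%N ->
  `|\sum_(0 <= m < q) locfun i q (n * m) * locfun i q (n' * m)| <=
    (if (n == n' %[mod q])%N then 1 else 0) + (q%:R - 1)^-1.
Proof.
move=> pq iq; have q0 := prime_gt0 pq; have h := prime_sub1_ge1 pq.
set u := q%:R - 1 in h *; have u0 : 0 < u by exact: lt_le_trans h.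
have ind0 : 0 <= (if (n == n' %[mod q])%N then 1 else 0) :> R by case: ifP.
have rhs0 : 0 <= (if (n == n' %[mod q])%N then 1 else 0) + u^-1 by rewrite addr_ge0 // invr_ge0 ltW.
case: (boolP (q %| n)%N) => qn.
  by rewrite big1 ?normr0 // => m _; rewrite locfun0 ?mul0r // dvdn_mulr.
case: (boolP (q %| n')%N) => qn'.
  by rewrite big1 ?normr0 // => m _; rewrite [X in _ * X]locfun0 ?mulr0 // dvdn_mulr.
have cn : coprime n q by rewrite coprime_sym prime_coprime.
have cn' : coprime n' q by rewrite coprime_sym prime_coprime.
pose a m : R := if (q %| n * m + i q)%N then 1 else 0.
pose b m : R := if (q %| n' * m + i q)%N then 1 else 0.
pose v m : R := if (q %| m)%N then 0 else 1.
have Sa : \sum_(0 <= m < q) a m = 1 by exact: sum_dvd_mul.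
have Sb : \sum_(0 <= m < q) b m = 1 by exact: sum_dvd_mul.
have Sv : \sum_(0 <= m < q) v m = u by exact: sum_ndvd.
have e m : locfun i q (n * m) * locfun i q (n' * m) = a m * b m - (a m + b m) / u + v m / u ^+ 2.
  rewrite /locfun !Euclid_dvdM // (negbTE qn) (negbTE qn') /= -/(a m) -/(b m) -/(v m) -/u.
  case: (boolP (q %| m)%N) => qm.
    have -> : a m = 0 by rewrite /a (dvdn_addr _ (dvdn_mull _ qm)) (negbTE iq).
    have -> : b m = 0 by rewrite /b (dvdn_addr _ (dvdn_mull _ qm)) (negbTE iq).
    by rewrite /v qm; ring.
  by rewrite /v (negbTE qm); field; rewrite lt0r_neq0.
have ab : \sum_(0 <= m < q) a m * b m <= if (n == n' %[mod q])%N then 1 else 0.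
  case: ifPn => nn.
    rewrite -Sa; apply: ler_sum => m _; rewrite /a /b; do 2! case: ifP => _; by rewrite ?mulr0 ?mul0r ?mulr1.
  rewrite big1 // => m _; rewrite /a /b; case: ifP => d1; last by rewrite mul0r.
  case: ifP => d2; last by rewrite mulr0.
  case/negP: nn; have cm : coprime m q.
    rewrite coprime_sym prime_coprime //; apply/negP => qm.
    by move: d1; rewrite (dvdn_addr _ (dvdn_mull _ qm)) (negbTE iq).
  have : (n * m + i q == n' * m + i q %[mod q])%N by rewrite (eqP d1) (eqP d2).
  rewrite eqn_modDr; wlog nn' : n n' {qn qn' cn cn' a b Sa Sb e d1 d2 rhs0 ind0} / (n' <= n)%N => [Wl|].
    case: (leqP n' n) => [/Wl//|/ltnW/Wl w] E.
    by rewrite eq_sym; apply: w; rewrite eq_sym.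
  by rewrite !eqn_mod_dvd ?leq_mul2r ?nn' ?orbT // -mulnBl Gauss_dvdl // coprime_sym.
have ab0 : 0 <= \sum_(0 <= m < q) a m * b m.
  by apply: sumr_ge0 => m _; rewrite /a /b; do 2! case: ifP => _; rewrite ?mulr0 ?mul0r ?mulr1.
under eq_bigr do rewrite e.
rewrite big_split sumrB /= -!mulr_suml big_split /= Sa Sb Sv.
have -> : \sum_(0 <= m < q) a m * b m - (1 + 1) / u + u / u ^+ 2 = \sum_(0 <= m < q) a m * b m - u^-1.
  by field; rewrite lt0r_neq0.
have ui : 0 <= u^-1 by rewrite invr_ge0 ltW.
rewrite ler_norml; move: ab ab0 ui ind0; clear; move: (\sum_(_ <= _ < _) _) (u^-1) (if _ then _ else _) => *.
by apply/andP; split; lra.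
Qed.

Lemma modulus_gt0 B : (forall q, q \in B -> prime q) -> (0 < modulus B)%N.
Proof. by move=> h; apply: prodn_cond_gt0 => q /h /prime_gt0. Qed.

Lemma modulusD1 B q : q \in B -> modulus B = (q * modulus (B :\ q))%N.
Proof. by move=> qB; rewrite /modulus (big_setD1 q). Qed.

Lemma dvdn_modulus B (p : nat) : prime p -> (forall q, q \in B -> prime q) ->
  (p %| modulus B)%N -> exists2 q, q \in B & (q : nat) = p.
Proof.
move=> pp; have [c] := ubnP #|B|; elim: c B => // c IH B cB pB.
have [->|[q qB]] := set_0Vmem B; first by rewrite /modulus big_set0 Euclid_dvd1.
rewrite (modulusD1 qB) Euclid_dvdM // => /orP[pq|].
  by exists q => //; apply/esym/eqP; rewrite -dvdn_prime2 // pB.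
move=> pm; case: (IH (B :\ q)) => // [|r|r].
- by move: cB; rewrite (cardsD1 q B) qB.
- by rewrite inE => /andP[_ /pB].
- by rewrite inE => /andP[_ rB] <-; exists r.
Qed.

Lemma coprime_modulus B q : prime q -> q \notin B -> (forall r, r \in B -> prime r) ->
  coprime (modulus B) q.
Proof.
move=> pq qB pB; rewrite coprime_sym prime_coprime //; apply/negP => qm.
have [r rB e] := dvdn_modulus pq pB qm; case/negP: qB; by rewrite -(val_inj e : r = q).
Qed.

Lemma crt_sum_set B (f0 : nat -> R) (f : T -> nat -> R) : (0 < W)%N ->
  (forall q, q \in B -> sievable q) -> periodic W f0 -> (forall q, periodic q (f q)) ->
  \sum_(0 <= m < W * modulus B) f0 m * \prod_(q in B) f q m =
    (\sum_(0 <= m < W) f0 m) * \prod_(q in B) \sum_(0 <= m < q) f q m.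
Proof.
move=> W0; have [c] := ubnP #|B|; elim: c B f0 => // c IH B f0 cB sB p0 pf.
have [->|[q qB]] := set_0Vmem B.
  rewrite /modulus big_set0 muln1 big_set0 mulr1.
  by apply: eq_bigr => m _; rewrite big_set0 mulr1.
have /andP[pq qW] := sB q qB; pose B' := B :\ q.
have sB' r : r \in B' -> sievable r by rewrite inE => /andP[_ /sB].
have pB' r : r \in B' -> prime r by move=> /sB' /andP[].
have cB' : (#|B'| < c)%N by move: cB; rewrite (cardsD1 q B) qB.
have W'0 : (0 < W * modulus B')%N by rewrite muln_gt0 W0 modulus_gt0.
have cop : coprime (W * modulus B') q.
  by rewrite coprimeMl coprime_modulus ?inE ?eqxx // andbT coprime_sym prime_coprime.
have pp : periodic (W * modulus B') (fun m => f0 m * \prod_(r in B') f r m).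
  move=> m; congr (_ * _); first by rewrite mulnC periodicM.
  apply: eq_bigr => r rB'; rewrite (modulusD1 rB') mulnCA mulnC periodicM //.
rewrite (modulusD1 qB) mulnCA mulnC (big_setD1 q) //=.
under eq_bigr do rewrite (big_setD1 q) //= mulrCA mulrC.
rewrite (crt_sum W'0 (prime_gt0 pq) cop pp (pf q)) (IH B' f0 cB' sB' p0 pf).
by rewrite mulrAC -mulrA.
Qed.

Lemma locprod_periodic i B : periodic (modulus B) (locprod i B).
Proof.
move=> n; apply: eq_bigr => q qB; rewrite (modulusD1 qB) mulnC periodicM //.
exact: locfun_periodic.
Qed.

Lemma locprod_le1 i B n : admissible i -> (forall q, q \in B -> sievable q) -> `|locprod i B n| <= 1.
Proof.
move=> ad sB; rewrite normr_prod.
apply: (@le_trans _ _ (\prod_(q in B) 1)); last by rewrite big1.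
apply: ler_prod => q qB; rewrite normr_ge0 /=; have s := sB q qB.
by apply: locfun_le1; [case/andP: s | exact: ad].
Qed.

Lemma locprod0 i B n : admissible i -> (forall q, q \in B -> sievable q) ->
  ~~ coprime n (modulus B) -> locprod i B n = 0.
Proof.
move=> ad sB; have pB q : q \in B -> prime q by move=> /sB /andP[].
rewrite coprime_sym => nc; have [p] : exists p, p \in primes (gcdn (modulus B) n).
  case E : (primes _) => [|p s]; last by exists p; rewrite mem_head.
  move: nc; rewrite /coprime; have g0 : (0 < gcdn (modulus B) n)%N by rewrite gcdn_gt0 modulus_gt0.
  by move/eqP: E; rewrite -size_eq0 size_eq0 primes_eq0 ltnS leq_eqVlt ltnNge g0 orbF => ->.
rewrite mem_primes dvdn_gcd => /and4P[pp _ pm pn].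
have [q qB e] := dvdn_modulus pp pB pm; rewrite -e in pn.
by rewrite /locprod (big_setD1 q) //= locfun0 ?mul0r //; exact: ad (sB q qB).
Qed.

End LocalFunctions.

(** * Sums over progressions and moments of the divisor function *)

Section SumTools.
Variable R : realType.
Notation lnn := (lnn R).

Lemma sum_interval_restrict (V : nmodType) X A b (F : nat -> V) : (0 < A)%N -> (b <= X.+1)%N ->
  \sum_(1 <= l < X.+1) (if (A <= l < b)%N then F l else 0) = \sum_(A <= l < b) F l.
Proof.
move=> A0 bX; case: (leqP A b) => Ab; last first.
  rewrite big_nat_cond big1 => [|l _]; first by rewrite big_geq // ltnW.
  by case: ifP => // /andP[h1 h2]; move: (leq_ltn_trans h1 h2); rewrite ltnNge ltnW.
rewrite (big_cat_nat (n := A)) //=; last exact: leq_trans bX.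
rewrite [Y in Y + _](_ : _ = 0) ?add0r; last first.
  by rewrite big_nat_cond big1 // => l /andP[/andP[_ lA] _]; rewrite leqNgt lA.
rewrite (big_cat_nat (n := b)) //= [Y in _ + Y](_ : _ = 0) ?addr0; last first.
  by rewrite big_nat_cond big1 // => l /andP[/andP[bl _] _]; rewrite ltnNge bl andbF.
by apply: eq_big_nat => l ->.
Qed.

Lemma prod_add_set (I : finType) (B : {set I}) (x w : I -> R) :
  \prod_(q in B) (x q + w q) = \sum_(F in powerset B) (\prod_(q in F) x q) * \prod_(q in B :\: F) w q.
Proof.
rewrite big_mkcond (eq_bigr (fun q => (if q \in B then x q else 0) + (if q \in B then w q else 1))); last first.
  by move=> q _; case: ifP; rewrite ?add0r.
rewrite bigA_distr /= [RHS]big_mkcond; apply: eq_bigr => J _.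
rewrite powersetE; case: ifPn => [JB|/subsetPn[q qJ qB]]; last first.
  by rewrite (bigD1 q) //= qJ (negbTE qB) mul0r.
rewrite [in RHS]big_mkcond [X in _ = _ * X]big_mkcond -big_split /=; apply: eq_bigr => q _.
rewrite inE; case: (boolP (q \in J)) => qJ /=; first by rewrite (subsetP JB) ?mulr1.
by rewrite mul1r.
Qed.

(** Writing j = c + e l with c < e, the condition j > U >= e excludes l = 0, so that 1/j <= 1/(e
    l). *)
Lemma sum_inv_ap X U e n : (0 < e <= U)%N ->
  \sum_(1 <= j < X.+1) (if (U < j)%N && (j == n %[mod e])%N then j%:R^-1 else 0 : R) <= (1 + lnn X) / e%:R.
Proof.
move=> /andP[e0 eU]; pose c := (n %% e)%N; have ce : (c < e)%N by rewrite ltn_pmod.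
have e0' : 0 < e%:R :> R by rewrite ltr0n.
apply: (@le_trans _ _ (\sum_(1 <= j < X.+1) \sum_(1 <= l < X.+1)
   (if j == (c + e * l)%N then (e * l)%:R^-1 else 0 : R))).
  apply: ler_sum_nat => j /andP[j1 jX]; case: ifP => [/andP[Uj /eqP jn]|_]; last first.
    by apply: sumr_ge0 => l _; case: ifP => // _; rewrite invr_ge0.
  pose l := (j %/ e)%N; have ej : j = (c + e * l)%N by rewrite /c -jn addnC mulnC -divn_eq.
  have l0 : (0 < l)%N by rewrite divn_gt0 // (leq_trans eU) // ltnW.
  have lX : (l < X.+1)%N by apply: leq_ltn_trans (leq_div _ _) jX.
  rewrite (bigD1_seq l) ?iota_uniq ?mem_index_iota ?l0 ?lX //= -ej eqxx.
  apply: ler_wpDr; first by apply: sumr_ge0 => x _; case: ifP => // _; rewrite invr_ge0.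
  by rewrite lef_pV2 ?posrE ?ltr0n ?muln_gt0 ?e0 ?l0 ?j1 // ler_nat ej leq_addl.
rewrite exchange_big /=.
apply: (@le_trans _ _ (\sum_(1 <= l < X.+1) (e * l)%:R^-1)).
  apply: ler_sum_nat => l /andP[l1 lX].
  case: (boolP (0 < c + e * l <= X)%N) => h.
    rewrite -[X in _ <= X](@sum_eq_index _ X (c + e * l)%N) //.
  by rewrite sum_eq_index0 // invr_ge0.
under eq_bigr do rewrite natrM invfM.
by rewrite -mulr_sumr mulrC ler_wpM2r ?invr_ge0 ?(ltW e0') // harmonic_le.
Qed.

Definition tau (n : nat) : R := dsum n (fun=> 1).

Lemma tau_size n : (0 < n)%N -> tau n = (size (divisors n))%:R.
Proof.
move=> n0; rewrite /tau /dsum -big_filter.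
have -> : size (divisors n) = size [seq d <- index_iota 1 n.+1 | (d %| n)%N].
  apply/perm_size/uniq_perm; rewrite ?divisors_uniq ?filter_uniq ?iota_uniq // => d.
  rewrite mem_filter -dvdn_divisors // mem_index_iota.
  case: (boolP (d %| n)%N) => //= dn; rewrite (dvdn_gt0 n0 dn) ltnS dvdn_leq //.
by rewrite big_const_seq count_predT iter_addr_0.
Qed.

Lemma tau_ge0 n : 0 <= tau n. Proof. exact: sumr_ge0. Qed.

(** The map d -> (gcd(d, a), d / gcd(d, a)) embeds the divisors of a b into pairs of divisors of a
    and of b. *)
Lemma tau_mul a b : (0 < a)%N -> (0 < b)%N -> tau (a * b) <= tau a * tau b.
Proof.
move=> a0 b0; rewrite !tau_size ?muln_gt0 ?a0 // -natrM ler_nat.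
rewrite -(size_allpairs muln (divisors a) (divisors b)).
apply: uniq_leq_size; first exact: divisors_uniq.
move=> d; rewrite -dvdn_divisors ?muln_gt0 ?a0 // => dab.
have g0 : (0 < gcdn d a)%N by rewrite gcdn_gt0 a0 orbT.
apply/allpairsP; exists (gcdn d a, d %/ gcdn d a)%N; split=> /=.
- by rewrite -dvdn_divisors // dvdn_gcdr.
- rewrite -dvdn_divisors // -(@Gauss_dvdr _ (a %/ gcdn d a)).
    by rewrite -(@dvdn_pmul2l (gcdn d a)) // mulnA !(mulnC (gcdn d a)) !divnK ?dvdn_gcdl ?dvdn_gcdr.
  rewrite /coprime -(eqn_pmul2l g0) muln1 muln_gcdr !(mulnC (gcdn d a)).
  by rewrite !divnK ?dvdn_gcdl ?dvdn_gcdr.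
- by rewrite mulnC divnK ?dvdn_gcdl.
Qed.

Lemma sum_tau X : \sum_(1 <= n < X.+1) tau n / n%:R <= (1 + lnn X) ^+ 2.
Proof.
pose F n : R := if (n <= X)%N then n%:R^-1 else 0.
have h : \sum_(1 <= n < X.+1) F n * tau n = \sum_(1 <= a < X.+1) \sum_(1 <= b < X.+1) 1 * F (a * b)%N.
  by apply: (@sum_dsum _ X (fun _ _ => 1) F) => n nX; rewrite /F leqNgt nX.
have -> : \sum_(1 <= n < X.+1) tau n / n%:R = \sum_(1 <= n < X.+1) F n * tau n.
  by apply: eq_big_nat => n /andP[_ nX]; rewrite /F -ltnS nX mulrC.
rewrite h; apply: (@le_trans _ _ ((\sum_(1 <= a < X.+1) a%:R^-1) * \sum_(1 <= b < X.+1) b%:R^-1)).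
  rewrite big_distrlr /=; apply: ler_sum => a _; apply: ler_sum => b _; rewrite mul1r /F.
  by case: ifP => _; rewrite ?natrM ?invfM // mulr_ge0 ?invr_ge0.
rewrite expr2; apply: ler_pM; rewrite ?sumr_ge0 ?harmonic_le // => n _; by rewrite invr_ge0.
Qed.

(** One of the two factors tau is opened as a sum over factorizations n = a b, and tau (a b) <= tau
    a * tau b separates the variables. *)
Lemma sum_tau_sqr X : \sum_(1 <= n < X.+1) tau n ^+ 2 / n%:R <= (1 + lnn X) ^+ 4.
Proof.
pose F n : R := if (n <= X)%N then tau n / n%:R else 0.
have h : \sum_(1 <= n < X.+1) F n * tau n = \sum_(1 <= a < X.+1) \sum_(1 <= b < X.+1) 1 * F (a * b)%N.
  by apply: (@sum_dsum _ X (fun _ _ => 1) F) => n nX; rewrite /F leqNgt nX.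
have -> : \sum_(1 <= n < X.+1) tau n ^+ 2 / n%:R = \sum_(1 <= n < X.+1) F n * tau n.
  by apply: eq_big_nat => n /andP[_ nX]; rewrite /F -ltnS nX; ring.
rewrite h; apply: (@le_trans _ _ ((\sum_(1 <= a < X.+1) tau a / a%:R) * \sum_(1 <= b < X.+1) tau b / b%:R)).
  rewrite big_distrlr /=; apply: ler_sum_nat => a /andP[a0 _]; apply: ler_sum_nat => b /andP[b0 _].
  have e : tau a / a%:R * (tau b / b%:R) = tau a * tau b / (a * b)%:R by rewrite natrM invfM; ring.
  rewrite mul1r /F e; case: ifP => _; first by rewrite ler_wpM2r ?invr_ge0 // tau_mul.
  by rewrite divr_ge0 // mulr_ge0 // tau_ge0.
rewrite -[4%N]/(2 + 2)%N exprD; apply: ler_pM; rewrite ?sum_tau ?sumr_ge0 // => n _; by rewrite divr_ge0 // tau_ge0.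
Qed.

Transparent mobius.
Lemma mobius_norm n : `|mobius R n| <= 1.
Proof.
rewrite /mobius; case: ifP => _; last by rewrite normr0.
by rewrite normrX normrN1 expr1n.
Qed.
Opaque mobius.

Lemma vaughan_coef_le U m : (0 < U)%N -> (0 < m)%N -> `|vaughan_coef R U m| <= tau m.
Proof.
move=> U0 m0; case: (leqP m U) => mU.
  by rewrite vaughan_coef0 ?m0 // normr0 tau_ge0.
rewrite /vaughan_coef (_ : (m == 1%N) = false) ?sub0r ?normrN; last by apply/negbTE; lia.
apply: le_trans (ler_norm_sum _ _ _) _; apply: ler_sum => d _; rewrite /cut.
case: ifP => _; last by rewrite normr0.
exact: mobius_norm.
Qed.

End SumTools.

(** * Type I and type II sums *)

Section Dispersion.
Variable R : realType.
Variables (Z W X V0 U D a : nat) (g : nat -> R) (G1 : R).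
Local Notation T := 'I_Z.
Notation lnn := (lnn R).
Notation mangoldt := (mangoldt R).
Notation locprod := (@locprod R Z).
Notation locfun := (@locfun R Z).
Implicit Types (B F : {set T}) (i : T -> nat) (n m l c : nat).

Hypotheses (W0 : (0 < W)%N) (U0 : (0 < U)%N) (UV : (U <= V0)%N) (VX : (V0 <= X)%N) (DU : (D <= U)%N).
Hypotheses (g1 : forall n, `|g n| <= 1) (G10 : 0 <= G1).
Hypothesis g_step : forall c l, (0 < c)%N -> (0 < l)%N -> `|g (c * l.+1)%N - g (c * l)%N| <= G1 / l%:R.

(** For empty B this is the bare weight of the main term; for other B the local factors have mean
    zero and the residual is an error term. *)
Definition sieve_weight i B n : R :=
  if (V0 < n <= X)%N && (n == a %[mod W])%N then locprod i B n * g n / n%:R else 0.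
Definition residual i B : R := \sum_(1 <= n < X.+1) mangoldt n * sieve_weight i B n.
Definition logX : R := 1 + lnn X.

Definition sievable_set B := forall q, q \in B -> sievable W q.

Lemma logX_ge1 : 1 <= logX.
Proof. by rewrite lerDl lnn_ge0. Qed.

Lemma sieve_weight_gtX i B n : (X < n)%N -> sieve_weight i B n = 0.
Proof. by move=> h; rewrite /sieve_weight (leqNgt n) h andbF. Qed.

Lemma range_mul c l : (0 < c)%N -> (V0 < c * l <= X)%N = (V0 %/ c < l < (X %/ c).+1)%N.
Proof. by move=> c0; rewrite ltn_divLR // mulnC ltnS leq_divRL. Qed.

Lemma range_pair u v v' x x' m :
  ((maxn u (maxn v v')).+1 <= m < (minn x x').+1)%N =
  [&& (u < m)%N, (v < m < x.+1)%N & (v' < m < x'.+1)%N].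
Proof.
rewrite !ltnS !gtn_max leq_min.
by case: (u < m)%N; case: (v < m)%N; case: (v' < m)%N; rewrite /= ?andbF ?andbT.
Qed.

Lemma phi_step (lam gg : nat -> R) (La G : R) l : (0 < l)%N -> 0 <= La -> 0 <= G ->
  `|lam l.+1| <= La -> `|gg l| <= 1 -> `|lam l.+1 - lam l| <= La / l%:R ->
  `|gg l.+1 - gg l| <= G / l%:R -> `|gg l.+1| <= 1 ->
  `|lam l.+1 * gg l.+1 / l.+1%:R - lam l * gg l / l%:R| <= La * (2 + G) / l%:R ^+ 2.
Proof.
move=> l0 La0 G0 h1 h2 h3 h4 h5; have l0' : 0 < l%:R :> R by rewrite ltr0n.
have l1' : 0 < l.+1%:R :> R by rewrite ltr0n.
have -> : lam l.+1 * gg l.+1 / l.+1%:R - lam l * gg l / l%:R =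
   ((lam l.+1 - lam l) * gg l) / l%:R + (lam l.+1 * (gg l.+1 - gg l)) / l%:R
    - (lam l.+1 * gg l.+1) * (l%:R^-1 - l.+1%:R^-1) by ring.
have inv : 0 <= (l%:R^-1 : R) - l.+1%:R^-1 <= l%:R ^- 2.
  have -> : l%:R^-1 - l.+1%:R^-1 = (l%:R * l.+1%:R)^-1 :> R.
    rewrite -natr1 in l1' *; field; by rewrite !lt0r_neq0.
  by rewrite invr_ge0 mulr_ge0 //= lef_pV2 ?posrE ?mulr_gt0 // expr2 ler_wpM2l // ler_nat.
have i0 : 0 <= l%:R^-1 :> R by rewrite invr_ge0.
rewrite (_ : La * (2 + G) / l%:R ^+ 2 = La / l%:R / l%:R + La * (G / l%:R) / l%:R + La * l%:R ^- 2); last first.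
  by field; rewrite lt0r_neq0.
apply: le_trans (ler_normB _ _) _; apply: lerD.
  apply: le_trans (ler_normD _ _) _; apply: lerD; rewrite normrM [`|l%:R^-1|]ger0_norm // ler_wpM2r //.
    rewrite normrM -[La / _]mulr1; exact: ler_pM.
  by rewrite normrM; exact: ler_pM.
move: inv => /andP[i1 i2]; rewrite normrM [`|_ - _|]ger0_norm //; apply: ler_pM => //.
by rewrite normrM -[La]mulr1; exact: ler_pM.
Qed.

Lemma sum_locprod_class i B c : admissible W i -> sievable_set B -> B != set0 ->
  \sum_(0 <= l < W * modulus B) (if (c * l == a %[mod W])%N then 1 else 0) * locprod i B (c * l) = 0.
Proof.
move=> ad sB /set0Pn[q qB].
have := @crt_sum_set R Z W B (fun l => if (c * l == a %[mod W])%N then 1 else 0)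
   (fun q l => locfun i q (c * l)) W0 sB.
rewrite /locprod /periodic => ->.
- rewrite [X in _ * X](big_setD1 q) //= sum_locfun ?mul0r ?mulr0 //.
    by have /andP[] := sB q qB.
  exact: ad (sB q qB).
- by move=> l; rewrite mulnDr -modnDmr modnMl addn0.
- by move=> r l; apply: (periodic_scale c (locfun_periodic R i r)).
Qed.

Lemma class_locprod_periodic i B c : sievable_set B ->
  periodic (W * modulus B) (fun l => (if (c * l == a %[mod W])%N then 1 else 0) * locprod i B (c * l)).
Proof.
move=> sB l; congr (_ * _).
  by rewrite mulnDr mulnCA -modnDmr modnMr addn0.
by rewrite mulnDr (mulnA c W) periodicM //; exact: locprod_periodic.
Qed.

Lemma class_locprod_le1 i B c l : admissible W i -> sievable_set B ->
  `|(if (c * l == a %[mod W])%N then 1 else 0) * locprod i B (c * l)| <= 1.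
Proof.
move=> ad sB; have h := @locprod_le1 R Z W i B (c * l) ad sB.
by case: ifP => _; rewrite ?mul1r // mul0r normr0.
Qed.

Lemma modulus_pos B : sievable_set B -> (0 < modulus B)%N.
Proof. by move=> sB; apply: modulus_gt0 => q /sB /andP[]. Qed.

(** Along l -> c l the local product has mean zero as soon as B is nonempty, whatever the common
    factors of c with the modulus; Abel summation over the period W * modulus B does the rest. The
    factor c in the size of the range cancels the 1/c of the weight. *)
Lemma typeI_inner i B c (lam : nat -> R) : admissible W i -> sievable_set B -> B != set0 -> (0 < c)%N ->
  (forall l, `|lam l| <= logX) -> (forall l, (0 < l)%N -> `|lam l.+1 - lam l| <= logX / l%:R) ->
  `|\sum_(1 <= l < X.+1) lam l * sieve_weight i B (c * l)| <=
    3 * (W * modulus B)%:R * (logX * (2 + G1)) / V0%:R.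
Proof.
move=> ad sB B0 c0 lam1 lam2; have L1 := logX_ge1; have m0 := modulus_pos sB.
have L0 : 0 <= logX by exact: le_trans L1.
have V00 : (0 < V0)%N by exact: leq_trans UV.
have V00' : 0 < V0%:R :> R by rewrite ltr0n.
have c0' : 0 < c%:R :> R by rewrite ltr0n.
pose H l : R := (if (c * l == a %[mod W])%N then 1 else 0) * locprod i B (c * l).
pose phi l : R := lam l * g (c * l) / l%:R.
pose A := (V0 %/ c).+1; pose b := (X %/ c).+1.
have Ab : (0 < A <= b)%N by rewrite /A /b /= ltnS leq_div2r.
have bX : (b <= X.+1)%N by rewrite ltnS leq_div.
have -> : \sum_(1 <= l < X.+1) lam l * sieve_weight i B (c * l) = c%:R^-1 * \sum_(A <= l < b) H l * phi l.
  rewrite -(@sum_interval_restrict R X A b) // mulr_sumr; apply: eq_big_nat => l /andP[l0 _].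
  rewrite /sieve_weight range_mul //; case: ifP => h1; last first.
    by rewrite mulr0; case: ifP => h2; rewrite ?mulr0 //; move: h1; rewrite h2 /= /H => ->; rewrite !mul0r mulr0.
  move/andP: h1 => [h1 h2]; rewrite h1 /H h2 /phi natrM invfM; ring.
have bnd : `|\sum_(A <= l < b) H l * phi l| <= 3 * (W * modulus B)%:R * (logX * (2 + G1)) / A%:R.
  apply: periodic_inv_sumR => //.
  - by rewrite muln_gt0 W0.
  - exact: class_locprod_periodic.
  - exact: sum_locprod_class.
  - by move=> n; exact: class_locprod_le1.
  - move=> n An; rewrite /phi !normrM normfV [`|n%:R|]ger0_norm // ler_wpM2r ?invr_ge0 //.
    have : `|lam n| * `|g (c * n)| <= logX * 1 by exact: ler_pM.
    move=> h; apply: le_trans h _; rewrite ler_wpM2l //; have := G10; lra.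
  - move=> n An; have n0 : (0 < n)%N by exact: leq_ltn_trans An.
    by apply: (@phi_step lam (fun l => g (c * l)%N)) => //; [exact: lam2 | exact: g_step].
rewrite normrM normfV (ger0_norm (ltW c0')).
apply: le_trans (ler_wpM2l _ bnd) _; first by rewrite invr_ge0 ltW.
have N0 : 0 <= 3 * (W * modulus B)%:R * (logX * (2 + G1)).
  by rewrite !mulr_ge0 // addr_ge0.
rewrite mulrCA ler_wpM2l // -invfM lef_pV2 ?posrE ?mulr_gt0 ?ltr0n //.
by rewrite -natrM ler_nat mulnC ltnW // ltn_ceil.
Qed.

Lemma typeI_bound i B : admissible W i -> sievable_set B -> B != set0 -> (modulus B <= D)%N ->
  `|\sum_(1 <= d < X.+1) cut U (mobius R) d * \sum_(1 <= j < X.+1) lnn j * sieve_weight i B (d * j) -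
    \sum_(1 <= d < X.+1) cut U (mobius R) d * \sum_(1 <= n < X.+1) cut U mangoldt n *
     \sum_(1 <= l < X.+1) sieve_weight i B (d * n * l)| <=
  6 * (W * D)%:R * U%:R ^+ 2 * logX ^+ 2 * (2 + G1) / V0%:R.
Proof.
move=> ad sB B0 BD; have L1 := logX_ge1; have L0 : 0 <= logX by exact: le_trans L1.
have V00 : (0 < V0)%N by exact: leq_trans UV.
have V00' : 0 < V0%:R :> R by rewrite ltr0n.
pose K : R := 3 * (W * D)%:R * (logX * (2 + G1)) / V0%:R.
have G2 : 0 <= 2 + G1 by rewrite addr_ge0.
have K0 : 0 <= K by rewrite /K divr_ge0 ?(ltW V00') // !mulr_ge0.
have WK : 3 * (W * modulus B)%:R * (logX * (2 + G1)) / V0%:R <= K.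
  rewrite /K ler_wpM2r ?invr_ge0 ?(ltW V00') // ler_wpM2r ?mulr_ge0 // ler_wpM2l // ler_nat leq_mul2l BD orbT //.
have UX : (U.+1 <= X.+1)%N by rewrite ltnS (leq_trans UV).
have cutsum (f F : nat -> R) : \sum_(1 <= d < X.+1) cut U f d * F d = \sum_(1 <= d < U.+1) f d * F d.
  rewrite -(@sum_interval_restrict R X 1 U.+1) //; apply: eq_big_nat => d /andP[d1 _].
  by rewrite /cut d1 ltnS; case: ifP; rewrite // mul0r.
rewrite !cutsum.
have S1 : `|\sum_(1 <= d < U.+1) mobius R d * \sum_(1 <= j < X.+1) lnn j * sieve_weight i B (d * j)| <= U%:R * K.
  apply: le_trans (ler_norm_sum _ _ _) _; apply: (@le_trans _ _ (\sum_(1 <= d < U.+1) K)); last first.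
    by rewrite sumr_const_nat subn1 mulr_natl.
  apply: ler_sum_nat => d /andP[d0 _]; rewrite normrM -[K]mul1r; apply: ler_pM => //; first exact: mobius_norm.
  apply: le_trans WK.
  (* Capping the logarithm at X makes it bounded for every l, as [typeI_inner] requires, without
     changing the sum. *)
  have -> : \sum_(1 <= j < X.+1) lnn j * sieve_weight i B (d * j) =
     \sum_(1 <= j < X.+1) lnn (minn j X) * sieve_weight i B (d * j).
    by apply: eq_big_nat => j /andP[_ jX]; rewrite (minn_idPl _).
  have lX l : `|lnn (minn l X)| <= logX.
    rewrite ger0_norm ?lnn_ge0 // /logX; case: (minn l X) (geq_minr l X) => [_|y yX].
      by rewrite /lnn ln0 // addr_ge0 // lnn_ge0.
    apply: le_trans (lnn_le _ _ yX) _ => //; by rewrite lerDr.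
  apply: typeI_inner => // l l0.
  have l0' : 0 < l%:R :> R by rewrite ltr0n.
  apply: (@le_trans _ _ l%:R^-1); last by rewrite -[X in X <= _]mul1r ler_wpM2r // invr_ge0.
  case: (leqP X l) => Xl.
    by rewrite ?(minn_idPr Xl) (minn_idPr (leq_trans Xl (leqnSn l))) subrr normr0 invr_ge0.
  rewrite ?(minn_idPl (ltnW Xl)) ?(minn_idPl Xl) ger0_norm ?subr_ge0 ?lnn_le //; exact: lnnS_le.
have S2 : `|\sum_(1 <= d < U.+1) mobius R d * \sum_(1 <= n < X.+1) cut U mangoldt n *
     \sum_(1 <= l < X.+1) sieve_weight i B (d * n * l)| <= U%:R * (U%:R * (logX * K)).
  apply: le_trans (ler_norm_sum _ _ _) _; apply: (@le_trans _ _ (\sum_(1 <= d < U.+1) U%:R * (logX * K))); last first.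
    by rewrite sumr_const_nat subn1 -[X in X <= _]mulr_natl.
  apply: ler_sum_nat => d /andP[d0 _]; rewrite normrM -[X in _ <= X]mul1r; apply: ler_pM => //; first exact: mobius_norm.
  rewrite cutsum; apply: le_trans (ler_norm_sum _ _ _) _.
  apply: (@le_trans _ _ (\sum_(1 <= n < U.+1) logX * K)); last by rewrite sumr_const_nat subn1 mulr_natl.
  apply: ler_sum_nat => n /andP[n0 nU]; rewrite normrM; apply: ler_pM => //.
    rewrite ger0_norm ?mangoldt_ge0 //; apply: le_trans (mangoldt_le _ _) _.
    apply: (@le_trans _ _ (lnn X)); last by rewrite lerDr.
    by apply: lnn_le => //; apply: (@leq_trans U) => //; exact: leq_trans UV VX.
  apply: le_trans WK; have dn0 : (0 < d * n)%N by rewrite muln_gt0 d0.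
  have := @typeI_inner i B (d * n) (fun=> 1) ad sB B0 dn0.
  under eq_bigr do rewrite mul1r.
  apply=> [l|l l0]; first by rewrite normr1.
  by rewrite subrr normr0 divr_ge0.
apply: le_trans (ler_normB _ _) _; apply: le_trans (lerD S1 S2) _.
have U1 : 1 <= U%:R :> R by rewrite ler1n.
have -> : 6 * (W * D)%:R * U%:R ^+ 2 * logX ^+ 2 * (2 + G1) / V0%:R = 2 * (U%:R * (U%:R * (logX * K))).
  by rewrite /K; ring.
have : U%:R * K <= U%:R * (U%:R * (logX * K)); last by lra.
rewrite ler_wpM2l // mulrA ler_peMl //; have : 1 * 1 <= U%:R * logX by exact: ler_pM.
by rewrite mul1r.
Qed.

Lemma eqn_mod_modulus F n n' : (forall q, q \in F -> prime q) ->
  (forall q, q \in F -> (n == n' %[mod q])%N) -> (n == n' %[mod modulus F])%N.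
Proof.
have [c] := ubnP #|F|; elim: c F => // c IH F cF pF h.
have [->|[q qF]] := set_0Vmem F; first by rewrite /modulus big_set0 !modn1.
have pF' r : r \in F :\ q -> prime r by rewrite inE => /andP[_ /pF].
rewrite (modulusD1 qF) mulnC chinese_remainder; last first.
  by apply: coprime_modulus => //; [exact: pF | rewrite !inE eqxx].
rewrite (h q qF) andbT; apply: IH => //; first by move: cF; rewrite (cardsD1 q F) qF.
by move=> r; rewrite inE => /andP[_ /h].
Qed.

(** Up to the factor W, a bound for the sum over a full period of the product of the local factors
    at n m and n' m. *)
Definition pair_density B n n' : R :=
  \prod_(q in B) ((if (n == n' %[mod q])%N then 1 else 0) + (q%:R - 1)^-1).

Lemma pair_density_ge0 B n n' : sievable_set B -> 0 <= pair_density B n n'.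
Proof.
move=> sB; apply: prodr_ge0 => q qB; have /andP[pq _] := sB q qB.
have := @prime_sub1_ge1 R Z q pq => h.
by rewrite addr_ge0 // ?invr_ge0 ?(le_trans ler01 h) //; case: ifP.
Qed.

Lemma modulus_subset F B : F \subset B -> sievable_set B -> (modulus F <= modulus B)%N.
Proof.
move=> FB sB; apply: dvdn_leq; first exact: modulus_pos.
by rewrite /modulus [X in (_ %| X)%N](big_setID F) /= (setIidPr FB) dvdn_mulr.
Qed.

(** Expand the product over q in B; F is the set of primes at which the congruence n = n' is
    imposed, and [sum_inv_ap] then saves a factor modulus F, because modulus F <= D <= U. *)
Lemma sum_pair_density B : sievable_set B -> (modulus B <= D)%N ->
  \sum_(1 <= n < X.+1) \sum_(1 <= n' < X.+1)
    (if (U < n)%N && (U < n')%N then pair_density B n n' / (n%:R * n'%:R) else 0) <=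
  logX ^+ 2 * \prod_(q in B) (q%:R^-1 + (q%:R - 1)^-1).
Proof.
move=> sB BD; have L0 : 0 <= logX by apply: le_trans logX_ge1.
have pB q : q \in B -> prime q by move=> /sB /andP[].
rewrite (@prod_add_set R _ B (fun q => q%:R^-1) (fun q => (q%:R - 1)^-1)) mulr_sumr.
apply: (@le_trans _ _ (\sum_(1 <= n < X.+1) \sum_(1 <= n' < X.+1) \sum_(F in powerset B)
   (if (U < n')%N && (n' == n %[mod modulus F])%N then n'%:R^-1 else 0) * n%:R^-1 * \prod_(q in B :\: F) (q%:R - 1)^-1)).
  apply: ler_sum_nat => n /andP[n1 _]; apply: ler_sum_nat => n' /andP[n1' _].
  have nn F : F \in powerset B -> 0 <= (if (U < n')%N && (n' == n %[mod modulus F])%N then n'%:R^-1 else 0) * n%:R^-1 *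
     \prod_(q in B :\: F) (q%:R - 1)^-1 :> R.
    move=> _; rewrite !mulr_ge0 ?invr_ge0 //; first by case: ifP; rewrite ?invr_ge0.
    apply: prodr_ge0 => q; rewrite inE => /andP[_ /pB pq]; rewrite invr_ge0.
    exact: le_trans (@prime_sub1_ge1 R Z q pq).
  case: ifP => [/andP[Un Un']|_]; last exact: sumr_ge0.
  rewrite /pair_density prod_add_set mulr_suml; apply: ler_sum => F FB.
  rewrite Un' /=; case: (boolP [forall (q | q \in F), n == n' %[mod q]]) => [/forall_inP h|/forall_inPn[q qF nq]].
    have pF q : q \in F -> prime q by move=> qF; apply: pB; move: FB; rewrite powersetE => /subsetP; apply.
    rewrite eq_sym eqn_mod_modulus // big1 => [|q /h -> //]; rewrite invfM mul1r; ring_le.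
  rewrite (big_setD1 q) //= (negbTE nq) !mul0r; have := nn F FB; by rewrite Un'.
under eq_bigr do rewrite exchange_big /=.
rewrite exchange_big /=; apply: ler_sum => F FB.
have FB' : F \subset B by rewrite -powersetE.
have sF : sievable_set F by move=> q qF; apply: sB; exact: (subsetP FB').
have w0 : 0 <= \prod_(q in B :\: F) (q%:R - 1)^-1 :> R.
  apply: prodr_ge0 => q; rewrite inE => /andP[_ /pB pq]; rewrite invr_ge0.
  exact: le_trans (@prime_sub1_ge1 R Z q pq).
have eF : \prod_(q in F) q%:R^-1 = (modulus F)%:R^-1 :> R.
  by rewrite /modulus natr_prod prodfV.
rewrite eF mulrA; under eq_bigr do rewrite -!mulr_suml.
rewrite -mulr_suml ler_wpM2r //.
have e0 : (0 < modulus F <= U)%N.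
  by rewrite modulus_pos //= (leq_trans (modulus_subset FB' sB)) // (leq_trans BD).
apply: (@le_trans _ _ (\sum_(1 <= n < X.+1) logX / (modulus F)%:R * n%:R^-1)).
  apply: ler_sum => n _; rewrite ler_wpM2r ?invr_ge0 //; exact: sum_inv_ap.
rewrite -mulr_sumr.
set h := \sum_(_ <= _ < _) _; have h1 : h <= logX by exact: harmonic_le.
have m0 : 0 <= (modulus F)%:R^-1 :> R by rewrite invr_ge0.
rewrite [X in _ <= X](_ : _ = logX * (logX * (modulus F)%:R^-1)); last by rewrite expr2; ring.
rewrite [X in X <= _](_ : _ = h * (logX * (modulus F)%:R^-1)); last by ring.
by apply: ler_wpM2r => //; exact: mulr_ge0.
Qed.

Definition pairfun i i' B B' n n' (q : T) m : R :=
  (if q \in B then locfun i q (n * m) else 1) * (if q \in B' then locfun i' q (n' * m) else 1).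

Definition class_pair n n' m : R :=
  (if (n * m == a %[mod W])%N then 1 else 0) * (if (n' * m == a %[mod W])%N then 1 else 0).

Lemma prod_pairfun i i' B B' n n' m :
  \prod_(q in B :|: B') pairfun i i' B B' n n' q m = locprod i B (n * m) * locprod i' B' (n' * m).
Proof.
rewrite /pairfun big_split /= -!big_mkcondr /locprod /=; congr (_ * _); apply: eq_bigl => q; rewrite inE.
  by case: (q \in B); rewrite ?andbF ?andbT.
by case: (q \in B'); rewrite ?andbF ?andbT ?orbT.
Qed.

Lemma pairfun_periodic i i' B B' n n' (q : T) : periodic q (pairfun i i' B B' n n' q).
Proof.
move=> m; rewrite /pairfun; congr (_ * _); case: ifP => // _.
  exact: (periodic_scale n (locfun_periodic R i q)).
exact: (periodic_scale n' (locfun_periodic R i' q)).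
Qed.

Lemma class_pair_periodic n n' : periodic W (class_pair n n').
Proof. by move=> m; rewrite /class_pair !mulnDr -!(modnDmr _ (_ * W)%N) !modnMl !addn0. Qed.

Lemma class_pair_le1 n n' m : 0 <= class_pair n n' m <= 1.
Proof. by rewrite /class_pair; do 2! case: ifP => _; rewrite ?mulr0 ?mul0r ?mulr1 ?ler01 ?lexx. Qed.

Lemma sievable_setU B B' : sievable_set B -> sievable_set B' -> sievable_set (B :|: B').
Proof. by move=> h h' q; rewrite inE => /orP[/h|/h']. Qed.

Lemma pair_period_sum i i' B B' n n' : sievable_set B -> sievable_set B' ->
  \sum_(0 <= m < W * modulus (B :|: B')) class_pair n n' m * \prod_(q in B :|: B') pairfun i i' B B' n n' q m =
  (\sum_(0 <= m < W) class_pair n n' m) * \prod_(q in B :|: B') \sum_(0 <= m < q) pairfun i i' B B' n n' q m.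
Proof.
move=> sB sB'; apply: crt_sum_set => //; first exact: sievable_setU.
  exact: class_pair_periodic.
exact: pairfun_periodic.
Qed.

(** A prime in exactly one of the two sets carries a single local factor, whose sum over the period
    is zero. Only the diagonal survives in the dispersion. *)
Lemma pair_sum_neq i i' B B' n n' : admissible W i -> admissible W i' -> sievable_set B -> sievable_set B' ->
  B != B' ->
  \sum_(0 <= m < W * modulus (B :|: B')) class_pair n n' m * \prod_(q in B :|: B') pairfun i i' B B' n n' q m = 0.
Proof.
move=> ad ad' sB sB' BB; rewrite pair_period_sum //.
have [q] : exists q, (q \in B) != (q \in B').
  apply/existsP; move: BB; apply: contraNT; rewrite negb_exists => /forallP h.
  by apply/eqP/setP => q; have := h q; rewrite negbK => /eqP.
case: (boolP (q \in B)) => qB; case: (boolP (q \in B')) => qB' // _.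
  have z : \sum_(0 <= m < q) pairfun i i' B B' n n' q m = 0.
    rewrite /pairfun qB (negbTE qB'); under eq_bigr do rewrite mulr1.
    by rewrite sum_locfun //; [case/andP: (sB q qB) | exact: ad (sB q qB)].
  by rewrite [X in _ * X](big_setD1 q) /= ?z ?mul0r ?mulr0 // inE qB.
have z : \sum_(0 <= m < q) pairfun i i' B B' n n' q m = 0.
  rewrite /pairfun qB' (negbTE qB); under eq_bigr do rewrite mul1r.
  by rewrite sum_locfun //; [case/andP: (sB' q qB') | exact: ad' (sB' q qB')].
by rewrite [X in _ * X](big_setD1 q) /= ?z ?mul0r ?mulr0 // inE qB' orbT.
Qed.

Lemma pair_sum_eq i B n n' : admissible W i -> sievable_set B ->
  `|\sum_(0 <= m < W * modulus (B :|: B)) class_pair n n' m * \prod_(q in B :|: B) pairfun i i B B n n' q m| <=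
  W%:R * pair_density B n n'.
Proof.
move=> ad sB; rewrite pair_period_sum // normrM setUid; apply: ler_pM => //.
  apply: le_trans (ler_norm_sum _ _ _) _; apply: (@le_trans _ _ (\sum_(0 <= m < W) 1)).
    by apply: ler_sum => m _; have /andP[h0 h1] := class_pair_le1 n n' m; rewrite ger0_norm.
  by rewrite sumr_const_nat subn0.
rewrite normr_prod; apply: ler_prod => q qB; rewrite normr_ge0 /=.
have /andP[pq _] := sB q qB; rewrite /pairfun qB; apply: locfun_correlation => //; exact: ad (sB q qB).
Qed.

Let Phi : R := (1 + G1) * (2 + G1).

Lemma Phi_ge1 : 1 <= Phi.
Proof. by rewrite /Phi; have := G10; nra. Qed.

Let E0 : R := 6 * (W * D ^ 2)%:R * Phi / U%:R.

Lemma E0_ge0 : 0 <= E0.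
Proof. by apply: divr_ge0 => //; apply: mulr_ge0; [apply: mulr_ge0 | apply: le_trans Phi_ge1]. Qed.

(** The sum over m is its mean over a period times a sum of 1/m, plus an error of size period / U.
    The mean is zero off the diagonal and at most [pair_density] / modulus on it, apart from the
    common factor 1/(n n'). *)
Lemma pair_inner i i' B B' n n' : admissible W i -> admissible W i' -> sievable_set B -> sievable_set B' ->
  (modulus B <= D)%N -> (modulus B' <= D)%N -> (0 < n)%N -> (0 < n')%N -> (B = B' -> i = i') ->
  `|\sum_(1 <= m < X.+1) (if (U < m)%N then m%:R * sieve_weight i B (n * m) * sieve_weight i' B' (n' * m) else 0)| <=
  (n%:R * n'%:R)^-1 * ((if B == B' then pair_density B n n' / (modulus B)%:R * logX else 0) +
     6 * (W * D ^ 2)%:R * Phi / U%:R).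
Proof.
move=> ad ad' sB sB' BD BD' n0 n0' ii.
have n0R : 0 < n%:R :> R by rewrite ltr0n.
have n0R' : 0 < n'%:R :> R by rewrite ltr0n.
have U0R : 0 < U%:R :> R by rewrite ltr0n.
have P1 := Phi_ge1.
pose H m := class_pair n n' m * \prod_(q in B :|: B') pairfun i i' B B' n n' q m.
pose phi m : R := g (n * m) * g (n' * m) / m%:R.
pose A := (maxn U (maxn (V0 %/ n) (V0 %/ n'))).+1; pose b := (minn (X %/ n) (X %/ n')).+1.
have UA : (U < A)%N by rewrite ltnS leq_maxl.
have bX : (b <= X.+1)%N by rewrite ltnS (leq_trans (geq_minl _ _)) // leq_div.
have eU : sievable_set (B :|: B') by exact: sievable_setU.
have -> : \sum_(1 <= m < X.+1) (if (U < m)%N then m%:R * sieve_weight i B (n * m) * sieve_weight i' B' (n' * m) else 0)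
  = (n%:R * n'%:R)^-1 * \sum_(A <= m < b) H m * phi m.
  rewrite -(@sum_interval_restrict R X A b) // mulr_sumr; apply: eq_big_nat => m /andP[m0 _].
  have -> : (A <= m < b)%N = [&& (U < m)%N, (V0 < n * m <= X)%N & (V0 < n' * m <= X)%N].
    by rewrite !range_mul //; exact: range_pair.
  case: ifP => Um; last by rewrite mulr0.
  rewrite /sieve_weight; case: ifP => [/andP[-> h1]|h1]; last first.
    rewrite mulr0 mul0r /=; case: ifP => [/andP[h2 h3]|_]; rewrite ?mulr0 //.
    by rewrite /H /class_pair; move: h1; rewrite h2 /= => ->; rewrite !mul0r mulr0.
  case: ifP => [/andP[-> h2]|h2]; last first.
    rewrite !mulr0 /=; case: ifP => h3; rewrite ?mulr0 //.
    by rewrite /H /class_pair; move: h2; rewrite h3 /= => ->; rewrite !(mulr0, mul0r).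
  have m0R : m%:R != 0 :> R by rewrite pnatr_eq0 -lt0n.
  rewrite /= /H /class_pair h1 h2 prod_pairfun /phi !natrM !mul1r; field.
  by rewrite m0R !lt0r_neq0.
have nn0 : 0 <= (n%:R * n'%:R)^-1 :> R by rewrite invr_ge0 mulr_ge0.
rewrite normrM (ger0_norm nn0) ler_wpM2l //.
case: (boolP (A <= b)%N) => Ab; last first.
  rewrite big_geq ?normr0; last by apply: ltnW; rewrite ltnNge.
  apply: addr_ge0; last exact: E0_ge0.
  case: ifP => // _; apply: mulr_ge0; last by apply: le_trans logX_ge1.
  by apply: divr_ge0 => //; exact: pair_density_ge0.
have pQ : (0 < W * modulus (B :|: B'))%N by rewrite muln_gt0 W0 modulus_pos.
have pH : periodic (W * modulus (B :|: B')) H.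
  move=> m; rewrite /H; congr (_ * _); first by rewrite mulnC periodicM //; exact: class_pair_periodic.
  by apply: eq_bigr => q qB; rewrite (modulusD1 qB) mulnCA mulnC periodicM //; exact: pairfun_periodic.
have H1 m : `|H m| <= 1.
  rewrite /H prod_pairfun normrM; have /andP[c0 c1] := class_pair_le1 n n' m.
  have h1 := @locprod_le1 R Z W i B (n * m) ad sB; have h2 := @locprod_le1 R Z W i' B' (n' * m) ad' sB'.
  by rewrite (ger0_norm c0) normrM; apply: mulr_ile1 => //; [exact: mulr_ge0 | exact: mulr_ile1].
have phi1 m : (A <= m)%N -> `|phi m| <= Phi / m%:R.
  move=> _; rewrite /phi !normrM normfV [`|m%:R|]ger0_norm // ler_wpM2r ?invr_ge0 //.
  by apply: le_trans P1; rewrite mulr_ile1.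
have phi2 m : (A <= m)%N -> `|phi m.+1 - phi m| <= Phi / m%:R ^+ 2.
  move=> Am; have m0 : (0 < m)%N by apply: leq_ltn_trans Am.
  have G0 : 0 <= 1 + G1 by rewrite addr_ge0.
  have G1' : 1 <= 1 + G1 by rewrite lerDl.
  apply: (@phi_step (fun l => g (n * l)%N) (fun l => g (n' * l)%N)) => //.
  - by apply: le_trans G1'.
  - apply: le_trans (g_step n0 m0) _; by rewrite ler_wpM2r ?invr_ge0 // lerDr.
  - exact: g_step.
have ab : (0 < A <= b)%N by rewrite Ab.
have hm := periodic_inv_sum_mean pQ pH H1 ab phi1 phi2; apply: (le_trans hm) => {hm}.
have Q0R : 0 < (W * modulus (B :|: B'))%:R :> R by rewrite ltr0n.
have QD : (W * modulus (B :|: B') <= W * D ^ 2)%N.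
  rewrite leq_mul2l; apply/orP; right; rewrite expnS expn1; apply: leq_trans (leq_mul BD BD').
  have -> : B :|: B' = B :|: (B' :\: B) by apply/setP => q; rewrite !inE; case: (q \in B).
  rewrite /modulus (bigID (mem B)) /= (eq_bigl (mem B)) => [|q]; last first.
    by rewrite !inE; case: (q \in B); rewrite ?andbF ?andbT.
  rewrite leq_mul2l; apply/orP; right.
  apply: (@leq_trans (modulus (B' :\: B))).
    by rewrite /modulus leq_eqVlt; apply/orP; left; apply/eqP/eq_bigl => q; rewrite !inE; case: (q \in B); rewrite ?andbF ?andbT.
  by apply: modulus_subset => //; exact: subsetDl.
apply: lerD; last first.
  have P0 : 0 <= Phi by apply: le_trans P1.
  apply: ler_pM; rewrite ?invr_ge0 //.
  - by apply: mulr_ge0 => //; apply: mulr_ge0.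
  - by apply: ler_wpM2r => //; apply: ler_wpM2l => //; rewrite ler_nat.
  - by rewrite lef_pV2 ?posrE ?ltr0n // ler_nat ltnW.
have S0 : 0 <= \sum_(A <= m < b) `|phi m| <= logX.
  rewrite sumr_ge0 //=; apply: le_trans (harmonic_le R X).
  rewrite -(@sum_interval_restrict R X A b) //; apply: ler_sum_nat => m /andP[m0 _].
  case: ifP => _; last by rewrite invr_ge0.
  rewrite /phi !normrM normfV [`|m%:R|]ger0_norm // -[X in _ <= X]mul1r ler_wpM2r ?invr_ge0 //.
  by rewrite mulr_ile1.
move: S0 => /andP[S0 S1]; case: eqP => BB; last first.
  by rewrite /H pair_sum_neq ?normr0 ?mul0r //; apply/eqP.
have -> : pair_density B n n' / (modulus B)%:R = W%:R * pair_density B n n' / (W * modulus (B :|: B'))%:R.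
  rewrite -BB setUid natrM; field; rewrite !pnatr_eq0 -!lt0n W0 modulus_pos //.
apply: ler_pM => //; first by rewrite divr_ge0 // ltW.
rewrite ler_wpM2r ?invr_ge0 ?(ltW Q0R) //; rewrite /H -(ii BB) -BB; exact: pair_sum_eq.
Qed.

Notation alpha := (fun n => mangoldt n - cut U mangoldt n).

Lemma alpha_le n : (n < X.+1)%N -> `|alpha n| <= if (U < n)%N then logX else 0.
Proof.
move=> nX; rewrite /cut /= ltnNge; case: (boolP (n <= U)%N) => nU /=; first by rewrite subrr normr0.
rewrite subr0 ger0_norm ?mangoldt_ge0 //; apply: le_trans (mangoldt_le _ _) _.
apply: (@le_trans _ _ (lnn X)); last by rewrite lerDr.
by apply: lnn_le => //; apply: leq_ltn_trans (leq0n U) _; rewrite ltnNge.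
Qed.

Lemma pair_outer i i' B B' : admissible W i -> admissible W i' -> sievable_set B -> sievable_set B' ->
  (modulus B <= D)%N -> (modulus B' <= D)%N -> (B = B' -> i = i') ->
  `|\sum_(1 <= n < X.+1) \sum_(1 <= n' < X.+1) alpha n * alpha n' *
    \sum_(1 <= m < X.+1) (if (U < m)%N then m%:R * sieve_weight i B (n * m) * sieve_weight i' B' (n' * m) else 0)| <=
  (if B == B' then logX ^+ 5 * \prod_(q in B) (q%:R^-1 * (q%:R^-1 + (q%:R - 1)^-1)) else 0) + logX ^+ 4 * E0.
Proof.
move=> ad ad' sB sB' BD BD' ii; have L0 : 0 <= logX by apply: le_trans logX_ge1.
pose c B := (modulus B)%:R^-1 * logX ^+ 3.
pose u n n' : R := if (U < n)%N && (U < n')%N then pair_density B n n' / (n%:R * n'%:R) else 0.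
apply: (@le_trans _ _ (\sum_(1 <= n < X.+1) \sum_(1 <= n' < X.+1)
   ((if B == B' then c B * u n n' else 0) + logX ^+ 2 * E0 * (n%:R^-1 * n'%:R^-1)))).
  apply: le_trans (ler_norm_sum _ _ _) _; apply: ler_sum_nat => n /andP[n0 nX].
  apply: le_trans (ler_norm_sum _ _ _) _; apply: ler_sum_nat => n' /andP[n0' nX'].
  have u0 : 0 <= u n n' by rewrite /u; case: ifP => // _; rewrite divr_ge0 ?pair_density_ge0 // mulr_ge0.
  have z0 : 0 <= (if B == B' then c B * u n n' else 0) by case: ifP => // _; rewrite !mulr_ge0 ?invr_ge0 ?exprn_ge0.
  have z1 : 0 <= logX ^+ 2 * E0 * (n%:R^-1 * n'%:R^-1) by rewrite (mulr_ge0 (mulr_ge0 (exprn_ge0 2 L0) E0_ge0)) // -invfM invr_ge0 mulr_ge0.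
  have a1 := alpha_le nX; have a2 := alpha_le nX'.
  rewrite !normrM; case: (boolP ((U < n) && (U < n'))%N) => Un; last first.
    rewrite (_ : `|alpha n| * `|alpha n'| = 0) ?mul0r ?addr_ge0 //.
    move: Un; rewrite negb_and => /orP[h|h].
      by move: a1; rewrite (negbTE h) normr_le0 => /eqP ->; rewrite normr0 mul0r.
    by move: a2; rewrite (negbTE h) normr_le0 => /eqP ->; rewrite normr0 mulr0.
  move/andP: (Un) => [Un1 Un2]; rewrite Un1 in a1; rewrite Un2 in a2.
  apply: le_trans (ler_pM _ _ (ler_pM _ _ a1 a2) (pair_inner ad ad' sB sB' BD BD' n0 n0' ii)) _;
    rewrite ?mulr_ge0 // -/E0.
  have split_le (p q x y : R) : p * (q * (x + y)) = p * (q * x) + p * (q * y) by ring.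
  rewrite split_le lerD //; last by rewrite invfM; ring_le.
  rewrite /u Un /c; case: ifP => _; last by rewrite !mulr0.
  by rewrite !invfM; ring_le.
have e2 : \sum_(1 <= n < X.+1) \sum_(1 <= n' < X.+1) logX ^+ 2 * E0 * (n%:R^-1 * n'%:R^-1) <= logX ^+ 4 * E0.
  under eq_bigr do rewrite -mulr_sumr -mulr_sumr.
  rewrite -mulr_sumr -mulr_suml.
  have h0 : 0 <= \sum_(1 <= n < X.+1) n%:R^-1 :> R by apply: sumr_ge0 => n _; rewrite invr_ge0.
  have h1 : \sum_(1 <= n < X.+1) n%:R^-1 <= logX by exact: harmonic_le.
  rewrite (_ : logX ^+ 4 * E0 = logX ^+ 2 * E0 * (logX * logX)); last by ring.
  apply: ler_wpM2l; first by rewrite mulr_ge0 ?exprn_ge0 ?E0_ge0.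
  exact: ler_pM.
under [X in X <= _]eq_bigr do rewrite big_split /=.
rewrite big_split /= lerD //; case: ifP => BB; last first.
  by rewrite big1 // => n _; rewrite big1.
under [X in X <= _]eq_bigr do rewrite -mulr_sumr.
rewrite -mulr_sumr; apply: le_trans (ler_wpM2l _ (sum_pair_density sB BD)) _.
  by rewrite /c mulr_ge0 ?invr_ge0 ?exprn_ge0.
rewrite big_split /= prodfV /c /modulus natr_prod; ring_le.
Qed.

(** Cauchy-Schwarz with a free parameter: v Y <= (t/2) v^2/m + m Y^2/(2t) for each m. The first
    terms give the second moment of tau. In the second the square over B is opened; the restriction
    m > U is free since [vaughan_coef] vanishes up to U. *)
Lemma typeII (Bs : {set {set T}}) (iB : {set T} -> T -> nat) (s : {set T} -> R) (t : R) : 0 < t ->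
  (forall B, B \in Bs -> [/\ admissible W (iB B), sievable_set B & (modulus B <= D)%N]) ->
  \sum_(B in Bs) s B * (\sum_(1 <= n < X.+1) \sum_(1 <= m < X.+1)
     alpha n * vaughan_coef R U m * sieve_weight (iB B) B (n * m)) <=
  t / 2 * logX ^+ 4 + (2 * t)^-1 * ((\sum_(B in Bs) `|s B|) ^+ 2 * (logX ^+ 4 * E0) +
    logX ^+ 5 * \sum_(B in Bs) s B ^+ 2 * \prod_(q in B) (q%:R^-1 * (q%:R^-1 + (q%:R - 1)^-1))).
Proof.
move=> t0 hB; have L0 : 0 <= logX by apply: le_trans logX_ge1.
pose Y m := \sum_(B in Bs) \sum_(1 <= n < X.+1) s B * (alpha n * sieve_weight (iB B) B (n * m)).
have -> : \sum_(B in Bs) s B * (\sum_(1 <= n < X.+1) \sum_(1 <= m < X.+1)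
     alpha n * vaughan_coef R U m * sieve_weight (iB B) B (n * m)) = \sum_(1 <= m < X.+1) vaughan_coef R U m * Y m.
  rewrite /Y; under [RHS]eq_bigr do rewrite mulr_sumr.
  rewrite exchange_big /=; apply: eq_bigr => B _; rewrite exchange_big mulr_sumr /=.
  apply: eq_bigr => m _; rewrite !mulr_sumr; apply: eq_bigr => n _; ring.
have t2 : 0 < (2 * t)^-1 by rewrite invr_gt0 mulr_gt0.
apply: (@le_trans _ _ (\sum_(1 <= m < X.+1) (t / 2 * (tau R m ^+ 2 / m%:R) +
     (2 * t)^-1 * (if (U < m)%N then m%:R * Y m ^+ 2 else 0)))).
  apply: ler_sum_nat => m /andP[m0 _]; have m0R : 0 < m%:R :> R by rewrite ltr0n.
  have n1 : 0 <= t / 2 * (tau R m ^+ 2 / m%:R) by rewrite mulr_ge0 ?divr_ge0 ?exprn_ge0 ?tau_ge0 // ltW.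
  case: (leqP m U) => Um; first by rewrite vaughan_coef0 ?m0 // mul0r mulr0 addr0.
  have V1 := @vaughan_coef_le R U m U0 m0; set v := vaughan_coef R U m in V1 *.
  have v2 : v ^+ 2 <= tau R m ^+ 2.
    by rewrite -[v ^+ 2]real_normK ?num_real // lerXn2r ?nnegrE ?tau_ge0.
  apply: (@le_trans _ _ (t / 2 * (v ^+ 2 / m%:R) + (2 * t)^-1 * (m%:R * Y m ^+ 2))); last first.
    by rewrite lerD2r; apply: ler_wpM2l; rewrite ?ler_wpM2r ?invr_ge0 // divr_ge0 // ltW.
  rewrite -subr_ge0.
  have -> : t / 2 * (v ^+ 2 / m%:R) + (2 * t)^-1 * (m%:R * Y m ^+ 2) - v * Y m =
     (2 * t * m%:R)^-1 * (t * v - m%:R * Y m) ^+ 2 by field; rewrite !lt0r_neq0.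
  by rewrite mulr_ge0 ?sqr_ge0 // invr_ge0 !mulr_ge0 // ltW.
rewrite big_split /= -!mulr_sumr lerD //.
  by apply: ler_wpM2l; [rewrite divr_ge0 // ltW | exact: sum_tau_sqr].
apply: ler_wpM2l; first exact: ltW.
pose K B B' := \sum_(1 <= n < X.+1) \sum_(1 <= n' < X.+1) alpha n * alpha n' *
    \sum_(1 <= m < X.+1) (if (U < m)%N then m%:R * sieve_weight (iB B) B (n * m) * sieve_weight (iB B') B' (n' * m) else 0).
have -> : \sum_(1 <= m < X.+1) (if (U < m)%N then m%:R * Y m ^+ 2 else 0) =
   \sum_(B in Bs) \sum_(B' in Bs) s B * s B' * K B B'.
  transitivity (\sum_(1 <= m < X.+1) \sum_(B in Bs) \sum_(B' in Bs) \sum_(1 <= n < X.+1) \sum_(1 <= n' < X.+1)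
     s B * s B' * (alpha n * alpha n' *
     (if (U < m)%N then m%:R * sieve_weight (iB B) B (n * m) * sieve_weight (iB B') B' (n' * m) else 0))).
    apply: eq_bigr => m _; case: ifP => Um; last first.
      by rewrite big1 // => B _; rewrite big1 // => B' _; rewrite big1 // => n _; rewrite big1 // => n' _; rewrite !mulr0.
    rewrite expr2 /Y big_distrlr mulr_sumr; apply: eq_bigr => B _; rewrite mulr_sumr; apply: eq_bigr => B' _.
    rewrite big_distrlr mulr_sumr; apply: eq_bigr => n _; rewrite mulr_sumr; apply: eq_bigr => n' _ /=; ring.
  rewrite exchange_big /=; apply: eq_bigr => B _; rewrite exchange_big /=; apply: eq_bigr => B' _.
  rewrite exchange_big /= /K mulr_sumr; apply: eq_bigr => n _; rewrite exchange_big /= mulr_sumr.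
  by apply: eq_bigr => n' _; rewrite !mulr_sumr.
apply: (@le_trans _ _ (\sum_(B in Bs) \sum_(B' in Bs) `|s B| * `|s B'| *
   ((if B == B' then logX ^+ 5 * \prod_(q in B) (q%:R^-1 * (q%:R^-1 + (q%:R - 1)^-1)) else 0) + logX ^+ 4 * E0))).
  apply: ler_sum => B /hB[ad sB BD]; apply: ler_sum => B' /hB[ad' sB' BD'].
  apply: le_trans (ler_norm _) _; rewrite !normrM; apply: ler_wpM2l; first exact: mulr_ge0.
  by apply: pair_outer => // ->.
pose d B : R := logX ^+ 5 * \prod_(q in B) (q%:R^-1 * (q%:R^-1 + (q%:R - 1)^-1)).
rewrite [X in _ <= X]addrC [X in X <= _](_ : _ =
  \sum_(B in Bs) (\sum_(B' in Bs) `|s B| * `|s B'| * (if B == B' then d B else 0)) +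
  \sum_(B in Bs) \sum_(B' in Bs) `|s B| * `|s B'| * (logX ^+ 4 * E0)); last first.
  rewrite -big_split /=; apply: eq_bigr => B _; rewrite -big_split /=; apply: eq_bigr => B' _.
  by rewrite -mulrDr.
apply: lerD.
  rewrite mulr_sumr; apply: ler_sum => B BB; rewrite (bigD1 B) //= eqxx big1 ?addr0 => [|B' /andP[_ h]].
    by rewrite -normrM -expr2 normrX real_normK ?num_real // mulrCA.
  by rewrite eq_sym (negbTE h) mulr0.
rewrite expr2 big_distrlr mulr_suml; apply: ler_sum => B _.
by rewrite mulr_suml.
Qed.

Lemma dispersion (Bs : {set {set T}}) (iB : {set T} -> T -> nat) (s : {set T} -> R) (t : R) : 0 < t ->
  (forall B, B \in Bs -> [/\ admissible W (iB B), sievable_set B, B != set0 & (modulus B <= D)%N]) ->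
  (forall B, B \in Bs -> 0 <= s B) ->
  \sum_(B in Bs) s B * `|residual (iB B) B| <=
  t / 2 * logX ^+ 4 + (2 * t)^-1 * ((\sum_(B in Bs) s B) ^+ 2 * (logX ^+ 4 * E0) +
    logX ^+ 5 * \sum_(B in Bs) s B ^+ 2 * \prod_(q in B) (q%:R^-1 * (q%:R^-1 + (q%:R - 1)^-1))) +
  (\sum_(B in Bs) s B) * (6 * (W * D)%:R * U%:R ^+ 2 * logX ^+ 2 * (2 + G1) / V0%:R).
Proof.
move=> t0 hB s0; have X0 : (0 < X)%N by exact: leq_trans U0 (leq_trans UV VX).
(* The signs of the residuals are absorbed into the coefficients, so that the sum of absolute values
   becomes linear in the residuals. *)
pose sg B := s B * Num.sg (residual (iB B) B).
have sgs B : B \in Bs -> `|sg B| <= s B.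
  move=> BB; rewrite /sg normrM (ger0_norm (s0 B BB)) -[X in _ <= X]mulr1 ler_wpM2l ?s0 //.
  by rewrite normr_sg; case: eqP.
pose ty1 B := \sum_(1 <= d < X.+1) cut U (mobius R) d * \sum_(1 <= j < X.+1) lnn j * sieve_weight (iB B) B (d * j) -
    \sum_(1 <= d < X.+1) cut U (mobius R) d * \sum_(1 <= n < X.+1) cut U mangoldt n *
     \sum_(1 <= l < X.+1) sieve_weight (iB B) B (d * n * l).
pose ty2 B := \sum_(1 <= n < X.+1) \sum_(1 <= m < X.+1)
     alpha n * vaughan_coef R U m * sieve_weight (iB B) B (n * m).
have res B : residual (iB B) B = ty2 B + ty1 B.
  rewrite /ty2 /ty1 addrA -(@vaughan_identity R X U U (sieve_weight (iB B) B)) //; last exact: sieve_weight_gtX.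
  apply: eq_bigr => n _; rewrite /cut; case: leqP => nU; last by rewrite subr0.
  by rewrite /sieve_weight ltnNge (leq_trans nU UV) /= !mulr0.
have -> : \sum_(B in Bs) s B * `|residual (iB B) B| = \sum_(B in Bs) sg B * ty2 B + \sum_(B in Bs) sg B * ty1 B.
  rewrite -big_split /=; apply: eq_bigr => B _.
  by rewrite -mulrDr -res /sg -mulrA; congr (_ * _); rewrite normrEsg.
apply: lerD.
  have h2 B : B \in Bs -> [/\ admissible W (iB B), sievable_set B & (modulus B <= D)%N] by case/hB.
  apply: le_trans (@typeII Bs iB sg t t0 h2) _; rewrite lerD2l ler_wpM2l ?invr_ge0 ?mulr_ge0 ?(ltW t0) //.
  have L0 : 0 <= logX by apply: le_trans logX_ge1.
  apply: lerD.
    apply: ler_wpM2r; first by rewrite mulr_ge0 ?exprn_ge0 ?E0_ge0.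
    by rewrite lerXn2r ?nnegrE ?sumr_ge0 //; apply: ler_sum => B /sgs.
  apply: ler_wpM2l; first exact: exprn_ge0.
  apply: ler_sum => B BB; have [_ sB _ _] := hB B BB; apply: ler_wpM2r.
    apply: prodr_ge0 => q /sB /andP[pq _]; have := @prime_sub1_ge1 R Z q pq => h.
    by rewrite mulr_ge0 ?addr_ge0 ?invr_ge0 // (le_trans ler01 h).
  by rewrite -[sg B ^+ 2]real_normK ?num_real // lerXn2r ?nnegrE ?s0 ?sgs.
rewrite mulr_suml; apply: ler_sum => B BB; have [ad sB B0 BD] := hB B BB.
apply: le_trans (ler_norm _) _; rewrite normrM; apply: ler_pM => //; first exact: sgs.
exact: typeI_bound.
Qed.

End Dispersion.

(** * The Brun-Hooley sieve *)

Section BrunHooley.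
Variables (R : realType) (I : finType).
Implicit Types (P Q A B : {set I}) (x : I -> R) (f h lam : {set I} -> R) (b n : nat).

(** A sieve weight is viewed as a multilinear polynomial. Evaluated at the conditions x q in {0, 1}
    it bounds an indicator; evaluated at densities it gives the main term. *)
Definition ev lam x : R := \sum_A lam A * \prod_(q in A) x q.

Lemma sum_powersetU1 (F : {set I} -> R) P q : q \notin P ->
  \sum_(A in powerset (q |: P)) F A = \sum_(A in powerset P) F A + \sum_(A in powerset P) F (q |: A).
Proof.
move=> qP; rewrite (bigID (fun A => q \in A)) /= addrC; congr (_ + _).
  apply: eq_bigl => A; rewrite !powersetE; apply/andP/idP => [[/subsetP s qA]|s].
    apply/subsetP => r rA; have := s r rA; rewrite !inE => /orP[/eqP e|//].
    by move: qA; rewrite -e rA.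
  split; first exact: subset_trans s (subsetUr _ _).
  by apply: contra qP; exact: (subsetP s).
rewrite (reindex_onto (fun A => q |: A) (fun A => A :\ q)) /=; last first.
  by move=> A /andP[_ qA]; rewrite setD1K.
apply: eq_bigl => A; rewrite !powersetE setU11 andbT; apply/andP/idP => [[s /eqP e]|s].
  rewrite -e; apply/subsetP => r; rewrite !inE => /andP[rq /orP[/eqP h|rA]]; first by rewrite h eqxx in rq.
  by have := subsetP s r; rewrite !inE (negbTE rq) /=; apply; rewrite rA.
split; first exact: setUS.
rewrite setU1K //; by apply: contra qP; exact: (subsetP s).
Qed.

Definition brun P b A : R := if (A \subset P) && (#|A| <= b)%N then (-1) ^+ #|A| else 0.
Definition slice P n A : R := if (A \subset P) && (#|A| == n) then 1 else 0.

Lemma ev_powerset lam P x : (forall A, ~~ (A \subset P) -> lam A = 0) ->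
  ev lam x = \sum_(A in powerset P) lam A * \prod_(q in A) x q.
Proof.
move=> h; rewrite /ev [RHS]big_mkcond; apply: eq_bigr => A _; rewrite powersetE.
by case: (boolP (A \subset P)) => // /h ->; rewrite mul0r.
Qed.

Lemma brun_out P b A : ~~ (A \subset P) -> brun P b A = 0.
Proof. by rewrite /brun => /negbTE ->. Qed.

Lemma slice_out P n A : ~~ (A \subset P) -> slice P n A = 0.
Proof. by rewrite /slice => /negbTE ->. Qed.

Lemma brun_setU1 P q b x : q \notin P ->
  ev (brun (q |: P) b.+1) x = ev (brun P b.+1) x - x q * ev (brun P b) x.
Proof.
move=> qP; rewrite !(ev_powerset _ (brun_out _)) sum_powersetU1 //.
rewrite mulr_sumr -sumrN; congr (_ + _); apply: eq_bigr => A; rewrite powersetE => s.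
  by rewrite /brun s (subset_trans s (subsetUr _ _)).
have qA : q \notin A by apply: contra qP; exact: (subsetP s).
rewrite /brun s setUS //= cardsU1 qA add1n ltnS big_setU1 //=.
by case: ifP => _; rewrite ?exprS; ring.
Qed.

Lemma brun0 P x : ev (brun P 0) x = 1.
Proof.
rewrite /ev (bigD1 set0) //= [X in _ + X]big1 => [|A A0]; last by rewrite /brun leqn0 cards_eq0 (negbTE A0) andbF mul0r.
by rewrite /brun sub0set cards0 /= big_set0 expr0 mulr1 addr0.
Qed.

Lemma prod_le1 P x : (forall q, 0 <= x q <= 1) -> 0 <= \prod_(q in P) (1 - x q) <= 1.
Proof.
move=> x01; apply/andP; split.
  by apply: prodr_ge0 => q _; rewrite subr_ge0; case/andP: (x01 q).
apply: (@le_trans _ _ (\prod_(q in P) 1)); last by rewrite big1.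
by apply: ler_prod => q _; have /andP[h0 h1] := x01 q; rewrite subr_ge0 h1 /= gerBl.
Qed.

(** Bonferroni's inequalities for real values in [0, 1], by removing one variable: the error for (P,
    b + 1) is the error for (P minus q, b + 1) minus x q times the error for (P minus q, b). *)
Lemma brun_sign P b x : (forall q, 0 <= x q <= 1) ->
  0 <= (-1) ^+ b * (ev (brun P b) x - \prod_(q in P) (1 - x q)).
Proof.
move=> x01; have [c] := ubnP #|P|; elim: c P b => // c IH P b cP.
have [->|[q qP]] := set_0Vmem P.
  rewrite big_set0 (_ : ev _ x = 1) ?subrr ?mulr0 //.
  rewrite /ev (bigD1 set0) //= [X in _ + X]big1 => [|A A0]; last by rewrite /brun subset0 (negbTE A0) mul0r.
  by rewrite /brun sub0set cards0 /= big_set0 expr0 mulr1 addr0.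
have cP' : (#|P :\ q| < c)%N by move: cP; rewrite (cardsD1 q P) qP.
have qP' : q \notin P :\ q by rewrite !inE eqxx.
case: b => [|b].
  by rewrite expr0 mul1r brun0 subr_ge0; case/andP: (prod_le1 P x01).
rewrite -(setD1K qP) brun_setU1 // big_setU1 //=.
have /andP[q0 _] := x01 q.
have h1 := IH _ b.+1 cP'; have h2 := mulr_ge0 q0 (IH _ b cP').
have -> : (-1) ^+ b.+1 * (ev (brun (P :\ q) b.+1) x - x q * ev (brun (P :\ q) b) x -
    (1 - x q) * \prod_(r in P :\ q) (1 - x r)) =
  (-1) ^+ b.+1 * (ev (brun (P :\ q) b.+1) x - \prod_(r in P :\ q) (1 - x r)) +
  x q * ((-1) ^+ b * (ev (brun (P :\ q) b) x - \prod_(r in P :\ q) (1 - x r))) by rewrite exprS; ring.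
exact: addr_ge0.
Qed.

Lemma brun_slice P b x : ev (brun P b.+1) x = ev (brun P b) x + (-1) ^+ b.+1 * ev (slice P b.+1) x.
Proof.
rewrite /ev mulr_sumr -big_split /=; apply: eq_bigr => A _.
rewrite /brun /slice; case: (A \subset P) => /=; last by rewrite !mul0r mulr0 addr0.
case: (ltngtP #|A| b.+1) => [h|h|->].
- by rewrite -ltnS h mul0r mulr0 addr0.
- by rewrite leqNgt (ltn_trans _ h) // !mul0r mulr0 addr0.
- by rewrite ltnn !mul0r add0r mul1r.
Qed.

Lemma brun_bounds P b x : ~~ odd b -> (forall q, 0 <= x q <= 1) ->
  ev (brun P b) x - ev (slice P b.+1) x <= \prod_(q in P) (1 - x q) <= ev (brun P b) x.
Proof.
move=> ob x01; have := brun_sign P b x01; have := brun_sign P b.+1 x01.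
rewrite brun_slice exprS -signr_odd (negbTE ob) expr0 mulr1 mul1r => h1 h2.
by apply/andP; split; lra.
Qed.

Lemma slice_ge0 P n x : (forall q, 0 <= x q) -> 0 <= ev (slice P n) x.
Proof.
move=> x0; apply: sumr_ge0 => A _; rewrite mulr_ge0 ?prodr_ge0 //.
by rewrite /slice; case: ifP.
Qed.

(** Rankin's trick: each set of size n is weighted by 2^(#|A| - n) and the size condition is
    dropped. *)
Lemma slice_le P n x : (forall q, 0 <= x q) -> ev (slice P n) x <= 2 ^- n * \prod_(q in P) (1 + 2 * x q).
Proof.
move=> x0; rewrite (ev_powerset _ (slice_out _)).
under [X in _ <= _ * X]eq_bigr do rewrite addrC.
rewrite (@prod_add_set R I P (fun q => 2 * x q) (fun=> 1)) mulr_sumr; apply: ler_sum => A; rewrite powersetE => s.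
rewrite [X in _ <= _ * (_ * X)]big1 // mulr1 big_split /= prodr_const mulrA.
have p0 : 0 <= \prod_(q in A) x q by apply: prodr_ge0.
apply: ler_wpM2r => //; rewrite /slice s /=; case: eqP => [->|_].
  by rewrite mulVf ?lexx // expf_neq0 // pnatr_eq0.
by rewrite mulr_ge0 ?invr_ge0 ?exprn_ge0.
Qed.

Definition conv Q P f h A : R := if A \subset Q :|: P then f (A :&: Q) * h (A :&: P) else 0.

Lemma ev_conv Q P f h x : [disjoint Q & P] -> (forall A, ~~ (A \subset Q) -> f A = 0) ->
  (forall A, ~~ (A \subset P) -> h A = 0) -> ev (conv Q P f h) x = ev f x * ev h x.
Proof.
move=> dQP f0 h0; rewrite (ev_powerset _ f0) (ev_powerset _ h0) big_distrlr pair_big_dep /=.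
rewrite (@ev_powerset _ (Q :|: P)); last by move=> A; rewrite /conv => /negbTE ->.
rewrite (reindex_onto (fun p : {set I} * {set I} => p.1 :|: p.2) (fun A => (A :&: Q, A :&: P))) /=; last first.
  by move=> A; rewrite powersetE -setIUr => /setIidPl.
have QP q : q \in Q -> q \in P -> False by move=> a b; have := disjointFr dQP a; rewrite b.
have key (p : {set I} * {set I}) : p.1 \subset Q -> p.2 \subset P ->
    ((p.1 :|: p.2) :&: Q = p.1) * ((p.1 :|: p.2) :&: P = p.2).
  move=> /subsetP s1 /subsetP s2; split; apply/setP => q; rewrite !inE.
    case: (boolP (q \in p.1)) => [/s1 -> //|_] /=; case: (boolP (q \in p.2)) => //= /s2 qP.
    by apply/negP => /QP; apply.
  case: (boolP (q \in p.2)) => [/s2 -> //|_] /=; first by rewrite orbT.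
  by rewrite orbF; case: (boolP (q \in p.1)) => //= /s1 qQ; apply/negP => /(QP _ qQ).
apply: eq_big => [p|p /andP[s /eqP e]].
  rewrite !powersetE; apply/andP/andP => [[s /eqP <-]|[s1 s2]]; first by rewrite !subsetIr.
  by rewrite !key // setUSS // -surjective_pairing eqxx.
have [s1 s2] : (p.1 \subset Q) /\ (p.2 \subset P) by rewrite -e /= !subsetIr.
rewrite /conv -powersetE s !key //.
have dp : [disjoint p.1 & p.2].
  by apply: disjointWl s1 _; apply: disjointWr s2 _.
rewrite (eq_bigl [predU p.1 & p.2]) => [|q]; last by rewrite !inE.
rewrite bigU //=; ring.
Qed.

Variables (P : nat -> {set I}) (b : nat -> nat).
Hypotheses (disj : forall j l, (j < l)%N -> [disjoint P j & P l]) (bE : forall j, ~~ odd (b j)).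

Definition blocks t : {set I} := \bigcup_(j < t) P j.

Lemma blocksS t : blocks t.+1 = blocks t :|: P t.
Proof. by rewrite /blocks big_ord_recr. Qed.

Lemma blocks_disj t : [disjoint blocks t & P t].
Proof.
rewrite -setI_eq0 big_distrl /=; apply/eqP; apply: big1 => j _.
by apply/eqP; rewrite setI_eq0 disj.
Qed.

Definition block_size_ok t A := (A \subset blocks t) && [forall j : 'I_t, #|A :&: P j| <= (b j).+1]%N.

Lemma block_size_okS t A : A \subset blocks t.+1 -> block_size_ok t (A :&: blocks t) ->
  (#|A :&: P t| <= (b t).+1)%N -> block_size_ok t.+1 A.
Proof.
move=> s /andP[_ /forallP h] ht; rewrite /block_size_ok s; apply/forallP => j.
case: (ltngtP j t) => jt; last by rewrite jt.
  have sub : P j \subset blocks t by exact: (@bigcup_sup _ _ (Ordinal jt) xpredT (fun l : 'I_t => P l) isT).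
  by have := h (Ordinal jt); rewrite /= -setIA (setIidPr sub).
by move: (ltn_ord j); rewrite ltnS leqNgt jt.
Qed.

(** The relative loss of the lower bound against the upper one: in each block, the first omitted
    elementary symmetric function divided by the exact product. *)
Definition block_defect x t : R :=
  \sum_(j < t) ev (slice (P j) (b j).+1) x / \prod_(q in P j) (1 - x q).

(* Hooley's recursion: an upper bound [lb] and a lower bound [lw] for the sieve by the first
   [t] blocks are extended by [lb * brun] and [lw * brun - lb * slice]. *)
Lemma brun_hooley t : exists lw lb : {set I} -> R,
  [/\ forall A, `|lw A| <= 1 /\ `|lb A| <= 1,
      forall A, ~~ block_size_ok t A -> lw A = 0 /\ lb A = 0,
      forall x, (forall q, 0 <= x q <= 1) ->
        ev lw x <= \prod_(q in blocks t) (1 - x q) <= ev lb x &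
      forall x, (forall q, 0 <= x q < 1) -> (1 - block_defect x t) * ev lb x <= ev lw x].
Proof.
elim: t => [|t [lw [lb [h1 h2 h3 h4]]]].
  exists (brun set0 0), (brun set0 0); split.
  - by move=> A; split; rewrite /brun; case: ifP => _; rewrite ?normr0 // normrX normrN normr1 expr1n.
  - move=> A; rewrite /block_size_ok /blocks big_ord0 negb_and => /orP[h|/negP[]]; last by apply/forallP => -[].
    by rewrite brun_out.
  - by move=> x _; rewrite /blocks big_ord0 big_set0 brun0 lexx.
  - by move=> x _; rewrite /block_defect big_ord0 subr0 mul1r.
pose Q := blocks t; have dQ : [disjoint Q & P t] by exact: blocks_disj.
have sub0 A : ~~ (A \subset Q) -> ~~ block_size_ok t A by apply: contra => /andP[].
have lw0 A : ~~ (A \subset Q) -> lw A = 0 by move=> /sub0 /h2[].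
have lb0 A : ~~ (A \subset Q) -> lb A = 0 by move=> /sub0 /h2[].
pose lb' A := conv Q (P t) lb (brun (P t) (b t)) A.
pose lw' A := conv Q (P t) lw (brun (P t) (b t)) A - conv Q (P t) lb (slice (P t) (b t).+1) A.
have evb x : ev lb' x = ev lb x * ev (brun (P t) (b t)) x by apply: ev_conv => // A; exact: brun_out.
have evw x : ev lw' x = ev lw x * ev (brun (P t) (b t)) x - ev lb x * ev (slice (P t) (b t).+1) x.
  rewrite -(ev_conv x dQ lw0 (@brun_out (P t) (b t))) -(ev_conv x dQ lb0 (@slice_out (P t) (b t).+1)).
  rewrite /ev -sumrB; apply: eq_bigr => A _; rewrite /lw'; ring.
exists lw', lb'; split.
- move=> A; have [hw hb] := h1 (A :&: Q).
  have sgn n : `|(-1) ^+ n| = 1 :> R by rewrite normrX normrN normr1 expr1n.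
  rewrite /lw' /lb' /conv; case: ifP => _; last by rewrite subr0 normr0.
  rewrite /brun /slice subsetIr /=; case: (ltngtP #|A :&: P t| (b t).+1) => h.
  + by rewrite -ltnS h mulr0 subr0 !normrM !sgn !mulr1.
  + by rewrite leqNgt (ltn_trans _ h) // !mulr0 subr0 normr0.
  + by rewrite h ltnn !mulr0 mulr1 sub0r normrN normr0.
- move=> A nA; rewrite /lw' /lb' /conv; case: ifP => [s|_]; last by rewrite subr0.
  case: (boolP (block_size_ok t (A :&: Q))) => h; last first.
    by have [-> ->] := h2 _ h; rewrite !mul0r subrr.
  have : ~~ (#|A :&: P t| <= (b t).+1)%N.
    by apply: contra nA => h'; apply: block_size_okS => //; rewrite blocksS.
  rewrite -ltnNge => h'; rewrite /brun /slice subsetIr /= gtn_eqF // leqNgt (ltn_trans _ h') // !mulr0.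
  by rewrite subrr.
- move=> x x01; have /andP[k1 k2] := h3 x x01; have /andP[k3 k4] := brun_bounds (P t) (bE t) x01.
  have /andP[k5 _] := prod_le1 (blocks t) x01; have /andP[k6 _] := prod_le1 (P t) x01.
  have k7 : 0 <= ev (slice (P t) (b t).+1) x by apply: slice_ge0 => q; case/andP: (x01 q).
  have -> : \prod_(q in blocks t.+1) (1 - x q) = \prod_(q in blocks t) (1 - x q) * \prod_(q in P t) (1 - x q).
    rewrite (eq_bigl [predU (blocks t) & (P t)]) => [|q]; first by rewrite bigU.
    by rewrite blocksS !inE.
  rewrite evb evw; apply/andP; split; last exact: ler_pM.
  set p := \prod_(q in blocks t) _ in k1 k2 k5 *; set r := \prod_(q in P t) _ in k3 k4 k6 *.
  move: k1 k2 k3 k4 k5 k6 k7; clear; move: (ev (slice _ _) x) (ev (brun _ _) x) (ev lb x) (ev lw x) => s u c w k1 k2 k3 k4 k5 k6 k7.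
  have e1 : w * u <= p * u by apply: ler_wpM2r => //; exact: le_trans k6 k4.
  have e2 : p * s <= c * s by exact: ler_wpM2r.
  have e3 : p * (u - s) <= p * r by exact: ler_wpM2l.
  by move: e3; rewrite mulrBr; lra.
- move=> x x01; have x01' q : 0 <= x q <= 1 by have /andP[-> /ltW ->] := x01 q.
  have k1 := h4 x x01; have /andP[_ k2] := h3 x x01'; have /andP[_ k4] := brun_bounds (P t) (bE t) x01'.
  have /andP[k5 _] := prod_le1 (blocks t) x01'.
  have k6 : 0 < \prod_(q in P t) (1 - x q) by apply: prodr_gt0 => q _; rewrite subr_gt0; case/andP: (x01 q).
  have k7 : 0 <= ev (slice (P t) (b t).+1) x by apply: slice_ge0 => q; case/andP: (x01 q).
  have k8 : 0 <= ev lb x by exact: le_trans k2.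
  rewrite evb evw /block_defect big_ord_recr /= -/(block_defect x t).
  move: k1 k4 k6 k7 k8; clear; move: (\prod_(_ in _) _) (block_defect x t) (ev (slice _ _) x) (ev (brun _ _) x) (ev lb x) (ev lw x).
  move=> p d s u c w k1 k4 k6 k7 k8.
  have e1 : (1 - d) * c * u <= w * u by apply: ler_wpM2r => //; exact: le_trans (ltW k6) k4.
  have e2 : c * (s * 1) <= c * (s / p * u).
    by apply: ler_wpM2l => //; rewrite -mulrA; apply: ler_wpM2l => //; rewrite mulrC ler_pdivlMr // mul1r.
  have -> : (1 - (d + s / p)) * (c * u) = (1 - d) * c * u - c * (s / p * u) by ring.
  by move: e2; rewrite mulr1; lra.
Qed.

End BrunHooley.

(** * The sieve expressed by residuals *)

Section SieveExpansion.
Variable R : realType.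
Variables (Z W X V0 D a k0 : nat) (g : nat -> R).
Local Notation T := 'I_Z.
Local Notation k := k0.+1.
Notation lnn := (lnn R).
Notation mangoldt := (mangoldt R).
Notation locprod := (@locprod R Z).
Notation locfun := (@locfun R Z).
Notation residual := (@residual R Z W X V0 a g).
Notation logX := (logX R X).
Implicit Types (A B F : {set T}) (i : T -> nat) (n m l : nat) (q : T).

Hypotheses (W0 : (0 < W)%N) (Wk : forall p, prime p -> (p <= k.*2.+1)%N -> (p %| W)%N).
Hypotheses (V00 : (0 < V0)%N) (D0 : (0 < D)%N) (g01 : forall n, 0 <= g n <= 1).

Definition sieving_primes : {set T} := [set q | sievable W q].
Local Notation PP := sieving_primes.

Lemma sieving_gt q : q \in PP -> (k.*2.+1 < q)%N.
Proof.
rewrite inE => /andP[pq qW]; rewrite ltnNge; apply: contra qW; exact: Wk.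
Qed.

(** The indicator that q divides one of n+1, ..., n+k: as q > k, at most one summand is 1. The
    primes up to 2k+1 are put into W so that moreover the density k/(q - 1) is at most 1/2. *)
Definition shift_count q n : R :=
  if q \in PP then \sum_(i < k) (if (q %| n + i.+1)%N then 1 else 0) else 0.
Definition shift_density q : R := if q \in PP then k%:R / (q%:R - 1) else 0.
Notation kap := shift_density.

Definition choice_shift (f : {ffun T -> 'I_k}) : T -> nat := fun q => (f q).+1.

Lemma choice_shift_admissible f : admissible W (choice_shift f).
Proof.
move=> q sq; have qk : (k.*2.+1 < q)%N by apply: sieving_gt; rewrite inE.
by rewrite gtnNdvd // /choice_shift; have := ltn_ord (f q); lia.
Qed.

Lemma sievable_sub A : A \subset PP -> forall q, q \in A -> sievable W q.
Proof. by move=> /subsetP s q /s; rewrite inE. Qed.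

Lemma shift_count_01 q n : 0 <= shift_count q n <= 1.
Proof.
rewrite /shift_count; case: ifP => [qP|_]; last by rewrite lexx ler01.
rewrite sumr_ge0 /=; last by move=> i _; case: ifP.
case: (pickP (fun i : 'I_k => (q %| n + i.+1)%N)) => [i hi|h]; last first.
  by rewrite big1 // => i _; rewrite h.
rewrite (bigD1 i) //= hi big1 ?addr0 // => j ji; case: ifP => // hj; case/negP: ji.
have qk := sieving_gt qP; have li := ltn_ord i; have lj := ltn_ord j.
apply/eqP/val_inj => /=; wlog ij : i j hi hj li lj / (i <= j)%N => [Wl|].
  by case: (leqP i j) => [/Wl|/ltnW /Wl] h; [apply: h | apply/esym/h].
have : (q %| j - i)%N by have := dvdn_sub hj hi; rewrite subnDl subSS.
case: (posnP (j - i)) => [|d0 /(dvdn_leq d0)]; last by lia.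
by move/eqP; rewrite subn_eq0 => h _; apply/eqP; rewrite eqn_leq h.
Qed.

Lemma kap_bounds q : 0 <= kap q <= 2^-1.
Proof.
rewrite /shift_density; case: ifP => [qP|_]; last by rewrite lexx invr_ge0 ler0n.
have qk := sieving_gt qP; have h : 2 * k%:R <= q%:R - 1 :> R.
  by rewrite lerBrDr -natrM natr1 ler_nat; lia.
have k1 : 0 < k%:R :> R by rewrite ltr0n.
have u0 : 0 < q%:R - 1 :> R by apply: lt_le_trans h; rewrite mulr_gt0.
by rewrite divr_ge0 ?(ltW u0) //= ler_pdivrMr //; lra.
Qed.

Lemma shift_countE q n : q \in PP -> ~~ (q %| n)%N ->
  shift_count q n = (\sum_(i < k) locfun (fun=> i.+1) q n) + kap q.
Proof.
move=> qP qn; rewrite /shift_count /shift_density qP /locfun (negbTE qn) sumrB.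
rewrite [X in _ - X](_ : _ = k%:R / (q%:R - 1)) ?subrK // sumr_const card_ord mul1r.
by rewrite mulr_natl.
Qed.

(** Functions equal to [ord0] outside B, so that each choice of shifts on B is counted once. *)
Definition choices B := [pred f : {ffun T -> 'I_k} | f \in pffun_on ord0 (mem B) predT].

Lemma card_choices B : #|choices B| = (k ^ #|B|)%N.
Proof.
have := card_pffun_on (ord0 : 'I_k) (mem B) (predT : {pred 'I_k}).
by rewrite card_ord => <-; apply: eq_card.
Qed.

Definition expansion A n : R :=
  \sum_(B in powerset A) (\prod_(q in A :\: B) kap q) * \sum_(f in choices B) locprod (choice_shift f) B n.

(** The identity requires that no sieving prime divide n, because [locfun] subtracts its mean over
    units only. The other n are charged to [bad_sum]. *)
Lemma expansionE A n : A \subset PP -> (forall q, q \in PP -> ~~ (q %| n)%N) ->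
  \prod_(q in A) shift_count q n = expansion A n.
Proof.
move=> /subsetP sA hn.
rewrite (eq_bigr (fun q => (\sum_(i < k) locfun (fun=> i.+1) q n) + kap q)); last first.
  by move=> q /sA qP; rewrite shift_countE // hn.
rewrite (@prod_add_set R _ A (fun q => \sum_(i < k) locfun (fun=> i.+1) q n) kap).
apply: eq_bigr => B _; rewrite mulrC; congr (_ * _).
rewrite (big_distr_big ord0); apply: eq_big => [f|f _]; last by [].
by rewrite inE.
Qed.

Lemma expansion_le A n : A \subset PP -> `|expansion A n| <= (modulus A)%:R.
Proof.
move=> sA; have s := subsetP sA.
have k1 : 0 <= k%:R :> R by [].
apply: (@le_trans _ _ (\sum_(B in powerset A) (\prod_(q in B) k%:R) * \prod_(q in A :\: B) kap q)).
  apply: le_trans (ler_norm_sum _ _ _) _; apply: ler_sum => B; rewrite powersetE => BA.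
  have sB := sievable_sub (subset_trans BA sA).
  have p0 : 0 <= \prod_(q in A :\: B) kap q by apply: prodr_ge0 => q _; case/andP: (kap_bounds q).
  rewrite normrM (ger0_norm p0) mulrC ler_wpM2r // prodr_const -natrX -card_choices.
  apply: le_trans (ler_norm_sum _ _ _) _.
  apply: (@le_trans _ _ (\sum_(f in choices B) 1)); last by rewrite sumr_const.
  by apply: ler_sum => f _; exact: (@locprod_le1 R Z W (choice_shift f) B n (choice_shift_admissible f) sB).
rewrite -(@prod_add_set R _ A (fun=> k%:R) kap) /modulus natr_prod; apply: ler_prod => q /s qP.
have /andP[h0 h1] := kap_bounds q; rewrite addr_ge0 //=; have := sieving_gt qP => h.
apply: (@le_trans _ _ (k%:R + 1)); last by rewrite natr1 ler_nat; lia.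
by rewrite lerD2l (le_trans h1) // invf_le1 // ler1n.
Qed.

Lemma modulus_inj A B : A \subset PP -> B \subset PP -> modulus A = modulus B -> A = B.
Proof.
have key A1 B1 : A1 \subset PP -> B1 \subset PP -> modulus A1 = modulus B1 -> A1 \subset B1.
  move=> /sievable_sub s1 /sievable_sub s2 e; apply/subsetP => q qA.
  have pq : prime q by case/andP: (s1 q qA).
  have pB r : r \in B1 -> prime r by move=> /s2 /andP[].
  have d : (q %| modulus B1)%N by rewrite -e (modulusD1 qA) dvdn_mulr.
  by have [r rB /val_inj <-] := dvdn_modulus pq pB d.
by move=> sA sB e; apply/eqP; rewrite eqEsubset (key A B sA sB e) (key B A sB sA (esym e)).
Qed.

Definition level_sets : {set {set T}} := [set A : {set T} | (A \subset PP) && (modulus A <= D)%N].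

Lemma card_level_sets : (#|level_sets| <= D.+1)%N.
Proof.
have h (A B : {set T}) : A \in level_sets -> B \in level_sets ->
    (inord (modulus A) : 'I_D.+1) = inord (modulus B) -> A = B.
  rewrite !inE => /andP[sA dA] /andP[sB dB] /(congr1 val) /=; rewrite !inordK //.
  exact: modulus_inj.
by have := @leq_card_in _ _ _ (mem level_sets) h; rewrite card_ord.
Qed.

Definition base_weight n : R := mangoldt n * sieve_weight W X V0 a g (fun _ : T => 0%N) set0 n.

Lemma sieve_weight_locprod i B n :
  sieve_weight W X V0 a g i B n = locprod i B n * sieve_weight W X V0 a g (fun _ : T => 0%N) set0 n.
Proof.
rewrite /sieve_weight /locprod big_set0; case: ifP => _; last by rewrite mulr0.
by rewrite mul1r !mulrA.
Qed.

Lemma base_weight_ge0 n : 0 <= base_weight n.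
Proof.
rewrite mulr_ge0 ?mangoldt_ge0 // /sieve_weight; case: ifP => // _.
by rewrite /locprod big_set0 mul1r divr_ge0 //; case/andP: (g01 n).
Qed.

Definition small_factor n := [exists q : T, prime q && (q %| n)%N].
Definition bad_sum : R := \sum_(1 <= n < X.+1) (if small_factor n then base_weight n else 0).

(** An n with a prime factor q < Z and mangoldt n <> 0 is a power q^j with j < J, so at most Z J
    values occur, each of weight at most logX / V0. *)
Lemma bad_sum_le J : (X < 2 ^ J)%N -> bad_sum <= (Z * J)%:R * logX / V0%:R.
Proof.
move=> XJ; have V0R : 0 < V0%:R :> R by rewrite ltr0n.
have L0 : 0 <= logX by apply: le_trans (logX_ge1 R X).
apply: (@le_trans _ _ (\sum_(1 <= n < X.+1) \sum_(q < Z) \sum_(j < J) (if n == (q ^ j)%N then logX / V0%:R else 0))).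
  apply: ler_sum_nat => n /andP[n0 nX].
  have nn : 0 <= \sum_(q < Z) \sum_(j < J) (if n == (q ^ j)%N then logX / V0%:R else 0).
    by do 2! (apply: sumr_ge0 => ? _); case: ifP => // _; rewrite divr_ge0 // ltW.
  case: ifP => // /existsP[q /andP[pq qn]].
  have [e|/eqP ne] := eqVneq (mangoldt n) 0; first by rewrite /base_weight e mul0r.
  have [p [j [pp j0 e]]] : exists p j, [/\ prime p, (0 < j)%N & n = (p ^ j)%N].
    by have := mangoldt_ppow (introN eqP ne) => -[p [j]] *; exists p, j; intuition.
  have qp : (q : nat) = p by apply/eqP; rewrite -dvdn_prime2 //; move: qn; rewrite e Euclid_dvdX // j0 andbT.
  have jJ : (j < J)%N.
    rewrite -(@ltn_exp2l 2) //; apply: leq_ltn_trans XJ; apply: (@leq_trans n) => //.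
    by rewrite e leq_exp2r // prime_gt1.
  rewrite (bigD1 q) //= (bigD1 (Ordinal jJ)) //= qp -e eqxx -addrA ler_wpDr //.
    rewrite addr_ge0 //; first by apply: sumr_ge0 => ? _; case: ifP => // _; rewrite divr_ge0 // ltW.
    by do 2! (apply: sumr_ge0 => ? _); case: ifP => // _; rewrite divr_ge0 // ltW.
  rewrite /base_weight /sieve_weight; case: ifP => [/andP[/andP[Vn _] _]|_]; last by rewrite mulr0 divr_ge0 // ltW.
  rewrite /locprod big_set0 mul1r mulrA; have /andP[h0 h1] := g01 n.
  apply: ler_pM; rewrite ?invr_ge0 ?mulr_ge0 ?mangoldt_ge0 //.
    rewrite -[logX]mulr1; apply: ler_pM => //; first exact: mangoldt_ge0.
    apply: le_trans (mangoldt_le _ _) _; apply: (@le_trans _ _ (lnn X)); last by rewrite lerDr.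
    by apply: lnn_le.
  by rewrite lef_pV2 ?posrE ?ltr0n // ler_nat ltnW.
rewrite exchange_big /=; under eq_bigr do rewrite exchange_big /=.
apply: (@le_trans _ _ (\sum_(q < Z) \sum_(j < J) logX / V0%:R)).
  apply: ler_sum => q _; apply: ler_sum => j _; case: (boolP (0 < q ^ j <= X)%N) => [h|h].
    by rewrite (sum_eq_index _ h).
  by rewrite (sum_eq_index0 _ h) divr_ge0 // ltW.
rewrite !sumr_const !card_ord -mulrnA -[X in X <= _]mulr_natl mulnC mulrA; exact: lexx.
Qed.

Definition total_residual A B : R := (\prod_(q in A :\: B) kap q) * \sum_(f in choices B) residual (choice_shift f) B.

Lemma sum_expansion A :
  \sum_(1 <= n < X.+1) base_weight n * expansion A n = \sum_(B in powerset A) total_residual A B.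
Proof.
rewrite /expansion; under eq_bigr do rewrite mulr_sumr.
rewrite exchange_big /=; apply: eq_bigr => B _.
rewrite /total_residual mulr_sumr; under eq_bigr do rewrite mulrCA !mulr_sumr.
rewrite exchange_big /=; apply: eq_bigr => f _.
rewrite /residual mulr_sumr; apply: eq_bigr => n _.
by rewrite (sieve_weight_locprod (choice_shift f)) /base_weight; ring.
Qed.

Lemma sum_shift_prod A : A \in level_sets ->
  `|\sum_(1 <= n < X.+1) base_weight n * \prod_(q in A) shift_count q n - \sum_(B in powerset A) total_residual A B|
   <= 2 * D%:R * bad_sum.
Proof.
rewrite inE => /andP[sA AD]; rewrite -sum_expansion -sumrB /bad_sum mulr_sumr.
apply: le_trans (ler_norm_sum _ _ _) _; apply: ler_sum => n _.
case: (boolP (small_factor n)) => [_|nb]; last first.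
  rewrite -expansionE // ?subrr ?normr0 ?mulr0 // => q; rewrite inE => /andP[pq _].
  by apply: contra nb => qn; apply/existsP; exists q; rewrite pq.
rewrite -mulrBr normrM (ger0_norm (base_weight_ge0 n)) mulrC ler_wpM2r ?base_weight_ge0 //.
apply: le_trans (ler_normB _ _) _; have h1 := expansion_le n sA.
have h2 : `|\prod_(q in A) shift_count q n| <= 1.
  rewrite ger0_norm; last by apply: prodr_ge0 => q _; case/andP: (shift_count_01 q n).
  apply: (@le_trans _ _ (\prod_(q in A) 1)); last by rewrite big1.
  by apply: ler_prod => q _; exact: shift_count_01.
have h3 : (modulus A)%:R <= D%:R :> R by rewrite ler_nat.
have h4 : 1 <= D%:R :> R by rewrite ler1n.
lra.
Qed.

(** Taking the worst shifts for each B, with multiplicity k^#|B|, leaves one residual per set;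
    [dispersion] can then treat distinct sets as orthogonal. *)
Lemma best_choice B : exists f : {ffun T -> 'I_k},
  forall f', `|residual (choice_shift f') B| <= `|residual (choice_shift f) B|.
Proof.
pose f0 : {ffun T -> 'I_k} := [ffun=> ord0].
case: (@arg_maxP _ _ _ f0 xpredT (fun f => `|residual (choice_shift f) B|) isT) => f _ h.
by exists f => f'; apply: h.
Qed.

Lemma total_residual_set0 A : total_residual A set0 = (\prod_(q in A) kap q) * residual (fun=> 0%N) set0.
Proof.
rewrite /total_residual setD0; congr (_ * _).
have e f : residual (choice_shift f) set0 = residual (fun=> 0%N) set0.
  by apply: eq_bigr => n _; rewrite /sieve_weight /locprod !big_set0.
under eq_bigr do rewrite e.
by rewrite sumr_const card_choices cards0 expn0.
Qed.

Definition density_product : R := \prod_(q in PP) (1 + kap q).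

(** For A containing B, the difference A minus B determines A, so the sum is part of the expansion
    of the product of 1 + kap. *)
Lemma sum_over_supersets B : \sum_(A in level_sets | B \subset A) \prod_(q in A :\: B) kap q <= density_product.
Proof.
have kp (F : {set T}) : 0 <= \prod_(q in F) kap q by apply: prodr_ge0 => q _; case/andP: (kap_bounds q).
have -> : density_product = \sum_(F in powerset PP) \prod_(q in F) kap q.
  rewrite /density_product; under eq_bigr do rewrite addrC.
  rewrite (@prod_add_set R _ PP kap (fun=> 1)); apply: eq_bigr => F _.
  by rewrite [X in _ * X]big1 // mulr1.
apply: (@le_trans _ _ (\sum_(F in powerset PP | F :&: B == set0) \prod_(q in F) kap q)); last first.
  by rewrite [X in _ <= X](bigID (fun F => F :&: B == set0)) /= lerDl sumr_ge0.
rewrite [X in _ <= X](reindex_onto (fun A => A :\: B) (fun F => F :|: B)) /=; last first.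
  move=> F /andP[_ /eqP h]; apply/setP => q; rewrite !inE; move/setP/(_ q): h; rewrite !inE.
  by case: (q \in F); case: (q \in B).
rewrite [X in _ <= X](bigID (fun A => (A \in level_sets) && (B \subset A))) /= ler_wpDr ?sumr_ge0 //.
rewrite le_eqVlt; apply/orP; left; apply/eqP/eq_bigl => A.
case: (boolP ((A \in level_sets) && (B \subset A))) => [/andP[AL BA]|]; last by rewrite andbF.
rewrite andbT; symmetry; apply/andP; split; last first.
  apply/eqP/setP => q; rewrite !inE; have := subsetP BA q.
  by case: (q \in B) => [->|_] //; rewrite orbF.
apply/andP; split.
  by move: AL; rewrite inE powersetE => /andP[s _]; apply: subset_trans s; exact: subsetDl.
by apply/eqP/setP => q; rewrite !inE; case: (q \in B); rewrite ?andbF.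
Qed.

Definition nontrivial_level_sets : {set {set T}} := level_sets :\ set0.

(** Expanding the local conditions, the empty set collects all the densities into [ev lw kap] times
    one residual. Nonempty B are grouped over the A that contain them, which costs
    [density_product]; the last term is the bad n, once for each of the at most D + 1 level sets. *)
Lemma sieve_lower_bound (lw : {set T} -> R) :
  (forall A, `|lw A| <= 1) -> (forall A, A \notin level_sets -> lw A = 0) ->
  (forall x : T -> R, (forall q, 0 <= x q <= 1) -> ev lw x <= \prod_(q in PP) (1 - x q)) ->
  exists fB : {set T} -> {ffun T -> 'I_k},
  ev lw kap * residual (fun=> 0%N) set0 <=
  \sum_(1 <= n < X.+1) base_weight n * \prod_(q in PP) (1 - shift_count q n) +
  density_product * (\sum_(B in nontrivial_level_sets) k%:R ^+ #|B| * `|residual (choice_shift (fB B)) B|) +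
  D.+1%:R * (2 * D%:R * bad_sum).
Proof.
move=> lw1 lw0 lwP.
have [fB hB] : exists fB : {set T} -> {ffun T -> 'I_k},
    forall B f', `|residual (choice_shift f') B| <= `|residual (choice_shift (fB B)) B|.
  by have [fB h] := boolp.choice best_choice; exists fB.
exists fB; set R0 := residual (fun=> 0%N) set0.
set S := \sum_(1 <= n < X.+1) base_weight n * \prod_(q in PP) (1 - shift_count q n).
have S1 : \sum_(A in level_sets) lw A * (\sum_(1 <= n < X.+1) base_weight n * \prod_(q in A) shift_count q n) <= S.
  rewrite (_ : \sum_(A in level_sets) _ = \sum_(1 <= n < X.+1) base_weight n * ev lw (fun q => shift_count q n)).
    apply: ler_sum => n _; apply: ler_wpM2l; first exact: base_weight_ge0.
    by apply: lwP => q; exact: shift_count_01.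
  under [RHS]eq_bigr do rewrite /ev mulr_sumr.
  rewrite exchange_big /= big_mkcond; apply: eq_bigr => A _; case: ifPn => [_|/lw0 ->]; last first.
    by rewrite big1 // => n _; rewrite mul0r mulr0.
  rewrite mulr_sumr; apply: eq_bigr => n _; exact: mulrCA.
have bs0 : 0 <= bad_sum by apply: sumr_ge0 => n _; case: ifP => // _; exact: base_weight_ge0.
have S2 : \sum_(A in level_sets) lw A * (\sum_(B in powerset A) total_residual A B) <= S + D.+1%:R * (2 * D%:R * bad_sum).
  apply: (@le_trans _ _ (\sum_(A in level_sets) (lw A * (\sum_(1 <= n < X.+1) base_weight n * \prod_(q in A) shift_count q n)
      + 2 * D%:R * bad_sum))).
    apply: ler_sum => A AL; have := sum_shift_prod AL.
    set u := \sum_(1 <= n < _) _; set v := \sum_(B in _) _ => h.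
    have : lw A * (v - u) <= 1 * (2 * D%:R * bad_sum); last by rewrite mulrBr mul1r; lra.
    apply: le_trans (ler_norm _) _; rewrite normrM distrC; exact: ler_pM.
  rewrite big_split /= lerD // sumr_const -[X in X <= _]mulr_natl ler_wpM2r ?mulr_ge0 // ler_nat; exact: card_level_sets.
have S3 : ev lw kap * R0 + \sum_(A in level_sets) lw A * (\sum_(B in powerset A | B != set0) total_residual A B) =
   \sum_(A in level_sets) lw A * (\sum_(B in powerset A) total_residual A B).
  have -> : ev lw kap * R0 = \sum_(A in level_sets) lw A * total_residual A set0.
    rewrite /ev mulr_suml [RHS]big_mkcond; apply: eq_bigr => A _; case: ifPn => [_|/lw0 ->]; last by rewrite !mul0r.
    by rewrite total_residual_set0 mulrA.
  rewrite -big_split /=; apply: eq_bigr => A _; rewrite -mulrDr; congr (_ * _).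
  by rewrite [RHS](bigD1 set0) //= powersetE sub0set.
have kp (F : {set T}) : 0 <= \prod_(q in F) kap q by apply: prodr_ge0 => q _; case/andP: (kap_bounds q).
have S4 : `|\sum_(A in level_sets) lw A * (\sum_(B in powerset A | B != set0) total_residual A B)| <=
   density_product * (\sum_(B in nontrivial_level_sets) k%:R ^+ #|B| * `|residual (choice_shift (fB B)) B|).
  pose r B := k%:R ^+ #|B| * `|residual (choice_shift (fB B)) B|.
  have r0 B : 0 <= r B by rewrite mulr_ge0 ?exprn_ge0.
  apply: (@le_trans _ _ (\sum_(A in level_sets) \sum_(B in powerset A | B != set0) (\prod_(q in A :\: B) kap q) * r B)).
    apply: le_trans (ler_norm_sum _ _ _) _; apply: ler_sum => A AL.
    rewrite normrM -[X in _ <= X]mul1r; apply: ler_pM => //.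
    apply: le_trans (ler_norm_sum _ _ _) _; apply: ler_sum => B _.
    rewrite /total_residual normrM (ger0_norm (kp _)) ler_wpM2l //.
    apply: le_trans (ler_norm_sum _ _ _) _.
    apply: (@le_trans _ _ (\sum_(f in choices B) `|residual (choice_shift (fB B)) B|)); first exact: ler_sum.
    by rewrite sumr_const card_choices -[X in X <= _]mulr_natl natrX.
  rewrite (exchange_big_dep (fun B => B \in nontrivial_level_sets)) /=; last first.
    move=> A B; rewrite !inE => /andP[sA AD] /andP[BA B0]; rewrite B0 /=.
    have sB := subset_trans BA sA; rewrite sB /=; apply: leq_trans AD.
    by apply: (modulus_subset (W := W) BA); exact: sievable_sub.
  rewrite mulr_sumr; apply: ler_sum => B; rewrite !inE => /andP[B0 _].
  rewrite -mulr_suml ler_wpM2r //; apply: le_trans (sum_over_supersets B).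
  by rewrite le_eqVlt; apply/orP; left; apply/eqP/eq_bigl => A; rewrite powersetE B0 andbT.
move: S4; rewrite ler_norml => /andP[S4 _]; move: S2 S3 S4; clear.
move: (density_product * _) (D.+1%:R * _) (ev lw kap * R0) (\sum_(A in _) _ * \sum_(B in _ | _) _).
by move: (\sum_(A in level_sets) _) => x1 x2 x3 x4 x5 h1 h2 h3; lra.
Qed.

End SieveExpansion.

(** * Small moduli and the main term *)

Section Weight.
Variable R : realType.
Local Notation C := R[i].
Local Open Scope complex_scope.
Notation lnn := (lnn R).
Notation mangoldt := (mangoldt R).
Variables (N m : nat).
Hypotheses (N0 : (0 < N)%N) (m0 : (0 < m)%N).
Notation h := (N%:R^-1 : R).

(** With v = n^(-1/N), the function 4 v (1 - v) has its maximum 1 at n = 2^N. Divided by n, the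
    weight is 4^m times [logweight] at s = 1 + m/N with m differences, which is what makes it a
    difference of L'/L. *)
Definition weight n : R := (4 * (pw h n * (1 - pw h n))) ^+ m.

Let N0R : 0 < N%:R :> R. Proof. by rewrite ltr0n. Qed.
Let h0 : 0 < h. Proof. by rewrite invr_gt0. Qed.

Lemma pw_01 n : 0 <= pw h n <= 1.
Proof. by rewrite pw_ge0 pw_le1 // ltW. Qed.

Lemma parabola_01 (x : R) : 0 <= x <= 1 -> 0 <= 4 * (x * (1 - x)) <= 1.
Proof.
case/andP=> x0 x1; have y0 : 0 <= 1 - x by rewrite subr_ge0.
rewrite mulr_ge0 ?mulr_ge0 //= -subr_ge0.
by rewrite (_ : _ - _ = (1 - 2 * x) ^+ 2) ?sqr_ge0 //; ring.
Qed.

Lemma weight_01 n : 0 <= weight n <= 1.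
Proof.
have /andP[b0 b1] := parabola_01 (pw_01 n).
by rewrite /weight exprn_ge0 //= exprn_ile1.
Qed.

Lemma norm_subrX_le (x y : R) : 0 <= x <= 1 -> 0 <= y <= 1 -> `|x ^+ m - y ^+ m| <= m%:R * `|x - y|.
Proof.
wlog xy : x y / y <= x => [Wl|].
  move=> hx hy; case/orP: (le_total y x) => yx; first exact: Wl.
  by rewrite distrC [`|x - y|]distrC; apply: Wl.
case/andP=> x0 x1 /andP[y0 y1].
rewrite !ger0_norm ?subr_ge0 // ?lerXn2r //.
have := @subrX_le R x y m; rewrite y0 xy => /(_ isT) h1; apply: le_trans h1 _.
rewrite ler_wpM2r ?subr_ge0 // -[X in _ <= X]mulr1 ler_wpM2l // exprn_ile1 //.
Qed.

Lemma weight_step c l : (0 < c)%N -> (0 < l)%N ->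
  `|weight (c * l.+1)%N - weight (c * l)%N| <= (4 * m%:R * h) / l%:R.
Proof.
move=> c0 l0; have l0R : 0 < l%:R :> R by rewrite ltr0n.
apply: le_trans (norm_subrX_le (parabola_01 (pw_01 _)) (parabola_01 (pw_01 _))) _.
have /andP[u0 u1] := pw_01 (c * l.+1); have /andP[v0 v1] := pw_01 (c * l).
have d0 : 0 <= pw h (c * l) - pw h (c * l.+1) <= h / l%:R.
  have cl0 : (0 < c * l)%N by rewrite muln_gt0 c0.
  rewrite subr_ge0 pw_le ?(ltW h0) ?leq_mul2l ?leqnSn ?orbT //= !pwM // -mulrBr.
  have /andP[a0 a1] := pw_01 c; have /andP[b0 b1] := pw_01 l.
  have s0 := pwS_diff (ltW h0) l0.
  have s1 : 0 <= pw h l - pw h l.+1 by rewrite subr_ge0 pw_le // ltW.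
  apply: (@le_trans _ _ (1 * (h / l%:R * pw h l))); first exact: ler_pM.
  by rewrite mul1r -[X in _ <= X]mulr1 ler_wpM2l // divr_ge0 // ltW.
have -> : 4 * (pw h (c * l.+1) * (1 - pw h (c * l.+1))) - 4 * (pw h (c * l) * (1 - pw h (c * l))) =
   4 * ((pw h (c * l) - pw h (c * l.+1)) * (pw h (c * l) + pw h (c * l.+1) - 1)) by ring.
rewrite !normrM [`|4|]ger0_norm //; case/andP: d0 => d0 d1; rewrite (ger0_norm d0).
have e1 : `|pw h (c * l) + pw h (c * l.+1) - 1| <= 1 by rewrite ler_norml; apply/andP; split; lra.
rewrite (_ : 4 * m%:R * h / l%:R = m%:R * (4 * (h / l%:R * 1))); last by ring.
by do 2! (apply: ler_wpM2l => //); apply: ler_pM.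
Qed.

(** Here 1 - v <= (log n)/N <= 1/8, so that 4 v (1 - v) <= 1/2. *)
Lemma weight_head V0 n : 8 * lnn V0 <= N%:R -> (0 < n <= V0)%N -> weight n <= 2 ^- m.
Proof.
move=> hV /andP[n0 nV]; rewrite -exprVn /weight.
have /andP[b0 b1] := parabola_01 (pw_01 n); have /andP[v0 v1] := pw_01 n.
apply: lerXn2r; rewrite ?nnegrE ?invr_ge0 //.
have /andP[c0 c1] := onesub_pw_le n (ltW h0).
have : h * lnn n <= 8^-1.
  rewrite mulrC ler_pdivrMr //; have := @lnn_le R n V0 n0 nV; lra.
move=> c2; have c3 := le_trans c1 c2.
have : pw h n * (1 - pw h n) <= 1 * 8^-1 by exact: ler_pM.
lra.
Qed.

Notation a2 := ((2 * N%:R)^-1 : R).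

(** For n >= 2^(6N) the square root of v is at most 1/8, so 4 v <= (1/2) v^(1/2). One factor v^(1/2)
    is kept for the convergence of the tail. *)
Lemma weight_tail n : (2 ^ (6 * N) <= n)%N -> weight n <= 2 ^- m * pw a2 n.
Proof.
move=> hn; have a0 : 0 <= a2 by rewrite invr_ge0 mulr_ge0.
have /andP[b0 b1] := parabola_01 (pw_01 n); have /andP[v0 v1] := pw_01 n.
have sq : pw h n = pw a2 n ^+ 2 by rewrite pwXn invfM mulrA divff ?mul1r // pnatr_eq0.
have s8 : pw a2 n <= 8^-1.
  apply: (@le_trans _ _ (pw a2 (2 ^ (6 * N)))); first by apply: pw_le; rewrite ?expn_gt0.
  rewrite /pw lnnX // (_ : - (a2 * ((6 * N)%:R * lnn 2)) = - (3%:R * lnn 2)); last first.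
    by rewrite natrM; field; rewrite pnatr_eq0 -lt0n.
  by rewrite expRN -expR_lnn2.
have p0 := pw_ge0 a2 n; have p1 := pw_le1 n a0.
apply: (@le_trans _ _ ((2^-1 * pw a2 n) ^+ m)).
  have q0 : 0 <= 2^-1 * pw a2 n by rewrite mulr_ge0 // invr_ge0.
  apply: lerXn2r; rewrite ?nnegrE //.
  have : pw h n * (1 - pw h n) <= pw h n * 1 by apply: ler_wpM2l => //; lra.
  rewrite mulr1 sq expr2 => e1.
  have : pw a2 n * pw a2 n <= 8^-1 * pw a2 n by exact: ler_wpM2r.
  lra.
rewrite exprMn exprVn ler_wpM2l ?invr_ge0 ?exprn_ge0 //.
by case: (m) m0 => // m' _; rewrite exprS -[X in _ <= X]mulr1 ler_wpM2l // exprn_ile1.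
Qed.

Lemma tail_sum X Y : X = (2 ^ (6 * N))%N ->
  \sum_(1 <= n < Y.+1) (if (X < n)%N then mangoldt n * (weight n / n%:R) else 0) <= 2 ^- m * (20 * N%:R ^+ 2).
Proof.
move=> eX; pose a4 : R := (4 * N%:R)^-1.
have a40 : 0 < a4 by rewrite invr_gt0 mulr_gt0.
have p2 : 0 <= 2 ^- m :> R by rewrite invr_ge0 exprn_ge0.
have N1 : 1 <= N%:R :> R by rewrite ler1n.
apply: (@le_trans _ _ (\sum_(1 <= n < Y.+1) 2 ^- m * (4 * N%:R * pw (1 + a4) n))).
  apply: ler_sum_nat => n /andP[n0 _]; case: ifP => nX; last by rewrite !mulr_ge0 ?pw_ge0.
  have w := weight_tail (n := n); rewrite -eX in w; have {}w := w (ltnW nX).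
  have /andP[w0 _] := weight_01 n; have n0R : 0 < n%:R :> R by rewrite ltr0n.
  apply: (@le_trans _ _ (lnn n * (2 ^- m * pw a2 n / n%:R))).
    apply: ler_pM; rewrite ?mangoldt_ge0 ?mangoldt_le ?divr_ge0 ?(ltW n0R) //.
    by rewrite ler_wpM2r ?invr_ge0 ?(ltW n0R).
  have -> : a2 = a4 + a4 by rewrite /a4; field; rewrite lt0r_neq0.
  rewrite !pwD pw1 // (_ : lnn n * _ = 2 ^- m * (lnn n * pw a4 n * (n%:R^-1 * pw a4 n))); last by ring.
  apply: ler_wpM2l => //; apply: ler_wpM2r; first by rewrite mulr_ge0 ?invr_ge0 ?pw_ge0.
  by have := lnn_pw_le n a40; rewrite {2}/a4 invrK.
rewrite -mulr_sumr -mulr_sumr; apply: ler_wpM2l => //.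
have s := @sum_pw_full R a4 Y a40; rewrite {2}/a4 invrK in s.
apply: le_trans (ler_wpM2l _ s) _; first exact: mulr_ge0.
have : N%:R * 1 <= N%:R * N%:R :> R by rewrite ler_wpM2l.
by rewrite mulr1 expr2; lra.
Qed.

Lemma head_sum V0 X Y : 8 * lnn V0 <= N%:R -> (V0 <= X)%N ->
  \sum_(1 <= n < Y.+1) (if (n <= V0)%N then mangoldt n * (weight n / n%:R) else 0) <= 2 ^- m * logX R X ^+ 2.
Proof.
move=> hV VX; have p2 : 0 <= 2 ^- m :> R by rewrite invr_ge0 exprn_ge0.
have L1 := logX_ge1 R X; have L0 : 0 <= logX R X by exact: le_trans L1.
have nn (n : nat) : 0 <= mangoldt n * (weight n / n%:R).
  by rewrite mulr_ge0 ?mangoldt_ge0 // divr_ge0 //; case/andP: (weight_01 n).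
apply: (@le_trans _ _ (\sum_(1 <= n < V0.+1) mangoldt n * (weight n / n%:R))).
  rewrite -(@sum_interval_restrict R (maxn Y V0) 1 V0.+1) //; last by rewrite ltnS leq_maxr.
  rewrite [X in _ <= X](big_cat_nat (n := Y.+1)) //=; last by rewrite ltnS leq_maxl.
  apply: ler_wpDr; first by apply: sumr_ge0 => n _; case: ifP.
  by apply: ler_sum_nat => n /andP[-> _]; rewrite ltnS.
apply: (@le_trans _ _ (\sum_(1 <= n < V0.+1) logX R X * 2 ^- m * n%:R^-1)).
  apply: ler_sum_nat => n /andP[n0 nV]; rewrite mulrA; apply: ler_wpM2r; first by rewrite invr_ge0.
  apply: ler_pM; rewrite ?mangoldt_ge0 //; first by case/andP: (weight_01 n).
    apply: le_trans (mangoldt_le _ _) _; apply: (@le_trans _ _ (lnn X)); last by rewrite lerDr.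
    by apply: lnn_le => //; exact: leq_trans VX.
  by apply: (weight_head hV); rewrite n0.
rewrite -mulr_sumr expr2 mulrA [2 ^- m * _]mulrC; apply: ler_wpM2l; first exact: mulr_ge0.
apply: le_trans (harmonic_le _ _) _; rewrite lerD2l; case: (posnP V0) => [->|V00].
  by rewrite {1}/lnn ln0 // lnn_ge0.
exact: lnn_le.
Qed.

Lemma Psum_weight Y (chi : nat -> C) :
  \sum_(1 <= n < Y.+1) (mangoldt n * (weight n / n%:R))%:C * chi n = (4 ^+ m)%:C * Psum Y chi (1 + m%:R * h) h m.
Proof.
rewrite /Psum mulr_sumr; apply: eq_big_nat => n /andP[n0 _].
have -> : mangoldt n * (weight n / n%:R) = 4 ^+ m * (mangoldt n * logweight (1 + m%:R * h) h m 0 n).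
  rewrite /logweight /weight expr0 mulr1 pwD pw1 // -pwXn !exprMn; ring.
by rewrite rmorphM /=; ring.
Qed.

(** Characters control the sum over all n up to a large truncation; the parts n <= V0 and n > X are
    then removed by the decay 2^(-m) of the weight on both sides. *)
Lemma twisted_mean q (H : nat -> R) V0 X (T : R) : (0 < q)%N -> X = (2 ^ (6 * N))%N -> (V0 <= X)%N ->
  8 * lnn V0 <= N%:R ->
  periodic q H -> (forall n, ~~ coprime n q -> H n = 0) -> (forall n, `|H n| <= 1) -> 0 <= T ->
  (forall chi, dchar q chi -> \sum_(0 <= a < q) (H a)%:C * Num.conj (chi a) != 0 ->
     exists X0, forall Y, (X0 <= Y)%N -> normc (Psum Y chi (1 + m%:R * h) h m) <= T) ->
  `|\sum_(1 <= n < X.+1) (if (V0 < n)%N then mangoldt n * (H n * (weight n / n%:R)) else 0)| <=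
   q%:R * (4 ^+ m * T) + 2 ^- m * (logX R X ^+ 2 + 20 * N%:R ^+ 2).
Proof.
move=> q0 eX VX hV pH Hu H1 T0 hchi.
have p4 : 0 <= 4 ^+ m :> R by exact: exprn_ge0.
have [|Y0 hY] := fourier_bound q0 (c := fun n => mangoldt n * (weight n / n%:R)) pH Hu H1 (mulr_ge0 p4 T0).
  move=> chi dc nz; have [X0 hX] := hchi chi dc nz; exists X0 => Y XY.
  by rewrite Psum_weight normcM normcR (ger0_norm p4) ler_wpM2l // hX.
have {hY} := hY (maxn Y0 X) (leq_maxl _ _); set Y := maxn Y0 X => hY.
have XY : (X.+1 <= Y.+1)%N by rewrite ltnS leq_maxr.
pose F n : R := mangoldt n * (weight n / n%:R).
have F0 n : 0 <= F n.
  by rewrite mulr_ge0 ?mangoldt_ge0 // divr_ge0 //; case/andP: (weight_01 n).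
have -> : \sum_(1 <= n < X.+1) (if (V0 < n)%N then mangoldt n * (H n * (weight n / n%:R)) else 0) =
   \sum_(1 <= n < Y.+1) F n * H n - \sum_(1 <= n < Y.+1) (if (n <= V0)%N then F n * H n else 0)
    - \sum_(1 <= n < Y.+1) (if (X < n)%N then F n * H n else 0).
  rewrite -!sumrB -(@sum_interval_restrict R Y 1 X.+1) //; apply: eq_big_nat => n /andP[n0 _].
  rewrite n0 /= ltnS /F; case: (leqP n X) => nX; case: (leqP n V0) => nV; try ring.
  by move: (leq_ltn_trans VX nX); rewrite ltnNge nV.
have bnd (P : pred nat) : `|\sum_(1 <= n < Y.+1) (if P n then F n * H n else 0)| <=
    \sum_(1 <= n < Y.+1) (if P n then F n else 0).
  apply: le_trans (ler_norm_sum _ _ _) _; apply: ler_sum => n _; case: ifP => _; last by rewrite normr0.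
  by rewrite normrM (ger0_norm (F0 n)) -[X in _ <= X]mulr1 ler_wpM2l.
apply: le_trans (ler_normB _ _) _; apply: le_trans (lerD (ler_normB _ _) (lexx _)) _.
have b1 := le_trans (bnd (fun n => n <= V0)%N) (head_sum Y hV VX).
have b2 := le_trans (bnd (fun n => X < n)%N) (tail_sum Y eX).
by rewrite mulrDr addrA; apply: lerD => //; apply: lerD.
Qed.

End Weight.

(** * Prime sums for small moduli at a scale without exceptional character *)

Section SmallModuli.
Variable R : realType.
Local Notation C := R[i].
Local Open Scope complex_scope.
Notation lnn := (lnn R).
Notation mangoldt := (mangoldt R).
Variables (W beta t : nat).
Hypothesis W0 : (0 < W)%N.
Notation K := (Kscale R W beta t).
Hypothesis noexc : forall e (chi : nat -> C), ~ exceptional W beta t e chi.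

Lemma Psum_small m (h : R) e (chi : nat -> C) : (0 < m)%N -> 0 < h -> 2 * m%:R * h <= sep_eta K ->
  (0 < e <= 2 ^ (beta * t))%N -> squarefree e -> coprime e W -> dchar (W * e) chi ->
  nonprincipal (W * e) chi -> full_char W e chi ->
  exists X0, forall Y, (X0 <= Y)%N ->
    normc (Psum Y chi (1 + m%:R * h) h m) <= h ^+ m * (m`!%:R * (4 / sep_eta K) ^+ m.+1).
Proof.
move=> m0 h0 mh be sqe ce dc np fc; have K26 : 26 <= K by exact: Kscale_ge26.
have K0 : 0 < K by apply: lt_le_trans K26.
have [e0 e1 _] := sep_eta_bounds K26.
have qK : logK R (W * e) <= K.
  case/andP: (be) => e_gt0 e_le.
  have be2 : (0 < e <= 2 ^ (beta * t.+1))%N.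
    by rewrite e_gt0 (leq_trans e_le) // leq_exp2l // leq_mul2l leqnSn orbT.
  apply: le_trans (Kscale_logK R W0 be be2).
  rewrite /logK lerD2r ler_wpM2l // lnn_le ?muln_gt0 ?W0 ?e_gt0 // -[X in (X <= _)%N]muln1 leq_mul2l.
  by rewrite [(1 <= _)%N]muln_gt0 W0 e_gt0 orbT.
have cm := dchar_cmult dc; have os := dchar_oscillating dc np.
have nL : ~ Lsmall chi (4 * sep_eta K * K ^+ 2).
  by move=> ls; apply: (noexc (e := e) (chi := chi)); split.
have [X1 hX1] := Lser_lower cm os qK (introT andP (conj e0 e1)) nL.
have kap0 : 0 < sep_eta K * K ^+ 2 by rewrite mulr_gt0 // exprn_gt0.
have -> : 4 / sep_eta K = 4 * K ^+ 2 / (sep_eta K * K ^+ 2) by field; rewrite !lt0r_neq0.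
apply: (twisted_prime_small cm os qK kap0 m0 h0); first exact: le_trans mh e1.
exists X1 => X hX s /andP[s1 s2]; apply: hX1 => //; rewrite s1 /=.
by apply: le_trans s2 _; rewrite lerD2l.
Qed.

(** With m! <= m^m the left-hand side is at most P (4 h m P)^m for P = 4/eta, and 4 h m P <= 1/2 is
    the hypothesis 32 m h <= eta. *)
Lemma twisted_size m (h : R) : 0 < h -> 32 * m%:R * h <= sep_eta K ->
  4 ^+ m * (h ^+ m * (m`!%:R * (4 / sep_eta K) ^+ m.+1)) <= 4 / sep_eta K * 2 ^- m.
Proof.
move=> h0 mh; have [e0 e1 _] := sep_eta_bounds (Kscale_ge26 R W beta t).
set P := 4 / sep_eta K; have P0 : 0 < P by rewrite divr_gt0.
have mf : m`!%:R <= m%:R ^+ m :> R.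
  rewrite -natrX ler_nat; elim: (m) => // j IH; rewrite factS expnS leq_mul //.
  by apply: leq_trans IH _; case: j => // j; rewrite leq_exp2r.
apply: (@le_trans _ _ (P * (4 * h * m%:R * P) ^+ m)).
  have expr4 (x y z w : R) : (x * y * z * w) ^+ m = x ^+ m * y ^+ m * z ^+ m * w ^+ m by rewrite !exprMn.
  rewrite expr4 (_ : 4 ^+ m * (h ^+ m * (m`!%:R * P ^+ m.+1)) = P * (4 ^+ m * h ^+ m * m`!%:R * P ^+ m)); last first.
    by rewrite exprS; ring.
  apply: ler_wpM2l; first exact: ltW.
  apply: ler_wpM2r; first by rewrite exprn_ge0 // ltW.
  by apply: ler_wpM2l => //; rewrite mulr_ge0 ?exprn_ge0 // ltW.
apply: ler_wpM2l; first exact: ltW.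
rewrite -exprVn; apply: lerXn2r; rewrite ?nnegrE ?invr_ge0 //.
  by rewrite mulr_ge0 ?(ltW P0) // mulr_ge0 // mulr_ge0 // ltW.
rewrite /P mulrA ler_pdivrMr //; lra.
Qed.

End SmallModuli.

(** * Characters occurring in a product of local factors *)

Section FullCharacter.
Variable R : realType.
Local Notation C := R[i].
Local Open Scope complex_scope.
Variables (Z W a : nat).
Local Notation T := 'I_Z.
Implicit Types (B : {set T}) (i : T -> nat).
Hypotheses (W0 : (0 < W)%N) (aW : coprime a W).

Definition class_fun i B n : R := (if (n == a %[mod W])%N then 1 else 0) * locprod R i B n.

Lemma class_fun_periodic i B : (forall q, q \in B -> prime q) -> periodic (W * modulus B) (class_fun i B).
Proof.
move=> pB n; rewrite /class_fun; congr (_ * _).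
  by rewrite -modnDmr modnMr addn0.
by rewrite (periodicM _ _ (locprod_periodic R i B)).
Qed.

Lemma class_fun_le1 i B n : admissible W i -> (forall q, q \in B -> sievable W q) -> `|class_fun i B n| <= 1.
Proof.
move=> ad sB; have h := @locprod_le1 R Z W i B n ad sB; rewrite /class_fun.
by case: ifP => _; rewrite ?mul1r // mul0r normr0.
Qed.

Lemma class_fun0 i B n : admissible W i -> (forall q, q \in B -> sievable W q) ->
  ~~ coprime n (W * modulus B) -> class_fun i B n = 0.
Proof.
move=> ad sB; rewrite coprimeMr negb_and => /orP[nW|nB]; last by rewrite /class_fun (locprod0 R ad sB nB) mulr0.
rewrite /class_fun; case: eqP => [e|_]; last by rewrite mul0r.
by case/negP: nW; rewrite -coprime_modl e coprime_modl.
Qed.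

Lemma coprime_class_mul (q n n' : nat) : (0 < q)%N -> coprime n q -> coprime n' q ->
  exists u, coprime u q /\ n = (n' * u)%N %[mod q].
Proof.
move=> q0 cn cn'; have [v cv vv] := inverse_mod cn'.
exists (v * n)%N; split; first by rewrite coprimeMl cv.
by rewrite mulnA -modnMml vv modnMml mul1n.
Qed.

(* Were chi trivial on the units that are 1 modulo W * (modulus B / p), it would agree, where the
   local factor at p does not vanish, with a function of period W * (modulus B / p), and the
   local factor has mean zero. *)
Lemma full_char_of_coef i B (chi : nat -> C) : admissible W i -> (forall q, q \in B -> sievable W q) ->
  dchar (W * modulus B) chi ->
  \sum_(0 <= n < W * modulus B) (class_fun i B n)%:C * Num.conj (chi n) != 0 ->
  full_char W (modulus B) chi.
Proof.
move=> ad sB dc nz p pp pB.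
have pr r : r \in B -> prime r by move=> /sB /andP[].
have [q qB eq] := dvdn_modulus pp pr pB; subst p.
apply: boolp.contrapT => H; case/negP: nz; apply/eqP.
have triv u : coprime u (W * modulus B) -> u = 1 %[mod W * (modulus B %/ q)] -> chi u = 1.
  by move=> cu u1; apply: boolp.contrapT => h; apply: H; exists u; split=> //; apply/eqP.
have q0 : (0 < q)%N by exact: prime_gt0.
have eB : (modulus B %/ q = modulus (B :\ q))%N by rewrite (modulusD1 qB) mulKn.
rewrite eB in triv; set Q := (W * modulus (B :\ q))%N in triv.
have eQ : (W * modulus B = Q * q)%N by rewrite /Q (modulusD1 qB) mulnCA mulnC.
have pr' r : r \in B :\ q -> prime r by rewrite inE => /andP[_ /pr].
have Q0 : (0 < Q)%N by rewrite muln_gt0 W0 modulus_gt0.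
have cop : coprime Q q.
  rewrite coprimeMl coprime_modulus ?inE ?eqxx // andbT coprime_sym prime_coprime //.
  by case/andP: (sB q qB).
rewrite eQ in dc triv *.
pose lift n := chinese Q q n 1.
pose chi' n := Num.conj (chi (lift n)).
have liftQ n : lift n = n %[mod Q] by exact: chinese_modl.
have liftq n : lift n = 1 %[mod q] by exact: chinese_modr.
have Qq0 : (0 < Q * q)%N by rewrite muln_gt0 Q0.
have chi'_per : periodic Q chi'.
  move=> n; rewrite /chi'; congr Num.conj.
  apply: (periodic_congr (dchar_periodic dc)); apply/eqP.
  by rewrite chinese_remainder // !liftQ !liftq modnDr !eqxx.
have cQ n : coprime (lift n) (Q * q) = coprime n Q.
  rewrite coprimeMr -(coprime_modl _ Q) liftQ coprime_modl -(coprime_modl _ q) liftq coprime_modl.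
  by rewrite coprime1n andbT.
have agree n : ~~ (q %| n)%N -> chi n = chi (lift n).
  move=> qn; have cnq : coprime n q by rewrite coprime_sym prime_coprime.
  case: (boolP (coprime n Q)) => cn; last first.
    rewrite (dchar_nunit dc); last by rewrite coprimeMr negb_and cn.
    by rewrite (dchar_nunit dc) // cQ.
  have c1 : coprime n (Q * q) by rewrite coprimeMr cn.
  have c2 : coprime (lift n) (Q * q) by rewrite cQ.
  have [u [cu nu]] := coprime_class_mul Qq0 c1 c2.
  rewrite (periodic_congr (dchar_periodic dc) nu) (dcharM dc) (triv u) ?mulr1 //.
  have : (lift n * u == n %[mod Q])%N.
    have dQ : (Q %| Q * q)%N by rewrite dvdn_mulr.
    by apply/eqP; rewrite -(modn_dvdm (lift n * u) dQ) -nu (modn_dvdm n dQ).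
  have cl : coprime (lift n) Q by move: c2; rewrite coprimeMr => /andP[].
  rewrite -modnMml liftQ modnMml -[X in (_ == X %[mod _])%N]muln1.
  wlog u1 : / (1 <= u)%N => [Wl|].
    case: (posnP u) => [u0|]; last exact: Wl.
    move: cu; rewrite u0 /coprime gcd0n muln_eq1 => /andP[_ /eqP q1].
    by have := prime_gt1 (pr q qB); rewrite q1.
  move=> E; apply/eqP; rewrite eqn_mod_dvd //; move: E.
  by rewrite eqn_mod_dvd ?leq_mul2l ?u1 ?orbT // -mulnBr Gauss_dvdr // coprime_sym.
pose f n : C := (class_fun i (B :\ q) n)%:C * chi' n.
pose lf n : C := (locfun R i q n)%:C.
rewrite (eq_bigr (fun n => f n * lf n)).
  rewrite (crt_sum Q0 q0 cop).
  - rewrite /lf -rmorph_sum /= [X in _ * X%:C](_ : _ = 0) ?rmorph0 ?mulr0 //.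
    have := @sum_locfun R Z i q 1 (pr q qB) (ad q (sB q qB)).
    by move=> h; rewrite -[RHS]h; apply: eq_bigr => x _; rewrite mul1n.
  - by move=> n; rewrite /f chi'_per (class_fun_periodic i pr').
  - by move=> n; rewrite /lf locfun_periodic.
move=> n _; rewrite /f /lf /class_fun /locprod (big_setD1 q qB) /=.
case: (boolP (q %| n)%N) => qn.
  by rewrite locfun0 ?mul0r ?mulr0 ?rmorph0 ?mul0r ?mulr0 //; exact: ad (sB q qB).
by rewrite agree // /chi' !rmorphM /=; ring.
Qed.

Lemma modulus_squarefree B : (forall q, q \in B -> prime q) -> squarefree (modulus B).
Proof.
move=> pB p pp; apply/negP => d; have dp : (p %| modulus B)%N by apply: dvdn_trans d; rewrite dvdn_exp.
have [q qB eq] := dvdn_modulus pp pB dp.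
move: d; rewrite -eq (modulusD1 qB) expnS expn1 dvdn_pmul2l ?prime_gt0 ?pB // => d.
have pB' r : r \in B :\ q -> prime r by rewrite inE => /andP[_ /pB].
have := @coprime_modulus Z (B :\ q) q (pB q qB); rewrite !inE eqxx => /(_ isT pB').
by rewrite coprime_sym prime_coprime ?pB // d.
Qed.

Lemma modulus_coprime B : (forall q, q \in B -> sievable W q) -> coprime (modulus B) W.
Proof.
move=> sB; rewrite /modulus; elim/big_ind: _ => [|x y hx hy|q /sB /andP[pq qW]].
- exact: coprime1n.
- by rewrite coprimeMl hx.
- by rewrite prime_coprime.
Qed.

End FullCharacter.

(** * Small residuals and the lower bound of the main residual *)

Section ResidualBounds.
Variable R : realType.
Local Notation C := R[i].
Local Open Scope complex_scope.
Notation lnn := (lnn R).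
Notation mangoldt := (mangoldt R).
Variables (Z W a beta t N m V0 X : nat).
Local Notation T := 'I_Z.
Implicit Types (B : {set T}) (i : T -> nat).
Notation K := (Kscale R W beta t).
Notation g := (weight R N m).
Hypotheses (W0 : (0 < W)%N) (aW : coprime a W) (N0 : (0 < N)%N) (m0 : (0 < m)%N).
Hypotheses (eX : X = (2 ^ (6 * N))%N) (VX : (V0 <= X)%N) (hV : 8 * lnn V0 <= N%:R).
Hypothesis noexc : forall e (chi : nat -> C), ~ exceptional W beta t e chi.
Hypothesis mK : 32 * m%:R / N%:R <= sep_eta K.

Let mh : 2 * m%:R * N%:R^-1 <= sep_eta K.
Proof.
apply: le_trans mK; apply: ler_wpM2r; first by rewrite invr_ge0.
by apply: ler_wpM2r => //; rewrite ler_nat.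
Qed.

Let h0 : 0 < N%:R^-1 :> R. Proof. by rewrite invr_gt0 ltr0n. Qed.

Definition mean_error (q : nat) : R :=
  q%:R * (4 / sep_eta K * 2 ^- m) + 2 ^- m * (logX R X ^+ 2 + 20 * N%:R ^+ 2).

Lemma mean_small q (H : nat -> R) : (0 < q)%N -> periodic q H ->
  (forall n, ~~ coprime n q -> H n = 0) -> (forall n, `|H n| <= 1) ->
  (forall chi, dchar q chi -> \sum_(0 <= b < q) (H b)%:C * Num.conj (chi b) != 0 ->
     exists e, [/\ q = (W * e)%N, (0 < e <= 2 ^ (beta * t))%N, squarefree e, coprime e W &
       nonprincipal q chi /\ full_char W e chi]) ->
  `|\sum_(1 <= n < X.+1) (if (V0 < n)%N then mangoldt n * (H n * (g n / n%:R)) else 0)| <= mean_error q.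
Proof.
move=> q0 pH Hu H1 hchi.
have [e0 e1 _] := sep_eta_bounds (Kscale_ge26 R W beta t).
pose T0 : R := N%:R^-1 ^+ m * (m`!%:R * (4 / sep_eta K) ^+ m.+1).
have T00 : 0 <= T0.
  by apply: mulr_ge0; [apply/exprn_ge0/ltW | apply: mulr_ge0 => //; apply: exprn_ge0; apply: divr_ge0 => //; exact: ltW].
have [|] := boolp.EM (forall chi, dchar q chi -> \sum_(0 <= b < q) (H b)%:C * Num.conj (chi b) != 0 ->
     exists X0, forall Y, (X0 <= Y)%N -> normc (Psum Y chi (1 + m%:R * N%:R^-1) N%:R^-1 m) <= T0).
  move=> hT; apply: le_trans (twisted_mean N0 m0 q0 eX VX hV pH Hu H1 T00 hT) _.
  rewrite lerD2r; apply: ler_wpM2l => //; have ts := twisted_size h0 mK; exact: ts.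
case=> chi dc nz; have [e [eq be sqe ce [np fc]]] := hchi chi dc nz.
by apply: (Psum_small W0 noexc m0 h0 mh be sqe ce); rewrite -?eq.
Qed.

Lemma residual_small i B : admissible W i -> (forall q, q \in B -> sievable W q) -> B != set0 ->
  (modulus B <= 2 ^ (beta * t))%N -> `|residual W X V0 a g i B| <= mean_error (W * modulus B).
Proof.
move=> ad sB /set0Pn[q qB] mB; have pB r : r \in B -> prime r by move=> /sB /andP[].
have M0 : (0 < modulus B)%N by exact: modulus_gt0.
rewrite (_ : residual W X V0 a g i B =
  \sum_(1 <= n < X.+1) (if (V0 < n)%N then mangoldt n * (class_fun R W a i B n * (g n / n%:R)) else 0)); last first.
  apply: eq_big_nat => n /andP[_ nX]; rewrite /sieve_weight /class_fun -[(n <= X)%N]ltnS nX andbT.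
  case: (V0 < n)%N => /=; last by rewrite mulr0.
  by case: ifP => _; ring.
apply: mean_small.
- by rewrite muln_gt0 W0.
- exact: class_fun_periodic.
- by move=> n; exact: class_fun0.
- by move=> n; exact: class_fun_le1.
move=> chi dc nz; exists (modulus B); split=> //; first by rewrite M0.
- exact: modulus_squarefree.
- exact: modulus_coprime.
have fc := full_char_of_coef W0 ad sB dc nz; split=> //.
have d : (q %| modulus B)%N by rewrite (modulusD1 qB) dvdn_mulr.
by have [u [cu _ h]] := fc q (pB q qB) d; exists u.
Qed.

(** Euler's totient of W. *)
Definition unit_count : R := \sum_(0 <= n < W) (if coprime n W then 1 else 0).

Lemma unit_count_ge1 : 1 <= unit_count.
Proof.
rewrite /unit_count (big_rem (a %% W)%N) ?mem_index_iota ?ltn_pmod //= coprime_modl aW.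
by rewrite lerDl sumr_ge0 // => n _; case: ifP.
Qed.

Lemma unit_count_le : unit_count <= W%:R.
Proof.
apply: (@le_trans _ _ (\sum_(0 <= n < W) 1)); last by rewrite sumr_const_nat subn0.
by apply: ler_sum => n _; case: ifP.
Qed.

(** Subtracting the mean over the units removes the principal character. The other characters modulo
    W fit [mean_small] with e = 1, where [full_char] is vacuous. *)
Lemma class_mean_small :
  `|\sum_(1 <= n < X.+1) (if (V0 < n)%N then mangoldt n *
     (((if (n == a %[mod W])%N then 1 else 0) - (if coprime n W then 1 else 0) / unit_count) * (g n / n%:R)) else 0)|
   <= mean_error W.
Proof.
have u1 := unit_count_ge1; have u0 : 0 < unit_count by exact: lt_le_trans u1.
have ui : 0 <= unit_count^-1 <= 1 by rewrite invr_ge0 (ltW u0) invf_le1.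
have cW n : (n == a %[mod W])%N -> coprime n W by move=> /eqP e; rewrite -coprime_modl e coprime_modl.
apply: mean_small => //.
- by move=> n; rewrite modnDr -(coprime_modl (n + W)) modnDr coprime_modl.
- move=> n nc; rewrite (negbTE nc) mul0r subr0; case: ifP => // /cW h; by rewrite h in nc.
- move=> n; move: ui => /andP[h1 h2]; rewrite ler_norml.
  by case: ifP => _; case: ifP => _; rewrite ?mul1r ?mul0r; apply/andP; split; lra.
move=> chi dc nz; exists 1%N; rewrite muln1 expn_gt0; split=> //; last split.
- by move=> p pp; rewrite gtnNdvd // -(expn0 p) ltn_exp2l // prime_gt1.
- exact: coprime1n.
- apply: boolp.contrapT => H; case/negP: nz; apply/eqP.
  have triv n : coprime n W -> chi n = 1.
    by move=> cn; apply: boolp.contrapT => h; apply: H; exists n => //; apply/eqP.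
  have e n : ((if (n == a %[mod W])%N then 1 else 0) - (if coprime n W then 1 else 0) / unit_count : R)%:C * Num.conj (chi n)
    = ((if (n == a %[mod W])%N then 1 else 0) - (if coprime n W then 1 else 0) / unit_count : R)%:C.
    case: (boolP (coprime n W)) => cn; first by rewrite triv // rmorph1 mulr1.
    case: ifP => [/cW h|_]; first by rewrite h in cn.
    by rewrite mul0r subr0 rmorph0 mul0r.
  under eq_bigr do rewrite e.
  rewrite -rmorph_sum /= sumrB -mulr_suml -/unit_count divff ?lt0r_neq0 //.
  rewrite [X in (X - 1)%:C](_ : _ = 1) ?subrr //.
  rewrite (big_rem (a %% W)%N) ?mem_index_iota ?ltn_pmod //= modn_mod eqxx.
  rewrite big_seq_cond big1 ?addr0 // => n; rewrite andbT mem_rem_uniq ?iota_uniq // !inE mem_index_iota.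
  case/andP=> [na /andP[_ nW]]; by rewrite modn_small // (negbTE na).
- by move=> p pp; rewrite dvdn1 => /eqP p1; move: pp; rewrite p1.
Qed.

Variable N1 : nat.
Hypothesis (N1m : (4 * m * N1 <= N)%N) (V2 : (V0 <= 2 ^ N)%N).

(** Write 4 v (1 - v) = 1 - (1 - 2v)^2. On the window 0 <= 1 - 2v <= 1/(4m), and Bernoulli's
    inequality gives at least 1 - 1/16. *)
Lemma weight_window n : (2 ^ N <= n <= 2 ^ (N + N1))%N -> 2^-1 <= g n.
Proof.
move=> /andP[n1 n2]; have N0R : 0 < N%:R :> R by rewrite ltr0n.
have n0 : (0 < n)%N by apply: leq_trans n1; rewrite expn_gt0.
have m1 : 1 <= m%:R :> R by rewrite ler1n.
pose v : R := pw N%:R^-1 n.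
have el : lnn 2 > 0 by apply: lt_le_trans (lnn2_ge R); rewrite invr_gt0.
have e2 : expR (lnn 2) = 2%:R by rewrite expR_lnn.
have v1 : v <= 2^-1.
  apply: le_trans (pw_le (ltW h0) (_ : 0 < 2 ^ N)%N n1) _; first by rewrite expn_gt0.
  by rewrite /pw lnnX // mulrA mulVf ?lt0r_neq0 // mul1r expRN e2.
have v2 : 1 - 2 * v <= (4 * m%:R)^-1.
  have h : 2^-1 * (1 - (4 * m%:R)^-1) <= v; last by lra.
  apply: le_trans (pw_le (ltW h0) n0 n2).
  rewrite /pw lnnX // natrD (_ : - (N%:R^-1 * ((N%:R + N1%:R) * lnn 2)) = - lnn 2 + - (N1%:R / N%:R * lnn 2)); last first.
    by field; rewrite lt0r_neq0.
  rewrite expRD expRN e2; apply: ler_wpM2l; first by rewrite invr_ge0.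
  apply: le_trans (expR_ge1Dx _); rewrite lerD2l lerN2.
  have r0 : 0 <= N1%:R / N%:R :> R by rewrite divr_ge0 // ltW.
  apply: (@le_trans _ _ (N1%:R / N%:R * 1)); first by rewrite ler_wpM2l // lnn2_le1.
  rewrite mulr1 ler_pdivrMr // -(@ler_pM2l _ (4 * m%:R)) ?mulr_gt0 ?ltr0n // mulrA divff ?mul1r; last first.
    by rewrite mulf_neq0 // ?pnatr_eq0 // -lt0n.
  by rewrite -natrM -natrM ler_nat.
have v3 : 0 <= 1 - 2 * v by lra.
rewrite /weight -/v.
have -> : 4 * (v * (1 - v)) = 1 - (1 - 2 * v) ^+ 2 by ring.
pose s : R := (1 - 2 * v) ^+ 2.
have s0 : 0 <= s by exact: sqr_ge0.
have s1 : s <= (4 * m%:R)^-1 * 4^-1.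
  rewrite /s expr2; apply: ler_pM => //; apply: le_trans v2 _.
  by rewrite lef_pV2 ?posrE ?mulr_gt0 ?ltr0n // ler_peMr.
have mi : m%:R^-1 <= 1 :> R by rewrite invf_le1 ?ltr0n.
have s2 : s <= 1.
  apply: le_trans s1 _; rewrite invfM; lra.
have ber : 1 - m%:R * s <= (1 - s) ^+ m.
  elim: (m) => [|j IH]; first by rewrite mul0r subr0 expr0.
  rewrite exprS -natr1; apply: (@le_trans _ _ ((1 - s) * (1 - j%:R * s))); last first.
    by apply: ler_wpM2l => //; rewrite subr_ge0.
  rewrite -subr_ge0 (_ : _ - _ = j%:R * s ^+ 2); last by ring.
  by rewrite mulr_ge0 ?sqr_ge0.
apply: le_trans ber; have : m%:R * s <= m%:R * ((4 * m%:R)^-1 * 4^-1) by rewrite ler_wpM2l.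
have -> : m%:R * ((4 * m%:R)^-1 * 4^-1) = 16^-1 :> R by field; rewrite pnatr_eq0 -lt0n.
rewrite -/s; lra.
Qed.

(** By [class_mean_small] the class of a has its share 1/phi(W) of the sum over units. The latter is
    bounded below on (2^N, 2^(N+N1)], where the weight is at least 1/2, by [mertens_window]; log 2
    >= 1/2 gives N1/2 - 5. Nonunits modulo W with mangoldt n <> 0 have a prime factor at most W < Z
    and are absorbed by [bad_sum]. *)
Lemma main_term : (0 < V0)%N -> (W < Z)%N -> (10 <= N1)%N ->
  (N1%:R / 2 - 5) / (2 * W%:R) - (Z * (6 * N).+1)%:R * logX R X / V0%:R - mean_error W <=
  residual W X V0 a g (fun _ : T => 0%N) set0.
Proof.
move=> V00 WZ N110; have u1 := unit_count_ge1; have uW := unit_count_le.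
have u0 : 0 < unit_count by exact: lt_le_trans u1.
pose F n : R := if (V0 < n)%N then mangoldt n * (g n / n%:R) else 0.
have F0 n : 0 <= F n.
  rewrite /F; case: ifP => // _; rewrite mulr_ge0 ?mangoldt_ge0 // divr_ge0 //.
  by case/andP: (@weight_01 R N m N0 n).
have := class_mean_small; rewrite ler_norml => /andP[S1 _].
set S := \sum_(_ <= _ < _) _ in S1.
have eR : residual W X V0 a g (fun _ : T => 0%N) set0 =
   S + unit_count^-1 * (\sum_(1 <= n < X.+1) (if coprime n W then F n else 0)).
  rewrite /S mulr_sumr -big_split /=; apply: eq_big_nat => n /andP[_ nX].
  rewrite /sieve_weight /locprod big_set0 -[(n <= X)%N]ltnS nX andbT /F.
  case: (V0 < n)%N => /=; last by rewrite !mulr0 add0r; case: ifP => _; rewrite mulr0.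
  by case: ifP => _; case: ifP => _; ring.
have bad : \sum_(1 <= n < X.+1) F n - (Z * (6 * N).+1)%:R * logX R X / V0%:R <=
    \sum_(1 <= n < X.+1) (if coprime n W then F n else 0).
  have XJ : (X < 2 ^ (6 * N).+1)%N by rewrite eX ltn_exp2l.
  have := @bad_sum_le R Z 1 X V0 a g V00 (@weight_01 R N m N0) _ XJ.
  suff : \sum_(1 <= n < X.+1) F n <= \sum_(1 <= n < X.+1) (if coprime n W then F n else 0) + bad_sum Z 1 X V0 a g by lra.
  rewrite /bad_sum -big_split /=; apply: ler_sum_nat => n /andP[n0 nX].
  have bw : base_weight Z 1 X V0 a g n = F n.
    rewrite /base_weight /sieve_weight /F /locprod big_set0 -[(n <= X)%N]ltnS nX andbT !modn1 eqxx andbT.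
    by case: ifP => _; rewrite ?mulr0 // mul1r.
  rewrite bw; case: ifPn => cn; first by rewrite lerDl; case: ifP.
  suff -> : small_factor Z n by rewrite add0r.
  have g1 : (1 < gcdn n W)%N.
    by rewrite ltn_neqAle eq_sym cn gcdn_gt0 n0.
  have gW : (gcdn n W <= W)%N by rewrite dvdn_leq // dvdn_gcdr.
  have qZ : (pdiv (gcdn n W) < Z)%N.
    apply: leq_ltn_trans WZ; apply: leq_trans gW; apply: pdiv_leq; exact: ltnW.
  apply/existsP; exists (Ordinal qZ); rewrite /= pdiv_prime //=.
  by apply: dvdn_trans (pdiv_dvd _) _; rewrite dvdn_gcdl.
have win : (N1%:R / 2 - 5) / 2 <= \sum_(1 <= n < X.+1) F n.
  have A0 : (0 < 2 ^ N)%N by rewrite expn_gt0.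
  have AB : (2 ^ N <= 2 ^ (N + N1))%N by rewrite leq_exp2l // leq_addr.
  have N1N : (N1 <= N)%N by apply: leq_trans N1m; rewrite leq_pmull // muln_gt0.
  have BX : ((2 ^ (N + N1)).+1 <= X.+1)%N by rewrite ltnS eX leq_exp2l //; lia.
  have /andP[h _] := @mertens_window R (2 ^ N) (2 ^ (N + N1)) A0 AB.
  have e : lnn (2 ^ (N + N1)) - lnn (2 ^ N) = N1%:R * lnn 2 by rewrite !lnnX // natrD; ring.
  rewrite e in h.
  have l2 : N1%:R / 2 <= N1%:R * lnn 2 by rewrite ler_wpM2l // lnn2_ge.
  apply: (@le_trans _ _ (\sum_((2 ^ N).+1 <= n < (2 ^ (N + N1)).+1) mangoldt n / n%:R * 2^-1)).
    by rewrite -mulr_suml ler_wpM2r ?invr_ge0 //; lra.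
  rewrite -(@sum_interval_restrict R X (2 ^ N).+1 (2 ^ (N + N1)).+1) //.
  apply: ler_sum => n _; case: ifP => // /andP[n1 n2].
  rewrite /F (leq_ltn_trans V2 n1) mulrAC -mulrA; apply: ler_wpM2l; first exact: mangoldt_ge0.
  apply: ler_wpM2r; first by rewrite invr_ge0.
  by apply: weight_window; rewrite (ltnW n1).
have W0R : 0 < W%:R :> R by rewrite ltr0n.
have N1R : 10 <= N1%:R :> R by rewrite (ler_nat R 10).
have M0 : 0 <= (N1%:R / 2 - 5) / 2 :> R by rewrite divr_ge0 //; lra.
have b0 : 0 <= (Z * (6 * N).+1)%:R * logX R X / V0%:R.
  by rewrite divr_ge0 // mulr_ge0 // (le_trans ler01 (logX_ge1 R X)).
rewrite eR; set bb := _ / V0%:R in bad b0 *; set mm := (_ - 5) / 2 in win M0.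
set SF := \sum_(1 <= n < X.+1) (if coprime n W then F n else 0) in bad *.
have -> : (N1%:R / 2 - 5) / (2 * W%:R) = mm / W%:R by rewrite /mm invfM mulrA.
have ui : W%:R^-1 <= unit_count^-1 <= 1 by rewrite lef_pV2 ?posrE // uW invf_le1.
case/andP: ui => ui1 ui2.
have e1 : unit_count^-1 * (mm - bb) <= unit_count^-1 * SF.
  by apply: ler_wpM2l; [rewrite invr_ge0 ltW | apply: (le_trans _ bad); rewrite lerD2r].
have e2 : mm * W%:R^-1 <= mm * unit_count^-1 by rewrite ler_wpM2l.
have e3 : unit_count^-1 * bb <= 1 * bb by rewrite ler_wpM2r.
rewrite mulrBr in e1; move: S1 e1 e2 e3; rewrite mul1r [mm * unit_count^-1]mulrC.
move: (mean_error W) (unit_count^-1 * SF) (unit_count^-1 * mm) (unit_count^-1 * bb) (mm / W%:R) => x1 x2 x3 x4 x5.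
by move=> *; lra.
Qed.

End ResidualBounds.

(** * Choice of the sieve parameters *)

Section SieveLevel.
Variable R : realType.
Variables (W k0 t : nat).
Local Notation k := k0.+1.
Local Notation M := (2 ^ t)%N.
Local Notation Z := (2 ^ (2 ^ t)).+1.
Local Notation T := 'I_Z.
Notation lnn := (lnn R).
Implicit Types (A B : {set T}) (q : T).
Hypotheses (W0 : (0 < W)%N) (Wk : forall p, prime p -> (p <= k.*2.+1)%N -> (p %| W)%N).
Notation PP := (sieving_primes Z W).
Notation kap := (shift_density R W k0 : T -> R).

(** Squaring the endpoint from block to block makes the sum of 1/q over each block bounded by
    [sum_inv_primes_window], and t blocks reach 2^(2^t). *)
Definition block (j : nat) : {set T} := [set q in PP | (2 ^ (2 ^ j) < q <= 2 ^ (2 ^ j.+1))%N].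
(** The top block allows a bounded number of primes, and each block below two more, which is
    affordable since its primes are smaller. The constant 180 k exceeds the 176 k binary digits lost
    in [block_defect_le] to the products of 1 + 2 kap and of 1/(1 - kap). *)
Definition block_bound (j : nat) : nat := (180 * k + 2 * (t - j.+1))%N.

Lemma block_disjoint j l : (j < l)%N -> [disjoint block j & block l].
Proof.
move=> jl; rewrite -setI_eq0; apply/eqP/setP => q; rewrite !inE; apply/negP.
case/andP=> /andP[_ /andP[_ h1]] /andP[_ /andP[h2 _]].
have : (2 ^ (2 ^ j.+1) <= 2 ^ (2 ^ l))%N by rewrite !leq_exp2l.
by move=> h; have := leq_ltn_trans h1 (leq_ltn_trans h h2); rewrite ltnn.
Qed.

Lemma block_bound_even j : ~~ odd (block_bound j).
Proof. by rewrite /block_bound oddD !oddM. Qed.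

Lemma blocks_cover : blocks block t = PP.
Proof.
have sub s : blocks block s = [set q in PP | (2 < q <= 2 ^ (2 ^ s))%N].
  elim: s => [|s IH].
    rewrite /blocks big_ord0; apply/setP => q; rewrite !inE expn0 expn1.
    by case: ltnP => h; rewrite ?andbF //= leqNgt h andbF.
  rewrite blocksS IH; apply/setP => q; rewrite !inE; case: (sievable W q) => //=.
  have h1 : (2 <= 2 ^ (2 ^ s))%N by rewrite -{1}(expn1 2) leq_exp2l // expn_gt0.
  have h2 : (2 ^ (2 ^ s) <= 2 ^ (2 ^ s.+1))%N by rewrite !leq_exp2l.
  case: (leqP q (2 ^ (2 ^ s))) => h /=; first by rewrite (leq_trans h h2) andbT orbF.
  by rewrite andbF (leq_ltn_trans h1 h).
rewrite sub; apply/setP => q; rewrite inE; case: (boolP (q \in PP)) => //= qP.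
have := sieving_gt Wk qP; have := ltn_ord q; rewrite ltnS => -> h; rewrite andbT.
by apply: leq_trans h; lia.
Qed.

Lemma sum_ord_nat_le (P : pred T) (Q : pred nat) (f : nat -> R) a b : (0 < a <= b)%N -> (forall n, 0 <= f n) ->
  (forall q, P q -> (a <= q < b)%N && Q q) ->
  \sum_(q | P q) f q <= \sum_(a <= n < b | Q n) f n.
Proof.
case/andP=> a0 ab f0 PQ; pose X := maxn Z b; pose F n := if (a <= n < b)%N && Q n then f n else 0.
have F0 n : 0 <= F n by rewrite /F; case: ifP.
have bX : (b <= X.+1)%N by apply: leqW; exact: leq_maxr.
have -> : \sum_(a <= n < b | Q n) f n = \sum_(0 <= n < X.+1) F n.
  rewrite big_mkcond -(@sum_interval_restrict R X a b) // [RHS]big_ltn // /F leqNgt a0 /= add0r.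
  by apply: eq_bigr => n _; case: ifP => //= _; case: ifP.
apply: (@le_trans _ _ (\sum_(0 <= n < Z) F n)).
  rewrite big_mkord big_mkcond; apply: ler_sum => q _; case: ifP => [/PQ h|_ //]; by rewrite /F h.
have ZX : (Z <= X.+1)%N by apply: leqW; exact: leq_maxl.
by rewrite [X in _ <= X](big_cat_nat (n := Z)) //= lerDl sumr_ge0.
Qed.

Lemma block_density j : \sum_(q in block j) kap q <= 22 * k%:R.
Proof.
pose A := (2 ^ (2 ^ j))%N; have A1 : (1 < A)%N by rewrite -{1}(expn0 2) ltn_exp2l // expn_gt0.
have A2 : (A * A = 2 ^ (2 ^ j.+1))%N by rewrite -expnD addnn -mul2n -expnS.
apply: (@le_trans _ _ (\sum_(q in block j) 2 * k%:R * q%:R^-1)).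
  apply: ler_sum => q; rewrite !inE => /andP[sq _].
  have qk := sieving_gt Wk (_ : q \in PP); rewrite /shift_density inE sq.
  have {}qk : (k.*2.+1 < q)%N by apply: qk; rewrite inE.
  have q2 : 2 <= q%:R :> R by rewrite (ler_nat R 2); lia.
  have u0 : 0 < q%:R - 1 :> R by lra.
  have q0 : 0 < q%:R :> R by lra.
  rewrite [2 * _]mulrC -mulrA ler_wpM2l // -ler_pdivrMl // -invfM lef_pV2 ?posrE ?mulr_gt0 ?invr_gt0 //.
  lra.
rewrite -mulr_sumr (_ : 22 * k%:R = 2 * k%:R * 11); last by ring.
apply: ler_wpM2l; first by rewrite mulr_ge0.
apply: le_trans (sum_inv_primes_window R A1).
apply: sum_ord_nat_le => [|n|q]; first by rewrite /= ltnS leq_pmulr // ltnW.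
  by rewrite invr_ge0.
by rewrite !inE => /andP[/andP[-> _]]; rewrite ltnS -A2 => ->.
Qed.

Lemma expR1_le4 : expR 1 <= 4 :> R.
Proof.
have e : 4%:R = expR (lnn 4) :> R by rewrite expR_lnn.
by rewrite e ler_expR -[4%N]/(2 ^ 2)%N lnnX //; have := lnn2_ge R; lra.
Qed.

Lemma expR_le_pow2 j : expR (j%:R) <= 2 ^+ (2 * j) :> R.
Proof.
rewrite exprM -[j%:R]mul1r mulrC expRM_natl; apply: lerXn2r; rewrite ?nnegrE ?expR_ge0 ?exprn_ge0 //.
by apply: le_trans expR1_le4 _; rewrite expr2; lra.
Qed.

Lemma onesub_ge_expR (x : R) : 0 <= x <= 2^-1 -> expR (- (2 * x)) <= 1 - x.
Proof.
move=> /andP[x0 x1]; have h := expR_ge1Dx (2 * x).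
have y0 : 0 < 1 - x by lra.
rewrite expRN -[1 - x]invrK lef_pV2 ?posrE ?expR_gt0 ?invr_gt0 //; apply: le_trans h.
by rewrite -div1r ler_pdivrMr //; nra.
Qed.

Lemma prod_add_le (B : {set T}) (c : nat) (L : nat) : \sum_(q in B) kap q <= L%:R ->
  \prod_(q in B) (1 + c%:R * kap q) <= 2 ^+ (2 * (c * L)).
Proof.
move=> hL; apply: (@le_trans _ _ (expR (\sum_(q in B) c%:R * kap q))).
  rewrite expR_sum; apply: ler_prod => q _; have /andP[h0 _] := kap_bounds R W0 Wk (isT : (0 < 1)%N) (isT : (0 < 1)%N) q.
  by rewrite expR_ge1Dx andbT addr_ge0 // mulr_ge0.
apply: le_trans (expR_le_pow2 _); rewrite ler_expR -mulr_sumr natrM; exact: ler_wpM2l.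
Qed.

Lemma prod_sub_ge (B : {set T}) (L : nat) : \sum_(q in B) kap q <= L%:R ->
  2 ^- (4 * L) <= \prod_(q in B) (1 - kap q).
Proof.
move=> hL; apply: (@le_trans _ _ (expR (\sum_(q in B) - (2 * kap q)))); last first.
  rewrite expR_sum; apply: ler_prod => q _; rewrite expR_ge0 /=; apply: onesub_ge_expR.
  exact: (kap_bounds R W0 Wk (isT : (0 < 1)%N) (isT : (0 < 1)%N) q).
rewrite sumrN -mulr_sumr expRN lef_pV2 ?posrE ?expR_gt0 ?exprn_gt0 //.
rewrite (_ : 4 * L = 2 * (2 * L))%N; last by rewrite mulnA.
apply: le_trans (expR_le_pow2 _); rewrite ler_expR natrM; exact: ler_wpM2l.
Qed.

Lemma total_density : \sum_(q in PP) kap q <= (22 * k * t)%:R.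
Proof.
rewrite -blocks_cover; suff key s : \sum_(q in blocks block s) kap q <= (22 * k * s)%:R by exact: key.
elim: s => [|s IH]; first by rewrite /blocks big_ord0 big_set0 muln0.
rewrite blocksS (eq_bigl [predU (blocks block s) & (block s)]) => [|q]; last by rewrite !inE.
rewrite bigU /=; last by apply: blocks_disj; exact: block_disjoint.
rewrite mulnS addnC natrD; apply: lerD => //; rewrite natrM; exact: block_density.
Qed.

(** By [slice_le] the defect of a block is at most 2^(176 k) 2^(-b - 1) with b its bound; by the
    choice of [block_bound] these form a geometric series starting at 1/8. *)
Lemma block_defect_le : block_defect block block_bound kap t <= 2^-1.
Proof.
rewrite /block_defect.
have k01 q := kap_bounds R W0 Wk (isT : (0 < 1)%N) (isT : (0 < 1)%N) q.
have L j := block_density j.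
apply: (@le_trans _ _ (\sum_(j < t) 8^-1 * 2 ^- (t - j.+1))).
  apply: ler_sum => j _.
  have p1 : \sum_(q in block j) kap q <= (22 * k)%:R by rewrite natrM; exact: block_density.
  have h1 := prod_sub_ge p1; have h2 := prod_add_le 2 p1.
  have h3 := @slice_le R T (block j) (block_bound j).+1 kap (fun q => proj1 (andP (k01 q))).
  have u0 : 0 < \prod_(q in block j) (1 - kap q) by apply: lt_le_trans h1; rewrite invr_gt0 exprn_gt0.
  have i0 : 0 <= 2 ^- (block_bound j).+1 :> R by rewrite invr_ge0 exprn_ge0.
  apply: (@le_trans _ _ (2 ^- (block_bound j).+1 * 2 ^+ (2 * (2 * (22 * k))) * 2 ^+ (4 * (22 * k)))).
    apply: ler_pM.
    - by apply: slice_ge0 => q; case/andP: (k01 q).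
    - by rewrite invr_ge0 ltW.
    - by apply: le_trans h3 _; apply: ler_wpM2l.
    - by rewrite -[X in _ <= X]invrK lef_pV2 ?posrE ?invr_gt0 ?exprn_gt0.
  pose E := (2 * (2 * (22 * k)) + 4 * (22 * k))%N; pose r := ((block_bound j).+1 - E)%N.
  have e : (block_bound j).+1 = (r + E)%N by rewrite /r /E /block_bound; lia.
  have rj : (3 + (t - j.+1) <= r)%N by rewrite /r /E /block_bound; lia.
  rewrite -mulrA -exprD -/E e exprD invfM mulfVK ?expf_neq0 ?pnatr_eq0 //.
  have -> : 8^-1 * 2 ^- (t - j.+1) = 2 ^- (3 + (t - j.+1)) :> R.
    by rewrite exprD invfM; congr (_^-1 * _); rewrite !exprS expr0; ring.
  by rewrite lef_pV2 ?posrE ?exprn_gt0 // ler_weXn2l // ler1n.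
rewrite -mulr_sumr (reindex_inj rev_ord_inj) /=.
have geo s : \sum_(j < s) 2 ^- j <= 2 - 2 * 2 ^- s :> R.
  elim: s => [|s IH]; first by rewrite big_ord0 expr0 invr1 mulr1 subrr.
  rewrite big_ord_recr /= exprS invfM; have i0 : 0 <= 2 ^- s :> R by rewrite invr_ge0 exprn_ge0.
  by move: IH i0; lra.
have e : \sum_(j < t) 2 ^- (t - (t - j.+1).+1) = \sum_(j < t) 2 ^- j :> R.
  by apply: eq_bigr => j _; congr (_ ^- _); have := ltn_ord j; lia.
rewrite e; have := geo t; have i0 : 0 <= 2 ^- t :> R by rewrite invr_ge0 exprn_ge0.
by move: i0; lra.
Qed.

(** The binary logarithm of the level: block j has primes up to 2^(2^(j+1)) and at most b + 2 (s - j
    - 1) + 1 of them. The sum is dominated by the top blocks, so the level is a fixed power of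
    2^(2^s). *)
Lemma level_exponent s b : (\sum_(j < s) 2 ^ j.+1 * (b + 2 * (s - j.+1)).+1 <= (2 * b + 6) * 2 ^ s)%N.
Proof.
elim: s => [|s IH]; first by rewrite big_ord0.
rewrite big_ord_recr /= subnn muln0 addn0.
have pw2 : (\sum_(j < s) 2 ^ j.+1 <= 2 * 2 ^ s)%N.
  elim: (s) => [|r IHr]; first by rewrite big_ord0.
  by move: IHr; rewrite big_ord_recr /=; move: (\sum_(_ < r) _)%N => S; rewrite !expnS; lia.
have -> : (\sum_(i < s) 2 ^ i.+1 * (b + 2 * (s.+1 - i.+1)).+1 =
   \sum_(j < s) 2 ^ j.+1 * (b + 2 * (s - j.+1)).+1 + 2 * \sum_(j < s) 2 ^ j.+1)%N.
  rewrite big_distrr -big_split /=; apply: eq_bigr => j _.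
  have js := ltn_ord j.
  by rewrite (_ : s.+1 - j.+1 = (s - j.+1).+1)%N; [ring | lia].
by rewrite expnS; move: IH pw2; nia.
Qed.

Lemma modulus_block_le A : block_size_ok block block_bound t A ->
  (modulus A <= 2 ^ ((360 * k + 6) * M))%N.
Proof.
case/andP=> sA /forallP hA.
have key s : (s <= t)%N -> (modulus (A :&: blocks block s) <= 2 ^ (\sum_(j < s) 2 ^ j.+1 * (block_bound j).+1))%N.
  elim: s => [|s IH] st.
    by rewrite /blocks big_ord0 setI0 /modulus big_set0 big_ord0.
  rewrite big_ord_recr /= expnD blocksS setIUr.
  have -> : modulus (A :&: blocks block s :|: A :&: block s) = (modulus (A :&: blocks block s) * modulus (A :&: block s))%N.
    rewrite /modulus (eq_bigl [predU (A :&: blocks block s) & (A :&: block s)]) => [|q]; last by rewrite !inE.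
    rewrite bigU //=; apply: disjointWl (subsetIr _ _) _; apply: disjointWr (subsetIr _ _) _.
    by apply: blocks_disj; exact: block_disjoint.
  apply: leq_mul; first by apply: IH; exact: ltnW.
  apply: (@leq_trans (\prod_(q in A :&: block s) 2 ^ (2 ^ s.+1))).
    rewrite /modulus; apply: leq_prod => q; rewrite !inE => /andP[_ /andP[_ /andP[_ h]]]; exact: h.
  by rewrite prod_nat_const -expnM leq_exp2l // leq_mul2l; apply/orP; right; exact: (hA (Ordinal st)).
have := key t (leqnn t); rewrite (setIidPl sA) => h; apply: leq_trans h _.
rewrite leq_exp2l //; apply: leq_trans (level_exponent t (180 * k)) _.
by rewrite leq_mul2r; apply/orP; right; lia.
Qed.

(** The total density is at most 22 k t, so the product of 1 - kap is at least 2^(-88 k t); the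
    extra factor 1/2 is the defect. In terms of Y = 2^t the loss is about Y^(-88 k), which the
    residual bounds must beat. *)
Lemma sieve_weights : exists lw : {set T} -> R,
  [/\ forall A, `|lw A| <= 1,
      forall A, A \notin level_sets Z W (2 ^ ((360 * k + 6) * M)) -> lw A = 0,
      forall x : T -> R, (forall q, 0 <= x q <= 1) -> ev lw x <= \prod_(q in PP) (1 - x q) &
      2 ^- (88 * k * t).+1 <= ev lw kap].
Proof.
have [lw [lb [h1 h2 h3 h4]]] := @brun_hooley R T block block_bound block_disjoint block_bound_even t.
have k01 q := kap_bounds R W0 Wk (isT : (0 < 1)%N) (isT : (0 < 1)%N) q.
have k1 q : 0 <= kap q < 1.
  by have /andP[-> h] := k01 q; apply: le_lt_trans h _; rewrite invf_lt1 ?ltr1n.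
have k1' q : 0 <= kap q <= 1 by have /andP[-> /ltW ->] := k1 q.
exists lw; split.
- by move=> A; case: (h1 A).
- move=> A nA; case: (h2 A) => //; apply: contra nA => ok; rewrite inE modulus_block_le // andbT.
  by rewrite -blocks_cover; case/andP: ok.
- by move=> x /h3; rewrite blocks_cover => /andP[].
have := h4 _ k1; have /andP[_] := h3 _ k1'; rewrite blocks_cover.
have d := block_defect_le; have p := prod_sub_ge total_density.
have -> : (88 * k * t).+1 = (1 + 4 * (22 * k * t))%N by lia.
rewrite exprD invfM expr1 => b1 b2; apply: le_trans b2.
apply: ler_pM; rewrite ?invr_ge0 ?exprn_ge0 //; first by lra.
exact: le_trans b1.
Qed.

Lemma density_product_le : density_product R Z W k0 <= 2 ^+ (44 * k * t).
Proof.
have := prod_add_le 1 total_density; rewrite (_ : 2 * (1 * (22 * k * t)) = 44 * k * t)%N; last by lia.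
by under eq_bigr do rewrite mul1r.
Qed.

End SieveLevel.

(** * Residuals whose modulus exceeds a power of log X *)

Section LargeModuli.
Variable R : realType.
Variables (W k0 t a gam D N m X : nat).
Local Notation k := k0.+1.
Local Notation Z := (2 ^ (2 ^ t)).+1.
Local Notation T := 'I_Z.
Local Notation U := (D ^ 7)%N.
Local Notation V0 := (D ^ 18)%N.
Notation lnn := (lnn R).
Notation Y := (2 ^+ t : R).
Notation g := (weight R N m).
Notation L := (logX R X).
Implicit Types (A B : {set T}) (q : T).
Hypotheses (W0 : (0 < W)%N) (Wk : forall p, prime p -> (p <= k.*2.+1)%N -> (p %| W)%N).
Hypotheses (N0 : (0 < N)%N) (D1 : (1 < D)%N) (VX : (V0 <= X)%N).
Hypotheses (LY : L <= Y ^+ 2) (mN : (4 * m <= N)%N) (WY : (72 * W <= 2 ^ t)%N).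
Hypotheses (eY : (2 ^ (18 * k * k) <= 2 ^ t)%N) (YD : Y ^+ (2 * gam + 9) <= D%:R).
Notation PP := (sieving_primes Z W).

Let D0 : (0 < D)%N. Proof. exact: ltnW. Qed.
Let D0R : 0 < D%:R :> R. Proof. by rewrite ltr0n. Qed.
Let Y0 : 0 < Y. Proof. exact: exprn_gt0. Qed.
Let Y72 : 72 <= Y.
Proof. by rewrite -natrX (ler_nat R 72); apply: leq_trans WY; rewrite leq_pmulr. Qed.
Let WYR : 72 * W%:R <= Y. Proof. by rewrite -natrM -natrX ler_nat. Qed.
Let Y1 : 1 <= Y. Proof. by apply: le_trans Y72; rewrite (ler_nat R 1). Qed.

Lemma pow_card_le B : B \subset PP -> (k ^ #|B| <= modulus B)%N.
Proof.
move=> /subsetP sB; rewrite -prod_nat_const; apply: leq_prod => q /sB qP.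
by apply: leq_trans (ltnW (sieving_gt Wk qP)); rewrite -addnn leqW // leq_addr.
Qed.

Lemma sum_pow_card (Bs : {set {set T}}) : Bs \subset level_sets Z W D ->
  \sum_(B in Bs) k%:R ^+ #|B| <= 2 * D%:R ^+ 2 :> R.
Proof.
move=> /subsetP sBs; apply: (@le_trans _ _ (\sum_(B in level_sets Z W D) D%:R)).
  rewrite big_mkcond [X in _ <= X]big_mkcond; apply: ler_sum => B _.
  case: (boolP (B \in Bs)) => [/sBs h|_]; last by case: ifP.
  rewrite h -natrX ler_nat; move: h; rewrite inE => /andP[sB BD].
  exact: leq_trans (pow_card_le sB) BD.
rewrite sumr_const -[X in X <= _]mulr_natl expr2 mulrA ler_wpM2r //.
apply: (@le_trans _ _ D.+1%:R); first by rewrite ler_nat; exact: card_level_sets.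
by rewrite -natrM ler_nat mul2n -addnn -addn1 leq_add2l.
Qed.

Lemma pw_modulus s B : (forall q, q \in B -> prime q) -> pw s (modulus B) = \prod_(q in B) pw s q :> R.
Proof.
move=> pB; suff [] : (0 < modulus B)%N /\ \prod_(q in B) pw s q = pw s (modulus B) :> R by [].
rewrite /modulus; elim/big_rec2: _ => [|q x y /pB /prime_gt0 q0 [y0 ->]]; first by rewrite pwn1.
by rewrite muln_gt0 q0 y0 pwM.
Qed.

(** The threshold is Y^(4 gam) with Y = 2^t, so that Rankin's trick with exponent 1/2 saves Y^(2
    gam). *)
Definition large_sets : {set {set T}} := [set B in nontrivial_level_sets Z W D | (2 ^ (4 * gam * t) < modulus B)%N].

(* Rankin's trick: the weights gain a factor (modulus B) ^ (1/2) *)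
Lemma large_rankin : \sum_(B in large_sets) (k%:R ^+ #|B|) ^+ 2 * \prod_(q in B) (q%:R^-1 * (q%:R^-1 + (q%:R - 1)^-1))
   <= Y * Y ^- (2 * gam) :> R.
Proof.
pose h : R := 2^-1; pose c : R := 3 * k%:R ^+ 2.
have c0 : 0 <= c by rewrite /c mulr_ge0 ?exprn_ge0.
apply: (@le_trans _ _ (\sum_(B in large_sets) Y ^- (2 * gam) * \prod_(q in B) (c * pw (1 + h) q))).
  apply: ler_sum => B; rewrite !inE => /andP[/andP[_ /andP[sB _]] RB].
  have sv := sievable_sub sB; have pB q : q \in B -> prime q by move=> /sv /andP[].
  have hB : pw h (modulus B) <= Y ^- (2 * gam).
    apply: (@le_trans _ _ (pw h (2 ^ (4 * gam * t)))).
      by apply: pw_le; rewrite ?expn_gt0 ?invr_ge0 // ltnW.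
    rewrite /pw lnnX // -exprM -natrX expR_lnn2 -expRN le_eqVlt; apply/orP; left; apply/eqP; congr (expR (- _)).
    by rewrite /h !natrM; field.
  have p0 : 0 <= \prod_(q in B) (c * pw (1 + h) q) by apply: prodr_ge0 => q _; rewrite mulr_ge0 ?pw_ge0.
  apply: le_trans (ler_wpM2r p0 hB); rewrite pw_modulus // -exprM mulnC exprM -prodr_const -!big_split /=.
  apply: ler_prod => q qB; have := prime_gt1 (pB q qB) => q1.
  have q2 : 2 <= q%:R :> R by rewrite (ler_nat R 2).
  have q0 : 0 < q%:R :> R by lra.
  have u0 : 0 < q%:R - 1 :> R by lra.
  have i1 : 0 <= q%:R^-1 :> R by rewrite invr_ge0 ltW.
  have i2 : 0 <= (q%:R - 1)^-1 :> R by rewrite invr_ge0 ltW.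
  rewrite !mulr_ge0 ?exprn_ge0 ?addr_ge0 //=.
  have -> : pw h q * (c * pw (1 + h) q) = k%:R ^+ 2 * (q%:R^-1 * (3 * q%:R^-1)).
    rewrite mulrCA -pwD (_ : h + (1 + h) = 1 + 1); last by rewrite /h; field.
    by rewrite pwD pw1 ?(ltnW q1) // /c; ring.
  do 2! (apply: ler_wpM2l; rewrite ?exprn_ge0 //).
  have : (q%:R - 1)^-1 <= 2 * q%:R^-1 :> R; last by lra.
  rewrite -[2 * _]invrK invfM invrK lef_pV2 ?posrE ?mulr_gt0 ?invr_gt0 //; lra.
rewrite -mulr_sumr mulrC ler_wpM2r ?invr_ge0 ?exprn_ge0 ?exprn_ge0 //.
have f0 q : 0 <= c * pw (1 + h) q by rewrite mulr_ge0 ?pw_ge0.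
apply: (@le_trans _ _ (\sum_(B in powerset PP) \prod_(q in B) (c * pw (1 + h) q))).
  rewrite big_mkcond [X in _ <= X]big_mkcond; apply: ler_sum => B _; rewrite powersetE.
  have p0 : 0 <= \prod_(q in B) (c * pw (1 + h) q) by apply: prodr_ge0.
  case: (boolP (B \in large_sets)) => [|_]; last by case: ifP.
  by rewrite !inE => /andP[/andP[_ /andP[-> _]] _].
have -> : \sum_(B in powerset PP) \prod_(q in B) (c * pw (1 + h) q) = \prod_(q in PP) (c * pw (1 + h) q + 1).
  rewrite (@prod_add_set R _ PP (fun q => c * pw (1 + h) q) (fun=> 1)); apply: eq_bigr => B _.
  by rewrite [X in _ * X]big1 // mulr1.
apply: (@le_trans _ _ (expR (\sum_(q in PP) c * pw (1 + h) q))).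
  rewrite expR_sum; apply: ler_prod => q _; rewrite addr_ge0 //= addrC; exact: expR_ge1Dx.
apply: (@le_trans _ _ (expR (9 * k * k)%:R)); last first.
  apply: le_trans (expR_le_pow2 R _) _; rewrite -!natrX ler_nat; apply: leq_trans eY.
  by rewrite leq_exp2l // !mulnA.
rewrite ler_expR -mulr_sumr.
have s3 : \sum_(q in PP) pw (1 + h) q <= 3.
  apply: (@le_trans _ _ (\sum_(1 <= n < Z | xpredT n) pw (1 + h) n)).
    apply: (@sum_ord_nat_le R t (mem PP) xpredT) => [|n|q qP]; rewrite ?pw_ge0 //.
    by rewrite andbT (ltn_ord q) andbT; apply: leq_trans (sieving_gt Wk qP).
  have h0 : 0 < h by rewrite invr_gt0.
  have := @sum_pw_full R h (2 ^ (2 ^ t)) h0; rewrite /h invrK => s; apply: le_trans s _; lra.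
apply: le_trans (ler_wpM2l c0 s3) _; rewrite /c !natrM expr2; lra.
Qed.

(** The coefficients sum to at most 2 D^2. The type II error is thus of size D^4 D^2 / U and the
    type I error of size D^2 D U^2 / V0, up to powers of Y; U = D^7 and V0 = D^18 leave 1/D in both,
    which [YD] turns into a negative power of Y. *)
Lemma large_bound (fB : {set T} -> {ffun T -> 'I_k}) :
  \sum_(B in large_sets) k%:R ^+ #|B| * `|residual W X V0 a g (choice_shift (fB B)) B| <= Y ^+ 12 * Y ^- gam.
Proof.
have N0R : 0 < N%:R :> R by rewrite ltr0n.
pose G1 : R := 4 * m%:R * N%:R^-1.
have G10 : 0 <= G1 by rewrite mulr_ge0 ?invr_ge0 // mulr_ge0.
have G11 : G1 <= 1 by rewrite ler_pdivrMr // mul1r -natrM ler_nat.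
have g1 n : `|g n| <= 1.
  by have /andP[h0 h1] := @weight_01 R N m N0 n; rewrite ger0_norm.
have U0 : (0 < U)%N by rewrite expn_gt0 D0.
have DU : (D <= U)%N by rewrite -{1}[D]expn1 leq_exp2l.
have UV : (U <= V0)%N by rewrite leq_exp2l.
have gs := @weight_step R N m N0.
(* The parameter of Cauchy-Schwarz balances tau against the diagonal term Y^(-2 gam) / tau. *)
pose tau : R := Y ^- gam; have tau0 : 0 < tau by rewrite invr_gt0 exprn_gt0.
have sub B : B \in large_sets -> [/\ B \subset PP, B != set0 & (modulus B <= D)%N].
  by rewrite !inE => /andP[/andP[-> /andP[-> ->]] _].
have hB B : B \in large_sets -> [/\ admissible W (choice_shift (fB B)), sievable_set W B, B != set0 & (modulus B <= D)%N].
  move=> /sub[s n0 md]; split=> //; last exact: sievable_sub.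
  exact: (choice_shift_admissible W0 Wk (isT : (0 < 1)%N) D0 (fB B)).
have s0 B : B \in large_sets -> 0 <= k%:R ^+ #|B| :> R by rewrite exprn_ge0.
apply: le_trans (@dispersion R Z W X V0 U D a g G1 W0 U0 UV VX DU g1 G10 gs
   large_sets (fun B => choice_shift (fB B)) (fun B => k%:R ^+ #|B|) tau tau0 hB s0) _.
have L1 := logX_ge1 R X; have L0 : 0 <= L by exact: le_trans L1.
have rk := large_rankin.
have sumk : (0 <= \sum_(B in large_sets) (k%:R ^+ #|B| : R)) && (\sum_(B in large_sets) (k%:R ^+ #|B| : R) <= 2 * D%:R ^+ 2).
  rewrite sumr_ge0 //= sum_pow_card //; apply/subsetP => B; rewrite !inE.
  by case/andP=> /andP[_ ->].
set s := \sum_(B in large_sets) k%:R ^+ #|B| in sumk *; set rr := \sum_(B in _) _ * _ in rk *.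
have rr0 : 0 <= rr.
  apply: sumr_ge0 => B /sub[sB _ _]; rewrite mulr_ge0 ?exprn_ge0 //; apply: prodr_ge0 => q qB.
  have /andP[pq _] := sievable_sub sB qB; have h := @prime_sub1_ge1 R Z q pq.
  by rewrite mulr_ge0 ?addr_ge0 ?invr_ge0 // (le_trans ler01 h).
have Dg : Y ^+ (gam + 9) / D%:R <= tau.
  rewrite ler_pdivrMr // /tau mulrC ler_pdivlMr ?exprn_gt0 // -exprD.
  by rewrite addnAC addnn -mul2n; exact: YD.
have Y20 : 0 <= Y ^+ 2 by apply: exprn_ge0; exact: ltW.
have Lpow j : L ^+ j <= (Y ^+ 2) ^+ j by apply: lerXn2r.
have L2 : L ^+ 2 <= Y ^+ 4 by have := Lpow 2; rewrite -(exprM Y 2 2).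
have L4 : L ^+ 4 <= Y ^+ 8 by have := Lpow 4; rewrite -(exprM Y 2 4).
have L5 : L ^+ 5 <= Y ^+ 10 by have := Lpow 5; rewrite -(exprM Y 2 5).
have P6 : (1 + G1) * (2 + G1) <= 6.
  apply: (@le_trans _ _ (2 * 3)); last by lra.
  by apply: ler_pM; rewrite ?addr_ge0 //; lra.
have P0 : 0 <= (1 + G1) * (2 + G1) by rewrite mulr_ge0 ?addr_ge0.
have DR n : (D ^ n)%:R = D%:R ^+ n :> R by rewrite natrX.
have Dne : D%:R != 0 :> R by rewrite lt0r_neq0.
have Yne : Y != 0 by rewrite lt0r_neq0.
have tauY : tau * Y ^+ gam = 1 by rewrite mulVf // expf_neq0.
have T1 : tau / 2 * L ^+ 4 <= Y ^+ 8 * tau.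
  apply: (@le_trans _ _ (tau / 2 * Y ^+ 8)); first by rewrite ler_wpM2l // divr_ge0 // ltW.
  have : 0 <= Y ^+ 8 * tau by rewrite mulr_ge0 ?exprn_ge0 // ltW.
  lra.
have t2 : (2 * tau)^-1 = 2^-1 * Y ^+ gam by rewrite invfM /tau invrK.
have T2 : (2 * tau)^-1 * (s ^+ 2 * (L ^+ 4 * (6 * (W * D ^ 2)%:R * ((1 + G1) * (2 + G1)) / U%:R))) <= tau.
  apply: le_trans Dg; rewrite t2.
  have e1 : s ^+ 2 <= 4 * D%:R ^+ 4.
    case/andP: sumk => h0 h1; rewrite (_ : 4 * D%:R ^+ 4 = (2 * D%:R ^+ 2) ^+ 2); last by ring.
    by apply: lerXn2r; rewrite ?nnegrE // mulr_ge0 ?exprn_ge0.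
  have e2 : 6 * (W * D ^ 2)%:R * ((1 + G1) * (2 + G1)) / U%:R <= 6 * (W%:R * D%:R ^+ 2) * 6 / D%:R ^+ 7.
    rewrite !DR natrM DR ler_wpM2r ?invr_ge0 ?exprn_ge0 // ler_wpM2l // !mulr_ge0 ?exprn_ge0 //.
  have n2 : 0 <= 6 * (W * D ^ 2)%:R * ((1 + G1) * (2 + G1)) / U%:R by rewrite divr_ge0 // mulr_ge0 // mulr_ge0.
  apply: (@le_trans _ _ (2^-1 * Y ^+ gam * (4 * D%:R ^+ 4 * (Y ^+ 8 * (6 * (W%:R * D%:R ^+ 2) * 6 / D%:R ^+ 7))))).
    apply: ler_wpM2l; first by rewrite mulr_ge0 ?invr_ge0 ?exprn_ge0.
    have L40 : 0 <= L ^+ 4 by exact: exprn_ge0.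
    have q1 := mulr_ge0 L40 n2; have q2 := sqr_ge0 s.
    by apply: ler_pM => //; apply: ler_pM.
  rewrite (_ : 2^-1 * Y ^+ gam * _ = (Y ^+ gam * Y ^+ 8) / D%:R * (72 * W%:R)); last by field.
  rewrite (_ : Y ^+ (gam + 9) / D%:R = (Y ^+ gam * Y ^+ 8) / D%:R * Y); last first.
    by rewrite addnS exprSr exprD; ring.
  by apply: ler_wpM2l => //; rewrite divr_ge0 // mulr_ge0 ?exprn_ge0.
have T3 : (2 * tau)^-1 * (L ^+ 5 * rr) <= Y ^+ 11 * tau.
  rewrite t2; apply: (@le_trans _ _ (2^-1 * Y ^+ gam * (Y ^+ 10 * (Y * Y ^- (2 * gam))))).
    apply: ler_wpM2l; first by rewrite mulr_ge0 ?invr_ge0 ?exprn_ge0.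
    by apply: ler_pM; rewrite ?exprn_ge0.
  have e2 : Y ^- (2 * gam) = tau * tau by rewrite mul2n -addnn exprD invfM.
  have regroup (y1 y2 y3 y4 : R) : 2^-1 * y1 * (y2 * (y3 * (y4 * y4))) = 2^-1 * (y2 * y3 * y4) * (y4 * y1) by ring.
  rewrite e2 regroup tauY mulr1 -exprSr.
  have : 0 <= Y ^+ 11 * tau by rewrite mulr_ge0 ?exprn_ge0 // ltW.
  lra.
have T4 : s * (6 * (W * D)%:R * U%:R ^+ 2 * L ^+ 2 * (2 + G1) / V0%:R) <= tau.
  apply: le_trans Dg.
  have e : 6 * (W * D)%:R * U%:R ^+ 2 * L ^+ 2 * (2 + G1) / V0%:R <=
      6 * (W%:R * D%:R) * (D%:R ^+ 7) ^+ 2 * Y ^+ 4 * 3 / D%:R ^+ 18.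
    rewrite !DR natrM ler_wpM2r ?invr_ge0 ?exprn_ge0 //; apply: ler_pM; rewrite ?addr_ge0 //.
    - by rewrite !mulr_ge0 // ?exprn_ge0 // exprn_ge0.
    - by apply: ler_wpM2l => //; rewrite !mulr_ge0 // exprn_ge0 // exprn_ge0.
    - by move: G11; lra.
  have n2 : 0 <= 6 * (W * D)%:R * U%:R ^+ 2 * L ^+ 2 * (2 + G1) / V0%:R.
    by rewrite divr_ge0 // mulr_ge0 ?addr_ge0 // !mulr_ge0 // exprn_ge0.
  case/andP: sumk => h0 h1; apply: le_trans (ler_pM h0 n2 h1 e) _.
  rewrite (_ : 2 * D%:R ^+ 2 * _ = Y ^+ 4 * (36 * W%:R) / D%:R); last by field.
  rewrite ler_wpM2r ?invr_ge0 // (_ : gam + 9 = 4 + (gam + 5))%N; last by rewrite addnCA.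
  rewrite exprD; apply: ler_wpM2l; first by apply: exprn_ge0; exact: ltW.
  apply: (@le_trans _ _ Y); last by rewrite -[X in X <= _]expr1 ler_weXn2l // addn_gt0 orbT.
  by have : 0 <= W%:R :> R by []; move: WYR; lra.
rewrite mulrDr; apply: (@le_trans _ _ (Y ^+ 8 * tau + (tau + Y ^+ 11 * tau) + tau)).
  by apply: lerD => //; apply: lerD => //; exact: lerD.
rewrite (_ : _ + _ + _ = (Y ^+ 8 + 2 + Y ^+ 11) * tau); last by ring.
apply: ler_wpM2r; first exact: ltW.
have y8 : Y ^+ 8 <= Y ^+ 11 by apply: ler_weXn2l.
have y11 : 1 <= Y ^+ 11 by rewrite exprn_ege1.
have : 72 * Y ^+ 11 <= Y ^+ 12 by rewrite (exprS Y 11) ler_wpM2r // exprn_ge0 // ltW.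
lra.
Qed.

End LargeModuli.

(** The requirements on gam = 132 k + 20: it must cover 44 k from [density_product_le], 88 k + 1
    from the main term, and 13 from the powers of Y in the residual bounds. *)
Lemma sieve_dim_bounds k : [/\ (44 * k + 13 + (88 * k).+1 <= 132 * k + 20)%N,
  (5 + (88 * k).+1 <= 2 * (132 * k + 20) + 9)%N & (6 <= 13 * (132 * k + 20))%N].
Proof. by split; lia. Qed.

(** * Lower bound of the sifted sum *)

Section SiftedSum.
Variable R : realType.
Variables (W k0 t a gam D N m X N1 : nat).
Local Notation k := k0.+1.
Local Notation Z := (2 ^ (2 ^ t)).+1.
Local Notation T := 'I_Z.
Local Notation V0 := (D ^ 18)%N.
Local Notation r0 := (2 ^ (4 * gam * t))%N.
Local Notation C := R[i].
Notation lnn := (lnn R).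
Notation Y := (2 ^+ t : R).
Notation g := (weight R N m).
Notation L := (logX R X).
Notation PP := (sieving_primes Z W).
Implicit Types (A B : {set T}) (q : T).
Hypotheses (W0 : (0 < W)%N) (Wk : forall p, prime p -> (p <= k.*2.+1)%N -> (p %| W)%N).
Hypotheses (N0 : (0 < N)%N) (m0 : (0 < m)%N) (D1 : (1 < D)%N) (VX : (V0 <= X)%N).
Hypotheses (LY : L <= Y ^+ 2) (mN : (4 * m <= N)%N) (WY : (72 * W <= 2 ^ t)%N).
Hypotheses (eY : (2 ^ (18 * k * k) <= 2 ^ t)%N) (YD : Y ^+ (2 * gam + 9) <= D%:R).
Hypotheses (aW : coprime a W) (egam : gam = (132 * k + 20)%N) (eX : X = (2 ^ (6 * N))%N).
Hypotheses (hV : 8 * lnn V0 <= N%:R) (em : m = (t * (13 * gam))%N).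
Hypothesis noexc : forall e (chi : nat -> C), ~ exceptional W (4 * gam) t e chi.
Notation eta := (sep_eta (Kscale R W (4 * gam) t)).
Hypotheses (mK : 32 * m%:R / N%:R <= eta) (etaY : 4 / eta <= Y) (NY : 20 * N%:R ^+ 2 <= Y ^+ 4).
Hypotheses (N6Y : (6 * N).+1%:R <= Y ^+ 2) (ZD : (2 ^ (2 ^ t) <= D)%N).
Hypotheses (N1m : (4 * m * N1 <= N)%N) (N112 : (12 <= N1)%N) (V2 : (V0 <= 2 ^ N)%N).
Hypothesis eD : D = (2 ^ ((360 * k + 6) * 2 ^ t))%N.

Let D0 : (0 < D)%N. Proof. exact: ltnW. Qed.
Let D0R : 0 < D%:R :> R. Proof. by rewrite ltr0n. Qed.
Let Y0 : 0 < Y. Proof. exact: exprn_gt0. Qed.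
Let Y72 : 72 <= Y.
Proof. by rewrite -natrX (ler_nat R 72); apply: leq_trans WY; rewrite leq_pmulr. Qed.
Let WYR : 72 * W%:R <= Y. Proof. by rewrite -natrM -natrX ler_nat. Qed.
Let Y1 : 1 <= Y. Proof. by apply: le_trans Y72; rewrite (ler_nat R 1). Qed.
Let W0R : 0 < W%:R :> R. Proof. by rewrite ltr0n. Qed.
Let V00 : (0 < V0)%N. Proof. by rewrite expn_gt0 D0. Qed.
Let r1 : (1 < r0)%N.
Proof.
rewrite -{1}(expn0 2) ltn_exp2l // muln_gt0 muln_gt0 /=; apply/andP; split; first by rewrite egam addn_gt0 orbT.
by move: m0; rewrite em muln_gt0 => /andP[].
Qed.

Let Yn0 n : 0 < Y ^+ n. Proof. exact: exprn_gt0. Qed.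
Let Ymono i j : (i <= j)%N -> Y ^+ i <= Y ^+ j. Proof. by move=> ij; apply: ler_weXn2l. Qed.
Let two_m : 2 ^- m = Y ^- (13 * gam) :> R. Proof. by rewrite em exprM. Qed.

Lemma mean_error_le (q : nat) : (0 < q)%N -> mean_error R W (4 * gam) t N m X q <= (q%:R * Y + 2 * Y ^+ 4) * Y ^- (13 * gam).
Proof.
move=> q0; have [e0 _ _] := sep_eta_bounds (Kscale_ge26 R W (4 * gam) t).
have L1 := logX_ge1 R X; have L0 : 0 <= L by exact: le_trans L1.
have L2 : L ^+ 2 <= Y ^+ 4.
  by rewrite (exprM Y 2 2); apply: lerXn2r => //; rewrite nnegrE ltW.
have i0 : 0 <= Y ^- (13 * gam) by rewrite invr_ge0 ltW.
have -> : mean_error R W (4 * gam) t N m X q =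
    q%:R * (4 / eta) * Y ^- (13 * gam) + (L ^+ 2 + 20 * N%:R ^+ 2) * Y ^- (13 * gam).
  by rewrite /mean_error two_m; ring.
rewrite [X in _ <= X]mulrDl; apply: lerD; apply: ler_wpM2r => //; first exact: ler_wpM2l.
by move: L2 NY; lra.
Qed.

Definition small_sets : {set {set T}} := [set B in nontrivial_level_sets Z W D | (modulus B <= r0)%N].

(** With r = Y^(4 gam) the coefficients sum to at most 2 r^2, and each mean error carries one more
    factor r from its modulus. The saving 2^(-m) = Y^(-13 gam) pays for r^3 = Y^(12 gam) and leaves
    Y^(-gam). *)
Lemma small_bound (fB : {set T} -> {ffun T -> 'I_k}) :
  \sum_(B in small_sets) k%:R ^+ #|B| * `|residual W X V0 a g (choice_shift (fB B)) B| <= Y ^+ 6 * Y ^- gam.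
Proof.
pose r : R := Y ^+ (4 * gam); have er : r0%:R = r by rewrite /r natrX mulnC exprM.
have r0' : 0 < r by exact: Yn0.
have r1' : 1 <= r by rewrite exprn_ege1.
pose ME : R := (W%:R * r * Y + 2 * Y ^+ 4) * Y ^- (13 * gam).
have i0 : 0 < Y ^- (13 * gam) by rewrite invr_gt0.
have ME0 : 0 <= ME.
  by rewrite /ME mulr_ge0 ?(ltW i0) // addr_ge0 ?mulr_ge0 ?exprn_ge0 // ?(ltW r0') // ltW.
apply: (@le_trans _ _ (\sum_(B in small_sets) k%:R ^+ #|B| * ME)).
  apply: ler_sum => B; rewrite !inE => /andP[/andP[n0 /andP[sB _]] Br].
  have sv := sievable_sub sB; have pB q : q \in B -> prime q by move=> /sv /andP[].
  have M0 := @modulus_gt0 Z B pB.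
  rewrite ler_wpM2l ?exprn_ge0 //.
  have ad : admissible W (choice_shift (fB B)) by exact: (choice_shift_admissible W0 Wk (isT : (0 < 1)%N) D0 (fB B)).
  have q0 : (0 < W * modulus B)%N by rewrite muln_gt0 W0.
  have rs := residual_small W0 aW N0 m0 eX VX hV noexc mK ad sv n0 Br.
  have hh := le_trans rs (mean_error_le q0).
  apply: (le_trans hh); apply: ler_wpM2r; first exact: ltW.
  rewrite lerD2r; apply: ler_wpM2r; first exact: ltW.
  by rewrite natrM ler_wpM2l // -er ler_nat.
rewrite -mulr_suml.
have s2 : \sum_(B in small_sets) k%:R ^+ #|B| <= 2 * r ^+ 2.
  rewrite -er; apply: (sum_pow_card R Wk r1); apply/subsetP => B; rewrite !inE.
  by case/andP=> /andP[_ /andP[-> _]].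
apply: le_trans (ler_wpM2r ME0 s2) _.
have e : Y ^+ 6 * Y ^- gam = r ^+ 2 * (r * Y ^+ 6) * Y ^- (13 * gam).
  have r3 : r ^+ 3 * r ^- 3 = 1 by rewrite mulfV // expf_neq0 // lt0r_neq0.
  have regroup (x1 x2 x3 x4 : R) : x1 * x2 * (x3 * x4) = x2 * x3 * (x1 * x4) by ring.
  have e13 : (13 * gam = gam + 4 * gam * 3)%N by rewrite mulnAC -mulSn.
  by rewrite mulrA -exprSr e13 exprD (exprM Y (4 * gam) 3) -/r invfM regroup r3 mulr1.
have regroup (x1 x2 x3 : R) : 2 * x1 * (x2 * x3) = x1 * (2 * x2) * x3 by ring.
rewrite e /ME regroup; apply: ler_wpM2r; first exact: ltW.
apply: ler_wpM2l; first exact: exprn_ge0 (ltW r0').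
have h1 : 2 * (W%:R * r * Y) <= r * Y ^+ 4.
  have y2 : Y ^+ 2 <= Y ^+ 4 by exact: Ymono.
  have h : 2 * W%:R * Y <= Y ^+ 2.
    by rewrite (expr2 Y); apply: ler_wpM2r; [exact: ltW | move: WYR W0R; lra].
  have swap (x1 x2 x3 : R) : 2 * (x1 * x2 * x3) = x2 * (2 * x1 * x3) by ring.
  rewrite swap.
  by apply: ler_wpM2l; [exact: ltW | exact: le_trans h y2].
have h2 : 2 * (2 * Y ^+ 4) <= 4 * (r * Y ^+ 4).
  rewrite mulrA (_ : 2 * 2 = 4 :> R); last by ring.
  by apply: ler_wpM2l => //; rewrite ler_peMl // ltW.
have h3 : 72 * (r * Y ^+ 4) <= r * Y ^+ 6.
  rewrite mulrCA; apply: ler_wpM2l; first exact: ltW.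
  apply: (@le_trans _ _ (Y * Y ^+ 4)); first by apply: ler_wpM2r => //; exact: ltW.
  by rewrite -exprS; exact: Ymono.
have p0 : 0 <= r * Y ^+ 4 by apply: mulr_ge0; exact: ltW.
rewrite mulrDr; apply: le_trans (lerD h1 h2) (le_trans _ h3).
by move: p0; move: (r * Y ^+ 4) => z z0; lra.
Qed.

Lemma bad_sum_small : bad_sum Z W X V0 a g <= 2 * Y ^+ 4 / D%:R ^+ 17.
Proof.
have XJ : (X < 2 ^ (6 * N).+1)%N by rewrite eX ltn_exp2l.
apply: le_trans (@bad_sum_le R Z W X V0 a g V00 (@weight_01 R N m N0) _ XJ) _.
have L1 := logX_ge1 R X; have L0 : 0 <= L by exact: le_trans L1.
rewrite natrM (_ : 2 * Y ^+ 4 / D%:R ^+ 17 = 2 * D%:R * Y ^+ 2 * Y ^+ 2 / D%:R ^+ 18); last first.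
  by field; rewrite lt0r_neq0.
rewrite natrX ler_wpM2r ?invr_ge0 ?exprn_ge0 //; apply: ler_pM => //; first by rewrite mulr_ge0.
apply: ler_pM => //; rewrite -natrM ler_nat mul2n -addnn -addn1 leq_add //.
Qed.

(** N1 >= 12 makes the window worth at least 1/(2 W); the two errors are at most 1/Y each, and 1/Y
    <= 1/(72 W). *)
Lemma residual_main : (4 * W%:R)^-1 <= residual W X V0 a g (fun _ : T => 0%N) set0.
Proof.
have WZ : (W < Z)%N.
  have W72 : (W <= 72 * W)%N by rewrite leq_pmull.
  rewrite ltnS; apply: (leq_trans (leq_trans W72 WY)); apply: ltnW; exact: ltn_expl.
have N110 : (10 <= N1)%N by apply: leq_trans N112.
have := main_term W0 aW N0 m0 eX VX hV noexc mK N1m V2 V00 WZ N110.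
apply: le_trans.
have i1 : 72 / Y <= W%:R^-1 by rewrite ler_pdivrMr // mulrC ler_pdivlMr // mulrC.
have b1 : (Z * (6 * N).+1)%:R * L / V0%:R <= Y^-1.
  have L1 := logX_ge1 R X; have L0 : 0 <= L by exact: le_trans L1.
  apply: (@le_trans _ _ (2 * Y ^+ 4 / D%:R ^+ 17)).
    rewrite natrM (_ : 2 * Y ^+ 4 / D%:R ^+ 17 = 2 * D%:R * Y ^+ 2 * Y ^+ 2 / D%:R ^+ 18); last first.
      by field; rewrite lt0r_neq0.
    rewrite natrX ler_wpM2r ?invr_ge0 ?exprn_ge0 //; apply: ler_pM => //; first by rewrite mulr_ge0.
    apply: ler_pM => //; rewrite -natrM ler_nat mul2n -addnn -addn1 leq_add //.
  have DY : Y ^+ 6 <= D%:R ^+ 17.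
    apply: (@le_trans _ _ (D%:R ^+ 1)); last by rewrite ler_weXn2l // ler1n.
    by rewrite expr1; apply: le_trans YD; apply: Ymono; rewrite (@leq_trans 9) // leq_addl.
  rewrite ler_pdivrMr ?exprn_gt0 // [X in _ <= X]mulrC ler_pdivlMr //; apply: le_trans DY.
  rewrite (_ : 2 * Y ^+ 4 * Y = Y ^+ 5 * 2); last by ring.
  rewrite (exprSr Y 5) ler_wpM2l ?(ltW (Yn0 5)) //; move: Y72; lra.
have b2 : mean_error R W (4 * gam) t N m X W <= Y^-1.
  apply: le_trans (mean_error_le W0) _.
  apply: (@le_trans _ _ (Y ^+ 5 * Y ^- 6)).
    apply: ler_pM; rewrite ?invr_ge0 ?(ltW (Yn0 _)) //.
    - by rewrite addr_ge0 ?mulr_ge0 // ltW.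
    - have y1 : Y ^+ 1 <= Y ^+ 4 by exact: Ymono.
      have h : W%:R * Y <= Y * Y ^+ 4.
        by apply: ler_pM => //; [exact: ltW | move: WYR W0R; lra].
      have : 72 * Y ^+ 4 <= Y * Y ^+ 4 by rewrite ler_wpM2r // ltW.
      have h' : W%:R * Y * 72 <= Y * Y ^+ 4.
        rewrite mulrAC mulrC [W%:R * 72]mulrC [X in _ <= X]mulrC; apply: ler_pM; rewrite ?mulr_ge0 //; last exact: ltW.
      rewrite exprS; have := ltW (Yn0 4); lra.
    - by rewrite lef_pV2 ?posrE //; apply: Ymono; rewrite egam; case: (sieve_dim_bounds k).
  by rewrite (exprS Y 5) invfM mulrCA mulfV ?mulr1 // expf_neq0 // lt0r_neq0.
have n1 : 1 <= N1%:R / 2 - 5 :> R.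
  have : 12 <= N1%:R :> R by rewrite (ler_nat R 12).
  lra.
have iw : 0 < W%:R^-1 :> R by rewrite invr_gt0.
have h : (2 * W%:R)^-1 <= (N1%:R / 2 - 5) / (2 * W%:R) :> R.
  by rewrite -[X in X <= _]mul1r; apply: ler_wpM2r => //; rewrite invr_ge0 mulr_ge0.
move: h; rewrite !invfM; move: b1 b2 i1 iw.
have iY : 0 < Y^-1 by rewrite invr_gt0.
move: iY; set x := Y^-1; set w := W%:R^-1; set u := _ / 2 - 5; set v1 := _ * L / _; set v2 := mean_error _ _ _ _ _ _ _ _.
move: (u * (2^-1 * w)) => z; lra.
Qed.

(** The main term is at least three times the claimed bound, and the residuals and the bad n cost at
    most once that bound each. Residuals are divided according to the threshold of [large_sets]. *)
Lemma sifted_lower : Y ^- (88 * k).+1 <=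
  \sum_(1 <= n < X.+1) base_weight Z W X V0 a g n * \prod_(q in PP) (1 - shift_count R W k0 q n).
Proof.
have [lw [h1 h2 h3 h4]] := sieve_weights R t W0 Wk; rewrite -eD in h2.
have [fB] := @sieve_lower_bound R Z W X V0 D a k0 g W0 Wk V00 D0 (@weight_01 R N m N0) lw h1 h2 h3.
set S := \sum_(1 <= n < X.+1) _; set R0 := residual _ _ _ _ _ _ _.
rewrite (bigID (fun B => B \in large_sets W t gam D)) /=.
have -> : \sum_(B in nontrivial_level_sets Z W D | B \in large_sets W t gam D)
    k%:R ^+ #|B| * `|residual W X V0 a g (choice_shift (fB B)) B| =
  \sum_(B in large_sets W t gam D) k%:R ^+ #|B| * `|residual W X V0 a g (choice_shift (fB B)) B|.
  by apply: eq_bigl => B; rewrite [B \in large_sets _ _ _ _]inE andbA andbb.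
have -> : \sum_(B in nontrivial_level_sets Z W D | B \notin large_sets W t gam D)
    k%:R ^+ #|B| * `|residual W X V0 a g (choice_shift (fB B)) B| =
  \sum_(B in small_sets) k%:R ^+ #|B| * `|residual W X V0 a g (choice_shift (fB B)) B|.
  apply: eq_bigl => B; have e1 : (B \in large_sets W t gam D) = (B \in nontrivial_level_sets Z W D) && (r0 < modulus B)%N.
    by rewrite in_set.
  have e2 : (B \in small_sets) = (B \in nontrivial_level_sets Z W D) && (modulus B <= r0)%N by rewrite in_set.
  by rewrite e1 e2 ltnNge; case: (B \in _); case: (_ <= _)%N.
have lb := large_bound a W0 Wk N0 D1 VX LY mN WY eY YD fB; have sb := small_bound fB.
have dp := density_product_le R t W0 Wk; have bs := bad_sum_small; have rm := residual_main.
set lg := \sum_(B in large_sets _ _ _ _) _ in lb *; set sm := \sum_(B in small_sets) _ in sb *.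
have lg0 : 0 <= lg by apply: sumr_ge0 => B _; rewrite mulr_ge0 // exprn_ge0.
have sm0 : 0 <= sm by apply: sumr_ge0 => B _; rewrite mulr_ge0 // exprn_ge0.
pose e1 : R := Y ^- (88 * k).+1; have e10 : 0 < e1 by rewrite invr_gt0.
have t1 : density_product R Z W k0 * (lg + sm) <= e1.
  apply: (@le_trans _ _ (Y ^+ (44 * k) * (Y ^+ 13 * Y ^- gam))).
    apply: ler_pM; rewrite ?addr_ge0 //.
    - by apply: prodr_ge0 => q _; have /andP[h _] := kap_bounds R W0 Wk V00 D0 q; rewrite addr_ge0.
    - by rewrite -exprM mulnC.
    - rewrite exprS -mulrA; apply: le_trans (lerD lb sb) _; rewrite -mulrDl mulrA; apply: ler_wpM2r.
        by rewrite invr_ge0 ltW.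
      have y612 : Y ^+ 6 <= Y ^+ 12 by exact: Ymono.
      apply: (@le_trans _ _ (72 * Y ^+ 12)); last by rewrite ler_wpM2r // ltW.
      by have := Yn0 12; move: y612; lra.
  rewrite /e1 mulrA -exprD ler_pdivrMr // mulrC ler_pdivlMr // -exprD.
  by apply: Ymono; rewrite egam; case: (sieve_dim_bounds k).
have t2 : D.+1%:R * (2 * D%:R * bad_sum Z W X V0 a g) <= e1.
  apply: (@le_trans _ _ (2 * D%:R * (2 * D%:R * (2 * Y ^+ 4 / D%:R ^+ 17)))).
    apply: ler_pM => //.
    - rewrite mulr_ge0 ?mulr_ge0 //; apply: sumr_ge0 => n _; case: ifP => // _.
      by apply: base_weight_ge0; exact: weight_01.
    - by rewrite -natrM ler_nat mul2n -addnn -addn1 leq_add2l.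
    - by rewrite ler_wpM2l // mulr_ge0.
  rewrite (_ : 2 * D%:R * _ = 8 * Y ^+ 4 / D%:R ^+ 15); last by field; rewrite lt0r_neq0.
  rewrite /e1 ler_pdivrMr ?exprn_gt0 // [X in _ <= X]mulrC ler_pdivlMr //.
  apply: (@le_trans _ _ (D%:R ^+ 1)); last by rewrite ler_weXn2l // ler1n.
  rewrite expr1; apply: le_trans YD; apply: (@le_trans _ _ (Y * Y ^+ 4 * Y ^+ (88 * k).+1)).
    rewrite ler_wpM2r ?(ltW (Yn0 _)) // ler_wpM2r ?(ltW (Yn0 _)) //; move: Y72; lra.
  by rewrite -exprS -exprD; apply: Ymono; rewrite egam; case: (sieve_dim_bounds k).
have t3 : 3 * e1 <= ev lw (shift_density R W k0) * R0.
  apply: (@le_trans _ _ (2 ^- (88 * k * t).+1 * (4 * W%:R)^-1)); last first.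
    by apply: ler_pM; rewrite ?invr_ge0 ?exprn_ge0 ?mulr_ge0.
  rewrite -invfM (_ : 2 ^+ (88 * k * t).+1 * (4 * W%:R) = 8 * W%:R * Y ^+ (88 * k)); last first.
    by rewrite exprS mulnC exprM; ring.
  have swap (y w : R) : 3 * (8 * w * y) = y * (24 * w) by ring.
  rewrite /e1 exprSr ler_pdivrMr ?mulr_gt0 // [X in _ <= X]mulrC ler_pdivlMr ?mulr_gt0 // swap.
  by apply: ler_wpM2l; [exact: ltW | move: WYR W0R; lra].
by rewrite -/e1 => h; move: t1 t2 t3 h e10; lra.
Qed.

End SiftedSum.

(** * Primes p with almost prime p+1, ..., p+k *)

Section AlmostPrimeShifts.
Variable R : realType.
Local Notation C := R[i].
Notation lnn := (lnn R).
Notation mangoldt := (mangoldt R).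

(** The term of order j + 1 of the exponential series for 2^t already exceeds c (t+1)^j when t is
    large. *)
Lemma eventually_pow2 (c : R) j : exists t0, forall t, (t0 <= t)%N -> c * t.+1%:R ^+ j <= 2 ^+ t.
Proof.
wlog c0 : c / 0 <= c => [Wl|].
  have [t0 h] := Wl `|c| (normr_ge0 _); exists t0 => t tt; apply: le_trans (h t tt).
  by apply: ler_wpM2r; [exact: exprn_ge0 | exact: ler_norm].
pose B : R := c * 2 ^+ j * (2 ^+ j.+1 * (j.+1)`!%:R).
exists (Num.truncn B).+1 => t tB.
have t1 : 1 <= t%:R :> R by rewrite ler1n; apply: leq_trans tB.
have t0 : 0 <= t%:R :> R by [].
have Bt : B <= t%:R by apply: ltW; apply: lt_le_trans (truncnS_gt _) _; rewrite ler_nat.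
have F0 : 0 < (j.+1)`!%:R :> R by rewrite ltr0n fact_gt0.
have P0 : 0 < 2 ^+ j.+1 :> R by exact: exprn_gt0.
apply: (@le_trans _ _ (c * (2 ^+ j * t%:R ^+ j))).
  apply: ler_wpM2l => //; rewrite -exprMn; apply: lerXn2r; rewrite ?nnegrE ?mulr_ge0 //.
  by rewrite -natr1; lra.
apply: (@le_trans _ _ ((t%:R / 2) ^+ j.+1 / (j.+1)`!%:R)).
  rewrite ler_pdivlMr // expr_div_n ler_pdivlMr // (exprS t%:R).
  rewrite (_ : c * _ * _ * _ = B * t%:R ^+ j); last by rewrite /B; ring.
  by apply: ler_wpM2r => //; exact: exprn_ge0.
rewrite -natrX expR_lnn2; apply: le_trans (expR_ge_pow j.+1 _) _; first by rewrite divr_ge0.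
by rewrite ler_expR ler_wpM2l // lnn2_ge.
Qed.

Lemma sum_shift_index_le X (i c : nat) (v : R) : 0 <= v ->
  \sum_(1 <= n < X.+1) (if (n + i == c)%N then v else 0) <= v.
Proof.
move=> v0; apply: (@le_trans _ _ (\sum_(1 <= n < X.+1) (if (n == c - i)%N then v else 0))).
  apply: ler_sum => n _; case: eqP => [<-|_]; first by rewrite addnK eqxx.
  by case: ifP.
by case: (boolP (0 < c - i <= X)%N) => h; [rewrite sum_eq_index | rewrite sum_eq_index0].
Qed.

(** The shift i = 0 is included in order to exclude proper prime powers n as well. *)
Definition square_shift k z n := exists s i, [/\ (z < s)%N, (i <= k)%N & (s ^ 2 %| n + i)%N].

(** Write n + i = s^2 l. As i <= k < n one has 1/n <= 2/(n + i), so the sum separates into 1/s^2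
    over s > z, of size 1/z, and a harmonic sum over l; with z = 2^(2^t) this is far below the
    sifted sum. *)
Lemma square_shift_sum k z V X : (0 < z)%N -> (k <= V)%N ->
  \sum_(1 <= n < X.+1) (if boolp.asbool ((V < n)%N /\ square_shift k z n) then mangoldt n / n%:R else 0)
   <= 4 * k.+1%:R * logX R X ^+ 2 / z%:R.
Proof.
move=> z0 kV; have L1 := logX_ge1 R X; have L0 : 0 <= logX R X by exact: le_trans L1.
pose X2 := (2 * X)%N.
pose v s l : R := 2 * logX R X * (s.+1%:R ^- 2 * l%:R^-1).
have v0 s l : 0 <= v s l by apply: mulr_ge0; apply: mulr_ge0; rewrite ?invr_ge0 ?exprn_ge0.
apply: (@le_trans _ _ (\sum_(1 <= n < X.+1) \sum_(i < k.+1) \sum_(z <= s < z + X2) \sum_(1 <= l < X2.+1)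
   (if (n + i == s.+1 ^ 2 * l)%N then v s l else 0))).
  apply: ler_sum_nat => n /andP[n0 nX].
  have rest0 (P : nat -> nat -> nat -> bool) s l i : 0 <= (if P s l i then v s l else 0) by case: ifP.
  case: ifP => [/boolp.asboolP[Vn [s' [i [zs ik]]]]|_]; last first.
    by apply: sumr_ge0 => i _; apply: sumr_ge0 => s _; apply: sumr_ge0 => l _; case: ifP.
  case: s' zs => // s zs /dvdnP[l e].
  have l0 : (0 < l)%N by case: l e => // e; move: n0; rewrite -(leq_add2r i) e; lia.
  have n2 : (n + i <= 2 * n)%N by rewrite mul2n -addnn leq_add2l; exact: leq_trans ik (leq_trans kV (ltnW Vn)).
  have nX2 : (n + i <= X2)%N by apply: leq_trans n2 _; rewrite leq_mul2l.
  have sl : (s.+1 <= s.+1 ^ 2)%N by rewrite -{1}(expn1 s.+1) leq_pexp2l.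
  have l1 : (l <= n + i)%N by rewrite e leq_pmulr // expn_gt0.
  have s1 : (s.+1 <= n + i)%N by rewrite e; apply: leq_trans sl _; rewrite leq_pmull.
  have ik' : (i < k.+1)%N by [].
  rewrite (bigD1 (Ordinal ik')) //= (bigD1_seq s) ?iota_uniq ?mem_index_iota //=; last first.
    by rewrite -ltnS zs /= ltn_addl // (leq_trans s1).
  rewrite (bigD1_seq l) ?iota_uniq ?mem_index_iota //=; last by rewrite l0 ltnS (leq_trans l1).
  rewrite e mulnC eqxx -!addrA ler_wpDr //.
    apply: addr_ge0; first by apply: sumr_ge0 => ? _; case: ifP.
    apply: addr_ge0; first by do 2! (apply: sumr_ge0 => ? _); case: ifP.
    by do 3! (apply: sumr_ge0 => ? _); case: ifP.
  have n0R : 0 < n%:R :> R by rewrite ltr0n.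
  have c0R : 0 < (n + i)%:R :> R by rewrite ltr0n addn_gt0 n0.
  have regroup (x1 x2 x3 : R) : 2 * x1 * (x2 * x3) = x1 * (2 * (x3 * x2)) by ring.
  have -> : v s l = logX R X * (2 / (n + i)%:R) by rewrite /v regroup -invfM -natrX -natrM -e.
  apply: ler_pM; rewrite ?mangoldt_ge0 ?invr_ge0 //.
    apply: le_trans (mangoldt_le _ _) _; apply: (@le_trans _ _ (lnn X)); last by rewrite lerDr.
    by apply: lnn_le.
  by rewrite ler_pdivlMr // mulrC ler_pdivrMr // -natrM ler_nat.
rewrite exchange_big /=; apply: (@le_trans _ _ (\sum_(i < k.+1) \sum_(z <= s < z + X2) \sum_(1 <= l < X2.+1) v s l)).
  apply: ler_sum => i _; rewrite exchange_big /=; apply: ler_sum => s _.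
  rewrite exchange_big /=; apply: ler_sum => l _; exact: sum_shift_index_le.
rewrite sumr_const card_ord -[X in X <= _]mulr_natl.
have z0R : 0 < z%:R :> R by rewrite ltr0n.
have inner : \sum_(z <= s < z + X2) \sum_(1 <= l < X2.+1) v s l <= 2 * logX R X * (z%:R^-1 * (2 * logX R X)).
  rewrite /v; under eq_bigr do rewrite -mulr_sumr -mulr_sumr.
  rewrite -mulr_sumr; apply: ler_wpM2l; first exact: mulr_ge0.
  rewrite -mulr_suml; apply: ler_pM.
  - by apply: sumr_ge0 => s _; rewrite invr_ge0 exprn_ge0.
  - by apply: sumr_ge0 => l _; rewrite invr_ge0.
  - exact: sum_inv_sqr_le.
  - apply: le_trans (harmonic_le _ _) _.
    case: (posnP X) => [X0|X0].
      have e : lnn X2 = 0 by rewrite /X2 X0 muln0 /lnn ln0.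
      by rewrite e addr0; move: L1; lra.
    rewrite /X2 lnnM // addrA /logX; have := lnn2_le1 R; have := lnn_ge0 R X; lra.
apply: le_trans (ler_wpM2l (ler0n _ _) inner) _; rewrite expr2; ring_le.
Qed.

Lemma prod_primes_dvd (s : seq nat) n : uniq s -> (forall q, q \in s -> prime q && (q %| n)%N) ->
  (\prod_(q <- s) q %| n)%N.
Proof.
elim: s => [|q s IH] /=; first by rewrite big_nil dvd1n.
case/andP=> qs us h; rewrite big_cons Gauss_dvd.
  have /andP[_ ->] := h q (mem_head q s).
  by apply: IH => // r rs; apply: h; rewrite inE rs orbT.
have /andP[pq _] := h q (mem_head q s); rewrite prime_coprime //; apply/negP.
have : forall r, r \in s -> prime r by move=> r rs; have : prime r && (r %| n)%N by [apply: h; rewrite inE rs orbT]; case/andP.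
elim: (s) qs => [|r s' IH'] /=; first by rewrite big_nil Euclid_dvd1.
rewrite inE negb_or => /andP[qr qs'] pr; rewrite big_cons Euclid_dvdM // => /orP[|].
  by move=> d; case/negP: qr; rewrite -dvdn_prime2 // pr ?mem_head.
by apply: IH' => // x xs; apply: pr; rewrite inE xs orbT.
Qed.

(** The square of p^(j/2), rounded down, divides p^j; the worst exponent is j = 3, whence the cube
    of z. *)
Lemma prime_power_square p j z : prime p -> (1 < j)%N -> (z ^ 3 < p ^ j)%N -> (z < p ^ j./2)%N.
Proof.
move=> pp j1 h; rewrite -(@ltn_exp2r _ _ 3) //; apply: leq_trans h _; rewrite -expnM leq_exp2l ?prime_gt1 //.
by have := odd_double_half j; case: (odd j) => /= e; rewrite -{1}e; lia.
Qed.

Section FixedScale.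
Variables (W k0 t a gam D N m X N1 : nat).
Local Notation k := k0.+1.
Local Notation M := (2 ^ t)%N.
Local Notation Z := (2 ^ (2 ^ t)).+1.
Local Notation T := 'I_Z.
Local Notation V0 := (D ^ 18)%N.
Notation Y := (2 ^+ t : R).
Notation g := (weight R N m).
Notation PP := (sieving_primes Z W).
Hypotheses (W0 : (0 < W)%N) (N0 : (0 < N)%N) (D0 : (0 < D)%N).
Hypotheses (Wk : forall p, prime p -> (p <= k.*2.+1)%N -> (p %| W)%N).
Hypothesis sifted : Y ^- (88 * k).+1 <=
  \sum_(1 <= n < X.+1) base_weight Z W X V0 a g n * \prod_(q in PP) (1 - shift_count R W k0 q n).
Hypothesis small_squares : 4 * k.+1%:R * logX R X ^+ 2 / (2 ^ M)%:R < Y ^- (88 * k).+1.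
Hypotheses (kV : (k <= V0)%N) (ZV : ((2 ^ M) ^ 3 <= V0)%N).

(** A positive sifted term forces mangoldt n <> 0 and no prime factor up to 2^(2^t), outside W, in
    any n + i. It remains to find such an n without large square factor. *)
Lemma sifted_prime : exists p, [/\ prime p, (p == a %[mod W])%N, (2 ^ M < p <= X)%N &
  forall i, (0 < i <= k)%N -> forall q, prime q -> ~~ (q %| W)%N -> (q %| p + i)%N ->
    (2 ^ M < q)%N /\ ~~ (q ^ 2 %| p + i)%N].
Proof.
pose sq n := boolp.asbool ((V0 < n)%N /\ square_shift k (2 ^ M) n).
pose P n : R := \prod_(q in PP) (1 - shift_count R W k0 q n).
have c01 (q : T) n : 0 <= shift_count R W k0 q n <= 1 by exact: (shift_count_01 R W0 Wk (isT : (0 < 1)%N) D0).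
have P01 n : 0 <= P n <= 1 by apply: prod_le1 => q; exact: c01.
(* Were every sifted term at most the corresponding square term, [small_squares] and [sifted] would
   contradict each other. *)
have [n [/andP[n0 nX] hn]] : exists n, (0 < n < X.+1)%N /\
    (if sq n then mangoldt n / n%:R else 0) < base_weight Z W X V0 a g n * P n.
  apply: boolp.contrapT => H; have := lt_le_trans small_squares sifted.
  rewrite ltNge; apply/negP; rewrite negbK; apply: le_trans (square_shift_sum X _ kV); last by rewrite expn_gt0.
  apply: ler_sum_nat => n nX; rewrite leNgt; apply/negP => h; apply: H; by exists n.
have /andP[p0 p1] := P01 n.
have bw : base_weight Z W X V0 a g n <= if (V0 < n)%N then mangoldt n / n%:R else 0.
  rewrite /base_weight /sieve_weight; case: (V0 < n)%N => /=; last by rewrite mulr0.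
  have mn : 0 <= mangoldt n / n%:R by rewrite divr_ge0 ?mangoldt_ge0.
  case: ifP => _; last by rewrite mulr0.
  have /andP[g0 g1] := @weight_01 R N m N0 n.
  rewrite /locprod big_set0 mul1r mulrA mulrAC -[X in _ <= X]mulr1; exact: ler_wpM2l.
have b0 : 0 <= base_weight Z W X V0 a g n by apply: base_weight_ge0; exact: weight_01.
have bp : 0 < base_weight Z W X V0 a g n * P n.
  by apply: le_lt_trans hn; case: ifP => // _; rewrite divr_ge0 ?mangoldt_ge0.
have bn : base_weight Z W X V0 a g n != 0 by apply: contraTneq bp => ->; rewrite mul0r ltxx.
have Pn : P n != 0 by apply: contraTneq bp => ->; rewrite mulr0 ltxx.
have [Vn nXb na Ln] : [/\ (V0 < n)%N, (n <= X)%N, (n == a %[mod W])%N & mangoldt n != 0].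
  move: bn; rewrite /base_weight mulf_eq0 negb_or /sieve_weight => /andP[->].
  by case: ifP => [/andP[/andP[-> ->] ->]|]; rewrite ?eqxx.
have nsq : ~ square_shift k (2 ^ M) n.
  move=> h; have sn : sq n by apply/boolp.asboolP.
  move: hn; rewrite sn ltNge => /negP; apply; apply: le_trans (ler_wpM2l b0 p1) _.
  by rewrite mulr1; move: bw; rewrite Vn.
have [p [j [pp j0 e]]] := mangoldt_ppow Ln.
have zV : (2 ^ M < n)%N.
  by apply: leq_ltn_trans Vn; apply: leq_trans ZV; rewrite -{1}(expn1 (2 ^ M)) leq_pexp2l // expn_gt0.
have j1 : j = 1%N.
  apply/eqP; rewrite eqn_leq j0 andbT leqNgt; apply/negP => j1; apply: nsq.
  exists (p ^ j./2)%N, 0%N; split=> //.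
    by apply: prime_power_square => //; rewrite -e; exact: leq_ltn_trans ZV Vn.
  rewrite addn0 e -expnM dvdn_exp2l // muln2 -{2}(odd_double_half j) leq_addl //.
exists n; split=> //; first by rewrite e j1 expn1.
  by rewrite zV.
move=> i /andP[i0 ik] q pq qW qn.
have zq : (2 ^ M < q)%N.
  rewrite ltnNge; apply/negP => qz; have qZ : (q < Z)%N by [].
  have qP : Ordinal qZ \in PP by rewrite inE /sievable /= pq qW.
  case/negP: Pn; rewrite /P (bigD1 (Ordinal qZ)) //= mulf_eq0; apply/orP; left.
  rewrite subr_eq0 eq_le andbC; have /andP[_ ->] := c01 (Ordinal qZ) n; rewrite /= /shift_count qP.
  have ik' : (i.-1 < k)%N by rewrite -ltnS prednK.
  rewrite (bigD1 (Ordinal ik')) //= prednK // qn lerDl; apply: sumr_ge0 => j' _; by case: ifP.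
split=> //; apply/negP => h; apply: nsq; by exists q, i.
Qed.

(** These primes exceed 2^(2^t) and their product divides p + i <= 2 X, which is less than a fixed
    power of 2^(2^t). *)
Lemma sifted_prime_count p i : (2 * X < 2 ^ ((6 * (144 * (360 * k + 6))).+2 * M))%N -> (0 < p <= X)%N -> (i <= k)%N -> (k <= p)%N ->
  (forall q, prime q -> ~~ (q %| W)%N -> (q %| p + i)%N -> (2 ^ M < q)%N) ->
  (size [seq q <- iota 0 (p + i).+1 | [&& prime q, ~~ (q %| W)%N & (q %| p + i)%N]] <= (6 * (144 * (360 * k + 6))).+2)%N.
Proof.
move=> XM /andP[p0 pX] ik kp h; set s := [seq q <- _ | _].
have hs q : q \in s -> [&& prime q, ~~ (q %| W)%N & (q %| p + i)%N] by rewrite mem_filter => /andP[].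
have d : (\prod_(q <- s) q %| p + i)%N.
  by apply: prod_primes_dvd; [rewrite filter_uniq // iota_uniq | move=> q /hs /and3P[-> _ ->]].
have pi0 : (0 < p + i)%N by rewrite addn_gt0 p0.
have le1 : ((2 ^ M) ^ size s <= \prod_(q <- s) q)%N.
  elim: (s) hs => [|q s' IH] hs'; first by rewrite big_nil.
  rewrite big_cons /= expnS; apply: leq_mul.
    by have /and3P[a1 a2 a3] := hs' q (mem_head q s'); apply: ltnW; exact: h.
  by apply: IH => r rs; apply: hs'; rewrite inE rs orbT.
have le2 : (p + i <= 2 * X)%N by rewrite mul2n -addnn leq_add // (leq_trans ik) // (leq_trans kp).
have lt : (2 ^ (M * size s) < 2 ^ ((6 * (144 * (360 * k + 6))).+2 * M))%N.
  by rewrite expnM; apply: leq_ltn_trans XM; apply: leq_trans le2; apply: leq_trans le1 _; exact: dvdn_leq.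
by move: lt; rewrite ltn_exp2l // mulnC ltn_mul2r expn_gt0 /= => /ltnW.
Qed.

End FixedScale.

Let summand_le (x1 x2 x3 x4 x5 x6 : nat) : let s := (x1 + x2 + x3 + x4 + x5 + x6)%N in
  [/\ (x1 <= s)%N, (x2 <= s)%N, (x3 <= s)%N, (x4 <= s)%N & (x5 <= s)%N /\ (x6 <= s)%N].
Proof. by move=> s; rewrite /s; split; [lia|lia|lia|lia|split; lia]. Qed.

(** [K0] comes before [W], [a] and [Zb]: in the application the precision is chosen in terms of
    [K0], and [W] in terms of the precision. *)
Theorem almost_prime_shifts k0 : exists K0, forall W a Zb, (0 < W)%N ->
  (forall p, prime p -> (p <= k0.+1.*2.+1)%N -> (p %| W)%N) -> coprime a W ->
  exists p, [/\ prime p, (p == a %[mod W])%N, (Zb < p)%N &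
    forall i, (0 < i <= k0.+1)%N ->
      (forall q, prime q -> ~~ (q %| W)%N -> (q %| p + i)%N -> (Zb < q)%N /\ ~~ (q ^ 2 %| p + i)%N) /\
      (size [seq q <- iota 0 (p + i).+1 | [&& prime q, ~~ (q %| W)%N & (q %| p + i)%N]] <= K0)%N].
Proof.
pose k := k0.+1; pose d := (360 * k + 6)%N; pose gam := (132 * k + 20)%N.
exists (6 * (144 * d)).+2 => W a Zb W0 Wk aW.
pose kap : R := 26 + 4 * lnn W + 4 * (4 * gam)%:R.
have kap0 : 26 <= kap.
  by rewrite /kap -addrA lerDl addr_ge0 ?mulr_ge0 ?lnn_ge0.
have sc0 := sep_const_gt0 R.
(* Each summand of [cn] serves one of the inequalities b1 to b6. *)
pose cn := (72 * W + 624 * gam + 865 * d + (88 * k + 9) + Zb + 4 * k.+1)%N.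
(* 416 = 32 * 13: this summand secures 32 m / eta <= 2^t, with m = 13 gam t and 1/eta proportional
   to (t+1)^9; hence also the exponent 10 below. *)
pose c : R := cn%:R + 416 * gam%:R * (kap ^+ 9 / sep_const R).
have kp : 0 <= kap ^+ 9 / sep_const R by rewrite divr_ge0 ?exprn_ge0 ?(ltW sc0) // (le_trans _ kap0).
have [t0 ht0] := eventually_pow2 c 10.
have [t tt noexc] := @good_scales R W (4 * gam) W0 (t0 + 18 * k * k + 1)%N.
have tt0 : (t0 <= t)%N by apply: leq_trans tt; rewrite -addnA leq_addr.
have t1 : (0 < t)%N by apply: leq_trans tt; rewrite addn1.
have tk : (18 * k * k <= t)%N by apply: leq_trans tt; rewrite addn1 ltnW // ltnS leq_addl.
have Y0 : 0 < 2 ^+ t :> R by exact: exprn_gt0.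
have hc := ht0 t tt0.
have T1 : 1 <= t.+1%:R :> R by rewrite ler1n.
have hn : (cn * t.+1 <= 2 ^ t)%N.
  rewrite -(ler_nat R) natrM natrX; apply: le_trans hc; apply: ler_pM => //.
    by rewrite lerDl mulr_ge0 // mulr_ge0.
  by rewrite -[X in X <= _]expr1 ler_weXn2l.
have ct : (cn <= 2 ^ t)%N by apply: leq_trans hn; rewrite leq_pmulr.
have he : 416 * gam%:R * t.+1%:R * (kap ^+ 9 / sep_const R * t.+1%:R ^+ 9) <= 2 ^+ t.
  apply: le_trans hc; rewrite (exprS _ 9) /c mulrDl.
  have : 0 <= cn%:R * (t.+1%:R * t.+1%:R ^+ 9) :> R by rewrite !mulr_ge0 // exprn_ge0.
  have regroup (x1 x2 x3 x4 : R) : x1 * x2 * (x3 * x4) = x1 * x3 * (x2 * x4) by ring.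
  by rewrite regroup; lra.
(* D is the level of [sieve_weights]. The factor 144 = 8 * 18 makes 8 log(D^18) <= N, as the head of
   the weight requires, and X = 2^(6 N) is where its tail begins. *)
pose M := (2 ^ t)%N; pose D := (2 ^ (d * M))%N; pose N := (144 * d * M)%N.
pose m := (t * (13 * gam))%N; pose X := (2 ^ (6 * N))%N; pose N1 := (N %/ (4 * m))%N.
have gam0 : (0 < gam)%N by rewrite /gam addn_gt0 orbT.
have d0 : (0 < d)%N by rewrite /d addn_gt0 orbT.
have k_gt0 : (0 < k)%N by [].
have M0 : (0 < M)%N by rewrite expn_gt0.
have N0 : (0 < N)%N by rewrite !muln_gt0 d0.
have m0 : (0 < m)%N by rewrite !muln_gt0 t1 gam0.
have cM x : (x <= cn)%N -> (x * t <= M)%N by move=> xc; apply: leq_trans hn; exact: leq_mul.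
have cM1 x : (x <= cn)%N -> (x <= M)%N by move=> xc; exact: leq_trans xc ct.
have [b1 b2 b3 b4 [b5 b6]] : [/\ (72 * W <= M)%N, (624 * gam * t <= M)%N, (865 * d <= M)%N, ((88 * k + 9) * t <= M)%N &
    (Zb <= M)%N /\ (4 * k.+1 <= M)%N].
  have [c1 c2 c3 c4 [c5 c6]] := summand_le (72 * W) (624 * gam) (865 * d) (88 * k + 9) Zb (4 * k.+1).
  by split; [exact: cM1 | exact: cM | exact: cM1 | exact: cM | split; exact: cM1].
have MR : M%:R = 2 ^+ t :> R by rewrite natrX.
have eV : ((D ^ 18) = 2 ^ (18 * (d * M)))%N by rewrite -expnM mulnC.
have N18 : (18 * (d * M) <= N)%N by rewrite /N -mulnA leq_mul2r orbT.
have D1 : (1 < D)%N by rewrite -{1}(expn0 2) ltn_exp2l // muln_gt0 d0.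
have VX : (D ^ 18 <= X)%N by rewrite eV leq_exp2l // (leq_trans N18) // leq_pmull.
have n6 : ((6 * N).+1 <= M ^ 2)%N.
  by rewrite expnS expn1; apply: leq_trans (leq_mul b3 (leqnn M)); rewrite /N; move: M0 d0; clear; nia.
have n6R : (6 * N).+1%:R <= (2 ^+ t) ^+ 2 :> R by rewrite -MR -natrX ler_nat.
have LY : logX R X <= (2 ^+ t) ^+ 2.
  apply: le_trans n6R; rewrite /logX lnnX // -natr1 addrC lerD2r.
  by rewrite -[X in _ <= X]mulr1 ler_wpM2l // lnn2_le1.
have mN : (4 * m * 12 <= N)%N.
  by apply: (@leq_trans (624 * gam * t)); [rewrite /m; move: t1; clear; lia | apply: (leq_trans b2); rewrite /N leq_pmull // muln_gt0 d0].
have eY : (2 ^ (18 * k * k) <= 2 ^ t)%N by rewrite leq_exp2l.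
have YD : (2 ^+ t) ^+ (2 * gam + 9) <= D%:R :> R.
  rewrite -exprM natrX ler_weXn2l ?ler1n // (@leq_trans M) ?leq_pmull //.
  by apply: leq_trans b2; rewrite mulnC leq_mul2r; apply/orP; right; move: gam0; clear; lia.
have hV : 8 * lnn (D ^ 18) <= N%:R.
  rewrite eV lnnX // mulrA -natrM -[X in _ <= X]mulr1; apply: ler_pM; rewrite ?lnn_ge0 ?lnn2_le1 // ler_nat.
  by rewrite /N; clear; lia.
have K26 := Kscale_ge26 R W (4 * gam) t; have [eta0 eta1 _] := sep_eta_bounds K26.
set eta := sep_eta _ in eta0 eta1.
have ei : eta^-1 = kap ^+ 9 / sep_const R * t.+1%:R ^+ 9.
  by rewrite /eta /sep_eta /Kscale -/kap invf_div exprMn mulrAC.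
have g1 : 1 <= gam%:R :> R by rewrite ler1n.
have ei0 : 0 < eta^-1 by rewrite invr_gt0.
rewrite -ei in he.
have etaY : 4 / eta <= 2 ^+ t.
  apply: le_trans he; apply: ler_wpM2r; first exact: ltW.
  by rewrite -!natrM ler_nat -mulnA (@leq_trans 416) // leq_pmulr // muln_gt0 gam0.
have mK : 32 * m%:R / N%:R <= eta.
  rewrite ler_pdivrMr ?ltr0n // [X in _ <= X]mulrC -ler_pdivrMr // /m !natrM.
  apply: (@le_trans _ _ (2 ^+ t)).
    apply: le_trans he; apply: ler_wpM2r; first exact: ltW.
    rewrite -!natrM ler_nat; move: (gam); clear; nia.
  by rewrite -MR -!natrM ler_nat leq_pmull // muln_gt0 d0.
have NY : 20 * N%:R ^+ 2 <= (2 ^+ t) ^+ 4 :> R.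
  rewrite -MR -!natrX -natrM ler_nat (_ : M ^ 4 = M ^ 2 * M ^ 2)%N; last by rewrite -expnD.
  rewrite /N (expnMn (144 * d) M) mulnA leq_mul2r; apply/orP; right.
  by apply: (@leq_trans ((865 * d) ^ 2)); [rewrite !expnMn; clear; lia | rewrite leq_exp2r].
have ZD : (2 ^ M <= D)%N by rewrite leq_exp2l // leq_pmull.
have N1m : (4 * m * N1 <= N)%N by rewrite mulnC /N1 leq_trunc_div.
have N112 : (12 <= N1)%N by rewrite leq_divRL; [rewrite mulnC | rewrite muln_gt0 m0].
have V2 : (D ^ 18 <= 2 ^ N)%N by rewrite eV leq_exp2l.
have mN' : (4 * m <= N)%N by apply: leq_trans mN; rewrite leq_pmulr.
have sifted := @sifted_lower R W k0 t a gam D N m X N1 W0 Wk N0 m0 D1 VX LY mN' b1 eY YD aW erefl erefl hV erefl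
  noexc mK etaY NY n6R ZD N1m N112 V2 erefl.
have kV : (k <= D ^ 18)%N.
  have kM : (k <= M)%N by apply: leq_trans b6; apply: (leq_trans (leqnSn k)); rewrite leq_pmull.
  rewrite (leq_trans kM) // eV (leq_trans (ltnW (ltn_expl M (isT : (1 < 2)%N)))) // leq_exp2l //.
  by rewrite mulnA leq_pmull // muln_gt0 d0.
have ZV : ((2 ^ M) ^ 3 <= D ^ 18)%N.
  by rewrite eV -expnM leq_exp2l // mulnC mulnA leq_mul2r; apply/orP; right; move: d0; clear; lia.
have sq : 4 * k.+1%:R * logX R X ^+ 2 / (2 ^ M)%:R < (2 ^+ t) ^- (88 * k).+1.
  rewrite ltr_pdivrMr ?ltr0n ?expn_gt0 // [X in _ < X]mulrC ltr_pdivlMr ?exprn_gt0 //.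
  have L2 : logX R X ^+ 2 <= (2 ^+ t) ^+ 4.
    have L0 := le_trans ler01 (logX_ge1 R X).
    by rewrite (exprM (2 ^+ t : R) 2 2); apply: lerXn2r; rewrite ?nnegrE ?exprn_ge0.
  apply: (@le_lt_trans _ _ (2 ^+ t * (2 ^+ t) ^+ 4 * (2 ^+ t) ^+ (88 * k).+1)).
    apply: ler_wpM2r; first by rewrite exprn_ge0 // ltW.
    apply: ler_pM => //; rewrite ?mulr_ge0 ?exprn_ge0 ?(le_trans ler01 (logX_ge1 R X)) //.
    by rewrite -MR -natrM ler_nat.
  rewrite -exprS -exprD -exprM natrX ltr_eXn2l ?ltr1n //; apply: leq_trans b4.
  by rewrite mulnC ltn_mul2r t1 /=; clear; lia.
have [p [pp pa /andP[zp pX] hp]] := @sifted_prime W k0 t a D N m X W0 N0 (ltnW D1) Wk sifted sq kV ZV.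
have Zz : (Zb <= 2 ^ M)%N by apply: leq_trans b5 (ltnW _); exact: ltn_expl.
exists p; split=> //; first exact: leq_ltn_trans zp.
move=> i ik; split=> [q pq qW qi|].
  by have [h1 h2] := hp i ik q pq qW qi; split=> //; exact: leq_ltn_trans h1.
have k_le_p : (k <= p)%N.
  have kM : (k <= M)%N by apply: leq_trans b6; apply: (leq_trans (leqnSn k)); rewrite leq_pmull.
  by apply: leq_trans (ltnW zp); apply: leq_trans kM (ltnW _); exact: ltn_expl.
case/andP: (ik) => i0 ik'; apply: (@sifted_prime_count W k0 t X).
- by rewrite /X -expnS ltn_exp2l // -/d -/M /N; move: M0; clear; nia.
- by rewrite prime_gt0.
- exact: ik'.
- exact: k_le_p.
- by move=> q pq qW qi; have [] := hp i ik q pq qW qi.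
Qed.

End AlmostPrimeShifts.

(** * Values of multiplicative functions at shifted primes *)

Section MultiplicativeFunctions.
Variable R : realType.
Implicit Types (f : nat -> R) (n i j p q B : nat).

Lemma prod_logn n B : (0 < n < B)%N -> (\prod_(0 <= q < B | prime q) q ^ logn q n = n)%N.
Proof.
case/andP=> n0 nB; rewrite -[RHS](partnT n0) /partn big_mkcond (big_cat_nat (n := n.+1)) //=.
rewrite [X in (_ * X)%N]big_nat_cond [X in (_ * X)%N]big1 ?muln1.
  by apply: eq_bigr => q _; case: ifP => // pq; rewrite lognE pq.
move=> q /andP[/andP[nq _] _]; case: ifP => // pq.
by rewrite lognE pq n0 gtnNdvd ?expn0.
Qed.

Lemma mult_prod_logn f n B : multiplicative_fn R f -> (0 < n < B)%N ->
  f n = \prod_(0 <= q < B | prime q) f (q ^ logn q n)%N.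
Proof.
move=> [f1 fM] nB; rewrite -[in LHS](prod_logn nB).
elim: (B) => [|b IH]; first by rewrite !big_geq.
rewrite big_mkcond [RHS]big_mkcond !(big_nat_recr b) //= -!big_mkcond /=.
case: ifP => pb; last by rewrite muln1 mulr1.
have pos : (0 < \prod_(0 <= q < b | prime q) q ^ logn q n)%N.
  by apply: prodn_cond_gt0 => q pq; rewrite expn_gt0 prime_gt0.
have cop : coprime (\prod_(0 <= q < b | prime q) q ^ logn q n) (b ^ logn b n).
  apply: coprimeXr; rewrite big_nat_cond; elim/big_ind: _ => [|x y cx cy|q /andP[/andP[_ qb] pq]].
  - exact: coprime1n.
  - by rewrite coprimeMl cx.
  - by apply: coprimeXl; rewrite prime_coprime // dvdn_prime2 // ltn_eqF.
by rewrite fM // ?IH // expn_gt0 prime_gt0.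
Qed.

Lemma mult_inv f : multiplicative_fn R f -> multiplicative_fn R (fun n => (f n)^-1).
Proof.
by case=> f1 fM; split=> [|m n m0 n0 c]; rewrite ?f1 ?invr1 // fM // invfM.
Qed.

(* The partial sums of (f p - 1)^+ force the greedy product to climb through y in steps
   of relative size at most 1 + e. *)
Lemma greedy_product f (e y : R) N0 : 0 < e -> 1 <= y -> (forall n, (0 < n)%N -> 0 < f n) ->
  (forall M : R, exists N, M < \sum_(0 <= p < N | prime p) Num.max 0 (f p - 1)) ->
  (exists N, forall p, prime p -> (N <= p)%N -> `|f p - 1| < e) ->
  exists s : seq nat, [/\ uniq s, (forall q, q \in s -> prime q /\ (N0 < q)%N) &
    y <= \prod_(q <- s) f q <= y * (1 + e)].
Proof.
move=> e0 y1 fp div [N1 hN1].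
pose L := maxn N0.+1 N1; pose P q := prime q && (1 < f q).
pose F n : R := \prod_(L <= q < n | P q) f q.
have sub n : (L <= n)%N -> \sum_(L <= q < n | prime q) Num.max 0 (f q - 1) <= F n.
  elim: n => [|n IH] Ln.
    by rewrite big_geq // /F big_geq ?ler01 // ltnW.
  case: (leqP L n) => Ln'; last by rewrite big_geq // /F big_geq ?ler01.
  have h := IH Ln'; have F1 : 1 <= F n.
    by rewrite /F; elim/big_ind: _ => [//|x z x1 z1|q /andP[_ /ltW //]]; rewrite mulr_ege1.
  rewrite /F big_mkcond [X in _ <= X]big_mkcond !(big_nat_recr n) //= -!big_mkcond /= -/(F n) /P.
  case: ifP => pn /=; last by rewrite addr0 mulr1.
  case: (boolP (1 < f n)) => f1; last first.
    by rewrite mulr1 (max_idPl _) ?addr0 // subr_le0 leNgt.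
  rewrite (max_idPr _) ?subr_ge0 ?(ltW f1) //.
  apply: (@le_trans _ _ (F n + F n * (f n - 1))); last by rewrite mulrBr mulr1 addrC subrK.
  by apply: lerD => //; rewrite ler_peMl // subr_ge0 ltW.
have [n yn] : exists n, y <= F n.
  have [n hn] := div (y + \sum_(0 <= p < L | prime p) Num.max 0 (f p - 1)).
  case: (leqP L n) => Ln.
    exists n; apply: le_trans (sub n Ln); move: hn; rewrite [X in _ < X](big_cat_nat (n := L)) //=.
    by move=> h; apply: ltW; move: h; lra.
  exfalso; move: hn; rewrite ltNge => /negP; apply; rewrite [X in _ <= _ + X](big_cat_nat (n := n)) //=; last exact: ltnW.
  rewrite addrCA lerDl addr_ge0 ?(le_trans ler01 y1) // sumr_ge0 // => q _.
  by rewrite le_max lexx.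
have ex : exists n, y <= F n by exists n.
case: (ex_minnP ex) => l yl lmin.
exists [seq q <- index_iota L l | P q]; split.
- by rewrite filter_uniq // iota_uniq.
- move=> q; rewrite mem_filter mem_index_iota => /andP[/andP[pq _] /andP[Lq _]]; split=> //.
  by apply: leq_trans Lq; rewrite leq_maxl.
rewrite big_filter -/(F l) yl /=.
case: (leqP l L) => lL.
  by rewrite /F big_geq //; apply: (le_trans y1); rewrite ler_peMr ?(le_trans ler01 y1) // lerDl ltW.
case: l lL yl lmin => // l lL yl lmin.
have Ll : (L <= l)%N by [].
have Fl : F l < y by rewrite ltNge; apply/negP => /lmin; rewrite ltnn.
have F0 : 0 < F l.
  by rewrite /F; elim/big_ind: _ => [|x z|q /andP[pq _]]; [exact: ltr01 | exact: mulr_gt0 | exact: fp (prime_gt0 pq)].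
rewrite /F big_mkcond (big_nat_recr l) //= -big_mkcond -/(F l).
case: ifP => [/andP[pl f1]|_]; last by rewrite mulr1 ltW // (lt_le_trans Fl) // ler_peMr ?lerDl ?ltW // (lt_le_trans F0) // ltW.
have h := hN1 l pl (leq_trans (leq_maxr _ _) Ll).
apply: ler_pM; rewrite ?(ltW F0) ?(ltW Fl) //; first by rewrite ltW // fp // prime_gt0.
by move: h; rewrite ltr_norml => /andP[_]; rewrite ltrBlDl => /ltW.
Qed.

End MultiplicativeFunctions.

(** * Approximation of a given tuple *)

Section ShiftedPrimeTuples.
Variable R : realType.
Implicit Types (f : nat -> R) (n i j p q B W F : nat) (L : seq (nat * nat)).

Lemma pow1D_le (e : R) n : 0 <= e <= 1 -> (1 + e) ^+ n <= 1 + 3 ^+ n * e.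
Proof.
case/andP=> e0 e1; elim: n => [|n IH]; first by rewrite !expr0 mul1r lerDl.
have t0 : 1 <= 3 ^+ n :> R by rewrite exprn_ege1 // (ler_nat R 1).
rewrite !exprS; apply: (@le_trans _ _ ((1 + e) * (1 + 3 ^+ n * e))).
  by apply: ler_wpM2l => //; rewrite addr_ge0.
set x := 3 ^+ n in t0 *; have x0 : 0 <= x by apply: le_trans t0.
have h1 : x * e * e <= x * e * 1 by apply: ler_wpM2l => //; rewrite mulr_ge0.
have h2 : e <= x * e by rewrite ler_peMl.
rewrite (_ : (1 + e) * (1 + x * e) = 1 + e + x * e + x * e * e); last by ring.
by move: h1 h2; rewrite mulr1; lra.
Qed.

Lemma pow1B_ge (e : R) n : 0 <= e <= 1 -> 1 - 3 ^+ n * e <= (1 - e) ^+ n.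
Proof.
case/andP=> e0 e1; elim: n => [|n IH]; first by rewrite !expr0 mul1r gerBl.
have t0 : 1 <= 3 ^+ n :> R by rewrite exprn_ege1 // (ler_nat R 1).
rewrite !exprS; apply: (@le_trans _ _ ((1 - e) * (1 - 3 ^+ n * e))); last first.
  by apply: ler_wpM2l => //; rewrite subr_ge0.
set x := 3 ^+ n in t0 *; have x0 : 0 <= x by apply: le_trans t0.
have h1 : 0 <= x * e * e by rewrite !mulr_ge0.
have h2 : e <= x * e by rewrite ler_peMl.
rewrite (_ : (1 - e) * (1 - x * e) = 1 - e - x * e + x * e * e); last by ring.
by move: h1 h2; lra.
Qed.

Lemma prod_near1 f (s : seq nat) (e : R) K : 0 <= e < 1 -> (forall q, q \in s -> `|f q - 1| < e) -> (size s <= K)%N ->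
  (1 - e) ^+ K <= \prod_(q <- s) f q <= (1 + e) ^+ K.
Proof.
case/andP=> e0 e1 hs sK; have a0 : 0 <= 1 - e by rewrite subr_ge0 ltW.
have a1 : 1 - e <= 1 by rewrite gerBl.
have b1 : 1 <= 1 + e by rewrite lerDl.
have key : (1 - e) ^+ size s <= \prod_(q <- s) f q <= (1 + e) ^+ size s.
  elim: s hs {sK} => [|q s IH] hs; first by rewrite big_nil !expr0 lexx.
  have /andP[i1 i2] : (1 - e) ^+ size s <= \prod_(q <- s) f q <= (1 + e) ^+ size s.
    by apply: IH => r rs; apply: hs; rewrite inE rs orbT.
  have := hs q (mem_head q s); rewrite ltr_norml => /andP[h1 h2].
  have f1 : 1 - e <= f q by move: h1; lra.
  have f2 : f q <= 1 + e by move: h2; lra.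
  have p0 : 0 <= \prod_(q <- s) f q by apply: le_trans i1; exact: exprn_ge0.
  rewrite big_cons /= !exprS; apply/andP; split; apply: ler_pM => //; [exact: exprn_ge0 | exact: le_trans f1].
case/andP: key => k1 k2; apply/andP; split.
  by apply: le_trans k1; apply: ler_wiXn2l.
by apply: le_trans k2 _; apply: ler_weXn2l.
Qed.

Lemma prime_dvd_fact q n : prime q -> (q %| n`!)%N = (q <= n)%N.
Proof.
move=> pq; elim: n => [|n IH]; first by rewrite fact0 Euclid_dvd1 // leqn0 gtn_eqF // prime_gt0.
rewrite factS Euclid_dvdM // IH; apply/orP/idP => [[/dvdn_leq -> //|h]|]; first exact: leqW.
by rewrite leq_eqVlt => /orP[/eqP -> |]; [left | right].
Qed.

Lemma eqmod_dvd d M n n' : (n = n' %[mod M])%N -> (d %| M)%N -> (d %| n)%N = (d %| n')%N.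
Proof. by move=> e dM; rewrite /dvdn -(modn_dvdm n dM) e (modn_dvdm n' dM). Qed.

Lemma logn_eq1 q n : prime q -> (0 < n)%N -> (q %| n)%N -> ~~ (q ^ 2 %| n)%N -> logn q n = 1%N.
Proof.
move=> pq n0 qn nq; apply/eqP; rewrite eqn_leq -[(1 <= _)%N](pfactor_dvdn 1 pq n0) expn1 qn andbT leqNgt.
by rewrite -pfactor_dvdn.
Qed.

(** Since m and q divide F, the modulus F^2 contains one power of q more than m does, so the
    congruence determines the exponent of q. *)
Lemma logn_congr q n m F : prime q -> (0 < m)%N -> (0 < n)%N -> (m %| F)%N -> (q %| F)%N ->
  n = m %[mod F ^ 2] -> logn q n = logn q m.
Proof.
move=> pq m0 n0 mF qF e.
have d1 : (q ^ (logn q m).+1 %| F ^ 2)%N.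
  rewrite expnS expnS expn1 dvdn_mul //; apply: dvdn_trans mF; exact: pfactor_dvdnn.
have d0 : (q ^ logn q m %| F ^ 2)%N by apply: dvdn_trans d1; rewrite dvdn_exp2l.
apply/eqP; rewrite eqn_leq leqNgt -!pfactor_dvdn // (eqmod_dvd e d1) (eqmod_dvd e d0) pfactor_dvdnn andbT.
by rewrite pfactor_dvdn // ltnn.
Qed.

Lemma crt_primes L M b : (0 < M)%N -> uniq [seq x.1 | x <- L] ->
  (forall x, x \in L -> prime x.1 /\ ~~ (x.1 %| M)%N) ->
  exists a, a = b %[mod M] /\ forall x, x \in L -> a = x.2 %[mod x.1 ^ 2].
Proof.
elim: L M b => [|x L IH] M b M0 /=; first by exists b.
case/andP=> xL uL hL; have [px xM] := hL x (mem_head x L).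
have cop : coprime M (x.1 ^ 2) by apply: coprimeXr; rewrite coprime_sym prime_coprime.
have M'0 : (0 < M * x.1 ^ 2)%N by rewrite muln_gt0 M0 expn_gt0 prime_gt0.
have [|a [a1 a2]] := IH (M * x.1 ^ 2)%N (chinese M (x.1 ^ 2) b x.2) M'0 uL.
  move=> y yL; have [py yM] : prime y.1 /\ ~~ (y.1 %| M)%N by apply: hL; rewrite inE yL orbT.
  split=> //; rewrite Euclid_dvdM // negb_or yM /= Euclid_dvdX // andbT dvdn_prime2 //.
  by apply: contra xL => /eqP <-; apply: map_f.
have aM : a = b %[mod M].
  by rewrite -(modn_dvdm a (dvdn_mulr (x.1 ^ 2) (dvdnn M))) a1 modn_dvdm ?dvdn_mulr // chinese_modl.
have ax : a = x.2 %[mod x.1 ^ 2].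
  have d2 : (x.1 ^ 2 %| M * x.1 ^ 2)%N by rewrite dvdn_mull.
  by rewrite -(modn_dvdm a d2) a1 (modn_dvdm _ d2); exact: chinese_modr.
exists a; split=> // y; rewrite inE => /orP[/eqP -> //|]; exact: a2.
Qed.

(** An entry (q, i) of [L] says that q belongs to Q_i. Each new set is taken beyond the primes
    already used, which makes the family disjoint. *)
Lemma greedy_family f (e : R) (y : nat -> R) N0 k : 0 < e -> (forall i, (i < k)%N -> 1 <= y i) ->
  (forall n, (0 < n)%N -> 0 < f n) ->
  (forall M : R, exists N, M < \sum_(0 <= p < N | prime p) Num.max 0 (f p - 1)) ->
  (exists N, forall p, prime p -> (N <= p)%N -> `|f p - 1| < e) ->
  exists L, [/\ uniq [seq x.1 | x <- L], forall x, x \in L -> [/\ prime x.1, (N0 < x.1)%N & (x.2 < k)%N] &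
    forall i, (i < k)%N -> y i <= \prod_(x <- L | x.2 == i) f x.1 <= y i * (1 + e)].
Proof.
move=> e0 hy fp div f1; elim: k hy => [|k IH] hy; first by exists [::].
have [i ik|L [uL hL pL]] := IH; first by apply: hy; exact: leqW.
have [s [us hs ps]] := greedy_product (maxn N0 (\max_(x <- L) x.1)) e0 (hy k (leqnn _)) fp div f1.
exists ([seq (q, k) | q <- s] ++ L); split.
- rewrite map_cat -map_comp map_id cat_uniq us uL andbT /=; apply/hasPn => q /mapP[x xL ->].
  apply/negP => /hs[_]; rewrite gtn_max => /andP[_]; rewrite ltnNge => /negP; apply.
  exact: (leq_bigmax_seq (F := fun x => x.1)).
- move=> x; rewrite mem_cat => /orP[/mapP[q /hs[pq]]|/hL[px Nx xk]]; last by split=> //; exact: leqW.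
  by rewrite gtn_max => /andP[Nq _] ->.
- move=> i ik; rewrite big_cat /= big_map /=; case: (ltngtP i k) => h; last first.
  + rewrite h [X in _ * X]big_seq_cond [X in _ * X]big1 ?mulr1.
      by rewrite (eq_bigl xpredT) // => q; rewrite eqxx.
    by move=> x /andP[/hL[_ _ xk] /eqP xe]; move: xk; rewrite xe ltnn.
  + by move: ik; rewrite ltnS leqNgt h.
  + by rewrite [X in X * _]big1 ?mul1r ?pL // => q /eqP e1; move: h; rewrite e1 ltnn.
Qed.

Section TuplesNear.
Variables (k : nat) (f : nat -> R) (L : seq (nat * nat)).
Hypothesis (mf : multiplicative_fn R f).
Hypothesis (uL : uniq [seq x.1 | x <- L]).
Hypothesis (hL : forall x, x \in L -> [/\ prime x.1, (k.*2.+1 < x.1)%N & (x.2 < k)%N]).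
Local Notation F := (k.*2.+1)`!.
(** The squares serve to fix exact exponents: of the primes up to 2k+1 through F^2, and of the
    primes of [L] through q^2. *)
Definition tuple_modulus : nat := (F ^ 2 * \prod_(x <- L) x.1 ^ 2)%N.
Local Notation W := tuple_modulus.

Lemma tuple_modulus_gt0 : (0 < W)%N.
Proof.
rewrite muln_gt0 expn_gt0 fact_gt0 /= big_seq_cond; apply: prodn_cond_gt0 => x; rewrite andbT => /hL[px _ _].
by rewrite expn_gt0 prime_gt0.
Qed.

Lemma dvd_modulusL x : x \in L -> (x.1 ^ 2 %| W)%N.
Proof. by move=> xL; rewrite /W (big_rem x) //= dvdn_mull // dvdn_mulr. Qed.

Lemma prime_dvd_modulus q : prime q -> (q %| W)%N -> (q <= k.*2.+1)%N \/ exists i, (q, i) \in L.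
Proof.
move=> pq; rewrite Euclid_dvdM // Euclid_dvdX // andbT prime_dvd_fact // => /orP[|h]; first by left.
right; move: h; rewrite big_seq_cond; elim/big_ind: _ => [|x y hx hy|[r j]].
- by rewrite Euclid_dvd1.
- by rewrite Euclid_dvdM // => /orP[].
- rewrite andbT => rL; rewrite Euclid_dvdX // andbT /=; have [pr _ _] := hL rL.
  by rewrite dvdn_prime2 // => /eqP ->; exists j.
Qed.

Lemma fst_inj x y : x \in L -> y \in L -> x.1 = y.1 -> x = y.
Proof.
move=> xL yL e; have nx := index_mem x L; have ny := index_mem y L.
have : index x L = index y L.
  apply/eqP; rewrite -(nth_uniq 0%N _ _ uL) ?size_map ?index_mem //.
  by rewrite !(nth_map x) ?index_mem // !nth_index // e.
by move=> h; rewrite -(nth_index x xL) h nth_index.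
Qed.

Variables (p K Zb : nat) (d : R).
Hypotheses (p0 : (0 < p)%N) (pF : p = 1 %[mod F ^ 2]) (pL : forall x, x \in L -> p = x.1 - x.2.+1 %[mod x.1 ^ 2]).
Hypotheses (d01 : 0 <= d < 1) (fZ : forall q, prime q -> (Zb < q)%N -> `|f q - 1| < d).

(** Set n = p + i + 1. As p = 1 modulo F^2, the part of n at the primes up to 2k+1 is that of i + 2.
    A prime q of index i in [L] divides n exactly once, and one of index j <> i does not divide n,
    since n = q + (i - j) modulo q^2 and 0 < |i - j| < q. The remaining primes are outside W and
    occur to the first power; they make up r. *)
Lemma tuple_value i : (i < k)%N ->
  (forall q, prime q -> ~~ (q %| W)%N -> (q %| p + i.+1)%N -> (Zb < q)%N /\ ~~ (q ^ 2 %| p + i.+1)%N) ->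
  (size [seq q <- iota 0 (p + i.+1).+1 | [&& prime q, ~~ (q %| W)%N & (q %| p + i.+1)%N]] <= K)%N ->
  exists r, (1 - d) ^+ K <= r <= (1 + d) ^+ K /\
    f (p + i.+1)%N = f i.+2 * \prod_(x <- L | x.2 == i) f x.1 * r.
Proof.
move=> ik hW hK; set n := (p + i.+1)%N in hW hK *.
have n0 : (0 < n)%N by rewrite addn_gt0 p0.
set s := [seq q <- _ | _] in hK.
exists (\prod_(q <- s) f q); split.
  apply: prod_near1 => // q; rewrite mem_filter => /andP[/and3P[pq qW qn] _].
  by apply: fZ => //; case: (hW q pq qW qn).
have [f1 _] := mf; have nB : (0 < n < n.+1)%N by rewrite n0 ltnSn.
have iB : (0 < i.+2 < n.+1)%N by rewrite /= ltnS /n addnS ltnS -[i.+1]add1n leq_add2r.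
rewrite (mult_prod_logn mf nB) (mult_prod_logn mf iB).
have mL x : x \in L -> x.2 = i -> (x.1 %| n)%N /\ ~~ (x.1 ^ 2 %| n)%N.
  move=> xL xi; have [px kx _] := hL xL; have ix : (i.+1 < x.1)%N.
    by apply: leq_ltn_trans kx; apply: leq_trans ik (leq_trans _ (leqnSn _)); rewrite -addnn leq_addr.
  have e : n = x.1 %[mod x.1 ^ 2].
    by rewrite /n -modnDml (pL xL) modnDml xi subnK // ltnW.
  rewrite (eqmod_dvd e) ?dvdn_exp // dvdnn (eqmod_dvd e) // gtnNdvd ?prime_gt0 //.
  by rewrite -{1}(expn1 x.1) ltn_exp2l // prime_gt1.
have nL x : x \in L -> x.2 != i -> ~~ (x.1 %| n)%N.
  move=> xL xi; have [px kx xk] := hL xL.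
  have kx2 : (k + k < x.1)%N by rewrite addnn; apply: ltnW.
  have e : n = x.1 - x.2.+1 + i.+1 %[mod x.1 ^ 2] by rewrite /n -modnDml (pL xL) modnDml.
  rewrite (eqmod_dvd e) ?dvdn_exp //; apply/negP => /dvdnP[c ec].
  have c1 : c = 1%N.
    case: c ec => [|[|c]] ec //; first by move: ec; rewrite mul0n addnS.
    have : (x.1 * 2 <= x.1 - x.2.+1 + i.+1)%N by rewrite ec mulnC leq_mul2r orbT.
    by move: ik xk kx2; clear; lia.
  by case/eqP: xi; move: ec; rewrite c1; move: ik xk kx2; clear; lia.
have eB : \prod_(x <- L | x.2 == i) f x.1 = \prod_(0 <= q < n.+1 | prime q) (if (q, i) \in L then f q else 1).
  rewrite -big_mkcondr -(big_filter _ (fun x => x.2 == i)) -(big_map (fun x : nat * nat => x.1) xpredT f).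
  rewrite -[RHS]big_filter; apply: perm_big; apply: uniq_perm.
  - by rewrite map_inj_in_uniq ?filter_uniq ?(map_uniq uL) // => x y; rewrite !mem_filter => /andP[_ xL] /andP[_ yL]; exact: fst_inj.
  - by rewrite filter_uniq // iota_uniq.
  move=> q; rewrite mem_filter mem_index_iota /=; apply/mapP/idP => [[x]|/andP[/andP[pq qL] _]].
    rewrite mem_filter => /andP[/eqP xi xL] ->; have [px _ _] := hL xL; have [xn _] := mL x xL xi.
    by rewrite px -xi -surjective_pairing xL ltnS dvdn_leq.
  by exists (q, i); rewrite // mem_filter qL eqxx.
have eC : \prod_(q <- s) f q = \prod_(0 <= q < n.+1 | prime q) (if ~~ (q %| W)%N && (q %| n)%N then f q else 1).
  by rewrite -big_mkcondr /s big_filter /index_iota subn0.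
rewrite eB eC -!big_split /=; apply: eq_bigr => q pq.
have i2 : (0 < i.+2)%N by [].
case: (leqP q k.*2.+1) => qk.
  have qF : (q %| F)%N by rewrite prime_dvd_fact.
  have iF : (i.+2 %| F)%N.
    apply: dvdn_fact; rewrite /= ltnS; apply: leq_trans ik _; by rewrite -addnn leq_addr.
  have qW : (q %| W)%N by rewrite /W dvdn_mulr // Euclid_dvdX // qF.
  have nq : (q, i) \in L = false by apply/negP => /hL[_]; rewrite ltnNge qk.
  have e : n = i.+2 %[mod F ^ 2] by rewrite /n -modnDml pF modnDml add1n.
  by rewrite (logn_congr pq i2 n0 iF qF e) nq qW /= !mulr1.
have li : logn q i.+2 = 0%N.
  apply/eqP; rewrite -leqn0 leqNgt logn_gt0 mem_primes pq /=; apply/negP => /(dvdn_leq i2); apply/negP.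
  by rewrite -ltnNge; apply: leq_ltn_trans qk; rewrite ltnS; apply: leq_trans ik _; rewrite -addnn leq_addr.
rewrite li expn0 f1 mul1r.
have lnd : ~~ (q %| n)%N -> logn q n = 0%N by move=> h; rewrite lognE pq n0 (negbTE h).
case: (boolP (q %| W)%N) => qW /=; last first.
  have nq : (q, i) \in L = false.
    apply/negP => qL; case/negP: qW; apply: dvdn_trans (dvd_modulusL qL); exact: dvdn_exp.
  rewrite nq mul1r; case: (boolP (q %| n)%N) => qn; last by rewrite lnd.
  by have [_ h] := hW q pq qW qn; rewrite logn_eq1.
rewrite mulr1; case: (boolP ((q, i) \in L)) => qL.
  by have [h1 h2] := mL _ qL erefl; rewrite logn_eq1.
have [|[j jL]] := prime_dvd_modulus pq qW; first by rewrite leqNgt qk.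
rewrite lnd //; apply: (nL _ jL); apply: contra qL => /= /eqP <-; exact: jL.
Qed.

End TuplesNear.

(** Coordinate i starts from the fixed value f(i+2), which the primes of [L] can only increase;
    hence targets above all of these are reached. *)
Theorem dense_above f k : (0 < k)%N -> positive_fun R f -> multiplicative_fn R f ->
  (forall M : R, exists N, M < \sum_(0 <= p < N | prime p) Num.max 0 (f p - 1)) ->
  tends_to_one_on_primes R f ->
  exists2 c : R, 0 < c & dense_in R k (prime_shift_tuples R f k) (boxcinf R k c).
Proof.
case: k => // k0 _; set k := k0.+1 => fp mf div f1.
(* Makes every quotient x i / f(i+2) at least 1, as the greedy product requires. *)
pose c : R := 1 + \sum_(i < k) f i.+2.
have s0 : 0 <= \sum_(i < k) f i.+2 by apply: sumr_ge0 => i _; apply/ltW/fp.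
have fc (i : 'I_k) : f i.+2 <= c.
  rewrite /c (bigD1 i) //= addrCA lerDl addr_ge0 //; apply: sumr_ge0 => j _; exact/ltW/fp.
exists c; first by rewrite ltr_pwDl.
move=> x xc e e0; have [K hK] := almost_prime_shifts R k0.
have x0 (i : 'I_k) : 0 < x i by apply: lt_le_trans (xc i); rewrite ltr_pwDl.
have S0 : 0 <= \sum_i x i by apply: sumr_ge0 => i _; exact: ltW.
(* A relative error that is below e in absolute terms for all coordinates at once. *)
pose e' := e / (e + 1 + \sum_i x i).
have den : 0 < e + 1 + \sum_i x i by move: e0 S0; lra.
have e'0 : 0 < e' by rewrite divr_gt0.
have e'1 : e' <= 1 by rewrite ler_pdivrMr // mul1r; move: S0; lra.
have e'x (i : 'I_k) : e' * x i < e.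
  rewrite /e' mulrAC ltr_pdivrMr // ltr_pM2l //; apply: (@le_lt_trans _ _ (\sum_i x i)); last by move: e0; lra.
  by rewrite (bigD1 i) //= lerDl; apply: sumr_ge0 => j _; exact: ltW.
(* The total factor lies between (1 - d)^K and (1 + d)^(K+1): one factor 1 + d from the greedy
   product and K from r. By [pow1D_le] and [pow1B_ge] the relative error is at most e'. *)
pose d := e' / 3 ^+ K.+1.
have p3 : 1 <= 3 ^+ K.+1 :> R by rewrite exprn_ege1 // (ler_nat R 1).
have p30 : 0 < 3 ^+ K.+1 :> R by exact: exprn_gt0.
have d0 : 0 < d by rewrite divr_gt0.
have d1 : d < 1.
  by rewrite ltr_pdivrMr // mul1r (le_lt_trans e'1) // -(expr0 3) ltr_eXn2l // (ltr_nat R 1).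
have dK : 3 ^+ K.+1 * d = e' by rewrite mulrCA divff ?mulr1 // lt0r_neq0.
pose y i : R := if insub i is Some j then x j / f i.+2 else 1.
have yE (i : 'I_k) : y i = x i / f i.+2 by rewrite /y insubT //= => ?; congr (x _ / _); apply: val_inj.
have y1 i : (i < k)%N -> 1 <= y i.
  move=> ik; rewrite (yE (Ordinal ik)) ler_pdivlMr ?fp // mul1r; exact: le_trans (fc _) (xc _).
have [L [uL hL pL]] := greedy_family k.*2.+1 d0 y1 fp div (f1 d d0).
have [Zb hZb] := f1 d d0.
pose W := tuple_modulus k L; have W0 : (0 < W)%N by exact: tuple_modulus_gt0.
have Wk p : prime p -> (p <= k.*2.+1)%N -> (p %| W)%N.
  by move=> pp pk; rewrite /W dvdn_mulr // Euclid_dvdX // prime_dvd_fact // pk.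
pose L' := [seq (u.1, u.1 - u.2.+1)%N | u <- L].
have [|||a [aF aL]] := @crt_primes L' ((k.*2.+1)`! ^ 2)%N 1%N.
- by rewrite expn_gt0 fact_gt0.
- by rewrite -map_comp (eq_map (g := fst)).
- move=> u /mapP[v /hL[pv kv _] ->] /=; split=> //.
  by rewrite Euclid_dvdX // andbT prime_dvd_fact // -ltnNge.
have aW : coprime a W.
  rewrite coprimeMr -coprime_modl aF coprime_modl coprime1n /= big_seq_cond.
  elim/big_ind: _ => [|u v hu hv|u]; first exact: coprimen1.
    by rewrite coprimeMr hu.
  rewrite andbT => uL'; have [pu ku uk] := hL u uL'; apply: coprimeXr.
  rewrite coprime_sym prime_coprime //.
  have := aL _ (map_f (fun u : nat * nat => (u.1, u.1 - u.2.+1)%N) uL') => /= /eqmod_dvd -> //; last exact: dvdn_exp.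
  have u2 : (u.2.+1 < u.1)%N.
    by apply: leq_ltn_trans ku; apply: leq_trans uk (leq_trans _ (leqnSn _)); rewrite -addnn leq_addr.
  by rewrite gtnNdvd ?subn_gt0 // ltn_subrL (leq_ltn_trans _ u2).
have [p [pp pa Zp hp]] := hK W a Zb W0 Wk aW.
have p0 := prime_gt0 pp; move/eqP: pa => pa.
have pF : p = 1 %[mod (k.*2.+1)`! ^ 2].
  have dF : ((k.*2.+1)`! ^ 2 %| W)%N by rewrite dvdn_mulr.
  by rewrite -(modn_dvdm p dF) pa (modn_dvdm a dF) aF.
have pLL u : u \in L -> p = u.1 - u.2.+1 %[mod u.1 ^ 2].
  move=> uL'; have dW := dvd_modulusL k uL'.
  rewrite -(modn_dvdm p dW) pa (modn_dvdm a dW).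
  exact: (aL _ (map_f (fun u : nat * nat => (u.1, u.1 - u.2.+1)%N) uL')).
exists (fun i => f (p + i.+1)%N); split; first by exists p.
move=> i; have ik := ltn_ord i.
have hpi := hp i.+1 ik; case: hpi => hp1 hp2.
have fZ q : prime q -> (Zb < q)%N -> `|f q - 1| < d by move=> pq /ltnW; exact: hZb.
have d01 : 0 <= d < 1 by rewrite ltW.
have [r [/andP[r1 r2] ->]] := tuple_value mf uL hL p0 pF pLL d01 fZ ik hp1 hp2.
have /andP[g1 g2] := pL i ik.
have fi : 0 < f i.+2 by exact: fp.
have q1 : x i <= f i.+2 * \prod_(u <- L | u.2 == i) f u.1.
  by apply: le_trans (ler_wpM2l (ltW fi) g1); rewrite yE mulrCA divff ?mulr1 // lt0r_neq0.
have q2 : f i.+2 * \prod_(u <- L | u.2 == i) f u.1 <= x i * (1 + d).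
  by apply: le_trans (ler_wpM2l (ltW fi) g2) _; rewrite yE mulrA [f _ * (_ / _)]mulrCA divff ?mulr1 // lt0r_neq0.
set g := f i.+2 * _ in q1 q2 *.
have dd : 0 <= d <= 1 by rewrite !ltW.
have m1 := pow1B_ge K dd; have m2 := pow1D_le K.+1 dd; rewrite dK in m2.
have m3 : 3 ^+ K * d <= e'.
  by rewrite -dK ler_wpM2r ?(ltW d0) // exprS ler_peMl ?exprn_ge0 // (ler_nat R 1).
have xi := x0 i; have hx := e'x i.
have lo : x i * (1 - e') <= g * r.
  apply: ler_pM => //; [exact: ltW | by rewrite subr_ge0 | apply: le_trans r1; apply: le_trans m1; lra].
have hi : g * r <= x i * (1 + e').
  apply: (@le_trans _ _ (x i * (1 + d) * (1 + d) ^+ K)).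
    apply: ler_pM => //; first exact: le_trans (ltW xi) q1.
    by apply: le_trans r1; rewrite exprn_ge0 // subr_ge0 ltW.
  by rewrite -mulrA -exprS; apply: ler_wpM2l => //; exact: ltW.
rewrite ltr_norml; move: lo hi hx; rewrite mulrBr mulrDr mulr1 [x i * e']mulrC => lo hi hx.
by apply/andP; split; lra.
Qed.

Lemma sum_pos_part_diverges f : prime_sum_diverges R f ->
  (forall M : R, exists N, M < \sum_(0 <= p < N | prime p) Num.max 0 (f p - 1)) \/
  (forall M : R, exists N, M < \sum_(0 <= p < N | prime p) Num.max 0 (1 - f p)).
Proof.
move=> div; apply: boolp.contrapT => /boolp.not_orP[/boolp.existsNP[M1 h1] /boolp.existsNP[M2 h2]].
have [N] := div (M1 + M2); rewrite -(big_mkord prime (fun p => `|f p - 1|)) ltNge => /negP; apply.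
have b1 : \sum_(0 <= p < N | prime p) Num.max 0 (f p - 1) <= M1.
  by rewrite leNgt; apply/negP => h; apply: h1; exists N.
have b2 : \sum_(0 <= p < N | prime p) Num.max 0 (1 - f p) <= M2.
  by rewrite leNgt; apply/negP => h; apply: h2; exists N.
apply: le_trans (lerD b1 b2); rewrite -big_split /=; apply: ler_sum => p _.
case/orP: (le_total 1 (f p)) => h.
  by rewrite ger0_norm ?subr_ge0 // (max_idPr _) ?subr_ge0 // lerDl le_max lexx.
have e2 : Num.max 0 (1 - f p) = 1 - f p by apply/max_idPr; rewrite subr_ge0.
by rewrite distrC ger0_norm ?subr_ge0 // e2 lerDr le_max lexx.
Qed.

End ShiftedPrimeTuples.

Theorem theorem1p1 (R : realType) (k : nat) (f : nat -> R) :
  (0 < k)%N ->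
  positive_fun R f ->
  multiplicative_fn R f ->
  prime_sum_diverges R f ->
  tends_to_one_on_primes R f ->
  exists c : R, 0 < c /\
    (dense_in R k (prime_shift_tuples R f k) (box0c R k c) \/
     dense_in R k (prime_shift_tuples R f k) (boxcinf R k c)).
Proof.
move=> k0 fp mf div f1; case: (sum_pos_part_diverges div) => hdiv.
  by have [c c0 h] := dense_above k0 fp mf hdiv f1; exists c; split=> //; right.
(* Inversion exchanges [c, oo) with (0, 1/c], so density for 1/f gives density for f in the box at
   0. *)
pose h n := (f n)^-1.
have hp : positive_fun R h by move=> n n0; rewrite invr_gt0 fp.
have h1 : tends_to_one_on_primes R h.
  move=> e e0; pose d := Num.min 2^-1 (e / 2).
  have d0 : 0 < d by rewrite lt_min invr_gt0 ltr0n divr_gt0.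
  have [N hN] := f1 d d0; exists N => p pp Np; have := hN p pp Np.
  rewrite lt_min => /andP[a1 a2]; have fp0 := fp p (prime_gt0 pp).
  have f2 : 2^-1 <= f p by move: a1; rewrite ltr_norml => /andP[a1 _]; lra.
  have -> : h p - 1 = - ((f p - 1) / f p) by rewrite /h; field; rewrite lt0r_neq0.
  rewrite normrN normrM [`|(f p)^-1|]ger0_norm ?invr_ge0 ?(ltW fp0) // ltr_pdivrMr //.
  by apply: lt_le_trans a2 _; rewrite ler_wpM2l // ltW.
(* 1/u - 1 >= 1 - u for u > 0, the difference being (1 - u)^2 / u. *)
have hd : forall M : R, exists N, M < \sum_(0 <= p < N | prime p) Num.max 0 (h p - 1).
  move=> M; have [N hN] := hdiv M; exists N; apply: lt_le_trans hN _; apply: ler_sum => p pp.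
  have fp0 := fp p (prime_gt0 pp); rewrite ge_max le_max lexx /= le_max.
  case: (lerP 1 (f p)) => f1p; first by rewrite subr_le0 f1p.
  apply/orP; right; rewrite /h -subr_ge0 (_ : _ - _ = (1 - f p) ^+ 2 / f p); last by field; rewrite lt0r_neq0.
  by rewrite divr_ge0 ?sqr_ge0 // ltW.
have [c c0 hc] := dense_above k0 hp (mult_inv mf) hd h1.
exists c^-1; rewrite invr_gt0; split=> //; left => x xc e e0.
(* Coordinates near 0 have no usable inverse; they are raised to a small positive value at a cost of
   e/2. *)
pose x' i := Num.max (x i) (Num.min c^-1 (e / 2)).
have m0 : 0 < Num.min c^-1 (e / 2) by rewrite lt_min invr_gt0 c0 divr_gt0.
have x'0 i : 0 < x' i by rewrite lt_max m0 orbT.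
have x'c i : x' i <= c^-1 by rewrite ge_max ge_min lexx /= andbT; case/andP: (xc i).
have x'x i : `|x' i - x i| <= e / 2.
  have /andP[xi0 _] := xc i; rewrite /x'; case: (leP (Num.min c^-1 (e / 2)) (x i)) => hx.
    by rewrite subrr normr0 divr_ge0 // ltW.
  rewrite ger0_norm ?subr_ge0 ?(ltW hx) // (@le_trans _ _ (Num.min c^-1 (e / 2))) ?gerBl //.
  by rewrite ge_min lexx orbT.
(* The first bound ensures u <= 2 v. Then u - v = - u v (1/u - 1/v) and v c <= 1 turn the second
   bound into |u - v| <= e/4. *)
pose e1 := Num.min (c / 2) (c ^+ 2 * e / 8).
have e10 : 0 < e1 by rewrite lt_min !divr_gt0 // mulr_gt0 // exprn_gt0.
have zc : boxcinf R k c (fun i => (x' i)^-1).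
  by move=> i; rewrite -[c]invrK lef_pV2 ?posrE ?invr_gt0.
have [y [[p [pp yp]] hy]] := hc _ zc e1 e10.
exists (fun i => f (p + i.+1)%N); split; first by exists p.
move=> i; have fi : 0 < f (p + i.+1)%N by apply: fp; rewrite addnS.
have := hy i; rewrite yp /h; set u := f (p + i.+1)%N in fi *; set v := x' i.
have v0 : 0 < v by exact: x'0.
have vc : v * c <= 1 by rewrite -ler_pdivlMr // mul1r; exact: x'c.
rewrite lt_min => /andP[a1 a2].
have cv : c <= v^-1 by exact: zc i.
have uv : u <= 2 * v.
  have : v^-1 / 2 <= u^-1 by move: a1; rewrite ltr_norml => /andP[a1 _]; lra.
  by rewrite -invfM lef_pV2 ?posrE ?mulr_gt0 // mulrC.
have e2 : u - v = - (u * v * (u^-1 - v^-1)) by field; rewrite !lt0r_neq0.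
have uv0 : 0 <= u * v by rewrite mulr_ge0 ?ltW.
have d1 : `|u - v| <= e / 4.
  rewrite e2 normrN normrM (ger0_norm uv0).
  apply: (@le_trans _ _ (2 * v * v * (c ^+ 2 * e / 8))).
    by apply: ler_pM => //; [apply: ler_wpM2r => //; exact: ltW | exact: ltW].
  rewrite (_ : 2 * v * v * (c ^+ 2 * e / 8) = (v * c) * (v * c) * (e / 4)); last by field.
  rewrite -[X in _ <= X]mul1r; apply: ler_wpM2r; first by rewrite divr_ge0 // ltW.
  by have v1 : 0 <= v * c by [rewrite mulr_ge0 ?ltW]; rewrite -[1]mulr1; exact: ler_pM.
have := ler_normD (u - v) (v - x i); rewrite subrKA => h3.
apply: le_lt_trans h3 _; have := x'x i; rewrite -/v => h4; lra.
Qed.
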